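(* Every finite semisimple 2-distributor between finite semisimple 2-categories is equivalent to a 2-functor. That is: let $\mathcal{C}$ and $\mathcal{D}$ be finite semisimple 2-categories over $k$ and let $P:\mathcal{D}^{\mathrm{op}}\times\mathcal{C}\to\mathrm{2Vect}$ be a $k$-bilinear 2-functor. Then there is a linear 2-functor $F:\mathcal{C}\to\mathcal{D}$ such that $P(-,-)\simeq\mathrm{Hom}_{\mathcal{D}}(-,F-)$ as 2-functors $\mathcal{D}^{\mathrm{op}}\times\mathcal{C}\to\mathrm{2Vect}$.
   Context: Throughout, $k$ is an algebraically closed field of characteristic zero and $\mathrm{Vect}$ is the category of finite-dimensional $k$-vector spaces. A linear 1-category is a $\mathrm{Vect}$-enriched category; a linear 2-category is a (weak) 2-category whose 2-morphism sets are finite-dimensional $k$-vector spaces and whose horizontal and vertical compositions of 2-morphisms are $k$-bilinear; linear 2-functors are 2-functors that are locally $k$-linear. $\mathcal{D}^{\mathrm{op}}$ has the directions of 1-morphisms reversed (not of 2-morphisms). $\circ$ denotes composition of 1-morphisms, $\cdot$ vertical composition of 2-morphisms, $1_A$ the identity 1-morphism of $A$. Semisimple linear 1-category: additive, idempotent complete, every object is a finite direct sum of simple objects, and composites of nonzero morphisms between simple objects are nonzero (equivalently: additive, idempotent complete, with semisimple endomorphism algebras). It is finite if it has finitely many isomorphism classes of simple objects. $\mathrm{2Vect}$ is the 2-category of finite semisimple linear 1-categories, linear functors, and natural transformations. A finite semisimple 2-distributor $\mathcal{C}\to\mathcal{D}$ between finite semisimple 2-categories is a $k$-bilinear 2-functor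 $\mathcal{D}^{\mathrm{op}}\times\mathcal{C}\to\mathrm{2Vect}$. A linear 2-category is locally (finite) semisimple if all its Hom 1-categories are (finite) semisimple. Zero object: an object $0$ with $1_0$ a zero object of $\mathrm{Hom}(0,0)$. Direct sum of objects $A_1,A_2$: an object $A_1\boxplus A_2$ with 1-morphisms $\iota_i:A_i\to A_1\boxplus A_2$, $\rho_i:A_1\boxplus A_2\to A_i$ such that $\rho_i\circ\iota_i\cong 1_{A_i}$, $\rho_2\circ\iota_1$ and $\rho_1\circ\iota_2$ are zero objects of the Hom-categories, and $1_{A_1\boxplus A_2}$ is a direct sum of $\iota_1\circ\rho_1$ and $\iota_2\circ\rho_2$. Additive: locally additive with a zero object and direct sums of pairs of objects. A monad $E:B\to B$ with multiplication $m:E\circ E\Rightarrow E$ and unit $u$ is separable if there is an $E$-$E$-bimodule map $c:E\Rightarrow E\circ E$ with $m\cdot c=1_E$. It admits a separable splitting if there are 1-morphisms $\iota:A\to B$, $\rho:B\to A$ with $\rho$ left adjoint to $\iota$, such that the counit $\epsilon:\rho\circ\iota\Rightarrow 1_A$ has a right inverse, together with an isomorphism of monads $E\cong\iota\circ\rho$. A 2-category is idempotent complete if its Hom 1-categories are idempotent complete and every separable monad in it admits a separable splitting. A semisimple 2-category is a locally semisimple linear 2-category in which every 1-morphism has a left and a right adjoint, and which is additive and idempotent complete. A nonzero object $B$ is simple if every fully faithful 1-morphism $A\to B$ (i.e. one such that $\mathrm{Hom}(X,A)\to\mathrm{Hom}(X,B)$ is fully faithful for all $X$) has $A$ a zero object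 or is an equivalence. A semisimple 2-category is finite if it is locally finite semisimple and has finitely many equivalence classes of simple objects. *)

(* Defs.v *)
From HB Require Import structures.
From mathcomp Require Import all_boot all_order all_algebra.
From mathcomp Require Import boolp.

Set Implicit Arguments.
Unset Strict Implicit.
Unset Printing Implicit Defensive.

Import GRing.Theory.
Local Open Scope ring_scope.

Reserved Notation "g ∙ f" (at level 40, left associativity).
Reserved Notation "g ∘ f" (at level 38, left associativity).
Reserved Notation "b ⋆ a" (at level 39, left associativity).

Record category : Type := Category {
  ob :> Type;
  mor : ob -> ob -> Type;
  idm : forall x, mor x x;
  cmp : forall x y z, mor y z -> mor x y -> mor x z;
  cmp1m : forall x y (f : mor x y), cmp (idm y) f = f;
  cmpm1 : forall x y (f : mor x y), cmp f (idm x) = f;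
  cmpA : forall x y z w (h : mor z w) (g : mor y z) (f : mor x y),
    cmp h (cmp g f) = cmp (cmp h g) f }.

Arguments mor {c} x y.
Arguments idm {c} x.
Arguments cmp {c x y z} g f.
Notation "g ∙ f" := (cmp g f).

Definition inverse (C : category) (x y : C) (f : mor x y) (g : mor y x) : Prop :=
  g ∙ f = idm x /\ f ∙ g = idm y.

Definition is_iso (C : category) (x y : C) (f : mor x y) : Prop :=
  exists g, inverse f g.

Definition isomorphic (C : category) (x y : C) : Prop :=
  exists f : mor x y, is_iso f.

Definition is_mono (C : category) (x y : C) (f : mor x y) : Prop :=
  forall z (g h : mor z x), f ∙ g = f ∙ h -> g = h.

Definition idempotent_complete1 (C : category) : Prop :=
  forall (x : C) (e : mor x x), e ∙ e = e ->
  exists (y : C) (r : mor x y) (s : mor y x), r ∙ s = idm y /\ s ∙ r = e.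

Record functor (C D : category) : Type := Functor {
  fob :> C -> D;
  fmor : forall x y, mor x y -> mor (fob x) (fob y);
  fmor_id : forall x, fmor (idm x) = idm (fob x);
  fmor_cmp : forall x y z (g : mor y z) (f : mor x y),
    fmor (g ∙ f) = fmor g ∙ fmor f }.

Arguments fmor {C D} F {x y} f : rename.

Record nattrans (C D : category) (F G : functor C D) : Type := Nattrans {
  ncomp :> forall x, mor (F x) (G x);
  ncompN : forall x y (f : mor x y), ncomp y ∙ fmor F f = fmor G f ∙ ncomp x }.

Lemma nattransP (C D : category) (F G : functor C D) (s t : nattrans F G) :
  (forall x, s x = t x) -> s = t.
Proof.
case: s t => [s sN] [t tN] /= st.
have E : s = t by apply: functional_extensionality_dep => x; apply: st.
by rewrite -{}E in tN *; congr Nattrans; apply: Prop_irrelevance.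
Qed.

Definition prod_cat (C D : category) : category.
Proof.
refine (@Category (C * D)%type (fun x y => (mor x.1 y.1 * mor x.2 y.2)%type)
  (fun x => (idm x.1, idm x.2))
  (fun x y z g f => (g.1 ∙ f.1, g.2 ∙ f.2)) _ _ _).
- by move=> x y [f g] /=; rewrite !cmp1m.
- by move=> x y [f g] /=; rewrite !cmpm1.
- by move=> x y z w h g f /=; rewrite !cmpA.
Defined.

Definition findim (k : fieldType) (V : lmodType k) : Prop :=
  exists n, inhabited (Vector.axiom n V).

(* A Vect-enrichment of [C]. *)
Record linear_on (k : fieldType) (C : category) : Type := LinearOn {
  lin_class : forall x y : C, GRing.Lmodule k (mor x y);
  lin_mor := fun x y => GRing.Lmodule.Pack (lin_class x y) : lmodType k;
  lin_findim : forall x y, findim (lin_mor x y);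
  lin_cmpl : forall x y z (f : mor x y),
    linear (fun g : lin_mor y z => g ∙ f : lin_mor x z);
  lin_cmpr : forall x y z (g : mor y z),
    linear (fun f : lin_mor x y => g ∙ f : lin_mor x z) }.

Record lincat (k : fieldType) : Type := Lincat {
  lc_cat :> category;
  lc_lin : linear_on k lc_cat }.

Definition lmor (k : fieldType) (C : lincat k) (x y : C) : lmodType k :=
  lin_mor (lc_lin C) x y.

Record linfunctor (k : fieldType) (C D : lincat k) : Type := Linfunctor {
  lf_fun :> functor C D;
  lf_lin : forall x y : C,
    linear (fun f : lmor x y => fmor lf_fun f : lmor (lf_fun x) (lf_fun y)) }.

Section Semisimple.
Variables (k : fieldType) (C : lincat k).

(* Hom-spaces always contain 0, so this says that [x] is initial and terminal. *)
Definition is_zero (x : C) : Prop :=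
  forall y : C, (forall f : lmor x y, f = 0) /\ (forall f : lmor y x, f = 0).

Definition is_dsum (n : nat) (X : 'I_n -> C) (Y : C) : Prop :=
  exists (i : forall j, mor (X j) Y) (p : forall j, mor Y (X j)),
  [/\ forall j, p j ∙ i j = idm (X j),
      forall j l, j != l -> p l ∙ i j = 0 :> lmor (X j) (X l) &
      \sum_(j < n) (i j ∙ p j : lmor Y Y) = idm Y].

Definition is_dsum2 (X1 X2 Y : C) : Prop :=
  exists (i1 : mor X1 Y) (i2 : mor X2 Y) (p1 : mor Y X1) (p2 : mor Y X2),
  [/\ p1 ∙ i1 = idm X1, p2 ∙ i2 = idm X2,
      p2 ∙ i1 = 0 :> lmor X1 X2, p1 ∙ i2 = 0 :> lmor X2 X1 &
      (i1 ∙ p1 : lmor Y Y) + (i2 ∙ p2 : lmor Y Y) = idm Y].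

Definition additive1 : Prop :=
  (exists z : C, is_zero z) /\
  forall X1 X2 : C, exists Y, is_dsum2 X1 X2 Y.

(* Nonzero, and every subobject is zero or everything. *)
Definition is_simple (x : C) : Prop :=
  ~ is_zero x /\
  forall (y : C) (f : mor y x), is_mono f -> is_zero y \/ is_iso f.

Record semisimple1 : Prop := Semisimple1 {
  ss1_additive : additive1;
  ss1_idem : idempotent_complete1 C;
  ss1_dsum : forall Y : C, exists (n : nat) (X : 'I_n -> C),
    (forall j, is_simple (X j)) /\ is_dsum X Y;
  ss1_comp : forall x y z : C, is_simple x -> is_simple y -> is_simple z ->
    forall (g : lmor y z) (f : lmor x y),
    g != 0 -> f != 0 -> (g ∙ f : lmor x z) != 0 }.

Definition finitely_many_simples1 : Prop :=
  exists (n : nat) (S : 'I_n -> C),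
  forall x, is_simple x -> exists j, isomorphic x (S j).

Definition finite_semisimple1 : Prop := semisimple1 /\ finitely_many_simples1.

End Semisimple.

Record fsscat (k : fieldType) : Type := Fsscat {
  fs_cat :> lincat k;
  fsP : finite_semisimple1 fs_cat }.

(* Weak 2-categories: [hm] is the Hom-category, [hc] and [hc2] are horizontal
   composition of 1- and 2-morphisms, [asc], [lu], [ru] the associator and the
   left and right unitors, with inverses [asci], [lui], [rui]. *)
Record bicategory : Type := Bicategory {
  bob :> Type;
  hm : bob -> bob -> category;
  one : forall A, hm A A;
  hc : forall {A B C}, hm B C -> hm A B -> hm A C
    where "g ∘ f" := (hc g f);
  hc2 : forall {A B C} {g g' : hm B C} {f f' : hm A B},
    mor g g' -> mor f f' -> mor (g ∘ f) (g' ∘ f')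
    where "b ⋆ a" := (hc2 b a);
  hc2_id : forall A B C (g : hm B C) (f : hm A B),
    idm g ⋆ idm f = idm (g ∘ f);
  hc2_cmp : forall A B C (g g' g'' : hm B C) (f f' f'' : hm A B)
    (b' : mor g' g'') (b : mor g g') (a' : mor f' f'') (a : mor f f'),
    (b' ∙ b) ⋆ (a' ∙ a) = (b' ⋆ a') ∙ (b ⋆ a);
  asc : forall {A B C D} (h : hm C D) (g : hm B C) (f : hm A B),
    mor ((h ∘ g) ∘ f) (h ∘ (g ∘ f));
  asci : forall {A B C D} (h : hm C D) (g : hm B C) (f : hm A B),
    mor (h ∘ (g ∘ f)) ((h ∘ g) ∘ f);
  lu : forall {A B} (f : hm A B), mor (one B ∘ f) f;
  lui : forall {A B} (f : hm A B), mor f (one B ∘ f);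
  ru : forall {A B} (f : hm A B), mor (f ∘ one A) f;
  rui : forall {A B} (f : hm A B), mor f (f ∘ one A);
  ascP : forall A B C D (h : hm C D) (g : hm B C) (f : hm A B),
    inverse (asc h g f) (asci h g f);
  luP : forall A B (f : hm A B), inverse (lu f) (lui f);
  ruP : forall A B (f : hm A B), inverse (ru f) (rui f);
  ascN : forall A B C D (h h' : hm C D) (g g' : hm B C) (f f' : hm A B)
    (c : mor h h') (b : mor g g') (a : mor f f'),
    asc h' g' f' ∙ ((c ⋆ b) ⋆ a) = (c ⋆ (b ⋆ a)) ∙ asc h g f;
  luN : forall A B (f f' : hm A B) (a : mor f f'),
    lu f' ∙ (idm (one B) ⋆ a) = a ∙ lu f;
  ruN : forall A B (f f' : hm A B) (a : mor f f'),
    ru f' ∙ (a ⋆ idm (one A)) = a ∙ ru f;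
  pentagon : forall A B C D E
    (i : hm D E) (h : hm C D) (g : hm B C) (f : hm A B),
    asc i h (g ∘ f) ∙ asc (i ∘ h) g f
    = (idm i ⋆ asc h g f) ∙ asc i (h ∘ g) f ∙ (asc i h g ⋆ idm f);
  triangle : forall A B C (g : hm B C) (f : hm A B),
    (idm g ⋆ lu f) ∙ asc g (one B) f = ru g ⋆ idm f }.

Arguments one {_} A.
Arguments hm {_} A B.
Notation "g ∘ f" := (hc g f).
Notation "b ⋆ a" := (hc2 b a).

Section BicategoryTheory.
Variable B : bicategory.
Implicit Types W X Y Z : B.

Lemma inverse_cmp (C : category) (x y z : C) (f : mor x y) f' (g : mor y z) g' :
  inverse f f' -> inverse g g' -> inverse (g ∙ f) (f' ∙ g').
Proof.
move=> [f1 f2] [g1 g2]; split.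
- by rewrite cmpA -(cmpA f') g1 cmpm1.
- by rewrite cmpA -(cmpA g) f2 cmpm1.
Qed.

Lemma inverse_sym (C : category) (x y : C) (f : mor x y) f' :
  inverse f f' -> inverse f' f.
Proof. by case. Qed.

Lemma inverse_id (C : category) (x : C) : inverse (idm x) (idm x).
Proof. by split; rewrite cmp1m. Qed.

Lemma inverse_hc2 X Y Z (g g' : hm Y Z) (f f' : hm X Y)
  (b : mor g g') b' (a : mor f f') a' :
  inverse b b' -> inverse a a' -> inverse (b ⋆ a) (b' ⋆ a').
Proof. by move=> [b1 b2] [a1 a2]; split; rewrite -hc2_cmp ?b1 ?a1 ?b2 ?a2 hc2_id. Qed.

Lemma inverse_eq (C : category) (x y : C) (f : mor x y) g h :
  inverse f g -> inverse f h -> g = h.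
Proof. by move=> [g1 g2] [h1 h2]; rewrite -[g]cmpm1 -h2 cmpA g1 cmp1m. Qed.

Lemma inverse_eqP (C : category) (x y : C) (f f' : mor x y) g g' :
  inverse f g -> inverse f' g' -> f = f' -> g = g'.
Proof. by move=> fg fg' E; rewrite -E in fg'; apply: inverse_eq fg fg'. Qed.

Lemma cancel_r (C : category) (x y z : C) (f : mor x y) g (a b : mor y z) :
  inverse f g -> a ∙ f = b ∙ f -> a = b.
Proof. by move=> [_ fg] E; rewrite -[a]cmpm1 -[b]cmpm1 -fg !cmpA E. Qed.

Lemma cancel_l (C : category) (x y z : C) (f : mor x y) g (a b : mor z x) :
  inverse f g -> f ∙ a = f ∙ b -> a = b.
Proof. by move=> [gf _] E; rewrite -[a]cmp1m -[b]cmp1m -gf -!cmpA E. Qed.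

Lemma hc2_cmpl X Y Z (g g' g'' : hm Y Z) (f : hm X Y)
  (b' : mor g' g'') (b : mor g g') : (b' ∙ b) ⋆ idm f = (b' ⋆ idm f) ∙ (b ⋆ idm f).
Proof. by rewrite -hc2_cmp cmp1m. Qed.

Lemma hc2_cmpr X Y Z (g : hm Y Z) (f f' f'' : hm X Y)
  (b' : mor f' f'') (b : mor f f') : idm g ⋆ (b' ∙ b) = (idm g ⋆ b') ∙ (idm g ⋆ b).
Proof. by rewrite -hc2_cmp cmp1m. Qed.

Lemma hc2_lr X Y Z (g g' : hm Y Z) (f f' : hm X Y) (b : mor g g') (a : mor f f') :
  (b ⋆ idm f') ∙ (idm g ⋆ a) = b ⋆ a.
Proof. by rewrite -hc2_cmp cmp1m cmpm1. Qed.

Lemma hc2_rl X Y Z (g g' : hm Y Z) (f f' : hm X Y) (b : mor g g') (a : mor f f') :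
  (idm g' ⋆ a) ∙ (b ⋆ idm f) = b ⋆ a.
Proof. by rewrite -hc2_cmp cmp1m cmpm1. Qed.

Lemma asciN W X Y Z (h h' : hm Y Z) (g g' : hm X Y) (f f' : hm W X)
  (c : mor h h') (b : mor g g') (a : mor f f') :
  asci h' g' f' ∙ (c ⋆ (b ⋆ a)) = ((c ⋆ b) ⋆ a) ∙ asci h g f.
Proof.
have [i1 i2] := ascP h g f; have [j1 j2] := ascP h' g' f'.
apply: (cancel_l (ascP h' g' f')).
by rewrite !cmpA j2 cmp1m ascN -cmpA i2 cmpm1.
Qed.

Lemma luiN X Y (f f' : hm X Y) (a : mor f f') :
  (idm (one Y) ⋆ a) ∙ lui f = lui f' ∙ a.
Proof.
apply: (cancel_l (luP f')).
by rewrite !cmpA luN (proj2 (luP f')) cmp1m -cmpA (proj2 (luP f)) cmpm1.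
Qed.

Lemma ruiN X Y (f f' : hm X Y) (a : mor f f') :
  (a ⋆ idm (one X)) ∙ rui f = rui f' ∙ a.
Proof.
apply: (cancel_l (ruP f')).
by rewrite !cmpA ruN (proj2 (ruP f')) cmp1m -cmpA (proj2 (ruP f)) cmpm1.
Qed.

Lemma pentagon_inv V W X Y Z (i : hm Y Z) (h : hm X Y) (g : hm W X) (f : hm V W) :
  asci (i ∘ h) g f ∙ asci i h (g ∘ f)
  = (asci i h g ⋆ idm f) ∙ asci i (h ∘ g) f ∙ (idm i ⋆ asci h g f).
Proof.
rewrite -cmpA; apply: inverse_eqP (pentagon i h g f).
  by apply: inverse_cmp; apply: ascP.
apply: inverse_cmp; first by apply: inverse_hc2; [apply: ascP | apply: inverse_id].
apply: inverse_cmp; first exact: ascP.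
by apply: inverse_hc2; [apply: inverse_id | apply: ascP].
Qed.

Lemma triangle_inv X Y Z (g : hm Y Z) (f : hm X Y) :
  asci g (one Y) f ∙ (idm g ⋆ lui f) = rui g ⋆ idm f.
Proof.
apply: inverse_eqP (triangle g f).
  apply: inverse_cmp; first exact: ascP.
  by apply: inverse_hc2; [apply: inverse_id | apply: luP].
by apply: inverse_hc2; [apply: ruP | apply: inverse_id].
Qed.

Lemma triangle' X Y Z (g : hm Y Z) (f : hm X Y) :
  (ru g ⋆ idm f) ∙ asci g (one Y) f = idm g ⋆ lu f.
Proof. by rewrite -triangle -cmpA (proj2 (ascP _ _ _)) cmpm1. Qed.

Lemma one_l_inj X Y (f f' : hm X Y) (a b : mor f f') :
  idm (one Y) ⋆ a = idm (one Y) ⋆ b -> a = b.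
Proof.
move=> E; apply: (cancel_r (luP f)); by rewrite -!luN E.
Qed.

Lemma one_r_inj X Y (f f' : hm X Y) (a b : mor f f') :
  a ⋆ idm (one X) = b ⋆ idm (one X) -> a = b.
Proof.
move=> E; apply: (cancel_r (ruP f)); by rewrite -!ruN E.
Qed.

Lemma lu_hc X Y Z (g : hm Y Z) (f : hm X Y) :
  lu (g ∘ f) ∙ asc (one Z) g f = lu g ⋆ idm f.
Proof.
apply: one_l_inj; rewrite hc2_cmpr.
apply: (cancel_r (ascP (one Z) (one Z ∘ g) f)).
apply: (cancel_r (inverse_hc2 (ascP (one Z) (one Z) g) (inverse_id f))).
rewrite -!cmpA (cmpA (idm (one Z) ⋆ asc _ _ _)) -pentagon !cmpA triangle.
rewrite -(hc2_id g f) -!ascN -!cmpA; congr (_ ∙ _).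
by rewrite -hc2_cmp triangle cmp1m.
Qed.

Lemma ru_hc X Y Z (g : hm Y Z) (f : hm X Y) :
  (idm g ⋆ ru f) ∙ asc g f (one X) = ru (g ∘ f).
Proof.
apply: one_r_inj; rewrite hc2_cmpl.
apply: (cancel_l (ascP g f (one X))).
rewrite !cmpA ascN -[in LHS]triangle hc2_cmpr -!cmpA (cmpA (idm g ⋆ asc _ _ _)).
rewrite -pentagon cmpA -ascN hc2_id -cmpA; congr (_ ∙ _).
exact: triangle.
Qed.

Lemma lu_hc' X Y Z (g : hm Y Z) (f : hm X Y) :
  (lu g ⋆ idm f) ∙ asci (one Z) g f = lu (g ∘ f).
Proof. by rewrite -lu_hc -cmpA (proj2 (ascP _ _ _)) cmpm1. Qed.

Lemma pentagon_mid V W X Y Z (i : hm Y Z) (h : hm X Y) (g : hm W X) (f : hm V W) :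
  asci i h (g ∘ f) ∙ (idm i ⋆ asc h g f) ∙ asc i (h ∘ g) f
  = asc (i ∘ h) g f ∙ (asci i h g ⋆ idm f).
Proof.
apply: (cancel_l (ascP i h (g ∘ f))).
rewrite !cmpA (proj2 (ascP _ _ _)) cmp1m pentagon -!cmpA -hc2_cmp.
by rewrite (proj2 (ascP _ _ _)) cmp1m hc2_id cmpm1.
Qed.

Lemma pentagon_last V W X Y Z (i : hm Y Z) (h : hm X Y) (g : hm W X) (f : hm V W) :
  (idm i ⋆ asci h g f) ∙ asc i h (g ∘ f) ∙ asc (i ∘ h) g f
  = asc i (h ∘ g) f ∙ (asc i h g ⋆ idm f).
Proof.
rewrite -cmpA pentagon !cmpA -hc2_cmp (proj1 (ascP _ _ _)) cmp1m hc2_id.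
by rewrite cmp1m.
Qed.

End BicategoryTheory.

(* [op_bicat] reverses 1-morphisms and keeps the direction of 2-morphisms. *)
Definition op_bicat (B : bicategory) : bicategory.
Proof.
refine (@Bicategory B (fun X Y => hm Y X) (fun X => one X)
  (fun _ _ _ g f => f ∘ g) (fun _ _ _ _ _ _ _ b a => a ⋆ b) _ _
  (fun _ _ _ _ h g f => asci f g h) (fun _ _ _ _ h g f => asc f g h)
  (fun _ _ f => ru f) (fun _ _ f => rui f)
  (fun _ _ f => lu f) (fun _ _ f => lui f) _ _ _ _ _ _ _ _).
- by move=> *; apply: hc2_id.
- by move=> *; apply: hc2_cmp.
- by move=> *; apply: inverse_sym; apply: ascP.
- by move=> *; apply: ruP.
- by move=> *; apply: luP.
- by move=> *; apply: asciN.
- by move=> *; apply: ruN.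
- by move=> *; apply: luN.
- by move=> *; apply: pentagon_inv.
- by move=> *; apply: triangle'.
Defined.

Lemma inverse_prod (C D : category) (x y : prod_cat C D) (f : mor x y) g :
  inverse f.1 g.1 -> inverse f.2 g.2 -> inverse f g.
Proof. by move=> [f1 g1] [f2 g2]; split; congr pair. Qed.

Definition prod_bicat (B B' : bicategory) : bicategory.
Proof.
refine (@Bicategory (B * B')%type
  (fun X Y => prod_cat (hm X.1 Y.1) (hm X.2 Y.2)) (fun X => (one X.1, one X.2))
  (fun _ _ _ g f => (g.1 ∘ f.1, g.2 ∘ f.2))
  (fun _ _ _ _ _ _ _ b a => (b.1 ⋆ a.1, b.2 ⋆ a.2)) _ _
  (fun _ _ _ _ h g f => (asc h.1 g.1 f.1, asc h.2 g.2 f.2))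
  (fun _ _ _ _ h g f => (asci h.1 g.1 f.1, asci h.2 g.2 f.2))
  (fun _ _ f => (lu f.1, lu f.2)) (fun _ _ f => (lui f.1, lui f.2))
  (fun _ _ f => (ru f.1, ru f.2)) (fun _ _ f => (rui f.1, rui f.2))
  _ _ _ _ _ _ _ _).
- by move=> * /=; rewrite !hc2_id.
- by move=> * /=; rewrite !hc2_cmp.
- by move=> *; apply: inverse_prod; apply: ascP.
- by move=> *; apply: inverse_prod; apply: luP.
- by move=> *; apply: inverse_prod; apply: ruP.
- by move=> * /=; rewrite !ascN.
- by move=> * /=; rewrite !luN.
- by move=> * /=; rewrite !ruN.
- by move=> * /=; rewrite !pentagon.
- by move=> * /=; rewrite !triangle.
Defined.

Record pseudofunctor (B B' : bicategory) : Type := Pseudofunctor {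
  pf0 :> B -> B';
  pf1 : forall {X Y}, functor (hm X Y) (hm (pf0 X) (pf0 Y));
  pfc : forall {X Y Z} (g : hm Y Z) (f : hm X Y),
    mor (pf1 g ∘ pf1 f) (pf1 (g ∘ f));
  pfu : forall X, mor (one (pf0 X)) (pf1 (one X));
  pfcP : forall X Y Z (g : hm Y Z) (f : hm X Y), is_iso (pfc g f);
  pfuP : forall X, is_iso (pfu X);
  pfcN : forall X Y Z (g g' : hm Y Z) (f f' : hm X Y)
    (b : mor g g') (a : mor f f'),
    pfc g' f' ∙ (fmor pf1 b ⋆ fmor pf1 a) = fmor pf1 (b ⋆ a) ∙ pfc g f;
  pf_asc : forall W X Y Z (h : hm Y Z) (g : hm X Y) (f : hm W X),
    fmor pf1 (asc h g f) ∙ pfc (h ∘ g) f ∙ (pfc h g ⋆ idm (pf1 f))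
    = pfc h (g ∘ f) ∙ (idm (pf1 h) ⋆ pfc g f) ∙ asc (pf1 h) (pf1 g) (pf1 f);
  pf_lu : forall X Y (f : hm X Y),
    fmor pf1 (lu f) ∙ pfc (one Y) f ∙ (pfu Y ⋆ idm (pf1 f)) = lu (pf1 f);
  pf_ru : forall X Y (f : hm X Y),
    fmor pf1 (ru f) ∙ pfc f (one X) ∙ (idm (pf1 f) ⋆ pfu X) = ru (pf1 f) }.

Arguments pf1 {B B'} F {X Y} : rename.
Arguments pfc {B B'} F {X Y Z} g f : rename.
Arguments pfu {B B'} F X : rename.
Notation pf2 F a := (fmor (pf1 F) a).

Lemma is_iso_cmp (C : category) (x y z : C) (g : mor y z) (f : mor x y) :
  is_iso g -> is_iso f -> is_iso (g ∙ f).
Proof. by move=> [g' gP] [f' fP]; exists (f' ∙ g'); apply: inverse_cmp. Qed.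

Lemma is_iso_fmor (C D : category) (F : functor C D) (x y : C) (f : mor x y) :
  is_iso f -> is_iso (fmor F f).
Proof.
by move=> [g [gf fg]]; exists (fmor F g); split; rewrite -fmor_cmp ?gf ?fg fmor_id.
Qed.

Lemma is_iso_id (C : category) (x : C) : is_iso (idm x).
Proof. by exists (idm x); apply: inverse_id. Qed.

Definition comp_functor (C D E : category) (G : functor D E) (F : functor C D) :
  functor C E.
Proof.
refine (@Functor C E (fun x => G (F x)) (fun _ _ f => fmor G (fmor F f)) _ _).
- by move=> x; rewrite !fmor_id.
- by move=> *; rewrite !fmor_cmp.
Defined.

Definition id_functor (C : category) : functor C C.
Proof. by refine (@Functor C C (fun x => x) (fun _ _ f => f) _ _). Defined.

Definition prod_functor (C D C' D' : category) (F : functor C D)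
  (F' : functor C' D') : functor (prod_cat C C') (prod_cat D D').
Proof.
refine (@Functor (prod_cat C C') (prod_cat D D') (fun x => (F x.1, F' x.2))
  (fun _ _ f => (fmor F f.1, fmor F' f.2)) _ _).
- by move=> x /=; rewrite !fmor_id.
- by move=> * /=; rewrite !fmor_cmp.
Defined.

Definition comp_pf (B1 B2 B3 : bicategory) (G : pseudofunctor B2 B3)
  (F : pseudofunctor B1 B2) : pseudofunctor B1 B3.
Proof.
refine (@Pseudofunctor B1 B3 (fun X => G (F X))
  (fun X Y => comp_functor (pf1 G) (pf1 F))
  (fun _ _ _ g f => pf2 G (pfc F g f) ∙ pfc G (pf1 F g) (pf1 F f))
  (fun X => pf2 G (pfu F X) ∙ pfu G (F X)) _ _ _ _ _ _) => /=.
- by move=> *; apply: is_iso_cmp; [apply: is_iso_fmor|]; apply: pfcP.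
- by move=> *; apply: is_iso_cmp; [apply: is_iso_fmor|]; apply: pfuP.
- by move=> *; rewrite -cmpA pfcN !cmpA -!fmor_cmp pfcN.
- move=> W X Y Z h g f.
  rewrite hc2_cmpl hc2_cmpr -!cmpA !(cmpA (pfc G _ _) (_ ⋆ _)).
  rewrite -(fmor_id (pf1 G)) pfcN -(fmor_id (pf1 G)) pfcN.
  rewrite !cmpA -!fmor_cmp pf_asc !fmor_cmp -!cmpA; congr (_ ∙ (_ ∙ _)).
  by rewrite !fmor_id !cmpA pf_asc.
- move=> X Y f; rewrite hc2_cmpl -!cmpA (cmpA (pfc G _ _)) -(fmor_id (pf1 G)) pfcN.
  by rewrite !cmpA -!fmor_cmp pf_lu fmor_id pf_lu.
- move=> X Y f; rewrite hc2_cmpr -!cmpA (cmpA (pfc G _ _)) -(fmor_id (pf1 G)) pfcN.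
  by rewrite !cmpA -!fmor_cmp pf_ru fmor_id pf_ru.
Defined.

Definition id_pf (B : bicategory) : pseudofunctor B B.
Proof.
refine (@Pseudofunctor B B (fun X => X) (fun X Y => id_functor (hm X Y))
  (fun _ _ _ g f => idm (g ∘ f)) (fun X => idm (one X)) _ _ _ _ _ _) => /=.
- by move=> *; apply: is_iso_id.
- by move=> *; apply: is_iso_id.
- by move=> *; rewrite cmp1m cmpm1.
- by move=> *; rewrite !hc2_id !cmpm1 !cmp1m.
- by move=> *; rewrite !hc2_id !cmpm1.
- by move=> *; rewrite !hc2_id !cmpm1.
Defined.

Lemma is_iso_prod (C D : category) (x y : prod_cat C D) (f : mor x y) :
  is_iso f.1 -> is_iso f.2 -> is_iso f.
Proof. by move=> [g gP] [h hP]; exists (g, h); apply: inverse_prod. Qed.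

Definition prod_pf (B1 B2 B1' B2' : bicategory) (F : pseudofunctor B1 B2)
  (F' : pseudofunctor B1' B2') :
  pseudofunctor (prod_bicat B1 B1') (prod_bicat B2 B2').
Proof.
refine (@Pseudofunctor (prod_bicat B1 B1') (prod_bicat B2 B2')
  (fun X => (F X.1, F' X.2))
  (fun X Y => prod_functor (pf1 F) (pf1 F'))
  (fun _ _ _ g f => (pfc F g.1 f.1, pfc F' g.2 f.2))
  (fun X => (pfu F X.1, pfu F' X.2)) _ _ _ _ _ _).
- by move=> *; apply: is_iso_prod; apply: pfcP.
- by move=> *; apply: is_iso_prod; apply: pfuP.
- by move=> * /=; rewrite !pfcN.
- by move=> * /=; rewrite !pf_asc.
- by move=> * /=; rewrite !pf_lu.
- by move=> * /=; rewrite !pf_ru.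
Defined.

(* Pseudonatural transformations, split into data and axioms; the naturality
   cell of [f : X -> Y] goes from [G f ∘ s X] to [s Y ∘ F f]. *)
Record pstrans_data (B B' : bicategory) (F G : pseudofunctor B B') : Type :=
  PstransData {
  pt1 :> forall X, hm (F X) (G X);
  pt2 : forall {X Y} (f : hm X Y), mor (pf1 G f ∘ pt1 X) (pt1 Y ∘ pf1 F f) }.

Record is_pstrans (B B' : bicategory) (F G : pseudofunctor B B')
  (s : pstrans_data F G) : Prop := IsPstrans {
  pt2P : forall X Y (f : hm X Y), is_iso (pt2 s f);
  pt2N : forall X Y (f f' : hm X Y) (a : mor f f'),
    (idm (s Y) ⋆ pf2 F a) ∙ pt2 s f = pt2 s f' ∙ (pf2 G a ⋆ idm (s X));
  pt2_one : forall X,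
    pt2 s (one X) ∙ (pfu G X ⋆ idm (s X))
    = (idm (s X) ⋆ pfu F X) ∙ rui (s X) ∙ lu (s X);
  pt2_hc : forall X Y Z (g : hm Y Z) (f : hm X Y),
    pt2 s (g ∘ f) ∙ (pfc G g f ⋆ idm (s X))
    = (idm (s Z) ⋆ pfc F g f) ∙ asc (s Z) (pf1 F g) (pf1 F f)
      ∙ (pt2 s g ⋆ idm (pf1 F f)) ∙ asci (pf1 G g) (s Y) (pf1 F f)
      ∙ (idm (pf1 G g) ⋆ pt2 s f) ∙ asc (pf1 G g) (pf1 G f) (s X) }.

Definition id_ptd (B B' : bicategory) (F : pseudofunctor B B') :
  pstrans_data F F :=
  PstransData (pt1 := fun X => one (F X))
    (fun X Y f => lui (pf1 F f) ∙ ru (pf1 F f)).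

Definition comp_ptd (B B' : bicategory) (F G H : pseudofunctor B B')
  (t : pstrans_data G H) (s : pstrans_data F G) : pstrans_data F H :=
  PstransData (pt1 := fun X => t X ∘ s X)
    (fun X Y f =>
       asci (t Y) (s Y) (pf1 F f) ∙ (idm (t Y) ⋆ pt2 s f)
       ∙ asc (t Y) (pf1 G f) (s X) ∙ (pt2 t f ⋆ idm (s X))
       ∙ asci (pf1 H f) (t X) (s X)).

(* An invertible modification from [s] to [t]. *)
Definition modif_iso (B B' : bicategory) (F G : pseudofunctor B B')
  (s t : pstrans_data F G) : Prop :=
  exists m : forall X, mor (s X) (t X),
  (forall X, is_iso (m X)) /\
  forall X Y (f : hm X Y),
    pt2 t f ∙ (idm (pf1 G f) ⋆ m X) = (m Y ⋆ idm (pf1 F f)) ∙ pt2 s f.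

(* Equivalence in the 2-category of pseudofunctors, pseudonatural
   transformations and modifications. The composites and identities need only
   the data of transformations, as modifications do not mention their axioms. *)
Definition pf_equivalent (B B' : bicategory) (F G : pseudofunctor B B') : Prop :=
  exists (s : pstrans_data F G) (t : pstrans_data G F),
  [/\ is_pstrans s, is_pstrans t,
      modif_iso (comp_ptd t s) (id_ptd F) & modif_iso (comp_ptd s t) (id_ptd G)].

Record linbicat (k : fieldType) : Type := Linbicat {
  lb_cat :> bicategory;
  lb_lin : forall X Y : lb_cat, linear_on k (hm X Y);
  lb_hcl : forall (X Y Z : lb_cat) (g g' : hm Y Z) (f f' : hm X Y)
    (a : mor f f'),
    linear (fun b : lin_mor (lb_lin Y Z) g g' =>
              b ⋆ a : lin_mor (lb_lin X Z) (g ∘ f) (g' ∘ f'));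
  lb_hcr : forall (X Y Z : lb_cat) (g g' : hm Y Z) (f f' : hm X Y)
    (b : mor g g'),
    linear (fun a : lin_mor (lb_lin X Y) f f' =>
              b ⋆ a : lin_mor (lb_lin X Z) (g ∘ f) (g' ∘ f')) }.

Definition lhm (k : fieldType) (B : linbicat k) (X Y : B) : lincat k :=
  Lincat (lb_lin X Y).

Definition locally_linear (k : fieldType) (B B' : linbicat k)
  (F : pseudofunctor B B') : Prop :=
  forall (X Y : B) (f f' : lhm X Y),
    linear (fun a : lmor f f' => pf2 F a : @lmor k (lhm _ _) (pf1 F f) (pf1 F f')).

(* [P] is linear in each variable separately on 2-morphisms of the product. The
   2-morphisms of [op_bicat B1] from [u.1] to [v.1] are those of [B1]. *)
Definition locally_bilinear (k : fieldType) (B1 B2 B' : linbicat k)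
  (P : pseudofunctor (prod_bicat (op_bicat B1) B2) B') : Prop :=
  forall (X Y : prod_bicat (op_bicat B1) B2) (u v : hm X Y),
  (forall b : mor u.2 v.2,
     linear (fun a : @lmor k (@lhm k B1 Y.1 X.1) u.1 v.1 =>
               pf2 P ((a, b) : mor u v) : @lmor k (lhm _ _) (pf1 P u) (pf1 P v))) /\
  (forall a : mor u.1 v.1,
     linear (fun b : @lmor k (@lhm k B2 X.2 Y.2) u.2 v.2 =>
               pf2 P ((a, b) : mor u v) : @lmor k (lhm _ _) (pf1 P u) (pf1 P v))).

Section Semisimple2.
Variables (k : fieldType) (B : linbicat k).

Definition equivalence1 (X Y : B) (f : hm X Y) : Prop :=
  exists g : hm Y X, isomorphic (g ∘ f) (one X) /\ isomorphic (f ∘ g) (one Y).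

Definition equivalent (X Y : B) : Prop := exists f : hm X Y, equivalence1 f.

Definition is_zero2 (Z : B) : Prop := is_zero (one Z : lhm Z Z).

Definition is_dsum_ob (A1 A2 S : B) : Prop :=
  exists (i1 : hm A1 S) (i2 : hm A2 S) (r1 : hm S A1) (r2 : hm S A2),
  [/\ isomorphic (r1 ∘ i1) (one A1) /\ isomorphic (r2 ∘ i2) (one A2),
      is_zero (r2 ∘ i1 : lhm A1 A2), is_zero (r1 ∘ i2 : lhm A2 A1) &
      @is_dsum2 k (lhm S S) (i1 ∘ r1) (i2 ∘ r2) (one S)].

Record additive2 : Prop := Additive2 {
  add2_local : forall X Y : B, additive1 (lhm X Y);
  add2_zero : exists Z : B, is_zero2 Z;
  add2_dsum : forall A1 A2 : B, exists S : B, is_dsum_ob A1 A2 S }.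

(* [l] is left adjoint to [r], with unit [eta] and counit [eps]. *)
Definition adjunction (X Y : B) (l : hm X Y) (r : hm Y X)
  (eta : mor (one X) (r ∘ l)) (eps : mor (l ∘ r) (one Y)) : Prop :=
  lu l ∙ (eps ⋆ idm l) ∙ asci l r l ∙ (idm l ⋆ eta) ∙ rui l = idm l /\
  ru r ∙ (idm r ⋆ eps) ∙ asc r l r ∙ (eta ⋆ idm r) ∙ lui r = idm r.

Definition left_adjoint_of (X Y : B) (l : hm X Y) (r : hm Y X) : Prop :=
  exists eta eps, @adjunction X Y l r eta eps.

Definition has_adjoints : Prop :=
  forall (X Y : B) (f : hm X Y),
  (exists l : hm Y X, left_adjoint_of l f) /\
  (exists r : hm Y X, left_adjoint_of f r).

Record monad (Y : B) : Type := Monad {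
  mon1 :> hm Y Y;
  mon_mul : mor (mon1 ∘ mon1) mon1;
  mon_unit : mor (one Y) mon1;
  mon_mulA : mon_mul ∙ (mon_mul ⋆ idm mon1)
    = mon_mul ∙ (idm mon1 ⋆ mon_mul) ∙ asc mon1 mon1 mon1;
  mon_mul1l : mon_mul ∙ (mon_unit ⋆ idm mon1) = lu mon1;
  mon_mul1r : mon_mul ∙ (idm mon1 ⋆ mon_unit) = ru mon1 }.

(* The last two equations say that [c] is a map of left and of right
   [E]-modules. *)
Definition separable (Y : B) (E : monad Y) : Prop :=
  exists c : mor E (E ∘ E),
  [/\ mon_mul E ∙ c = idm (E : hm Y Y),
      c ∙ mon_mul E = (mon_mul E ⋆ idm (E : hm Y Y)) ∙ asci E E E ∙ (idm (E : hm Y Y) ⋆ c) &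
      c ∙ mon_mul E = (idm (E : hm Y Y) ⋆ mon_mul E) ∙ asc E E E ∙ (c ⋆ idm (E : hm Y Y))].

(* [phi] is an isomorphism of monads, where [i ∘ r] has the unit [eta] and the
   multiplication [i ⋆ eps ⋆ r]. *)
Definition separably_splits (Y : B) (E : monad Y) : Prop :=
  exists (X : B) (i : hm X Y) (r : hm Y X)
    (eta : mor (one Y) (i ∘ r)) (eps : mor (r ∘ i) (one X)),
  [/\ adjunction eta eps,
      exists s : mor (one X) (r ∘ i), eps ∙ s = idm (one X) &
      exists phi : mor (E : hm Y Y) (i ∘ r),
      [/\ is_iso phi, phi ∙ mon_unit E = eta &
          phi ∙ mon_mul E
          = (idm i ⋆ (lu r ∙ (eps ⋆ idm r) ∙ asci r i r))
            ∙ asc i r (i ∘ r) ∙ (phi ⋆ phi)]].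

Definition idempotent_complete2 : Prop :=
  (forall X Y : B, idempotent_complete1 (hm X Y)) /\
  (forall (Y : B) (E : monad Y), separable E -> separably_splits E).

Definition locally_semisimple : Prop :=
  forall X Y : B, semisimple1 (lhm X Y).

Definition locally_finite_semisimple : Prop :=
  forall X Y : B, finite_semisimple1 (lhm X Y).

Record semisimple2 : Prop := Semisimple2 {
  ss2_local : locally_semisimple;
  ss2_adj : has_adjoints;
  ss2_additive : additive2;
  ss2_idem : idempotent_complete2 }.

Definition fully_faithful1 (X Y : B) (f : hm X Y) : Prop :=
  forall (W : B) (g h : hm W X),
    bijective (fun a : mor g h => idm f ⋆ a).

Definition is_simple2 (Y : B) : Prop :=
  ~ is_zero2 Y /\
  forall (X : B) (f : hm X Y),
    fully_faithful1 f -> is_zero2 X \/ equivalence1 f.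

Definition finitely_many_simples2 : Prop :=
  exists (n : nat) (S : 'I_n -> B),
  forall X, is_simple2 X -> exists j, equivalent X (S j).

Record finite_semisimple2 : Prop := FiniteSemisimple2 {
  fss2_ss : semisimple2;
  fss2_local : locally_finite_semisimple;
  fss2_simples : finitely_many_simples2 }.

End Semisimple2.

Section NattransLmod.
Variables (k : fieldType) (C : category) (D : lincat k) (F G : functor C D).
Implicit Types s t : nattrans F G.

Let V x y : lmodType k := lmor (x : D) y.

Lemma cmpDl (x y z : D) (f : mor x y) (g g' : V y z) :
  (g + g') ∙ f = (g ∙ f : V x z) + (g' ∙ f : V x z).
Proof. by have := lin_cmpl (l := lc_lin D) f 1 g g'; rewrite !scale1r. Qed.

Lemma cmpDr (x y z : D) (g : mor y z) (f f' : V x y) :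
  g ∙ (f + f' : V x y) = (g ∙ f : V x z) + (g ∙ f' : V x z).
Proof. by have := lin_cmpr (l := lc_lin D) g 1 f f'; rewrite !scale1r. Qed.

Lemma cmp0l (x y z : D) (f : mor x y) : (0 : V y z) ∙ f = 0 :> V x z.
Proof.
by have := lin_cmpl (l := lc_lin D) f (-1) (0 : V y z) 0; rewrite !scaleN1r !addNr.
Qed.

Lemma cmp0r (x y z : D) (g : mor y z) : g ∙ (0 : V x y) = 0 :> V x z.
Proof.
by have := lin_cmpr (l := lc_lin D) g (-1) (0 : V x y) 0; rewrite !scaleN1r !addNr.
Qed.

Lemma cmpZl (x y z : D) (f : mor x y) a (g : V y z) :
  (a *: g) ∙ f = a *: (g ∙ f : V x z).
Proof.
have := lin_cmpl (l := lc_lin D) f a g 0; rewrite addr0 => ->.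
by rewrite -[X in _ + X]/(cmp _ _) cmp0l addr0.
Qed.

Lemma cmpZr (x y z : D) (g : mor y z) a (f : V x y) :
  g ∙ (a *: f : V x y) = a *: (g ∙ f : V x z).
Proof.
have := lin_cmpr (l := lc_lin D) g a f 0; rewrite addr0 => ->.
by rewrite -[X in _ + X]/(cmp _ _) cmp0r addr0.
Qed.

Definition nt_zero : nattrans F G.
Proof.
exists (fun x => 0 : V (F x) (G x)).
by move=> x y f; rewrite cmp0l cmp0r.
Defined.

Definition nt_add s t : nattrans F G.
Proof.
exists (fun x => (s x : V _ _) + (t x : V _ _)).
by move=> x y f; rewrite cmpDl cmpDr !ncompN.
Defined.

Definition nt_scale (a : k) s : nattrans F G.
Proof.
exists (fun x => a *: (s x : V _ _)).
by move=> x y f; rewrite cmpZl cmpZr !ncompN.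
Defined.

HB.instance Definition _ := gen_eqMixin (nattrans F G).
HB.instance Definition _ := gen_choiceMixin (nattrans F G).

Fact nt_addA : associative nt_add.
Proof. by move=> s t u; apply: nattransP => x; apply: (@addrA (V _ _)). Qed.
Fact nt_addC : commutative nt_add.
Proof. by move=> s t; apply: nattransP => x; apply: (@addrC (V _ _)). Qed.
Fact nt_add0 : left_id nt_zero nt_add.
Proof. by move=> s; apply: nattransP => x; apply: (@add0r (V _ _)). Qed.
Fact nt_addN : left_inverse nt_zero (nt_scale (-1)) nt_add.
Proof.
by move=> s; apply: nattransP => x /=; rewrite scaleN1r; apply: (@addNr (V _ _)).
Qed.

HB.instance Definition _ :=
  GRing.isZmodule.Build (nattrans F G) nt_addA nt_addC nt_add0 nt_addN.

Fact nt_scaleA a b s : nt_scale a (nt_scale b s) = nt_scale (a * b) s.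
Proof. by apply: nattransP => x; apply: (@scalerA k (V _ _)). Qed.
Fact nt_scale1 : left_id 1 nt_scale.
Proof. by move=> s; apply: nattransP => x; apply: (@scale1r k (V _ _)). Qed.
Fact nt_scaleDr : right_distributive nt_scale +%R.
Proof. by move=> a s t; apply: nattransP => x; apply: (@scalerDr k (V _ _)). Qed.
Fact nt_scaleDl s : {morph nt_scale^~ s : a b / a + b}.
Proof. by move=> a b; apply: nattransP => x; apply: (@scalerDl k (V _ _)). Qed.

HB.instance Definition _ := GRing.Zmodule_isLmodule.Build k (nattrans F G)
  nt_scaleA nt_scale1 nt_scaleDr nt_scaleDl.

End NattransLmod.

(* A subspace of a finite-dimensional space is finite-dimensional. *)
Lemma findim_inj (k : fieldType) (V : lmodType k) (N : nat) (j : V -> 'rV[k]_N) :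
  linear j -> injective j -> findim V.
Proof.
move=> jlin jinj.
pose P r := `[< exists2 b : 'I_r -> V, True & row_free (\matrix_i j (b i)) >].
have P0 : exists r, P r.
  exists 0%N; apply/asboolP; exists (fun=> 0) => //.
  by rewrite /row_free -leqn0 rank_leq_row.
have Pb r : P r -> (r <= N)%N.
  by move=> /asboolP [b _ /eqP E]; rewrite -{1}E rank_leq_col.
have [r /asboolP [b _ bfree] rmax] := ex_maxnP P0 Pb.
pose jl := GRing.isLinear.Build k V 'rV[k]_N _ j jlin.
pose J : {linear V -> 'rV[k]_N} := HB.pack j jl.
pose A := \matrix_i j (b i).
have jA v : (j v <= A)%MS.
  apply: contraT => vA.
  have : P r.+1.
    apply/asboolP; exists (fun i => oapp b v (unlift ord0 i)) => //.
    have -> : \matrix_i j (oapp b v (unlift ord0 i)) = col_mx (j v) A :> 'M_(1 + r, N).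
      apply/matrixP => a c; rewrite !mxE; case: splitP => i ai; rewrite ?mxE.
        rewrite (ord1 i) in ai *; have -> : a = ord0 by apply: val_inj.
        by rewrite unlift_none.
      have -> : a = lift ord0 i by apply: val_inj.
      by rewrite liftK.
    rewrite /row_free.
    have vz : j v != 0 by apply: contraNneq vA => ->; apply: sub0mx.
    have rk1 : \rank (j v) = 1%N by rewrite rank_rV vz.
    have <- : \rank (j v + A)%MS = \rank (col_mx (j v) A) by exact: (fst (addsmxE _ _)).
    rewrite mxrank_disjoint_sum ?rk1 ?(eqP bfree) //.
    apply/eqP; rewrite -mxrank_eq0 -leqn0 leqNgt; apply: contra vA => H.
    have cj : (j v :&: A <= j v)%MS by apply: capmxSl.
    have : (j v <= j v :&: A)%MS.
      have [le <-] := mxrank_leqif_sup cj.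
      by rewrite eqn_leq le rk1.
    by move=> /submx_trans; apply; apply: capmxSr.
  by move/rmax; rewrite ltnn.
exists r; constructor; exists (fun v => j v *m pinvmx A).
  by move=> a u v; rewrite jlin mulmxDl scalemxAl.
exists (fun c : 'rV[k]_r => \sum_i c 0 i *: b i) => [v|c].
  apply: jinj; rewrite -[j (\sum_i _)]/(J (\sum_i _)) linear_sum /=.
  rewrite -[RHS](mulmxKpV (jA v)) [RHS]mulmx_sum_row.
  by apply: eq_bigr => i _; rewrite rowK -[j (_ *: _)]/(J _) linearZ_LR.
rewrite -[j _]/(J _) linear_sum /= -[RHS](mulmxKp bfree).
rewrite -/A [c *m A]mulmx_sum_row; congr (_ *m _).
by apply: eq_bigr => i _; rewrite rowK -[j (_ *: _)]/(J _) linearZ_LR.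
Qed.

Lemma findim_family (k : fieldType) (V : lmodType k) (n : nat)
  (W : 'I_n -> lmodType k) (e : forall j, V -> W j) :
  (forall j, findim (W j)) -> (forall j, linear (e j)) ->
  (forall u v, (forall j, e j u = e j v) -> u = v) -> findim V.
Proof.
move=> Wfd elin einj.
have H j : {d : nat & {phi : W j -> 'rV[k]_d | linear phi /\ injective phi}}.
  have /cid [d dP] := Wfd j; exists d; apply: cid; case: dP => -[phi phil phib].
  by exists phi; split => //; apply: bij_inj.
pose d j := projT1 (H j); pose phi j : W j -> 'rV[k]_(d j) := sval (projT2 (H j)).
have philin j : linear (phi j) by case: (svalP (projT2 (H j))).
have phiinj j : injective (phi j) by case: (svalP (projT2 (H j))).
pose I := {j : 'I_n & 'I_(d j)}.
apply: (@findim_inj k V #|{: I}| (fun v => \row_a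
   let u : I := enum_val a in phi (tag u) (e (tag u) v) 0 (tagged u))).
  by move=> a u v; apply/rowP => c; rewrite !mxE /= elin philin !mxE.
move=> u v /rowP E; apply: einj => j; apply: phiinj; apply/rowP => i.
by have := E (enum_rank (Tagged (fun j => 'I_(d j)) i : I)); rewrite !mxE enum_rankK.
Qed.

Section NattransFindim.
Variables (k : fieldType) (C : fsscat k) (D : lincat k) (F G : linfunctor C D).

Lemma lf_sum (H : linfunctor C D) (x y : C) (I : Type) (r : seq I)
  (f : I -> lmor x y) :
  fmor H (\sum_(i <- r) f i) = \sum_(i <- r) (fmor H (f i) : lmor (H x) (H y)) :> lmor (H x) (H y).
Proof.
pose jl := GRing.isLinear.Build k (lmor x y) (lmor (H x) (H y)) _
  (fun f => fmor H f) (@lf_lin _ _ _ H x y).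
pose J : {linear lmor x y -> lmor (H x) (H y)} := HB.pack (fun f => fmor H f) jl.
exact: (linear_sum J).
Qed.

Lemma cmp_suml (x y z : D) (f : mor x y) (I : Type) (r : seq I)
  (g : I -> lmor y z) :
  (\sum_(i <- r) g i : lmor y z) ∙ f = \sum_(i <- r) (g i ∙ f : lmor x z) :> lmor x z.
Proof.
elim: r => [|i r IH]; first by rewrite !big_nil cmp0l.
by rewrite !big_cons cmpDl IH.
Qed.

Lemma cmp_sumr (x y z : D) (f : mor y z) (I : Type) (r : seq I)
  (g : I -> lmor x y) :
  f ∙ (\sum_(i <- r) g i : lmor x y) = \sum_(i <- r) (f ∙ g i : lmor x z) :> lmor x z.
Proof.
elim: r => [|i r IH]; first by rewrite !big_nil cmp0r.
by rewrite !big_cons cmpDr IH.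
Qed.

Lemma nattrans_findim : findim (nattrans F G).
Proof.
have [ss [n [S SP]]] := fsP C.
refine (@findim_family k (nattrans F G) n (fun j => lmor (F (S j)) (G (S j)))
  (fun j (s : nattrans F G) => s (S j)) _ _ _) => [j|j|s t st].
- exact: lin_findim.
- by [].
apply: nattransP => Y; have [m [X [Xs [i [p [_ _ ip]]]]]] := ss1_dsum ss Y.
have stX l : s (X l) = t (X l).
  have [j [f [g [gf _]]]] := SP _ (Xs l).
  rewrite -[s _]cmp1m -[t _]cmp1m -(fmor_id G) -gf fmor_cmp -!cmpA.
  by rewrite -!ncompN st.
have E (u : nattrans F G) : u Y = \sum_l (fmor G (i l) ∙ u (X l) ∙ fmor F (p l) : lmor (F Y) (G Y)) :> lmor (F Y) (G Y).
  rewrite -[u Y]cmpm1 -fmor_id -ip lf_sum cmp_sumr.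
  by apply: eq_bigr => l _; rewrite fmor_cmp cmpA ncompN.
by rewrite !E; apply: eq_bigr => l _; rewrite stX.
Qed.

End NattransFindim.

Definition nt_id (C D : category) (F : functor C D) : nattrans F F.
Proof. by exists (fun x => idm (F x)) => x y f; rewrite cmp1m cmpm1. Defined.

Definition nt_cmp (C D : category) (F G H : functor C D) (t : nattrans G H)
  (s : nattrans F G) : nattrans F H.
Proof.
exists (fun x => t x ∙ s x) => x y f.
by rewrite -cmpA ncompN cmpA ncompN cmpA.
Defined.

Definition lf_cat (k : fieldType) (C D : lincat k) : category.
Proof.
refine (@Category (linfunctor C D) (fun F G => nattrans F G)
  (fun F => nt_id F) (fun _ _ _ t s => nt_cmp t s) _ _ _).
- by move=> F G s; apply: nattransP => x /=; rewrite cmp1m.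
- by move=> F G s; apply: nattransP => x /=; rewrite cmpm1.
- by move=> F G H K u t s; apply: nattransP => x /=; rewrite cmpA.
Defined.

Definition lf_lincat (k : fieldType) (C : fsscat k) (D : lincat k) :
  linear_on k (lf_cat C D).
Proof.
refine (@LinearOn k (lf_cat C D) (fun F G => GRing.Lmodule.class (nattrans F G)) _ _ _).
- by move=> F G; apply: nattrans_findim.
- by move=> F G H s a t t'; apply: nattransP => x /=; rewrite cmpDl cmpZl.
- by move=> F G H t a s s'; apply: nattransP => x /=; rewrite cmpDr cmpZr.
Defined.

Definition lf_comp (k : fieldType) (C D E : lincat k) (G : linfunctor D E)
  (F : linfunctor C D) : linfunctor C E.
Proof.
exists (comp_functor G F) => x y a f g /=.
by rewrite (lf_lin F) (lf_lin G).
Defined.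

Definition lf_id (k : fieldType) (C : lincat k) : linfunctor C C.
Proof. by exists (id_functor C). Defined.

(* Horizontal composition. *)
Definition nt_hc (C D E : category) (G G' : functor D E) (F F' : functor C D)
  (t : nattrans G G') (s : nattrans F F') :
  nattrans (comp_functor G F) (comp_functor G' F').
Proof.
exists (fun x => t (F' x) ∙ fmor G (s x)) => x y f /=.
by rewrite -cmpA -fmor_cmp (ncompN s) fmor_cmp !cmpA (ncompN t).
Defined.

(* The coherence cells of 2Vect have identities as components. *)
Definition nt_asc (k : fieldType) (C1 C2 C3 C4 : lincat k)
  (H : linfunctor C3 C4) (G : linfunctor C2 C3) (F : linfunctor C1 C2) :
  nattrans (lf_comp (lf_comp H G) F) (lf_comp H (lf_comp G F)).
Proof.
refine (@Nattrans _ _ (lf_comp (lf_comp H G) F) (lf_comp H (lf_comp G F))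
  (fun x => idm (H (G (F x)))) _).
by move=> x y f; rewrite /= cmp1m cmpm1.
Defined.

Definition nt_asci (k : fieldType) (C1 C2 C3 C4 : lincat k)
  (H : linfunctor C3 C4) (G : linfunctor C2 C3) (F : linfunctor C1 C2) :
  nattrans (lf_comp H (lf_comp G F)) (lf_comp (lf_comp H G) F).
Proof.
refine (@Nattrans _ _ (lf_comp H (lf_comp G F)) (lf_comp (lf_comp H G) F)
  (fun x => idm (H (G (F x)))) _).
by move=> x y f; rewrite /= cmp1m cmpm1.
Defined.

Definition nt_lu (k : fieldType) (C D : lincat k) (F : linfunctor C D) :
  nattrans (lf_comp (lf_id D) F) (F).
Proof.
refine (@Nattrans _ _ (lf_comp (lf_id D) F) (F)
  (fun x => idm (F x)) _).
by move=> x y f; rewrite /= cmp1m cmpm1.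
Defined.

Definition nt_lui (k : fieldType) (C D : lincat k) (F : linfunctor C D) :
  nattrans (F) (lf_comp (lf_id D) F).
Proof.
refine (@Nattrans _ _ (F) (lf_comp (lf_id D) F)
  (fun x => idm (F x)) _).
by move=> x y f; rewrite /= cmp1m cmpm1.
Defined.

Definition nt_ru (k : fieldType) (C D : lincat k) (F : linfunctor C D) :
  nattrans (lf_comp F (lf_id C)) (F).
Proof.
refine (@Nattrans _ _ (lf_comp F (lf_id C)) (F)
  (fun x => idm (F x)) _).
by move=> x y f; rewrite /= cmp1m cmpm1.
Defined.

Definition nt_rui (k : fieldType) (C D : lincat k) (F : linfunctor C D) :
  nattrans (F) (lf_comp F (lf_id C)).
Proof.
refine (@Nattrans _ _ (F) (lf_comp F (lf_id C))
  (fun x => idm (F x)) _).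
by move=> x y f; rewrite /= cmp1m cmpm1.
Defined.

Definition twoVect_bicat (k : fieldType) : bicategory.
Proof.
refine (@Bicategory (fsscat k) (fun C D => lf_cat C D) (fun C => lf_id C)
  (fun _ _ _ G F => lf_comp G F) (fun _ _ _ _ _ _ _ t s => nt_hc t s) _ _
  (fun _ _ _ _ H G F => nt_asc H G F) (fun _ _ _ _ H G F => nt_asci H G F)
  (fun _ _ F => nt_lu F) (fun _ _ F => nt_lui F)
  (fun _ _ F => nt_ru F) (fun _ _ F => nt_rui F) _ _ _ _ _ _ _ _).
- by move=> *; apply: nattransP => x /=; rewrite fmor_id cmp1m.
- move=> C1 C2 C3 G G' G'' F F' F'' b' b a' a; apply: nattransP => x /=.
  by rewrite fmor_cmp !cmpA; congr (_ ∙ _); rewrite -!cmpA ncompN.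
- by move=> *; split; apply: nattransP => x /=; rewrite cmp1m.
- by move=> *; split; apply: nattransP => x /=; rewrite cmp1m.
- by move=> *; split; apply: nattransP => x /=; rewrite cmp1m.
- by move=> *; apply: nattransP => x /=; rewrite cmp1m cmpm1 fmor_cmp cmpA.
- by move=> *; apply: nattransP => x /=; rewrite !cmp1m cmpm1.
- by move=> *; apply: nattransP => x /=; rewrite fmor_id cmp1m !cmpm1.
- by move=> *; apply: nattransP => x /=; rewrite !fmor_id !cmp1m.
- by move=> *; apply: nattransP => x /=; rewrite !fmor_id !cmp1m.
Defined.

Definition twoVect (k : fieldType) : linbicat k.
Proof.
refine (@Linbicat k (twoVect_bicat k) (fun C D => lf_lincat C D) _ _).
- move=> C1 C2 C3 G G' F F' s a t t'; apply: nattransP => x /=.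
  by rewrite cmpDl cmpZl.
- move=> C1 C2 C3 G G' F F' t a s s'; apply: nattransP => x /=.
  by rewrite (lf_lin G) cmpDr cmpZr.
Defined.

Section HomPf.
Variables (k : fieldType) (D : linbicat k) (Dlfs : locally_finite_semisimple D).

Definition hom_fs (X Y : D) : fsscat k := Fsscat (Dlfs X Y).

(* [Hom(f, g)] is [h |-> g ∘ (h ∘ f)]. *)
Definition hom_fun (X X' Y Y' : D) (f : hm X' X) (g : hm Y Y') :
  functor (hm X Y) (hm X' Y').
Proof.
refine (@Functor (hm X Y) (hm X' Y') (fun h => g ∘ (h ∘ f))
  (fun _ _ a => idm g ⋆ (a ⋆ idm f)) _ _).
- by move=> h; rewrite !hc2_id.
- by move=> *; rewrite hc2_cmpl hc2_cmpr.
Defined.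

Definition hom_lf (X X' Y Y' : D) (f : hm X' X) (g : hm Y Y') :
  linfunctor (hom_fs X Y) (hom_fs X' Y').
Proof.
exists (hom_fun f g) => h h' a u v /=.
by rewrite (lb_hcl (l := D)) (lb_hcr (l := D)).
Defined.

Definition hom_nt (X X' Y Y' : D) (f f' : hm X' X) (g g' : hm Y Y')
  (a : mor f f') (b : mor g g') : nattrans (hom_lf f g) (hom_lf f' g').
Proof.
refine (@Nattrans _ _ (hom_lf f g) (hom_lf f' g') (fun h => b ⋆ (idm h ⋆ a)) _).
by move=> h h' c /=; rewrite -!hc2_cmp !cmp1m !cmpm1.
Defined.

Definition hom_ntc (X1 X2 X3 Y1 Y2 Y3 : D) (f1 : hm X2 X1) (f2 : hm X3 X2)
  (g1 : hm Y1 Y2) (g2 : hm Y2 Y3) :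
  nattrans (lf_comp (hom_lf f2 g2) (hom_lf f1 g1)) (hom_lf (f1 ∘ f2) (g2 ∘ g1)).
Proof.
refine (@Nattrans _ _ (lf_comp (hom_lf f2 g2) (hom_lf f1 g1))
  (hom_lf (f1 ∘ f2) (g2 ∘ g1)) (fun h => asci g2 g1 (h ∘ (f1 ∘ f2)) ∙
     (idm g2 ⋆ ((idm g1 ⋆ asc h f1 f2) ∙ asc g1 (h ∘ f1) f2))) _).
move=> h h' c /=; rewrite -cmpA -hc2_cmpr -!cmpA ascN (cmpA _ _ (asc _ _ _)).
rewrite -!hc2_cmpr ascN !hc2_cmpr !cmpA; congr (_ ∙ _ ∙ _).
by rewrite asciN !hc2_id.
Defined.

Definition hom_ntu (X Y : D) :
  nattrans (lf_id (hom_fs X Y)) (hom_lf (one X) (one Y)).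
Proof.
refine (@Nattrans _ _ (lf_id (hom_fs X Y)) (hom_lf (one X) (one Y))
  (fun h => lui (h ∘ one X) ∙ rui h) _).
by move=> h h' c /=; rewrite cmpA luiN -!cmpA ruiN.
Defined.

Lemma nt_is_iso (C E : fsscat k) (F G : linfunctor C E) (s : nattrans F G) :
  (forall x, is_iso (s x)) -> is_iso (s : @mor (lf_cat C E) F G).
Proof.
move=> sP; pose t x := sval (cid (sP x)).
have tP x : inverse (s x) (t x) := svalP (cid (sP x)).
have tN x y (f : mor x y) : t y ∙ fmor G f = fmor F f ∙ t x.
  apply: (cancel_l (tP y)); rewrite !cmpA (proj2 (tP y)) cmp1m ncompN -cmpA.
  by rewrite (proj2 (tP x)) cmpm1.
exists (Nattrans (ncomp := t) tN).
by split; apply: nattransP => x /=; case: (tP x).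
Qed.

Lemma hom_ntc_asc (X1 X2 X3 X4 Y1 Y2 Y3 Y4 : D) (h : hm X1 Y1)
  (f1 : hm X2 X1) (f2 : hm X3 X2) (f3 : hm X4 X3)
  (g1 : hm Y1 Y2) (g2 : hm Y2 Y3) (g3 : hm Y3 Y4) :
  (asc g3 g2 g1 ⋆ (idm h ⋆ asci f1 f2 f3))
    ∙ hom_ntc f1 (f2 ∘ f3) g1 (g3 ∘ g2) h
    ∙ hom_ntc f2 f3 g2 g3 (g1 ∘ (h ∘ f1))
  = hom_ntc (f1 ∘ f2) f3 (g2 ∘ g1) g3 h
    ∙ (idm g3 ⋆ (hom_ntc f1 f2 g1 g2 h ⋆ idm f3)).
Proof.
rewrite /=.
set K := (idm g1 ⋆ asc h f1 (f2 ∘ f3)) ∙ asc g1 (h ∘ f1) (f2 ∘ f3).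
set N := (idm g1 ⋆ asc h f1 f2) ∙ asc g1 (h ∘ f1) f2.
pose M := (idm g1 ⋆ (idm h ⋆ asci f1 f2 f3)) ∙ K ∙ asc (g1 ∘ (h ∘ f1)) f2 f3.
have EM : M = (idm g1 ⋆ asc h (f1 ∘ f2) f3) ∙ asc g1 (h ∘ (f1 ∘ f2)) f3
              ∙ (N ⋆ idm f3).
  rewrite /M /K /N -!cmpA pentagon !cmpA -!hc2_cmpr.
  rewrite pentagon_last !hc2_cmpr hc2_cmpl !cmpA; congr (_ ∙ _).
  by rewrite -!cmpA -ascN.
pose Q := (idm g2 ⋆ M) ∙ asc g2 ((g1 ∘ (h ∘ f1)) ∘ f2) f3.
have EL : (asc g3 g2 g1 ⋆ (idm h ⋆ asci f1 f2 f3))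
    ∙ (asci (g3 ∘ g2) g1 (h ∘ (f1 ∘ (f2 ∘ f3))) ∙ (idm (g3 ∘ g2) ⋆ K))
    ∙ (asci g3 g2 ((g1 ∘ (h ∘ f1)) ∘ (f2 ∘ f3))
       ∙ (idm g3 ⋆ ((idm g2 ⋆ asc (g1 ∘ (h ∘ f1)) f2 f3)
           ∙ asc g2 ((g1 ∘ (h ∘ f1)) ∘ f2) f3)))
  = asci g3 (g2 ∘ g1) (h ∘ ((f1 ∘ f2) ∘ f3))
    ∙ (idm g3 ⋆ (asci g2 g1 (h ∘ ((f1 ∘ f2) ∘ f3)) ∙ Q)).
  rewrite -(hc2_id g3 g2) -!cmpA (cmpA (_ ⋆ K)) -asciN.
  rewrite !cmpA -[_ ∙ asci (g3 ∘ g2) _ _ ∙ _]cmpA pentagon_inv !cmpA.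
  rewrite -hc2_cmp (proj2 (ascP _ _ _)) cmpm1 -(hc2_id g3 (g2 ∘ g1)) -asciN -!cmpA; congr (_ ∙ _).
  rewrite -!hc2_cmpr; congr (idm g3 ⋆ _).
  rewrite /Q /M !hc2_cmpr !cmpA; congr (_ ∙ _ ∙ _ ∙ _).
  by rewrite -(hc2_id g2 g1) -asciN.
rewrite -!cmpA in EL *.
rewrite EL; congr (_ ∙ _); rewrite -hc2_cmpr; apply: (congr1 (hc2 (idm g3))).
rewrite /Q EM; clearbody N.
rewrite !hc2_cmpr !cmpA asciN hc2_id -!cmpA; congr (_ ∙ _).
by rewrite -ascN !cmpA pentagon_mid hc2_cmpl !cmpA.
Qed.

Lemma hom_ntc_asc_full (X1 X2 X3 X4 Y1 Y2 Y3 Y4 : D) (h : hm X1 Y1)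
  (f1 : hm X2 X1) (f2 : hm X3 X2) (f3 : hm X4 X3)
  (g1 : hm Y1 Y2) (g2 : hm Y2 Y3) (g3 : hm Y3 Y4) :
  (asc g3 g2 g1 ⋆ (idm h ⋆ asci f1 f2 f3))
    ∙ hom_ntc f1 (f2 ∘ f3) g1 (g3 ∘ g2) h
    ∙ (hom_ntc f2 f3 g2 g3 (g1 ∘ (h ∘ f1))
       ∙ (idm g3 ⋆ ((idm g2 ⋆ (idm (g1 ∘ (h ∘ f1)) ⋆ idm f2)) ⋆ idm f3)))
  = hom_ntc (f1 ∘ f2) f3 (g2 ∘ g1) g3 h
    ∙ (idm (g3 ∘ ((g2 ∘ g1) ∘ (h ∘ (f1 ∘ f2)) ∘ f3))
       ∙ (idm g3 ⋆ (hom_ntc f1 f2 g1 g2 h ⋆ idm f3)))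
    ∙ idm (g3 ∘ ((g2 ∘ ((g1 ∘ (h ∘ f1)) ∘ f2)) ∘ f3)).
Proof. by rewrite !hc2_id !cmpm1 cmp1m hom_ntc_asc. Qed.

Lemma hom_ntc_lu (X X' Y Y' : D) (f : hm X' X) (g : hm Y Y') (h : hm X Y) :
  (lu g ⋆ (idm h ⋆ ru f)) ∙ hom_ntc f (one X') g (one Y') h
    ∙ hom_ntu X' Y' (g ∘ (h ∘ f)) = idm (g ∘ (h ∘ f)).
Proof.
rewrite /= -[lu g]cmp1m -[idm h ⋆ ru f]cmpm1 hc2_cmp.
rewrite !cmpA -[_ ∙ asci _ _ _]cmpA lu_hc' -[_ ∙ (idm (one Y') ⋆ _)]cmpA luN.
rewrite !cmpA -[_ ∙ lui _]cmpA (proj2 (luP _)) cmpm1 -hc2_cmpr ru_hc ru_hc.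
by rewrite (proj2 (ruP _)).
Qed.

Lemma hom_ntc_ru (X X' Y Y' : D) (f : hm X' X) (g : hm Y Y') (h : hm X Y) :
  (ru g ⋆ (idm h ⋆ lu f)) ∙ hom_ntc (one X) f (one Y) g h
    ∙ (idm g ⋆ (hom_ntu X Y h ⋆ idm f)) = idm (g ∘ (h ∘ f)).
Proof.
rewrite /= -[ru g]cmp1m -[idm h ⋆ lu f]cmpm1 hc2_cmp.
rewrite !cmpA -[_ ∙ asci _ _ _]cmpA triangle' -!hc2_cmpr.
rewrite !cmpA -[_ ∙ (idm (one Y) ⋆ _)]cmpA luN !cmpA.
rewrite -[_ ∙ asc (one Y) _ _]cmpA lu_hc -[_ ∙ (_ ⋆ idm f)]cmpA -hc2_cmpl.
rewrite !cmpA (proj2 (luP _)) cmp1m triangle -hc2_cmpl (proj2 (ruP _)).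
by rewrite !hc2_id.
Qed.

Lemma hom_ntc_lu_full (X X' Y Y' : D) (f : hm X' X) (g : hm Y Y') (h : hm X Y) :
  (lu g ⋆ (idm h ⋆ ru f)) ∙ hom_ntc f (one X') g (one Y') h
    ∙ (hom_ntu X' Y' (g ∘ (h ∘ f)) ∙ idm (g ∘ (h ∘ f))) = idm (g ∘ (h ∘ f)).
Proof. by rewrite cmpm1 hom_ntc_lu. Qed.

Lemma hom_ntc_ru_full (X X' Y Y' : D) (f : hm X' X) (g : hm Y Y') (h : hm X Y) :
  (ru g ⋆ (idm h ⋆ lu f)) ∙ hom_ntc (one X) f (one Y) g h
    ∙ (idm (g ∘ ((one Y ∘ (h ∘ one X)) ∘ f))
       ∙ (idm g ⋆ (hom_ntu X Y h ⋆ idm f))) = idm (g ∘ (h ∘ f)).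
Proof. by rewrite cmp1m hom_ntc_ru. Qed.

Lemma hom_ntc_iso (X1 X2 X3 Y1 Y2 Y3 : D) (f1 : hm X2 X1) (f2 : hm X3 X2)
  (g1 : hm Y1 Y2) (g2 : hm Y2 Y3) h : is_iso (hom_ntc f1 f2 g1 g2 h).
Proof.
eexists; apply: inverse_cmp; last by apply: inverse_sym; apply: ascP.
apply: inverse_hc2; first exact: inverse_id.
apply: inverse_cmp; first exact: ascP.
by apply: inverse_hc2; [exact: inverse_id | exact: ascP].
Qed.

Lemma hom_ntu_iso (X Y : D) h : is_iso (hom_ntu X Y h).
Proof.
by eexists; apply: inverse_cmp; apply: inverse_sym; [apply: ruP | apply: luP].
Qed.

Lemma hom_ntcN (X1 X2 X3 Y1 Y2 Y3 : D) (f1 f1' : hm X2 X1) (f2 f2' : hm X3 X2)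
  (g1 g1' : hm Y1 Y2) (g2 g2' : hm Y2 Y3) (a1 : mor f1 f1') (a2 : mor f2 f2')
  (b1 : mor g1 g1') (b2 : mor g2 g2') (h : hm X1 Y1) :
  hom_ntc f1' f2' g1' g2' h ∙
    ((b2 ⋆ (idm (g1' ∘ (h ∘ f1')) ⋆ a2))
     ∙ (idm g2 ⋆ ((b1 ⋆ (idm h ⋆ a1)) ⋆ idm f2)))
  = ((b2 ⋆ b1) ⋆ (idm h ⋆ (a1 ⋆ a2))) ∙ hom_ntc f1 f2 g1 g2 h.
Proof.
rewrite /= -!hc2_cmp cmpm1 cmp1m cmpm1 -cmpA -hc2_cmp cmp1m -cmpA ascN cmpA.
rewrite -hc2_cmp cmp1m ascN -[b1 in LHS]cmpm1 hc2_cmp.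
rewrite -[b2 in LHS]cmpm1 -cmpA hc2_cmp !cmpA; congr (_ ∙ _).
by rewrite asciN.
Qed.

Definition hom_pf1 (X Y : prod_bicat (op_bicat D) D) :
  functor (hm X Y) (lf_cat (hom_fs X.1 X.2) (hom_fs Y.1 Y.2)).
Proof.
refine (@Functor (hm X Y) (lf_cat (hom_fs X.1 X.2) (hom_fs Y.1 Y.2))
  (fun u => hom_lf (u.1 : @hm D Y.1 X.1) u.2)
  (fun _ _ a => hom_nt (a.1 : @mor (@hm D Y.1 X.1) _ _) a.2) _ _).
- by move=> u; apply: nattransP => h /=; rewrite !hc2_id.
- by move=> *; apply: nattransP => h /=; rewrite -!hc2_cmp cmp1m.
Defined.

Definition hom_pf : pseudofunctor (prod_bicat (op_bicat D) D) (twoVect k).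
Proof.
refine (@Pseudofunctor (prod_bicat (op_bicat D) D) (twoVect k)
  (fun X => hom_fs X.1 X.2) hom_pf1
  (fun X Y Z g f => @hom_ntc X.1 Y.1 Z.1 X.2 Y.2 Z.2 f.1 g.1 f.2 g.2)
  (fun X => hom_ntu X.1 X.2) _ _ _ _ _ _).
- by move=> X Y Z g f; apply: nt_is_iso => h; apply: hom_ntc_iso.
- by move=> X; apply: nt_is_iso => h; apply: hom_ntu_iso.
- by move=> X Y Z g g' f f' b a; apply: nattransP => h; apply: hom_ntcN.
- move=> W X Y Z h g f; apply: nattransP => x.
  have E := @hom_ntc_asc_full W.1 X.1 Y.1 Z.1 W.2 X.2 Y.2 Z.2 x f.1 g.1 h.1 f.2 g.2 h.2.
  exact: E.
- move=> X Y f; apply: nattransP => h.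
  exact: (@hom_ntc_lu_full X.1 Y.1 X.2 Y.2 f.1 f.2 h).
- move=> X Y f; apply: nattransP => h.
  exact: (@hom_ntc_ru_full X.1 Y.1 X.2 Y.2 f.1 f.2 h).
Defined.

End HomPf.

(* [Hom_D(-, F -)]. *)
Definition hom_along (k : fieldType) (C D : linbicat k)
  (Dlfs : locally_finite_semisimple D) (F : pseudofunctor C D) :
  pseudofunctor (prod_bicat (op_bicat D) C) (twoVect k) :=
  comp_pf (hom_pf Dlfs) (prod_pf (id_pf (op_bicat D)) F).

(* Main.v *)
(* For each [c] the presheaf [P(-, c)] is represented by a point [x] of some
   [P(F c, c)] that is universal in the sense that [h |-> P(h, c) x] is an
   equivalence [Hom(d, F c) -> P(d, c)]; the pseudofunctor structure of [F] and
   the comparison with [Hom(-, F -)] are then forced by full faithfulness.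

   Let [Q] be a presheaf on [D] with finite semisimple values and let [1_Z] be
   simple, so that [End Z] is a fusion category acting on [Q Z]. For an object
   [y] of [Q Z] containing every simple object of an [End Z]-stable family, the
   internal endomorphism object [E] of [y] is a monad on [Z], and the plain trace
   on [End y] induces a map [E -> 1_Z] exhibiting [E] as a Frobenius monad. Its
   product after its coproduct is the unit scaled by the global dimension
   [\sum_i d_i ^ 2], which is nonzero in characteristic zero without any pivotal
   structure: double rotation acts as an involution on the multiplicity spaces,
   so the structure constants of the dimension identities are integers, and a
   sum of squares of rational matrices only kills what each of them kills.
   Hence [E] is separable; splitting it gives [X] with a fully faithful point of
   [Q X]. Running through the finitely many simple objects of [D] and adding up
   such points gives a fully faithful point that reaches every object. *)
From HB Require Import structures.
From mathcomp Require Import all_boot all_order all_algebra.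
From mathcomp Require Import boolp ring.
Require Import Defs.

Set Implicit Arguments.
Unset Strict Implicit.
Unset Printing Implicit Defensive.

Import Order.TTheory GRing.Theory Num.Theory.
Local Open Scope ring_scope.

(** * Integrality in characteristic zero *)

(** Calculations with duals drown in associators when they are done with 2-morphisms of [D]. A
    2-morphism between endomorphisms of [Z] is replaced by the family of its effects on all points
    of all presheaves: there functors compose strictly, words need no brackets, and a natural
    compatible family is determined by its value at the point [one Z] of the presheaf represented by
    [Z]. Snake equations, rotations and monad laws are proved for families and brought back to [D]
    once.

    Left and right duals of a simple object are isomorphic, but no isomorphism is preferred. One is
    chosen and rescaled until the two loops are equal; the common value [d_i] is fixed up to sign,
    and the global dimension involves only its square. Traces are then cyclic only up to a double
    rotation, and comparing left with right closings shows that this rotation is an involution.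

    The point added for a simple [Z] involves only the simple objects of [Q Z] not yet reached.
    These are stable under [End Z], and the new point is orthogonal to the old one, so the direct
    sum stays fully faithful. *)

Section CharacteristicZero.
Variables (k : fieldType) (char0 : [pchar k] =i pred0).

Lemma char0_intr_eq0 (z : int) : ((z%:~R : k) == 0) = (z == 0).
Proof.
have /pcharf0P H := char0.
by case: z => n; rewrite ?NegzE ?mulrNz ?oppr_eq0 -pmulrn H.
Qed.

(** Denominators are invertible in characteristic zero, so the value of [ratr] at a fraction does
    not depend on the fraction. This embeds the ordered field [rat] in [k], and positivity can be
    used there. *)
Lemma char0_ratr : exists f : {rmorphism rat -> k}, forall z : int, f z%:~R = z%:~R.
Proof.
have dnz (x : rat) : ((denq x)%:~R : k) != 0 by rewrite char0_intr_eq0 denq_neq0.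
have E (x : rat) (a b : int) : b != 0 -> x = a%:~R / b%:~R -> @ratr k x = a%:~R / b%:~R.
  move=> bnz xE; rewrite /ratr; apply/eqP; rewrite eqr_div ?char0_intr_eq0 // -!intrM.
  rewrite -subr_eq0 -intrB char0_intr_eq0 subr_eq0 -(inj_eq (intr_inj (R := rat))) !intrM.
  by rewrite -eqr_div ?intr_eq0 // divq_num_den xE.
have D : zmod_morphism (@ratr k).
  move=> x y; rewrite (@E (x - y) (numq x * denq y - numq y * denq x) (denq x * denq y)).
  - rewrite /ratr intrB !intrM; field.
    by rewrite !dnz.
  - by rewrite mulf_neq0 ?denq_neq0.
  - rewrite intrB !intrM -{1}[x]divq_num_den -{1}[y]divq_num_den; field.
    by rewrite !intr_eq0 !denq_neq0.
have M : monoid_morphism (@ratr k).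
  split=> [|x y]; first by rewrite (@E 1 1 1) // divr1.
  rewrite (@E (x * y) (numq x * numq y) (denq x * denq y)).
  - by rewrite /ratr !intrM invfM mulrACA.
  - by rewrite mulf_neq0 ?denq_neq0.
  - by rewrite !intrM invfM mulrACA !divq_num_den.
pose f : {rmorphism rat -> k} := HB.pack (@ratr k)
  (GRing.isZmodMorphism.Build rat k _ D) (GRing.isMonoidMorphism.Build rat k _ M).
exists f => z; rewrite /= (@E _ z 1) ?divr1 //.
Qed.

(** Write [P = C R] with [C] of full column rank and [R] of full row rank. Cancelling them on the
    outside of [C R C R = C R] leaves [R C = 1], and the trace is cyclic. *)
Lemma idempotent_mxtrace n (P : 'M[k]_n) : P *m P = P -> \tr P = (\rank P)%:R.
Proof.
move=> PP; move: PP (mulmx_base P) (col_base_full P) (row_base_free P).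
move: (col_base P) (row_base P); generalize (\rank P) => q C R PP E Cf Rf.
rewrite -E mxtrace_mulC; suff -> : R *m C = 1%:M by rewrite mxtrace1.
move: PP; rewrite -E; move: (mulVpmx Cf) (mulmxVp Rf).
move: (pinvmx C) (pinvmx R) => C' R' CC RR /(congr1 (fun X => C' *m X *m R')).
by rewrite !mulmxA CC !mul1mx -!mulmxA RR mulmx1.
Qed.

(** [(1 + A) / 2] is idempotent, so the trace of [A] is twice the rank of this idempotent minus
    [n]. *)
Lemma involution_mxtrace_int n (A : 'M[k]_n) : A *m A = 1%:M -> exists z : int, \tr A = z%:~R.
Proof.
move=> AA; have two : (2 : k) != 0 by rewrite -[2%:R]/((2 : int)%:~R) char0_intr_eq0.
pose P := 2^-1 *: (1%:M + A).
have PP : P *m P = P.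
  rewrite /P -scalemxAl -scalemxAr mulmxDl mul1mx mulmxDr mulmx1 AA scalerA.
  rewrite [A + _]addrC -mulr2n -scaler_nat scalerA; congr (_ *: _).
  by rewrite -mulrA mulVf // mulr1.
exists (Posz (\rank P).*2 - Posz n); rewrite intrB -!pmulrn -addnn natrD -idempotent_mxtrace //.
by rewrite /P mxtraceZ raddfD /= mxtrace1; field.
Qed.

(** The vector [d] is an eigenvector, with eigenvalue [d i], of the integer matrix [M i] and of its
    transpose, hence [P] multiplies it by the sum in question. If that were zero, [d] would lie in
    the kernel of [P]. This kernel is defined over [rat], where a vanishing sum of squares forces
    each [M i] to vanish on it; yet [M i] multiplies the nonzero [d] by the nonzero [d i]. *)
Lemma sum_sq_neq0 r (d : 'I_r -> k) (T : 'I_r -> 'I_r -> 'I_r -> int) :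
  (0 < r)%N -> (forall i, d i != 0) ->
  (forall i j, \sum_l (T i j l)%:~R * d l = d i * d j) ->
  (forall i l, \sum_j (T i j l)%:~R * d j = d i * d l) ->
  \sum_i d i * d i != 0.
Proof.
move=> r0 dnz T1 T2; have [f fz] := char0_ratr.
pose M i : 'M[rat]_r := \matrix_(j, l) (T i j l)%:~R.
pose P : 'M[rat]_r := \sum_i ((M i)^T *m M i).
pose v : 'rV[k]_r := \row_l d l.
have vMT i : v *m map_mx f (M i)^T = d i *: v.
  apply/rowP => j; rewrite !mxE -T1; apply: eq_bigr => l _.
  by rewrite !mxE fz mulrC.
have vM i : v *m map_mx f (M i) = d i *: v.
  apply/rowP => j; rewrite !mxE -T2; apply: eq_bigr => l _.
  by rewrite !mxE fz mulrC.
have vP : v *m map_mx f P = (\sum_i d i * d i) *: v.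
  rewrite /P raddf_sum mulmx_sumr scaler_suml; apply: eq_bigr => i _.
  by rewrite /= map_mxM mulmxA vMT -scalemxAl vM scalerA.
apply/eqP => S0; have /eqP vP0 : v *m map_mx f P = 0 by rewrite vP S0 scale0r.
pose K := kermx P.
have KM i : K *m (M i)^T = 0.
  have KPK : K *m P *m K^T = 0 by rewrite mulmx_ker mul0mx.
  apply/matrixP => a b.
  have : (K *m P *m K^T) a a = \sum_i \sum_b (K *m (M i)^T) a b ^+ 2.
    rewrite /P mulmx_sumr mulmx_suml summxE; apply: eq_bigr => j _.
    rewrite mulmxA -mulmxA -[M j *m _]trmxK trmx_mul trmxK mxE; apply: eq_bigr => c _.
    by rewrite [X in _ * X]mxE expr2.
  rewrite KPK mxE => /esym/eqP; rewrite psumr_eq0 => [|j _]; last first.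
    by apply: sumr_ge0 => c _; apply: sqr_ge0.
  move/allP/(_ i); rewrite mem_index_enum => /(_ isT) /=.
  rewrite psumr_eq0 => [|c _]; last exact: sqr_ge0.
  move/allP/(_ b); rewrite mem_index_enum => /(_ isT) /=.
  by rewrite sqrf_eq0 => /eqP ->; rewrite mxE.
(* Kernels commute with field extension, so [v] is a combination over [k] of rational vectors killed
   by every [M i]. *)
have /submxP [w wE] : (v <= map_mx f K)%MS by rewrite map_kermx; apply/sub_kermxP/eqP.
have := vMT (Ordinal r0); rewrite wE -mulmxA -map_mxM KM raddf0 mulmx0 -wE => /esym /eqP.
rewrite scaler_eq0 (negbTE (dnz _)) /= => /eqP /rowP /(_ (Ordinal r0)).
by rewrite !mxE => /eqP; rewrite (negbTE (dnz _)).
Qed.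

End CharacteristicZero.

(** * Finite semisimple categories *)

Section Bilinearity.
Variables (k : fieldType) (D : lincat k) (x y z : D).

Lemma mDl (f : mor x y) (g g' : lmor y z) :
  (g + g') ∙ f = (g ∙ f : lmor x z) + (g' ∙ f : lmor x z) :> lmor x z.
Proof. exact: cmpDl. Qed.
Lemma mDr (g : mor y z) (f f' : lmor x y) :
  g ∙ (f + f') = (g ∙ f : lmor x z) + (g ∙ f' : lmor x z) :> lmor x z.
Proof. exact: cmpDr. Qed.
Lemma m0l (f : mor x y) : (0 : lmor y z) ∙ f = 0 :> lmor x z.
Proof. exact: cmp0l. Qed.
Lemma m0r (g : mor y z) : g ∙ (0 : lmor x y) = 0 :> lmor x z.
Proof. exact: cmp0r. Qed.
Lemma mZl (f : mor x y) a (g : lmor y z) : (a *: g) ∙ f = a *: (g ∙ f : lmor x z) :> lmor x z.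
Proof. exact: cmpZl. Qed.
Lemma mZr (g : mor y z) a (f : lmor x y) : g ∙ (a *: f) = a *: (g ∙ f : lmor x z) :> lmor x z.
Proof. exact: cmpZr. Qed.
Lemma mBl (f : mor x y) (g g' : lmor y z) :
  (g - g') ∙ f = (g ∙ f : lmor x z) - (g' ∙ f : lmor x z) :> lmor x z.
Proof. by rewrite mDl -[- g']scaleN1r mZl scaleN1r. Qed.
Lemma mBr (g : mor y z) (f f' : lmor x y) :
  g ∙ (f - f') = (g ∙ f : lmor x z) - (g ∙ f' : lmor x z) :> lmor x z.
Proof. by rewrite mDr -[- f']scaleN1r mZr scaleN1r. Qed.

End Bilinearity.

Section LinearCategory.
Variables (k : fieldType) (C : lincat k).
Implicit Types x y z : C.

Lemma is_zero_idm x : (idm x : lmor x x) = 0 -> is_zero x.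
Proof.
move=> E y; split=> f.
  by rewrite -[f](cmpm1 (f : mor x y)) E m0r.
by rewrite -[f](cmp1m (f : mor y x)) E m0l.
Qed.

Lemma idm_neq0 x : ~ is_zero x -> (idm x : lmor x x) != 0.
Proof. by move=> xnz; apply/eqP => /is_zero_idm. Qed.

Lemma is_zero_iso x y : isomorphic x y -> is_zero x -> is_zero y.
Proof.
move=> [f [g [gf fg]]] xz; apply: is_zero_idm.
have [/(_ f) f0 _] := xz y.
by rewrite -fg -[f]/(f : lmor x y) f0 m0l.
Qed.

Lemma isomorphic_sym (D : category) (x y : D) : isomorphic x y -> isomorphic y x.
Proof. by move=> [f [g fg]]; exists g, f; apply: inverse_sym. Qed.

Lemma isomorphic_trans (D : category) (x y z : D) :
  isomorphic x y -> isomorphic y z -> isomorphic x z.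
Proof. by move=> [f fi] [g gi]; exists (g ∙ f); apply: is_iso_cmp. Qed.

Lemma simple_iso x y : isomorphic x y -> is_simple x -> is_simple y.
Proof.
move=> xy [xnz xs]; have [f [g [gf fg]]] := xy; split.
  by move=> /(is_zero_iso (isomorphic_sym xy)).
move=> z h hm.
have hm' : is_mono (g ∙ h).
  move=> w a b E; apply: hm; rewrite -[h ∙ a]cmp1m -[h ∙ b]cmp1m -fg.
  by move: E; rewrite -!cmpA => ->.
have [|ghi] := xs z _ hm'; [by left | right].
rewrite -[h]cmp1m -fg -cmpA; apply: is_iso_cmp => //.
by exists g.
Qed.

Lemma findim_basis (V : lmodType k) : findim V ->
  exists n (b : 'I_n -> V) (c : 'I_n -> V -> k),
  [/\ forall i, scalar (c i), forall i j, c i (b j) = (i == j)%:R &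
      forall v, v = \sum_i c i v *: b i].
Proof.
move=> [n [[phi philin [psi psiK phiK]]]].
exists n, (fun i => psi (delta_mx 0 i)), (fun i v => phi v 0 i).
split=> [i a u v|i j|v]; first by rewrite philin !mxE.
  by rewrite phiK mxE eqxx /=.
pose jl := GRing.isLinear.Build k V 'rV[k]_n _ phi philin.
pose J : {linear V -> 'rV[k]_n} := HB.pack phi jl.
apply: (can_inj psiK); rewrite -[RHS]/(J _) linear_sum.
rewrite [LHS]row_sum_delta; apply: eq_bigr => i _.
by rewrite linearZ_LR /= phiK.
Qed.

Lemma lmor_basis x y :
  exists n (b : 'I_n -> lmor x y) (c : 'I_n -> lmor x y -> k),
  [/\ forall i, scalar (c i), forall i j, c i (b j) = (i == j)%:R &
      forall v, v = \sum_i c i v *: b i].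
Proof. exact/findim_basis/lin_findim. Qed.

(** Made total with the default 0, so that it can be summed freely. On a simple object over an
    algebraically closed field the default is never taken, by [schur_end]. *)
Definition scal x (f : lmor x x) : k :=
  if pselect (exists c, f = c *: (idm x : lmor x x)) is left H then sval (cid H) else 0.

Lemma scalE x (f : lmor x x) c : ~ is_zero x -> f = c *: (idm x : lmor x x) -> scal f = c.
Proof.
move=> /idm_neq0 xnz ->; rewrite /scal; case: pselect => [H|[]]; last by exists c.
case: (cid H) => d /= E; have : c *: (idm x : lmor x x) == d *: (idm x : lmor x x) by apply/eqP.
rewrite -subr_eq0 -scalerBl scaler_eq0 (negbTE xnz) orbF.
by rewrite subr_eq0 eq_sym => /eqP.
Qed.

End LinearCategory.

Lemma scalar_sum (k : fieldType) (V : lmodType k) (f : V -> k) (flin : scalar f)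
  (I : Type) (r : seq I) (P : pred I) (F : I -> V) :
  f (\sum_(i <- r | P i) F i) = \sum_(i <- r | P i) f (F i).
Proof.
pose jl := GRing.isLinear.Build k V k _ f flin.
pose J : {scalar V} := HB.pack f jl.
exact: (linear_sum J).
Qed.

Lemma scalarZ (k : fieldType) (V : lmodType k) (f : V -> k) (flin : scalar f) a v :
  f (a *: v) = a * f v.
Proof.
pose jl := GRing.isLinear.Build k V k _ f flin.
pose J : {scalar V} := HB.pack f jl.
exact: (linearZ_LR J).
Qed.

Section LinearMaps.
Variables (k : fieldType) (U V : lmodType k) (f : U -> V) (flin : linear f).
Let J : {linear U -> V} := HB.pack f (GRing.isLinear.Build k U V _ f flin).

Lemma lin_sum (I : Type) (r : seq I) (P : pred I) (F : I -> U) :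
  f (\sum_(i <- r | P i) F i) = \sum_(i <- r | P i) f (F i).
Proof. exact: (linear_sum J). Qed.
Lemma lin0 : f 0 = 0. Proof. exact: (linear0 J). Qed.
Lemma linZ a v : f (a *: v) = a *: f v. Proof. exact: (linearZ_LR J). Qed.
Lemma linD u v : f (u + v) = f u + f v. Proof. exact: (linearD J). Qed.
Lemma linB u v : f (u - v) = f u - f v. Proof. exact: (linearB J). Qed.

End LinearMaps.


Section Semisimple.
Variables (k : closedFieldType) (C : lincat k).
Implicit Types x y z : C.

Lemma mor_ext (ss : semisimple1 C) x y (f g : mor x y) :
  (forall z (h : mor z x), is_simple z -> f ∙ h = g ∙ h) -> f = g.
Proof.
move=> fg; have [n [X [Xs [i [p [_ _ ip]]]]]] := ss1_dsum ss x.
rewrite -[f]cmpm1 -[g]cmpm1 -ip !cmp_sumr.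
by apply: eq_bigr => j _; rewrite !cmpA fg.
Qed.

(** Tested on simple objects, the composition axiom makes a nonzero [f] monic; simplicity of the
    target, which is stated through monomorphisms, does the rest. *)
Lemma schur_iso (ss : semisimple1 C) x y (f : lmor x y) :
  is_simple x -> is_simple y -> f != 0 -> is_iso f.
Proof.
move=> xs ys fnz; have [] // := proj2 ys _ f; last by move/(proj1 xs).
move=> z g h E; apply: (mor_ext ss) => w u ws.
apply: (@subr0_eq (lmor w x)); apply/eqP; apply: contraT => /(ss1_comp ss ws xs ys fnz) /eqP [].
by rewrite mBr !cmpA E subrr.
Qed.

Lemma schur_noniso (ss : semisimple1 C) x y (f : lmor x y) :
  is_simple x -> is_simple y -> ~ isomorphic x y -> f = 0.
Proof.
move=> xs ys xy; apply/eqP; apply: contraT => /(schur_iso ss xs ys) fi.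
by case: xy; exists f.
Qed.

(** Left composition with [f] is a linear endomorphism of the nonzero space [End x], so it has an
    eigenvector [g]. From [(f - a) g = 0] and the absence of zero divisors among endomorphisms of
    [x], [f] is the scalar [a]. *)
Lemma schur_end (ss : semisimple1 C) x (f : lmor x x) :
  is_simple x -> f = scal f *: (idm x : lmor x x).
Proof.
move=> xs; have xnz := idm_neq0 (proj1 xs).
suff [a E] : exists a, f = a *: (idm x : lmor x x) by rewrite [LHS]E (scalE (proj1 xs) E).
have [n [b [c [clin cb bc]]]] := lmor_basis x x.
case: n b c clin cb bc => [|n] b c clin cb bc.
  by move: xnz; rewrite [(idm x : lmor x x)]bc big_ord0 eqxx.
pose A : 'M[k]_n.+1 := \matrix_(i, j) c j (f ∙ b i : lmor x x).
have [|a] := @closed_rootP k (char_poly A) _; first by rewrite size_char_poly.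
rewrite -eigenvalue_root_char => /eigenvalueP [v vA vnz].
pose g : lmor x x := \sum_i v 0 i *: b i.
have cg j : c j g = v 0 j.
  rewrite scalar_sum // (bigD1 j) //= scalarZ // cb eqxx mulr1 big1 ?addr0 // => i ij.
  by rewrite scalarZ // cb eq_sym (negbTE ij) mulr0.
have gnz : g != 0.
  apply: contraNneq vnz => g0; apply/eqP/rowP => j.
  by rewrite -cg g0 mxE -(scale0r (0 : lmor x x)) scalarZ // mul0r.
have fg : f ∙ g = a *: g :> lmor x x.
  rewrite /g cmp_sumr scaler_sumr [RHS](eq_bigr (fun i => (a *: v) 0 i *: b i)); last first.
    by move=> i _; rewrite scalerA mxE.
  rewrite -vA.
  transitivity (\sum_i \sum_j (v 0 i * c j (f ∙ b i : lmor x x)) *: b j).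
    apply: eq_bigr => i _; rewrite mZr [in LHS](bc (f ∙ b i)) scaler_sumr.
    by apply: eq_bigr => j _; rewrite scalerA.
  rewrite exchange_big /=; apply: eq_bigr => j _; rewrite mxE scaler_suml.
  by apply: eq_bigr => i _; rewrite mxE.
exists a; apply/eqP; rewrite -subr_eq0; apply: contraT.
move=> /(ss1_comp ss xs xs xs) /(_ gnz) /eqP [].
by rewrite mBl mZl cmp1m fg subrr.
Qed.

Lemma scal_lin (ss : semisimple1 C) x : is_simple x -> scalar (@scal k C x).
Proof.
move=> xs a f g; apply: scalE; first exact: (proj1 xs).
by rewrite {1}[f](schur_end ss) // {1}[g](schur_end ss) // scalerA -scalerDl.
Qed.

Lemma simple_retract (ss : semisimple1 C) x y (f : lmor x y) : is_simple x -> f != 0 ->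
  exists g : mor y x, g ∙ f = idm x.
Proof.
move=> xs fnz; have [n [X [Xs [i [p [_ _ ip]]]]]] := ss1_dsum ss y.
have [j pf] : exists j, (p j ∙ f : lmor x (X j)) != 0.
  apply: contrapT => H; move/eqP: fnz; apply.
  rewrite -[LHS](cmp1m (f : mor x y)) -ip cmp_suml big1 // => j _.
  rewrite -cmpA; have [->|pf] := eqVneq (p j ∙ f : lmor x (X j)) 0; first exact: m0r.
  by case: H; exists j.
have [h [hf _]] := schur_iso ss xs (Xs j) pf.
by exists (h ∙ p j); rewrite -cmpA.
Qed.

Lemma simple_section (ss : semisimple1 C) x y (f : lmor y x) : is_simple x -> f != 0 ->
  exists g : mor x y, f ∙ g = idm x.
Proof.
move=> xs fnz; have [n [X [Xs [i [p [_ _ ip]]]]]] := ss1_dsum ss y.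
have [j fi] : exists j, (f ∙ i j : lmor (X j) x) != 0.
  apply: contrapT => H; move/eqP: fnz; apply.
  rewrite -[LHS](cmpm1 (f : mor y x)) -ip cmp_sumr big1 // => j _.
  rewrite cmpA; have [->|fi] := eqVneq (f ∙ i j : lmor (X j) x) 0; first exact: m0l.
  by case: H; exists j.
have [h [_ fh]] := schur_iso ss (Xs j) xs fi.
by exists (i j ∙ h); rewrite cmpA.
Qed.

(** The projector onto some simple summand is a nonzero scalar; being idempotent it is the identity,
    so [x] is that summand. *)
Lemma simple_of_end (ss : semisimple1 C) x : ~ is_zero x ->
  (forall f : lmor x x, exists c, f = c *: (idm x : lmor x x)) -> is_simple x.
Proof.
move=> xnz H; have [n [X [Xs [i [p [pi pi0 ip]]]]]] := ss1_dsum ss x.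
have [j [c cnz E]] : exists j, exists2 c, c != 0 & i j ∙ p j = c *: (idm x : lmor x x) :> lmor x x.
  apply: contrapT => NE; apply/xnz/is_zero_idm; rewrite -ip big1 // => j _.
  have [c E] := H (i j ∙ p j); rewrite E.
  have [->|cnz] := eqVneq c 0; first by rewrite scale0r.
  by case: NE; exists j; exists c.
apply: (simple_iso _ (Xs j)); exists (i j), (c^-1 *: (p j : lmor _ _)); split.
  suff c1 : c = 1 by rewrite c1 invr1 scale1r.
  have := E; rewrite -[i j in LHS]cmpm1 -(pi j) cmpA.
  have E' : i j ∙ p j ∙ i j = c *: (i j : lmor _ _) :> lmor (X j) x by rewrite E mZl cmp1m.
  have inz : (i j : lmor (X j) x) != 0.
    by apply: contraNneq (idm_neq0 (proj1 (Xs j))) => i0; rewrite -(pi j) i0 m0r.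
  move=> _; rewrite -cmpA pi cmpm1 in E'.
  have : (c - 1) *: (i j : lmor (X j) x) == 0 by rewrite scalerBl scale1r -E' subrr.
  by rewrite scaler_eq0 (negbTE inz) orbF subr_eq0 => /eqP.
by rewrite mZr E scalerA mulVf // scale1r.
Qed.

(** The composition pairing of [Hom(y, x)] with [Hom(x, y)] is perfect for simple [x]. On a summand
    isomorphic to [x] the value of [phi] prescribes a multiple of the inverse isomorphism; the other
    summands contribute zero. *)
Lemma functional_rep (ss : semisimple1 C) x y (phi : lmor x y -> k) : is_simple x ->
  scalar phi -> exists t : mor y x, forall g, t ∙ g = phi g *: (idm x : lmor x x).
Proof.
move=> xs phil; have [n [X [Xs [i [p [pi pi0 ip]]]]]] := ss1_dsum ss y.
have H j : exists t : lmor (X j) x, forall g : lmor x (X j),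
    t ∙ g = phi (i j ∙ g) *: (idm x : lmor x x).
  have [iso|niso] := pselect (isomorphic x (X j)); last first.
    exists 0 => g; rewrite m0l (schur_noniso ss g xs (Xs j) niso) m0r.
    by rewrite -(scale0r (0 : lmor x y)) scalarZ // mul0r scale0r.
  have [u [v [vu uv]]] := iso.
  exists (phi (i j ∙ u) *: (v : lmor (X j) x)) => g.
  have [c E] : exists c, v ∙ g = c *: (idm x : lmor x x) :> lmor x x.
    by exists (scal (v ∙ g : lmor x x)); apply: schur_end.
  have gE : i j ∙ g = c *: (i j ∙ u : lmor x y) :> lmor x y.
    by rewrite -[g in LHS]cmp1m -uv -[u ∙ v ∙ g]cmpA E mZr cmpm1 mZr.
  by rewrite mZl E scalerA gE scalarZ // mulrC.
pose t j := sval (cid (H j)).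
exists (\sum_j (t j ∙ p j : lmor y x)) => g.
have gE : (g : lmor x y) = \sum_j (i j ∙ (p j ∙ g) : lmor x y).
  rewrite -[LHS](cmp1m (g : mor x y)) -ip cmp_suml.
  by apply: eq_bigr => j _; rewrite cmpA.
rewrite [in RHS]gE scalar_sum // scaler_suml cmp_suml.
by apply: eq_bigr => j _; rewrite -cmpA (svalP (cid (H j))).
Qed.

(** The multiplicity spaces are [Hom(S i, y)]: a basis gives the inclusions, and [functional_rep]
    turns its coordinate functionals into the projections. Only the simple objects that occur in [y]
    have to be covered by [S]. *)
Lemma isotypic_decomposition (ss : semisimple1 C) r (S : 'I_r -> C) y :
  (forall i, is_simple (S i)) -> (forall i j, isomorphic (S i) (S j) -> i = j) ->
  (forall x (f : lmor x y), is_simple x -> f != 0 -> exists i, isomorphic x (S i)) ->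
  exists (m : 'I_r -> nat) (u : forall i, 'I_(m i) -> lmor (S i) y)
         (p : forall i, 'I_(m i) -> lmor y (S i)),
  (forall i l l', p i l ∙ u i l' = (l == l')%:R *: (idm (S i) : lmor _ _) :> lmor _ _) /\
  \sum_i \sum_l (u i l ∙ p i l : lmor y y) = idm y.
Proof.
move=> Ss Sinj Scov.
have H i : {n : nat & {b : 'I_n -> lmor (S i) y & {p : 'I_n -> lmor y (S i) |
    (forall l l', p l ∙ b l' = (l == l')%:R *: (idm (S i) : lmor _ _) :> lmor _ _) /\
    forall g, g = \sum_l (b l ∙ (p l ∙ g) : lmor (S i) y)}}}.
  have /cid [n /cid [b /cid [c [clin cb bc]]]] := lmor_basis (S i) y.
  exists n, b.
  have P l := functional_rep ss (Ss i) (clin l).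
  exists (fun l => sval (cid (P l))); split=> [l l'|g].
    by rewrite (svalP (cid (P l))) cb.
  rewrite [LHS]bc; apply: eq_bigr => l _.
  by rewrite (svalP (cid (P l))) mZr cmpm1.
pose m i := projT1 (H i); pose u i := projT1 (projT2 (H i)).
pose p i := sval (projT2 (projT2 (H i))).
exists m, u, p; split=> [i|].
  exact: (proj1 (svalP (projT2 (projT2 (H i))))).
apply: (mor_ext ss) => x h xs; rewrite cmp1m.
have [->|hnz] := eqVneq (h : lmor x y) 0; first by rewrite m0r.
have [i [f [g [gf fg]]]] := Scov x h xs hnz.
suff E : (\sum_i \sum_l (u i l ∙ p i l : lmor y y) : lmor y y) ∙ (h ∙ g) = h ∙ g.
  by rewrite -[h]cmpm1 -gf (cmpA h) cmpA E.
rewrite cmp_suml (big_only1 i) // => [|j ji _].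
  rewrite cmp_suml [RHS](proj2 (svalP (projT2 (projT2 (H i))))).
  by apply: eq_bigr => l _; rewrite -[u i l ∙ p i l ∙ _]cmpA.
rewrite cmp_suml big1 // => l _.
rewrite -[u j l ∙ p j l ∙ _]cmpA [(p j l ∙ _ : lmor _ _)](schur_noniso ss) ?m0r //.
by move=> /Sinj E; rewrite E eqxx in ji.
Qed.

(** The definition of finiteness allows repetitions and nonsimple entries in the list; both are
    pruned by induction on its length. *)
Lemma simple_reps (fss : finite_semisimple1 C) : exists r (S : 'I_r -> C),
  [/\ forall i, is_simple (S i), forall i j, isomorphic (S i) (S j) -> i = j &
      forall x, is_simple x -> exists i, isomorphic x (S i)].
Proof.
have [ss [n [S Scov]]] := fss.
suff [r [T [Ts Tinj Tcov]]] : exists r (T : 'I_r -> C),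
    [/\ forall i, is_simple (T i), forall i j, isomorphic (T i) (T j) -> i = j &
    forall i, is_simple (S i) -> exists j, isomorphic (S i) (T j)].
  exists r, T; split=> // x xs; have [i xi] := Scov x xs.
  have [j ij] := Tcov i (simple_iso xi xs).
  by exists j; apply: isomorphic_trans xi ij.
elim: n S {Scov} => [|n IH] S; first by exists 0%N, S; split=> [[]|[]|[]].
have [r [T [Ts Tinj Tcov]]] := IH (fun i => S (lift ord0 i)).
have [[Ss NT]|H] := pselect (is_simple (S ord0) /\ forall j, ~ isomorphic (S ord0) (T j)).
  exists r.+1, (fun i => if unlift ord0 i is Some j then T j else S ord0); split=> [i|i j|i].
  - by case: unliftP => [j|] _.
  - case: unliftP => [a ->|->]; case: unliftP => [b ->|->] //.
    + by move=> /Tinj ->.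
    + by move=> /isomorphic_sym /NT.
    + by move=> /NT.
  - case: (unliftP ord0 i) => [a ->|-> _].
      by move=> /Tcov [j ij]; exists (lift ord0 j); rewrite liftK.
    by exists ord0; rewrite unlift_none; exists (idm _); apply: is_iso_id.
exists r, T; split=> // i; case: (unliftP ord0 i) => [a ->|-> Ss]; first exact: Tcov.
by apply: contrapT => NT; apply: H; split=> // j Hj; apply: NT; exists j.
Qed.

Lemma dsum_exists (add : additive1 C) (I : finType) (X : I -> C) :
  exists (Y : C) (u : forall j, mor (X j) Y) (p : forall j, mor Y (X j)),
  [/\ forall j, p j ∙ u j = idm (X j),
      forall j l, j != l -> p l ∙ u j = 0 :> lmor (X j) (X l) &
      \sum_j (u j ∙ p j : lmor Y Y) = idm Y].
Proof.
suff [Y [u [p [H1 H2 H3]]]] : exists (Y : C) (u : forall j, mor (X j) Y) (p : forall j, mor Y (X j)),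
  [/\ forall j, j \in enum I -> p j ∙ u j = idm (X j),
      forall j l, j \in enum I -> l \in enum I -> j != l -> p l ∙ u j = 0 :> lmor (X j) (X l) &
      \sum_(j <- enum I) (u j ∙ p j : lmor Y Y) = idm Y].
  exists Y, u, p; split=> [j|j l jl|]; last by rewrite -H3 big_enum.
    by apply: H1; rewrite mem_enum.
  by apply: H2; rewrite ?mem_enum.
have : uniq (enum I) by apply: enum_uniq.
elim: (enum I) => [_|j0 s IH /= /andP [j0s /IH]].
  have [[z zz] _] := add; exists z, (fun=> 0 : lmor _ _), (fun=> 0 : lmor _ _); split=> //.
  by rewrite big_nil; apply/esym/(proj1 (zz z)).
move=> [Y [u [p [H1 H2 H3]]]].
have [W [a [b [c [d [ca db da cb abcd]]]]]] := proj2 add (X j0) Y.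
pose u' j : mor (X j) W := b ∙ u j; pose p' j : mor W (X j) := p j ∙ d.
exists W, (@dfwith _ (fun j => mor (X j) W) u' j0 a), (@dfwith _ (fun j => mor W (X j)) p' j0 c).
have ne j : j \in s -> j0 != j by apply: contraTneq => <-.
split=> [j|j l|].
- rewrite inE; have [-> _|nj /= js] := eqVneq j j0; first by rewrite !dfwith_in.
  by rewrite !dfwith_out ?ne // /u' /p' /= cmpA -(cmpA (p j)) db cmpm1 H1.
- rewrite !inE => /orP [/eqP ->|js] /orP [/eqP ->|ls] jl; first by rewrite eqxx in jl.
  + by rewrite dfwith_in dfwith_out ?ne // -[p' l]/(p l ∙ d) -cmpA da m0r.
  + by rewrite dfwith_in dfwith_out ?ne // -[u' j]/(b ∙ u j) cmpA cb m0l.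
  + rewrite !dfwith_out ?ne // -[u' j]/(b ∙ u j) -[p' l]/(p l ∙ d) cmpA -(cmpA (p l)) db cmpm1.
    exact: H2.
- suff E : \sum_(j <- s) (dfwith u' a j ∙ dfwith p' c j : lmor W W) = b ∙ d.
    by rewrite big_cons !dfwith_in E abcd.
  rewrite (eq_big_seq (fun j => (b ∙ (u j ∙ p j) ∙ d : lmor W W))); last first.
    by move=> j js; rewrite !dfwith_out ?ne // -[u' j]/(b ∙ u j) -[p' j]/(p j ∙ d) !cmpA.
  by rewrite -cmp_suml -cmp_sumr H3 cmpm1.
Qed.

Lemma multi_dsum_exists (ss : semisimple1 C) r (S : 'I_r -> C) (n : 'I_r -> nat) :
  (forall i, is_simple (S i)) -> (forall i j, isomorphic (S i) (S j) -> i = j) ->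
  exists (e : C) (u : forall i, 'I_(n i) -> lmor (S i) e) (p : forall i, 'I_(n i) -> lmor e (S i)),
  (forall i l l', p i l ∙ u i l' = (l == l')%:R *: (idm (S i) : lmor _ _) :> lmor _ _) /\
  \sum_i \sum_l (u i l ∙ p i l : lmor e e) = idm e.
Proof.
move=> Ss Sinj; have add := ss1_additive ss.
have H i := cid (dsum_exists add (fun _ : 'I_(n i) => S i)).
pose e' i := sval (H i).
have H2 i := cid (svalP (H i)); have H3 i := cid (svalP (H2 i)).
pose u' i : 'I_(n i) -> mor (S i) (e' i) := sval (H2 i).
pose p' i : 'I_(n i) -> mor (e' i) (S i) := sval (H3 i).
have [e [U [P [PU PU0 UP]]]] := dsum_exists add e'.
exists e, (fun i l => U i ∙ u' i l), (fun i l => p' i l ∙ P i); split=> [i l l'|].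
  rewrite cmpA -(cmpA (p' i l)) PU cmpm1.
  have [h1 h2 _] := svalP (H3 i); have [->|ll] := eqVneq l l'.
    by rewrite scale1r h1.
  by rewrite scale0r h2 1?eq_sym.
rewrite -UP; apply: eq_bigr => i _.
rewrite (eq_bigr (fun l => (U i ∙ (u' i l ∙ p' i l) ∙ P i : lmor e e))); last first.
  by move=> l _; rewrite !cmpA.
rewrite -cmp_suml -cmp_sumr; have [_ _ ->] := svalP (H3 i).
by rewrite cmpm1.
Qed.

Lemma simple_expand (ss : semisimple1 C) r (S : 'I_r -> C) (n : 'I_r -> nat) e
  (u : forall i, 'I_(n i) -> lmor (S i) e) (p : forall i, 'I_(n i) -> lmor e (S i)) :
  (forall i, is_simple (S i)) -> (forall i j, isomorphic (S i) (S j) -> i = j) ->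
  \sum_i \sum_l (u i l ∙ p i l : lmor e e) = idm e ->
  forall i (a : lmor (S i) e), a = \sum_l scal (p i l ∙ a : lmor (S i) (S i)) *: u i l.
Proof.
move=> Ss Sinj up i a.
rewrite -[LHS](cmp1m (a : mor _ _)) -up cmp_suml (big_only1 i) // => [|j ji _].
  rewrite cmp_suml; apply: eq_bigr => l _.
  by rewrite -cmpA {1}[(p i l ∙ a : lmor _ _)](schur_end ss) // mZr cmpm1.
rewrite cmp_suml big1 // => l _.
rewrite -cmpA [(p j l ∙ a : lmor _ _)](schur_noniso ss) ?m0r //.
by move=> /Sinj E; rewrite E eqxx in ji.
Qed.

End Semisimple.

(** * Values of right adjoints of linear functors *)

Section RightAdjointObject.
Variables (k : closedFieldType) (A B : lincat k) (fssA : finite_semisimple1 A).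
Variables (G : linfunctor A B) (z : B).
Let ssA := proj1 fssA.

(* The value at [z] of a right adjoint of [G]. *)
Lemma right_adjoint_object : exists (e : A) (ev : mor (G e) z),
  forall (x : A) (f : mor (G x) z), exists! a : mor x e, ev ∙ fmor G a = f.
Proof.
have [r [S [Ss Sinj Scov]]] := simple_reps fssA.
have H i : {n : nat & {b : 'I_n -> lmor (G (S i)) z & {c : 'I_n -> lmor (G (S i)) z -> k |
    [/\ forall i, scalar (c i), forall i j, c i (b j) = (i == j)%:R &
      forall v, v = \sum_i c i v *: b i]}}}.
  have /cid [n /cid [b /cid [c cP]]] := lmor_basis (G (S i)) z.
  by exists n, b, c.
pose n i := projT1 (H i); pose b i : 'I_(n i) -> lmor (G (S i)) z := projT1 (projT2 (H i)).
pose c i : 'I_(n i) -> lmor (G (S i)) z -> k := sval (projT2 (projT2 (H i))).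
have clin i l : scalar (@c i l).
  by have [h _ _] := svalP (projT2 (projT2 (H i))); apply: h.
have cb i l l' : @c i l (@b i l') = (l == l')%:R.
  by have [_ h _] := svalP (projT2 (projT2 (H i))); apply: h.
have bc i v : v = \sum_l @c i l v *: @b i l.
  by have [_ _ h] := svalP (projT2 (projT2 (H i))); apply: h.
(* [e] is the sum of [Hom(G (S i), z)] many copies of [S i], that is, one for each basis vector, and
   [ev] applies to each copy the basis vector that indexes it. *)
have [e [u [p [pu up]]]] := multi_dsum_exists ssA n Ss Sinj.
have Glin x y := lf_lin G (x := x) (y := y).
pose ev : lmor (G e) z := \sum_i \sum_l (@b i l ∙ fmor G (p i l) : lmor (G e) z).
have pu0 i j l l' : j != i -> p j l' ∙ u i l = 0 :> lmor _ _.
  move=> ji; apply: (schur_noniso ssA) => // /Sinj E.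
  by rewrite E eqxx in ji.
have evu i l : ev ∙ fmor G (u i l) = @b i l.
  rewrite /ev cmp_suml (big_only1 i) // => [|j ji _].
    rewrite cmp_suml (big_only1 l) // => [|l' ll _].
      by rewrite -cmpA -fmor_cmp pu eqxx scale1r fmor_id cmpm1.
    rewrite -cmpA -fmor_cmp pu (negbTE ll) scale0r.
    by rewrite (lin0 (Glin _ _)) m0r.
  rewrite cmp_suml big1 // => l' _.
  by rewrite -cmpA -fmor_cmp pu0 // (lin0 (Glin _ _)) m0r.
have eva x : linear (fun a : lmor x e => ev ∙ fmor G a : lmor (G x) z).
  by move=> s a a'; rewrite Glin mDr mZr.
have Suniq i (a : lmor (S i) e) : ev ∙ fmor G a = 0 :> lmor _ _ -> a = 0.
  move=> E; rewrite [a](simple_expand ssA Ss Sinj up); apply: big1 => l _.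
  suff -> : scal (p i l ∙ a : lmor (S i) (S i)) = @c i l (ev ∙ fmor G a : lmor _ _).
    by rewrite E -(scale0r (0 : lmor _ _)) scalarZ // mul0r scale0r.
  rewrite [in RHS](simple_expand ssA Ss Sinj up a) (lin_sum (eva _)) scalar_sum // (bigD1 l) //=.
  rewrite (linZ (eva _)) scalarZ // evu cb eqxx mulr1 big1 ?addr0 // => l' ll.
  by rewrite (linZ (eva _)) scalarZ // evu cb eq_sym (negbTE ll) mulr0.
have Sex i (f : lmor (G (S i)) z) : exists a : lmor (S i) e, ev ∙ fmor G a = f.
  exists (\sum_l @c i l f *: u i l); rewrite (lin_sum (eva _)) [RHS]bc.
  by apply: eq_bigr => l _; rewrite (linZ (eva _)) evu.
exists e, ev => x f.
have uniq (a a' : lmor x e) : ev ∙ fmor G a = ev ∙ fmor G a' -> a = a'.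
  move=> E; apply: (mor_ext ssA) => y h ys.
  have [i [v [w [wv vw]]]] := Scov y ys.
  have Es : isomorphic (S i) y by exists w, v.
  apply: (cancel_r (f := w) (g := v)) => //; apply: (@subr0_eq (lmor (S i) e)).
  apply: Suniq; rewrite (linB (eva _)) -!cmpA !fmor_cmp !cmpA E.
  by rewrite subrr.
have [m [v [q [qv vq]]]] := isotypic_decomposition ssA Ss Sinj
  (fun y (_ : lmor y x) ys _ => Scov y ys).
pose a i l := sval (cid (Sex i (f ∙ fmor G (v i l)))).
have evA : ev ∙ fmor G (\sum_i \sum_l (a i l ∙ q i l : lmor x e)) = f.
  rewrite [LHS](lin_sum (eva _)) -[RHS]cmpm1 -fmor_id -vq.
  rewrite [fmor _ _](lin_sum (Glin _ _)) cmp_sumr; apply: eq_bigr => i _.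
  rewrite [LHS](lin_sum (eva _)) [fmor _ _](lin_sum (Glin _ _)) cmp_sumr; apply: eq_bigr => l _.
  by rewrite !fmor_cmp !cmpA (svalP (cid (Sex _ _))).
exists (\sum_i \sum_l (a i l ∙ q i l : lmor x e)); split=> // a' E.
by apply: uniq; rewrite E evA.
Qed.

End RightAdjointObject.

(** * Presheaves on a 2-category *)

Section Reassociation.
Variables (C : category) (v w x y z : C).

Lemma pre2 (g : mor y z) (f : mor x y) h (e : mor w x) : g ∙ f = h -> g ∙ (f ∙ e) = h ∙ e.
Proof. by move=> <-; rewrite cmpA. Qed.
Lemma end3 (g : mor y z) (f : mor x y) (e : mor w x) h : g ∙ f ∙ e = h -> g ∙ (f ∙ e) = h.
Proof. by rewrite -cmpA. Qed.
Lemma pre3 (g : mor y z) (f : mor x y) (e : mor w x) h (d : mor v w) :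
  g ∙ f ∙ e = h -> g ∙ (f ∙ (e ∙ d)) = h ∙ d.
Proof. by move=> <-; rewrite !cmpA. Qed.

End Reassociation.

(* Rewriting in right-associated composites. *)
Tactic Notation "rq" uconstr(H) :=
  first [ rewrite (pre2 _ H) | rewrite (pre3 _ H) | rewrite H | rewrite (end3 H) ]; rewrite -?cmpA.

Lemma whf (C E : category) (F : functor C E) (x y y' z : C) (g : mor y z) (f : mor x y)
  (g' : mor y' z) (f' : mor x y') : g ∙ f = g' ∙ f' -> fmor F g ∙ fmor F f = fmor F g' ∙ fmor F f'.
Proof. by rewrite -!fmor_cmp => ->. Qed.
Lemma whf1 (C E : category) (F : functor C E) (x y : C) (g : mor y x) (f : mor x y) :
  g ∙ f = idm x -> fmor F g ∙ fmor F f = idm (F x).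
Proof. by rewrite -!fmor_cmp => ->; rewrite fmor_id. Qed.

Lemma inv12 (C : category) (x y : C) (f : mor x y) g : inverse f g -> g ∙ f = idm x.
Proof. by case. Qed.
Lemma cancelK (C : category) (x y z : C) (f : mor x y) g (h : mor z x) : inverse f g -> g ∙ (f ∙ h) = h.
Proof. by case=> gf _; rewrite cmpA gf cmp1m. Qed.
Lemma inv21 (C : category) (x y : C) (f : mor x y) g : inverse f g -> f ∙ g = idm y.
Proof. by case. Qed.

Reserved Notation "n · f" (at level 37, left associativity).
Reserved Notation "u • f" (at level 37, left associativity).
Reserved Notation "n ◂ a" (at level 37, left associativity).

(* A contravariant linear pseudofunctor from [D] to linear categories, written
   as a right action; composition of functors being strict, so are the coherence
   equations. *)
Record psh (k : fieldType) (D : linbicat k) : Type := Psh {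
  ps :> D -> lincat k;
  pa : forall {X Y : D} (f : hm X Y), linfunctor (ps Y) (ps X)
    where "n · f" := (fob (lf_fun (pa f)) n) and "u • f" := (fmor (lf_fun (pa f)) u);
  pa2 : forall {X Y : D} {f g : hm X Y} (a : mor f g) (n : ps Y), mor (n · f) (n · g)
    where "n ◂ a" := (pa2 a n);
  pw : forall {X Y Z : D} (f : hm Y Z) (g : hm X Y) (n : ps Z), mor (n · f · g) (n · (f ∘ g));
  pwi : forall {X Y Z : D} (f : hm Y Z) (g : hm X Y) (n : ps Z), mor (n · (f ∘ g)) (n · f · g);
  pu : forall {X : D} (n : ps X), mor n (n · one X);
  pui : forall {X : D} (n : ps X), mor (n · one X) n;
  pwP : forall X Y Z (f : hm Y Z) (g : hm X Y) n, inverse (pw f g n) (pwi f g n);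
  puP : forall X (n : ps X), inverse (pu n) (pui n);
  pa2N : forall X Y (f g : hm X Y) (a : mor f g) n m (u : mor n m),
    m ◂ a ∙ (u • f) = u • g ∙ (n ◂ a);
  pa2_id : forall X Y (f : hm X Y) n, n ◂ idm f = idm (n · f);
  pa2_cmp : forall X Y (f g h : hm X Y) (b : mor g h) (a : mor f g) n,
    n ◂ (b ∙ a) = n ◂ b ∙ (n ◂ a);
  pa2_lin : forall X Y (f g : hm X Y) n,
    linear (fun a : @lmor k (lhm X Y) f g => n ◂ a : lmor (n · f) (n · g));
  pwN : forall X Y Z (f : hm Y Z) (g : hm X Y) n m (u : mor n m),
    pw f g m ∙ (u • f • g) = u • (f ∘ g) ∙ pw f g n;
  pwNl : forall X Y Z (f f' : hm Y Z) (a : mor f f') (g : hm X Y) n,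
    pw f' g n ∙ ((n ◂ a) • g) = n ◂ (a ⋆ idm g) ∙ pw f g n;
  pwNr : forall X Y Z (f : hm Y Z) (g g' : hm X Y) (b : mor g g') n,
    pw f g' n ∙ (n · f ◂ b) = n ◂ (idm f ⋆ b) ∙ pw f g n;
  puN : forall X (n m : ps X) (u : mor n m), pu m ∙ u = u • one X ∙ pu n;
  pasc : forall W X Y Z (h : hm Y Z) (g : hm X Y) (f : hm W X) n,
    n ◂ asc h g f ∙ pw (h ∘ g) f n ∙ (pw h g n • f) = pw h (g ∘ f) n ∙ pw g f (n · h);
  plu : forall X Y (f : hm X Y) n, n ◂ lu f ∙ pw (one Y) f n ∙ (pu n • f) = idm (n · f);
  pru : forall X Y (f : hm X Y) n, n ◂ ru f ∙ pw f (one X) n ∙ pu (n · f) = idm (n · f) }.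

Arguments pa {k D} N {X Y} f : rename.
Arguments pa2 {k D N X Y f g} a n : rename.
Arguments pw {k D N X Y Z} f g n : rename.
Arguments pwi {k D N X Y Z} f g n : rename.
Arguments pu {k D N X} n : rename.
Arguments pui {k D N X} n : rename.
Notation "n · f" := (fob (lf_fun (pa _ f)) n).
Notation "u • f" := (fmor (lf_fun (pa _ f)) u).
Notation "n ◂ a" := (pa2 a n).

Section PshTheory.
Variables (k : fieldType) (D : linbicat k) (N : psh D).

Lemma paZ X Y (f : hm X Y) (n m : N Y) c (u : lmor n m) :
  (c *: u) • f = c *: (u • f : lmor _ _) :> lmor (n · f) (m · f).
Proof. exact: (linZ (@lf_lin _ _ _ (pa N f) n m)). Qed.

Lemma pa0 X Y (f : hm X Y) (n m : N Y) : (0 : lmor n m) • f = 0 :> lmor (n · f) (m · f).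
Proof. exact: (lin0 (@lf_lin _ _ _ (pa N f) n m)). Qed.

Lemma pa_sum X Y (f : hm X Y) (n m : N Y) (I : Type) (r : seq I) (F : I -> lmor n m) :
  (\sum_(i <- r) F i) • f = \sum_(i <- r) (F i • f : lmor _ _) :> lmor (n · f) (m · f).
Proof. exact: (lin_sum (@lf_lin _ _ _ (pa N f) n m)). Qed.

Lemma pa2Z X Y (f g : hm X Y) (n : N Y) c (a : @lmor k (lhm X Y) f g) :
  n ◂ (c *: a) = c *: (n ◂ a : lmor _ _) :> lmor (n · f) (n · g).
Proof. exact: (linZ (pa2_lin n)). Qed.

Lemma pa20 X Y (f g : hm X Y) (n : N Y) : n ◂ (0 : @lmor k (lhm X Y) f g) = 0 :> lmor (n · f) (n · g).
Proof. exact: (lin0 (pa2_lin n)). Qed.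

Lemma pa2_sum X Y (f g : hm X Y) (n : N Y) (I : Type) (r : seq I) (F : I -> @lmor k (lhm X Y) f g) :
  n ◂ (\sum_(i <- r) F i) = \sum_(i <- r) (n ◂ F i : lmor _ _) :> lmor (n · f) (n · g).
Proof. exact: (lin_sum (pa2_lin n)). Qed.

Lemma pwiN X Y Z (f : hm Y Z) (g : hm X Y) (n m : N Z) (u : mor n m) :
  pwi f g m ∙ (u • (f ∘ g)) = u • f • g ∙ pwi f g n.
Proof.
apply: (cancel_l (pwP f g m)); rewrite !cmpA (proj2 (pwP _ _ _)) cmp1m pwN -cmpA.
by rewrite (proj2 (pwP _ _ _)) cmpm1.
Qed.

Lemma pwiNl X Y Z (f f' : hm Y Z) (a : mor f f') (g : hm X Y) (n : N Z) :
  pwi f' g n ∙ (n ◂ (a ⋆ idm g)) = (n ◂ a) • g ∙ pwi f g n.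
Proof.
apply: (cancel_l (pwP f' g n)); rewrite !cmpA (proj2 (pwP _ _ _)) cmp1m pwNl -cmpA.
by rewrite (proj2 (pwP _ _ _)) cmpm1.
Qed.

Lemma pwiNr X Y Z (f : hm Y Z) (g g' : hm X Y) (b : mor g g') (n : N Z) :
  pwi f g' n ∙ (n ◂ (idm f ⋆ b)) = n · f ◂ b ∙ pwi f g n.
Proof.
apply: (cancel_l (pwP f g' n)); rewrite !cmpA (proj2 (pwP _ _ _)) cmp1m pwNr -cmpA.
by rewrite (proj2 (pwP _ _ _)) cmpm1.
Qed.

Lemma puiN X (n m : N X) (u : mor n m) : u ∙ pui n = pui m ∙ (u • one X).
Proof.
apply: (cancel_l (puP m)); rewrite !cmpA (proj2 (puP _)) cmp1m puN -cmpA.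
by rewrite (proj2 (puP _)) cmpm1.
Qed.

Lemma inverse_pa2 X Y (f g : hm X Y) (a : mor f g) b (n : N Y) :
  inverse a b -> inverse (n ◂ a) (n ◂ b).
Proof. by move=> [ba ab]; split; rewrite -pa2_cmp ?ba ?ab pa2_id. Qed.

Lemma inverse_fmor (C E : category) (F : functor C E) x y (f : mor x y) g :
  inverse f g -> inverse (fmor F f) (fmor F g).
Proof. by move=> [gf fg]; split; rewrite -fmor_cmp ?gf ?fg fmor_id. Qed.

Lemma pw_pu X Y (f : hm X Y) (n : N Y) : pw f (one X) n ∙ pu (n · f) = n ◂ rui f.
Proof.
apply: (cancel_l (inverse_pa2 n (ruP f))).
by rewrite -pa2_cmp (proj2 (ruP _)) pa2_id cmpA pru.
Qed.

Lemma pw_pu_l X Y (f : hm X Y) (n : N Y) : pw (one Y) f n ∙ (pu n • f) = n ◂ lui f.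
Proof.
apply: (cancel_l (inverse_pa2 n (luP f))).
by rewrite -pa2_cmp (proj2 (luP _)) pa2_id cmpA plu.
Qed.

Lemma pui_pwi X Y (f : hm X Y) (n : N Y) : pui (n · f) ∙ pwi f (one X) n = n ◂ ru f.
Proof.
apply: inverse_eqP (pw_pu f n).
  by apply: inverse_cmp; [apply: puP | apply: pwP].
by apply: inverse_pa2; apply: inverse_sym; apply: ruP.
Qed.

Lemma pui_pwi_l X Y (f : hm X Y) (n : N Y) : (pui n • f) ∙ pwi (one Y) f n = n ◂ lu f.
Proof.
apply: inverse_eqP (pw_pu_l f n).
  by apply: inverse_cmp; [apply: inverse_fmor; apply: puP | apply: pwP].
by apply: inverse_pa2; apply: inverse_sym; apply: luP.
Qed.

Lemma pasci W X Y Z (h : hm Y Z) (g : hm X Y) (f : hm W X) (n : N Z) :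
  (pw h g n • f) ∙ pwi g f (n · h) ∙ pwi h (g ∘ f) n = pwi (h ∘ g) f n ∙ (n ◂ asci h g f).
Proof.
apply: (cancel_l (pwP (h ∘ g) f n)); apply: (cancel_l (inverse_pa2 n (ascP h g f))).
rewrite -!cmpA; rq (pasc _ _ _ _); rq (inv21 (pwP g f _)); rewrite cmp1m.
rewrite (inv21 (pwP _ _ _)); rq (inv21 (pwP _ _ _)); rewrite cmp1m.
by rewrite -pa2_cmp (proj2 (ascP _ _ _)) pa2_id.
Qed.

(* The unit and the counit of an adjunction in [D], acting on [N]. *)
Definition cupf X Y (r : hm Y X) (l : hm X Y) (eta : mor (one X) (r ∘ l)) (n : N X) :
  mor n (n · r · l) := pwi r l n ∙ (n ◂ eta) ∙ pu n.
Definition capf X Y (l : hm X Y) (r : hm Y X) (eps : mor (l ∘ r) (one Y)) (n : N Y) :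
  mor (n · l · r) n := pui n ∙ (n ◂ eps) ∙ pw l r n.

Lemma cupfN X Y (r : hm Y X) (l : hm X Y) eta (n m : N X) (u : mor n m) :
  cupf (r := r) (l := l) eta m ∙ u = u • r • l ∙ cupf eta n.
Proof. by rewrite /cupf -!cmpA puN (cmpA (m ◂ eta)) pa2N !cmpA pwiN. Qed.

Lemma capfN X Y (l : hm X Y) (r : hm Y X) eps (n m : N Y) (u : mor n m) :
  capf (l := l) (r := r) eps m ∙ (u • l • r) = u ∙ capf eps n.
Proof. by rewrite /capf -!cmpA pwN !cmpA puiN -!cmpA (cmpA (m ◂ eps)) pa2N !cmpA. Qed.

Section Adjunction.
Variables (X Y : D) (l : hm X Y) (r : hm Y X) (eta : mor (one X) (r ∘ l)) (eps : mor (l ∘ r) (one Y)).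
Hypothesis adj : adjunction eta eps.

Lemma zigzag_l (n : N Y) : (capf eps n • l) ∙ cupf eta (n · l) = idm (n · l).
Proof.
rewrite /capf /cupf !fmor_cmp.
have E : n · l ◂ eta = pwi l (r ∘ l) n ∙ (n ◂ (idm l ⋆ eta)) ∙ pw l (one X) n.
  by rewrite pwiNr -cmpA (proj1 (pwP _ _ _)) cmpm1.
rewrite E -!cmpA pw_pu; rq (pasci _ _ _ _); rq (esym (pwiNl _ _ _)).
rq (pui_pwi_l _ _); rewrite -!pa2_cmp !cmpA.
by rewrite (proj1 adj) pa2_id.
Qed.

Lemma zigzag_r (n : N X) : capf eps (n · r) ∙ (cupf eta n • r) = idm (n · r).
Proof.
rewrite /capf /cupf !fmor_cmp.
have E : n · r ◂ eps = pwi r (one Y) n ∙ (n ◂ (idm r ⋆ eps)) ∙ pw r (l ∘ r) n.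
  by rewrite pwiNr -cmpA (proj1 (pwP _ _ _)) cmpm1.
rewrite E -!cmpA; rq (pui_pwi _ _).
have F : pw r (l ∘ r) n ∙ pw l r (n · r) = n ◂ asc r l r ∙ pw (r ∘ l) r n ∙ (pw r l n • r).
  by rewrite pasc.
rq F.
have G : (pw r l n • r) ∙ (pwi r l n • r) = idm _ by rewrite -fmor_cmp (inv21 (pwP _ _ _)) fmor_id.
rq G; rewrite cmp1m; rq (pwNl _ _ _); rewrite pw_pu_l -!pa2_cmp !cmpA.
by rewrite (proj2 adj) pa2_id.
Qed.

End Adjunction.

End PshTheory.

Arguments cupf {k D N X Y r l} eta n.
Arguments capf {k D N X Y l r} eps n.

(** * The represented presheaf *)

Section Reg.
Variables (k : fieldType) (D : linbicat k) (W : D).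

Definition reg_fun (X Y : D) (f : hm X Y) : linfunctor (lhm Y W) (lhm X W).
Proof.
unshelve refine (@Linfunctor k (lhm Y W) (lhm X W)
  (@Functor (lhm Y W) (lhm X W) (fun n => n ∘ f) (fun _ _ u => u ⋆ idm f) _ _) _).
- by move=> n; apply: hc2_id.
- by move=> *; apply: hc2_cmpl.
- by move=> n m a u v /=; rewrite (lb_hcl (l := D)).
Defined.

(** The presheaf [Hom(-, W)]. Its coherence laws are those of the 2-category, so an equation between
    actions that holds in every presheaf yields an equation in [D] when it is read at [one W]. *)
Definition reg : psh D.
Proof.
refine (@Psh k D (fun X => lhm X W) reg_fun (fun _ _ _ _ a n => idm n ⋆ a)
  (fun _ _ _ f g n => asc n f g) (fun _ _ _ f g n => asci n f g)
  (fun _ n => rui n) (fun _ n => ru n) _ _ _ _ _ _ _ _ _ _ _ _ _).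
- by move=> *; apply: ascP.
- by move=> *; apply: inverse_sym; apply: ruP.
- by move=> X Y f g a n m u /=; rewrite hc2_lr hc2_rl.
- by move=> *; apply: hc2_id.
- by move=> *; apply: hc2_cmpr.
- by move=> X Y f g n a u v /=; rewrite (lb_hcr (l := D)).
- by move=> X Y Z f g n m u /=; rewrite ascN hc2_id.
- by move=> X Y Z f f' a g n /=; rewrite ascN.
- by move=> X Y Z f g g' b n /=; rewrite -hc2_id ascN.
- by move=> X n m u /=; rewrite ruiN.
- by move=> V X Y Z h g f n /=; rewrite pentagon.
- move=> X Y f n /=; rewrite triangle -hc2_cmpl (proj2 (ruP n)); exact: hc2_id.
- by move=> X Y f n /=; rewrite ru_hc (proj2 (ruP _)).
Defined.

End Reg.

(** Naturality of [lu] against itself gives [lu (one X ∘ one X) = idm (one X) ⋆ lu (one X)]; the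
    triangle then compares the two unitors after whiskering with [one X]. *)
Lemma lu_one (B : bicategory) (X : B) : lu (one X) = ru (one X).
Proof.
have E : lu (one X ∘ one X) = idm (one X) ⋆ lu (one X).
  by apply: (cancel_l (luP (one X))); rewrite luN.
by apply: one_r_inj; rewrite -triangle -E lu_hc.
Qed.

(** * Strict words of endomorphisms and natural families between them *)

Section Words.
Variables (k : fieldType) (D : linbicat k) (Z : D).

(* An endofunctor of [N Z], for every [N], of the form [n |-> n · w] up to a
   coherent isomorphism [wk]; the point is that these compose strictly. *)
Record wfun : Type := Wfun {
  wf : forall N : psh D, linfunctor (N Z) (N Z);
  wk : forall (N : psh D) (B : D) (n : N B) (m : hm Z B),
    mor (n · (wf (reg B) m : hm Z B)) (wf N (n · m));
  wki : forall (N : psh D) (B : D) (n : N B) (m : hm Z B),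
    mor (wf N (n · m)) (n · (wf (reg B) m : hm Z B));
  wkP : forall (N : psh D) (B : D) (n : N B) (m : hm Z B), inverse (wk n m) (wki n m);
  wkNr : forall (N : psh D) (B : D) (n : N B) (m m' : hm Z B) (a : mor m m'),
    wk n m' ∙ (n ◂ (fmor (wf (reg B)) a : @mor (hm Z B) _ _)) = fmor (wf N) (n ◂ a) ∙ wk n m;
  wkNl : forall (N : psh D) (B : D) (n n' : N B) (u : mor n n') (m : hm Z B),
    wk n' m ∙ (u • (wf (reg B) m : hm Z B)) = fmor (wf N) (u • m) ∙ wk n m;
  wkA : forall (N : psh D) (A B : D) (n : N B) (v : hm A B) (m : hm Z A),
    wk n (v ∘ m) ∙ (n ◂ (@wk (reg B) A v m : @mor (hm Z B) _ _)) ∙ pw v (wf (reg A) m : hm Z A) n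
    = fmor (wf N) (pw v m n) ∙ wk (n · v) m;
  wkU : forall (B : D) (m : hm Z B),
    fmor (wf (reg B)) (lu m) ∙ @wk (reg B) B (one B) m = lu (wf (reg B) m : hm Z B) }.

Definition idw : wfun.
Proof.
refine (@Wfun (fun N => lf_id (N Z)) (fun N B n m => idm (n · m)) (fun N B n m => idm (n · m))
  _ _ _ _ _).
- by move=> *; apply: inverse_id.
- by move=> * /=; rewrite cmp1m cmpm1.
- by move=> * /=; rewrite cmp1m cmpm1.
- by move=> * /=; rewrite pa2_id !cmp1m !cmpm1.
- by move=> * /=; rewrite !cmpm1.
Defined.

Definition at_ (X : hm Z Z) : wfun.
Proof.
refine (@Wfun (fun N => pa N X) (fun N B n m => pwi m X n) (fun N B n m => pw m X n)
  _ _ _ _ _).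
- by move=> *; apply: inverse_sym; apply: pwP.
- by move=> * /=; rewrite pwiNl.
- by move=> * /=; rewrite pwiN.
- move=> N A B n v m /=; apply: (cancel_l (pwP (v ∘ m) X n)).
  rewrite -!cmpA; rq (inv21 (pwP _ _ _)); rewrite cmp1m.
  apply: (cancel_l (inverse_pa2 n (ascP v m X))).
  rq (pasc _ _ _ _); rewrite (inv21 (pwP _ _ _)) cmpm1.
  by rewrite cmpA -pa2_cmp (inv21 (ascP _ _ _)) pa2_id cmp1m.
- by move=> B m /=; rewrite lu_hc'.
Defined.

(** [G] is applied first: [compw (at_ b) (at_ a)] is the word [n · a · b]. *)
Definition compw (F G : wfun) : wfun.
Proof.
refine (@Wfun (fun N => lf_comp (wf F N) (wf G N))
  (fun N B n m => fmor (wf F N) (wk G n m) ∙ wk F n (wf G (reg B) m))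
  (fun N B n m => wki F n (wf G (reg B) m) ∙ fmor (wf F N) (wki G n m)) _ _ _ _ _).
- move=> N B n m; apply: inverse_cmp; [apply: wkP | apply: inverse_fmor; apply: wkP].
- by move=> N B n m m' a /=; rewrite -cmpA wkNr !cmpA -!fmor_cmp wkNr.
- by move=> N B n n' u m /=; rewrite -cmpA wkNl !cmpA -!fmor_cmp wkNl.
- move=> N A B n v m /=.
  rewrite [X in _ ∙ X ∙ _](pa2_cmp _ _ n) -!cmpA (cmpA (wk F n _) (n ◂ _)) wkNr -!cmpA.
  rewrite !(cmpA (wk F n _)) wkA !cmpA -!fmor_cmp; congr (_ ∙ _).
  by rewrite wkA.
- move=> B m /=; rewrite cmpA -fmor_cmp wkU.
  exact: wkU.
Defined.

(* Families indexed by all [N] and [n], natural and compatible with [wk]: they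
   correspond to 2-morphisms of [D]. *)
Definition isd (F G : wfun) (phi : forall (N : psh D) (n : N Z), mor (wf F N n) (wf G N n)) : Prop :=
  (forall (N : psh D) (n m : N Z) (u : mor n m),
     phi N m ∙ fmor (wf F N) u = fmor (wf G N) u ∙ phi N n) /\
  (forall (N : psh D) B (n : N B) (m : hm Z B),
     phi N (n · m) ∙ wk F n m = wk G n m ∙ (n ◂ (phi (reg B) m : @mor (hm Z B) _ _))).

Lemma isd_id F : isd (F := F) (G := F) (fun N n => idm _).
Proof. by split=> *; rewrite ?pa2_id cmp1m cmpm1. Qed.

Lemma isd_cmp F G H (psi : forall (N : psh D) (n : N Z), mor (wf G N n) (wf H N n)) 
  (phi : forall (N : psh D) (n : N Z), mor (wf F N n) (wf G N n)) :
  isd psi -> isd phi -> isd (F := F) (G := H) (fun N n => psi N n ∙ phi N n).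
Proof.
move=> [p1 p2] [f1 f2]; split=> [N n m u|N B n m].
  by rewrite -cmpA f1 !cmpA p1.
by rewrite -cmpA f2 cmpA p2 -cmpA -(pa2_cmp _ _ n).
Qed.

Lemma isd_l F G W (phi : forall (N : psh D) (n : N Z), mor (wf F N n) (wf G N n)) :
  isd phi -> isd (F := compw F W) (G := compw G W) (fun N n => phi N (wf W N n)).
Proof.
move=> [f1 f2]; split=> [N n m u|N B n m] /=; first by rewrite f1.
by rewrite cmpA f1 -!cmpA; congr (_ ∙ _); rewrite f2.
Qed.

Lemma isd_r F G W (phi : forall (N : psh D) (n : N Z), mor (wf F N n) (wf G N n)) :
  isd phi -> isd (F := compw W F) (G := compw W G) (fun N n => fmor (wf W N) (phi N n)).
Proof.
move=> [f1 f2]; split=> [N n m u|N B n m] /=; first by rewrite -!fmor_cmp f1.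
rewrite cmpA -fmor_cmp f2 fmor_cmp -!cmpA; congr (_ ∙ _).
by rewrite wkNr.
Qed.

Lemma isd_2mor X Y (a : mor X Y) : isd (F := at_ X) (G := at_ Y) (fun N n => n ◂ a).
Proof.
split=> [N n m u|N B n m] /=; first by rewrite pa2N.
by rewrite pwiNr.
Qed.

Lemma isd_pw X Y : isd (F := compw (at_ Y) (at_ X)) (G := at_ (X ∘ Y)) (fun N n => pw X Y n).
Proof.
split=> [N n m u|N B n m] /=; first by rewrite pwN.
apply: (cancel_l (pwP m (X ∘ Y) n)); rq (inv21 (pwP m (X ∘ Y) n)).
have E : pw m (X ∘ Y) n ∙ pw X Y (n · m) = n ◂ asc m X Y ∙ pw (m ∘ X) Y n ∙ (pw m X n • Y).
  by rewrite pasc.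
rq E; rewrite cmp1m.
have F : (pw m X n • Y) ∙ (pwi m X n • Y) = idm _ by rewrite -fmor_cmp (inv21 (pwP _ _ _)) fmor_id.
by rq F; rewrite cmp1m (inv21 (pwP _ _ _)) cmpm1.
Qed.

Lemma isd_inv F G (phi : forall (N : psh D) (n : N Z), mor (wf F N n) (wf G N n)) psi :
  isd phi -> (forall N n, inverse (phi N n) (psi N n)) -> isd (F := G) (G := F) psi.
Proof.
move=> [f1 f2] P; split=> [N n m u|N B n m].
  apply: (cancel_l (P N m)); rewrite !cmpA (inv21 (P N m)) cmp1m f1 -cmpA.
  by rewrite (inv21 (P N n)) cmpm1.
apply: (cancel_l (P N _)); rewrite !cmpA (inv21 (P N _)) cmp1m f2 -cmpA -(pa2_cmp _ _ n).
by rewrite [X in n ◂ X](inv21 (P (reg B) m)) [n ◂ _]pa2_id cmpm1.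
Qed.

Lemma isd_pwi X Y : isd (F := at_ (X ∘ Y)) (G := compw (at_ Y) (at_ X)) (fun N n => pwi X Y n).
Proof. by apply: (isd_inv (isd_pw X Y)) => N n; apply: pwP. Qed.

Lemma isd_pui : isd (F := at_ (one Z)) (G := idw) (fun N n => pui n).
Proof.
split=> [N n m u|N B n m] /=; first by rewrite puiN.
by rewrite cmp1m pui_pwi.
Qed.

Lemma isd_pu : isd (F := idw) (G := at_ (one Z)) (fun N n => pu n).
Proof. by apply: (isd_inv isd_pui) => N n; apply/inverse_sym/puP. Qed.

(** A Yoneda argument: naturality along [pu n] moves the value at [n] to [n · one Z], and
    compatibility with [wk] reads it off from the represented presheaf. Equality of families thus
    needs a single check. *)
Lemma isd_uniq F G (phi psi : forall (N : psh D) (n : N Z), mor (wf F N n) (wf G N n)) :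
  isd phi -> isd psi -> phi (reg Z) (one Z) = psi (reg Z) (one Z) -> forall N n, phi N n = psi N n.
Proof.
move=> [f1 f2] [p1 p2] E N n.
apply: (cancel_l (inverse_fmor (wf G N) (puP n))); rewrite -f1 -p1; congr (_ ∙ _).
by apply: (cancel_r (wkP F n (one Z))); rewrite f2 p2 E.
Qed.

(** Contracts a word to one letter, the 1-morphism that the word gives at [one Z]. *)
Definition collapse (H : wfun) (N : psh D) (n : N Z) := wki H n (one Z) ∙ fmor (wf H N) (pu n).

Lemma collapse_iso (H : wfun) (N : psh D) (n : N Z) :
  inverse (collapse H n) (fmor (wf H N) (pui n) ∙ wk H n (one Z)).
Proof.
apply: inverse_cmp; first by apply: inverse_fmor; apply: puP.
exact/inverse_sym/wkP.
Qed.

Lemma collapse_act (H : wfun) (N : psh D) (B : D) (n : N B) (m : hm Z B) :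
  pw m (wf H (reg Z) (one Z) : hm Z Z) n ∙ collapse H (n · m) ∙ wk H n m
  = n ◂ (@collapse H (reg B) m : @mor (hm Z B) _ _).
Proof.
apply: (cancel_l (inverse_cmp (inverse_pa2 n (wkP H (m : reg B Z) (one Z) : @inverse (hm Z B) _ _ _ _))
  (wkP H n (m ∘ one Z)))).
rewrite /collapse -!cmpA (cmpA (n ◂ _) (pw _ _ _)) (cmpA (wk H n _)) (cmpA (wk H n _)) wkA.
rewrite -!cmpA; rq (inv21 (wkP H _ _)); rewrite cmp1m cmpA -fmor_cmp pw_pu.
have E : n ◂ @wk H (reg B) Z m (one Z) ∙ (n ◂ (@collapse H (reg B) m : @mor (hm Z B) _ _))
    = n ◂ (fmor (wf H (reg B)) (@pu _ _ (reg B) Z m) : @mor (hm Z B) _ _).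
  rewrite -(pa2_cmp _ _ n) /collapse; apply: (congr1 (fun a => n ◂ a)).
  exact: (cancelK _ (inverse_sym (@wkP H (reg B) Z m (one Z)))).
by rewrite E wkNr.
Qed.

Section Ext.
Variables (F G : wfun) (a : mor (wf F (reg Z) (one Z)) (wf G (reg Z) (one Z))).

(** Inverse to evaluation at [one Z]: [a] acts on [n] as a single letter, between the contraction of
    [F] and the inverse contraction of [G]. *)
Definition ext (N : psh D) (n : N Z) : mor (wf F N n) (wf G N n) :=
  fmor (wf G N) (pui n) ∙ wk G n (one Z) ∙ (n ◂ (a : @mor (hm Z Z) _ _)) ∙ wki F n (one Z)
  ∙ fmor (wf F N) (pu n).

Lemma ext_at1 : @ext (reg Z) (one Z) = a.
Proof.
rewrite /ext /=.
have E (H : wfun) : fmor (wf H (reg Z)) (ru (one Z)) ∙ @wk H (reg Z) Z (one Z) (one Z)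
    = lu (wf H (reg Z) (one Z) : hm Z Z).
  by rewrite -wkU lu_one.
rewrite E -!cmpA.
have E' : @wki F (reg Z) Z (one Z) (one Z) ∙ fmor (wf F (reg Z)) (rui (one Z))
    = lui (wf F (reg Z) (one Z) : hm Z Z).
  apply: inverse_eqP (E F); last exact: luP.
  by apply: inverse_cmp; [apply: wkP | apply: inverse_fmor; apply: ruP].
by rewrite E' cmpA luN -cmpA (inv21 (luP _)) cmpm1.
Qed.

Lemma isd_ext : isd (F := F) (G := G) ext.
Proof.
have extE (N : psh D) (n : N Z) : collapse G n ∙ ext n = (n ◂ (a : @mor (hm Z Z) _ _)) ∙ collapse F n.
  rewrite /ext -!cmpA; rq (inv21 (inverse_fmor (wf G N) (puP n))).
  by rewrite cmp1m (cancelK _ (wkP G n _)).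
have cN (H : wfun) (N : psh D) (n m : N Z) (u : mor n m) :
    collapse H m ∙ fmor (wf H N) u = u • (wf H (reg Z) (one Z) : hm Z Z) ∙ collapse H n.
  rewrite /collapse -cmpA -fmor_cmp puN fmor_cmp !cmpA; congr (_ ∙ _).
  apply: (cancel_l (wkP H m (one Z))); rewrite !cmpA (inv21 (wkP H m _)) cmp1m wkNl.
  by rewrite -cmpA (inv21 (wkP H n _)) cmpm1.
have iso := collapse_iso; have act := collapse_act; move: extE cN iso act.
generalize collapse (@ext) => c e extE cN iso act.
split=> [N n m u|N B n m].
  apply: (cancel_l (iso G N m)); rewrite !cmpA extE cN -!cmpA extE cN.
  by rewrite !cmpA pa2N.
apply: (cancel_l (iso G N (n · m))); apply: (cancel_l (pwP m _ n)).
rq (extE _ _); rewrite (pre3 _ (act G _ _ _ _)).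
have E := extE (reg B) m.
have -> : n ◂ (c G (reg B) m : @mor (hm Z B) _ _) ∙ (n ◂ (e (reg B) m : @mor (hm Z B) _ _))
  = n ◂ (idm m ⋆ a) ∙ (n ◂ (c F (reg B) m : @mor (hm Z B) _ _)).
  by rewrite -!(pa2_cmp _ _ n); apply: (congr1 (fun a => n ◂ a)).
by rewrite -act -!cmpA; rq (pwNr _ _ _).
Qed.

End Ext.

Lemma ext_uniq F G (phi : forall (N : psh D) (n : N Z), mor (wf F N n) (wf G N n)) :
  isd phi -> forall N n, ext (phi (reg Z) (one Z)) n = phi N n.
Proof. by move=> phid; apply: isd_uniq => //; [apply: isd_ext | apply: ext_at1]. Qed.

Lemma isd_lin F G c (phi psi : forall (N : psh D) (n : N Z), mor (wf F N n) (wf G N n)) :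
  isd phi -> isd psi ->
  isd (F := F) (G := G) (fun N n => c *: (phi N n : lmor _ _) + (psi N n : lmor _ _)).
Proof.
move=> [f1 f2] [p1 p2]; split=> [N n m u|N B n m].
  by rewrite mDl mDr mZl mZr f1 p1.
rewrite mDl mZl f2 p2.
have := pa2_lin n c (phi (reg B) m : @lmor k (lhm Z B) _ _) (psi (reg B) m).
by move=> ->; rewrite mDr mZr.
Qed.

Lemma isd0 F G : isd (F := F) (G := G) (fun N n => 0 : lmor _ _).
Proof.
split=> [N n m u|N B n m]; first by rewrite m0l m0r.
by rewrite m0l [n ◂ _](lin0 (pa2_lin n)) m0r.
Qed.

Lemma isd_scale F G c (phi : forall (N : psh D) (n : N Z), mor (wf F N n) (wf G N n)) :
  isd phi -> isd (F := F) (G := G) (fun N n => c *: (phi N n : lmor _ _)).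
Proof.
move=> phid; have [h1 h2] := isd_lin c phid (isd0 F G).
by split=> [N n m u|N B n m]; [have := h1 N n m u | have := h2 N B n m]; rewrite !addr0.
Qed.

Lemma isd_sum F G (I : finType) (phi : I -> forall (N : psh D) (n : N Z), mor (wf F N n) (wf G N n)) :
  (forall i, isd (phi i)) ->
  isd (F := F) (G := G) (fun N n => \sum_i (phi i N n : lmor _ _)).
Proof.
move=> phid.
suff : forall r : seq I, isd (F := F) (G := G) (fun N n => \sum_(i <- r) (phi i N n : lmor _ _)).
  by apply.
elim=> [|i r IH].
  have [h1 h2] := isd0 F G.
  by split=> [N n m u|N B n m]; [have := h1 N n m u | have := h2 N B n m]; rewrite !big_nil.
have [h1 h2] := isd_lin 1 (phid i) IH.
by split=> [N n m u|N B n m]; [have := h1 N n m u | have := h2 N B n m]; rewrite !scale1r !big_cons.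
Qed.

End Words.

Arguments isd {k D Z} F G phi.
Arguments ext {k D Z} F G a {N} n.

(** * Dual objects *)

(* Changes the bracketing of the words between which a family goes. *)
Ltac isd_cast H :=
  let h1 := fresh in let h2 := fresh in
  have [h1 h2] := H;
  split; [exact: h1 | let N := fresh in let B := fresh in let n := fresh in let m := fresh in
    intros N B n m; have := h2 N B n m;
    rewrite /= ?fmor_cmp ?fmor_id ?cmp1m ?cmpm1 -?cmpA;
    let E := fresh in intro E; exact: E ].

Section Biduals.
Variables (k : closedFieldType) (D : linbicat k) (Z : D).

Definition fam (F G : wfun Z) := forall (N : psh D) (n : N Z), mor (wf F N n) (wf G N n).

(* [X'] is left adjoint to [X]; words are read from left to right. *)
Record adjf (X X' : hm Z Z) : Type := Adjf {
  cu : forall (N : psh D) (n : N Z), mor n (n · X · X');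
  ce : forall (N : psh D) (n : N Z), mor (n · X' · X) n;
  cu_d : isd (idw Z) (compw (at_ X') (at_ X)) cu;
  ce_d : isd (compw (at_ X) (at_ X')) (idw Z) ce;
  zz1 : forall (N : psh D) (n : N Z), ce (n · X) ∙ (cu n • X) = idm (n · X);
  zz2 : forall (N : psh D) (n : N Z), (ce n • X') ∙ cu (n · X') = idm (n · X') }.

Arguments cu {X X'} a {N} n.
Arguments ce {X X'} a {N} n.

Lemma cuN X X' (a : adjf X X') (N : psh D) (n m : N Z) (u : mor n m) :
  cu a m ∙ u = u • X • X' ∙ cu a n.
Proof. exact: (proj1 (cu_d a)). Qed.
Lemma ceN X X' (a : adjf X X') (N : psh D) (n m : N Z) (u : mor n m) :
  ce a m ∙ (u • X' • X) = u ∙ ce a n.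
Proof. exact: (proj1 (ce_d a)). Qed.

Lemma adjf_of_adjunction (l r : hm Z Z) eta eps : @adjunction k D Z Z l r eta eps ->
  inhabited (adjf r l).
Proof.
move=> adj; constructor.
refine (@Adjf r l (fun N n => cupf eta n) (fun N n => capf eps n) _ _ _ _).
- exact: (isd_cmp (isd_cmp (isd_pwi r l) (isd_2mor eta)) (isd_pu Z)).
- exact: (isd_cmp (isd_cmp (isd_pui Z) (isd_2mor eps)) (isd_pw l r)).
- by move=> N n; apply: zigzag_r adj n.
- by move=> N n; apply: zigzag_l adj n.
Qed.

Hypothesis ss : semisimple1 (lhm Z Z).

Lemma fam_scalar (F : wfun Z) phi : is_simple (wf F (reg Z) (one Z) : lhm Z Z) -> isd F F phi ->
  exists c, forall (N : psh D) (n : N Z), phi N n = c *: (idm _ : lmor _ _) :> lmor _ _.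
Proof.
move=> Fs phid.
exists (scal (phi (reg Z) (one Z) : @lmor k (lhm Z Z) _ _)) => N n.
apply: (isd_uniq (psi := fun N n => _ *: (idm (wf F N n) : lmor _ _)) phid).
  by apply: isd_scale; apply: isd_id.
exact: (schur_end ss).
Qed.

Lemma fam_eq0 (F G : wfun Z) phi : isd F G phi -> phi (reg Z) (one Z) = 0 :> @lmor k (lhm Z Z) _ _ ->
  forall (N : psh D) (n : N Z), phi N n = 0 :> lmor _ _.
Proof. by move=> phid E N n; apply: (isd_uniq phid (isd0 F G)). Qed.

(** The mate of [alpha] is an endomorphism of the simple [X], hence a scalar; taking mates again
    gives [alpha] back by the snake equations. *)
Lemma end_right X X' (a : adjf X X') alpha :
  is_simple (wf (at_ X) (reg Z) (one Z) : lhm Z Z) -> isd (at_ X') (at_ X') alpha ->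
  exists c, forall (N : psh D) (n : N Z), alpha N n = c *: (idm _ : lmor _ _) :> lmor _ _.
Proof.
move=> Xs ad.
have aN : forall (N : psh D) (n m : N Z) (u : mor n m), alpha N m ∙ (u • X') = u • X' ∙ alpha N n.
  exact: (proj1 ad).
have [|c cP] := @fam_scalar (at_ X)
    (fun N n => ce a (n · X) ∙ (alpha N (n · X) • X) ∙ (cu a n • X)) Xs.
  apply: (isd_cmp (G := compw (compw (at_ X) (at_ X')) (at_ X))).
    apply: (isd_cmp (G := compw (compw (at_ X) (at_ X')) (at_ X))).
      by isd_cast (isd_l (at_ X) (ce_d a)).
    by isd_cast (isd_l (at_ X) (isd_r (at_ X) ad)).
  by isd_cast (isd_r (at_ X) (cu_d a)).
exists c => N n; have := cP N (n · X').
move/(congr1 (fun u => (ce a n • X') ∙ (u • X') ∙ cu a (n · X'))).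
rewrite paZ fmor_id mZr mZl cmpm1 zz2 => <-.
rewrite !fmor_cmp -!cmpA -cuN; rq (esym (cuN _ _)).
by rq (zz2 _ _); rewrite cmp1m; rq (esym (aN _ _ _ _)); rewrite zz2 cmpm1.
Qed.

Lemma end_left X X' (a : adjf X X') alpha :
  is_simple (wf (at_ X') (reg Z) (one Z) : lhm Z Z) -> isd (at_ X) (at_ X) alpha ->
  exists c, forall (N : psh D) (n : N Z), alpha N n = c *: (idm _ : lmor _ _) :> lmor _ _.
Proof.
move=> Xs ad.
have aN : forall (N : psh D) (n m : N Z) (u : mor n m), alpha N m ∙ (u • X) = u • X ∙ alpha N n.
  exact: (proj1 ad).
have [|c cP] := @fam_scalar (at_ X')
    (fun N n => (ce a n • X') ∙ (alpha N (n · X') • X') ∙ cu a (n · X')) Xs.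
  apply: (isd_cmp (G := compw (compw (at_ X') (at_ X)) (at_ X'))).
    apply: (isd_cmp (G := compw (compw (at_ X') (at_ X)) (at_ X'))).
      by isd_cast (isd_r (at_ X') (ce_d a)).
    by isd_cast (isd_l (at_ X') (isd_r (at_ X') ad)).
  by isd_cast (isd_l (at_ X') (cu_d a)).
exists c => N n; have := cP N (n · X).
move/(congr1 (fun u => ce a (n · X) ∙ (u • X) ∙ (cu a n • X))).
rewrite paZ fmor_id mZr mZl cmpm1 zz1 => <-.
rewrite !fmor_cmp -!cmpA; rq (ceN _ _); rq (ceN _ _); rq (zz1 _ _); rewrite cmp1m.
by rewrite aN; rq (zz1 _ _); rewrite cmp1m.
Qed.

(** [X'] is dual to [X] on both sides, normalized so that both loops have the same value. Rescaling
    either duality changes the two loops inversely, so their product [bd ^ 2], known as the squared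
    norm, needs no pivotal structure. *)
Record bidual (X X' : hm Z Z) : Type := Bidual {
  bl : adjf X X';
  br : adjf X' X;
  bd : k;
  bd_neq0 : bd != 0;
  loopl : forall (N : psh D) (n : N Z), ce br n ∙ cu bl n = bd *: (idm n : lmor _ _) :> lmor _ _;
  loopr : forall (N : psh D) (n : N Z), ce bl n ∙ cu br n = bd *: (idm n : lmor _ _) :> lmor _ _ }.

Hypothesis adj : has_adjoints D.
Hypothesis Z1 : is_simple (one Z : lhm Z Z).

Lemma one_act_iso (X : hm Z Z) : isomorphic (X : lhm Z Z) (one Z ∘ X).
Proof. by exists (lui X), (lu X); apply/inverse_sym/luP. Qed.

Lemma fam_section (F G : wfun Z) phi : isd F G phi ->
  is_simple (wf G (reg Z) (one Z) : lhm Z Z) ->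
  (phi (reg Z) (one Z) : @lmor k (lhm Z Z) _ _) != 0 ->
  exists psi, isd G F psi /\ forall (N : psh D) (n : N Z), phi N n ∙ psi N n = idm _.
Proof.
move=> phid Gs phinz; have [s sP] := simple_section ss Gs phinz.
exists (fun N n => ext G F s n); split=> [|N n]; first exact: isd_ext.
apply: (isd_uniq (psi := fun N n => idm (wf G N n)) (isd_cmp phid (isd_ext s))).
  exact: isd_id.
by rewrite ext_at1.
Qed.

Lemma fam_retract (F G : wfun Z) phi : isd F G phi ->
  is_simple (wf F (reg Z) (one Z) : lhm Z Z) ->
  (phi (reg Z) (one Z) : @lmor k (lhm Z Z) _ _) != 0 ->
  exists psi, isd G F psi /\ forall (N : psh D) (n : N Z), psi N n ∙ phi N n = idm _.
Proof.
move=> phid Gs phinz; have [s sP] := simple_retract ss Gs phinz.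
exists (fun N n => ext G F s n); split=> [|N n]; first exact: isd_ext.
apply: (isd_uniq (psi := fun N n => idm (wf F N n)) (isd_cmp (isd_ext s) phid)).
  exact: isd_id.
by rewrite ext_at1.
Qed.

Lemma fam_iso (F G : wfun Z) phi : isd F G phi ->
  is_simple (wf F (reg Z) (one Z) : lhm Z Z) -> is_simple (wf G (reg Z) (one Z) : lhm Z Z) ->
  (phi (reg Z) (one Z) : @lmor k (lhm Z Z) _ _) != 0 ->
  exists psi, isd G F psi /\ forall (N : psh D) (n : N Z), inverse (phi N n) (psi N n).
Proof.
move=> phid Fs Gs phinz; have [s [sphi phis]] := schur_iso ss Fs Gs phinz.
exists (fun N n => ext G F s n); split=> [|N n]; first exact: isd_ext.
split.
  apply: (isd_uniq (psi := fun N n => idm (wf F N n)) (isd_cmp (isd_ext s) phid)).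
    exact: isd_id.
  by rewrite ext_at1.
apply: (isd_uniq (psi := fun N n => idm (wf G N n)) (isd_cmp phid (isd_ext s))).
  exact: isd_id.
by rewrite ext_at1.
Qed.

Lemma simple_at_of_scalar (X : hm Z Z) : ~ is_zero (one Z ∘ X : lhm Z Z) ->
  (forall alpha, isd (at_ X) (at_ X) alpha ->
    exists c, forall (N : psh D) (n : N Z), alpha N n = c *: (idm _ : lmor _ _) :> lmor _ _) ->
  is_simple (one Z ∘ X : lhm Z Z).
Proof.
move=> Xnz H; apply: (simple_of_end ss) => // f.
have [c cP] := H _ (isd_ext (F := at_ X) (G := at_ X) f).
exists c; have := cP (reg Z) (one Z).
by rewrite (ext_at1 (F := at_ X) (G := at_ X)).
Qed.

(** The counit for [X] and its right adjoint is a nonzero map to the simple [one Z] and has a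
    section [s]. Through the adjunction with the left adjoint, [s] corresponds to a nonzero map
    [phi] from the left to the right adjoint; both are simple, so one object serves on both
    sides. *)
Lemma bidual_exists (X : hm Z Z) : is_simple (X : lhm Z Z) ->
  exists X' : hm Z Z, inhabited (bidual X X').
Proof.
move=> Xs0; have Xs : is_simple (one Z ∘ X : lhm Z Z) := simple_iso (one_act_iso X) Xs0.
have [[l [eta1 [eps1 /adjf_of_adjunction [A1]]]] [r [eta2 [eps2 /adjf_of_adjunction [A2]]]]] := adj X.
have onz := idm_neq0 (proj1 Z1); have Xnz := idm_neq0 (proj1 Xs).
have ce2nz : (ce A2 (one Z : reg Z Z) : @lmor k (lhm Z Z) _ _) != 0.
  apply: contraNneq Xnz => /(fam_eq0 (ce_d A2)) E.
  have := zz2 A2 (one Z : reg Z Z); rewrite E pa0 m0l.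
  by move=> <-.
have [s [sd ces]] := fam_section (ce_d A2) Z1 ce2nz.
have sN : forall (N : psh D) (n m : N Z) (u : mor n m), s N m ∙ u = u • X • r ∙ s N n.
  exact: (proj1 sd).
pose phi (N : psh D) (n : N Z) : mor (n · l) (n · r) := (ce A1 n • r) ∙ s N (n · l).
have phid : isd (at_ l) (at_ r) phi.
  apply: (isd_cmp (G := compw (at_ r) (compw (at_ X) (at_ l)))).
    by isd_cast (isd_r (at_ r) (ce_d A1)).
  by isd_cast (isd_l (at_ l) sd).
have phiN : forall (N : psh D) (n m : N Z) (u : mor n m), phi N m ∙ (u • l) = u • r ∙ phi N n.
  exact: (proj1 phid).
have sE (N : psh D) (n : N Z) : s N n = phi N (n · X) ∙ cu A1 n.
  rewrite /phi -cmpA sN cmpA -fmor_cmp zz1 fmor_id cmp1m.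
  by [].
have phinz : (phi (reg Z) (one Z) : @lmor k (lhm Z Z) _ _) != 0.
  apply: contraNneq onz => /(fam_eq0 phid) E.
  by rewrite -(ces (reg Z) (one Z)) sE E m0l m0r.
have nzl (Y : hm Z Z) (psi : @lmor k (lhm Z Z) (one Z ∘ l) Y) : psi != 0 -> ~ is_zero (one Z ∘ l : lhm Z Z).
  move=> psinz lz; have [/(_ psi) E _] := lz Y.
  by rewrite E eqxx in psinz.
have nzr (Y : hm Z Z) (psi : @lmor k (lhm Z Z) Y (one Z ∘ r)) : psi != 0 -> ~ is_zero (one Z ∘ r : lhm Z Z).
  move=> psinz lz; have [_ /(_ psi) E] := lz Y.
  by rewrite E eqxx in psinz.
have ls : is_simple (one Z ∘ l : lhm Z Z).
  by apply: simple_at_of_scalar (nzl _ _ phinz) _ => alpha; apply: end_right A1 _ Xs.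
have rs : is_simple (one Z ∘ r : lhm Z Z).
  by apply: simple_at_of_scalar (nzr _ _ phinz) _ => alpha; apply: end_left A2 _ Xs.
have [psi [psid psiP]] := fam_iso phid ls rs phinz.
(* [s] and [cea] are the unit and the counit of [A1], carried over from [l] to [r] along [phi]. *)
pose cea (N : psh D) (n : N Z) : mor (n · r · X) n := ce A1 n ∙ (psi N n • X).
have cead : isd (compw (at_ X) (at_ r)) (idw Z) cea.
  exact: (isd_cmp (ce_d A1) (isd_r (at_ X) psid)).
have psiN : forall (N : psh D) (n m : N Z) (u : mor n m), psi N m ∙ (u • r) = u • l ∙ psi N n.
  exact: (proj1 psid).
have z1 (N : psh D) (n : N Z) : cea N (n · X) ∙ (s N n • X) = idm (n · X).
  by rewrite sE /cea -cmpA -fmor_cmp (cancelK _ (psiP _ _)) zz1.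
have z2 (N : psh D) (n : N Z) : (cea N n • r) ∙ s N (n · r) = idm (n · r).
  by rewrite /cea fmor_cmp -cmpA -sN cmpA -[X in X ∙ _]/(phi N n) (inv21 (psiP _ _)).
(* The second loop [c] is nonzero: [cu A2] has a retraction [rho], and [rho] is a multiple of [cea]
   because its mate is an endomorphism of the simple [X]. *)
have [rho [rhod rhoP]] : exists rho, isd (compw (at_ X) (at_ r)) (idw Z) rho /\
    forall (N : psh D) (n : N Z), rho N n ∙ cu A2 n = idm _.
  apply: (fam_retract (cu_d A2) Z1).
  apply: contraNneq Xnz => /(fam_eq0 (cu_d A2)) E.
  have := zz2 A2 (one Z : reg Z Z); rewrite E m0r.
  by move=> <-.
have rhoN : forall (N : psh D) (n m : N Z) (u : mor n m), rho N m ∙ (u • r • X) = u ∙ rho N n.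
  exact: (proj1 rhod).
have [|c0 c0P] := @fam_scalar (at_ X) (fun N n => rho N (n · X) ∙ (s N n • X)) Xs.
  apply: (isd_cmp (G := compw (compw (at_ X) (at_ r)) (at_ X))).
    by isd_cast (isd_l (at_ X) rhod).
  by isd_cast (isd_r (at_ X) sd).
have [c cP] := @fam_scalar (idw Z) (fun N n => cea N n ∙ cu A2 n) Z1 (isd_cmp cead (cu_d A2)).
have c0c : c0 * c = 1.
  have rhoE (N : psh D) (n : N Z) : rho N n = c0 *: (cea N n : lmor _ _).
    have E : (cea N n • r • X) ∙ (s N (n · r) • X) = idm _ by rewrite -fmor_cmp z2 fmor_id.
    by rewrite -[LHS]cmpm1 -E cmpA rhoN -cmpA c0P mZr cmpm1.
  have := rhoP (reg Z) (one Z); rewrite rhoE mZl cP scalerA => E.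
  have : (c0 * c - 1) *: (idm (one Z) : @lmor k (lhm Z Z) _ _) = 0.
    by rewrite scalerBl scale1r [X in X - _]E subrr.
  by move/eqP; rewrite scaler_eq0 (negbTE onz) orbF subr_eq0 => /eqP.
have cnz : c != 0 by apply: contra_eq_neq c0c => ->; rewrite mulr0 eq_sym oner_eq0.
(* The loops are now 1 and [c]. Scaling [s] by a square root of [c], and [cea] by its inverse, makes
   both equal to that root. *)
have [lam lamP] : exists lam : k, lam * lam = c.
  have [|lam] := @closed_rootP k ('X^2 - c%:P) _; first by rewrite size_XnsubC.
  by rewrite rootE !hornerE subr_eq0 expr2 => /eqP; exists lam.
have lamnz : lam != 0 by apply: contraNneq cnz => l0; rewrite -lamP l0 mul0r.
exists r; constructor.
unshelve refine (@Bidual X r (@Adjf X r (fun N n => lam *: (s N n : lmor _ _)) (fun N n => lam^-1 *: (cea N n : lmor _ _))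
  _ _ _ _) A2 lam lamnz _ _) => /=.
- exact: isd_scale.
- exact: isd_scale.
- by move=> N n; rewrite paZ mZl mZr z1 scalerA mulVf // scale1r.
- by move=> N n; rewrite paZ mZl mZr z2 scalerA mulVf // scale1r.
- by move=> N n; rewrite mZr ces.
- by move=> N n; rewrite mZl cP scalerA -lamP mulKf.
Qed.

End Biduals.

Arguments cu {k D Z X X'} a {N} n.
Arguments ce {k D Z X X'} a {N} n.
Arguments bd {k D Z X X'} b.
Arguments fam {k D Z} F G.

(** * Global dimension *)

Section Traces.
Variables (k : closedFieldType) (D : linbicat k) (Z : D).

Section Closing.
Variables (a b a' b' : hm Z Z) (ba : bidual a a') (bb : bidual b b').

(* Closing the last letter of an endomorphism of [a b]. *)
Definition ptr (h : fam (compw (at_ b) (at_ a)) (compw (at_ b) (at_ a))) : fam (at_ a) (at_ a) :=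
  fun N n => ce (br bb) (n · a) ∙ (h N n • b') ∙ cu (bl bb) (n · a).

Lemma ptr_isd h : isd _ _ h -> isd _ _ (ptr h).
Proof.
move=> hd; apply: (isd_cmp (G := compw (compw (at_ b') (at_ b)) (at_ a))).
  apply: (isd_cmp (G := compw (compw (at_ b') (at_ b)) (at_ a))).
    by isd_cast (isd_l (at_ a) (ce_d (br bb))).
  by isd_cast (isd_r (at_ b') hd).
by isd_cast (isd_l (at_ a) (cu_d (bl bb))).
Qed.

(* Closing the first letter. *)
Definition lptr (h : fam (compw (at_ b) (at_ a)) (compw (at_ b) (at_ a))) : fam (at_ b) (at_ b) :=
  fun N n => (ce (bl ba) n • b) ∙ h N (n · a') ∙ (cu (br ba) n • b).

Lemma lptr_isd h : isd _ _ h -> isd _ _ (lptr h).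
Proof.
move=> hd; apply: (isd_cmp (G := compw (at_ b) (compw (at_ a) (at_ a')))).
  apply: (isd_cmp (G := compw (at_ b) (compw (at_ a) (at_ a')))).
    by isd_cast (isd_r (at_ b) (ce_d (bl ba))).
  by isd_cast (isd_l (at_ a') hd).
by isd_cast (isd_r (at_ b) (cu_d (br ba))).
Qed.

(** The two closings happen at opposite ends of the word and interchange, so closing both strands
    gives the same endomorphism of [n] in either order. This ties the scalar of a right closing to
    that of a left closing. *)
Lemma closing_order h s s' :
  (forall (N : psh D) (n : N Z), ptr h n = s *: (idm _ : lmor _ _) :> lmor _ _) ->
  (forall (N : psh D) (n : N Z), lptr h n = s' *: (idm _ : lmor _ _) :> lmor _ _) ->
  forall (N : psh D) (n : N Z),
  (bd ba * s) *: (idm n : lmor _ _) = (bd bb * s') *: (idm n : lmor _ _).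
Proof.
move=> hs hs' N n.
transitivity (ce (bl ba) n ∙ ptr h (n · a') ∙ cu (br ba) n : lmor n n).
  by rewrite hs mZr mZl cmpm1 loopr scalerA mulrC.
transitivity (ce (br bb) n ∙ (lptr h n • b') ∙ cu (bl bb) n : lmor n n); last first.
  by rewrite hs' paZ fmor_id mZr mZl cmpm1 loopl scalerA mulrC.
rewrite /ptr /lptr !fmor_cmp -!cmpA cuN; rq (esym (ceN _ _)).
by [].
Qed.

End Closing.

Section Rotation.
Variables (a b c a' b' c' : hm Z Z) (ba : bidual a a') (bb : bidual b b') (bc : bidual c c').
Variable p : fam (compw (at_ b) (at_ a)) (at_ c).
Hypothesis pd : isd _ _ p.

Let pN (N : psh D) (n m : N Z) (u : mor n m) : p m ∙ (u • a • b) = u • c ∙ p n.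
Proof. exact: (proj1 pd). Qed.

(** [q] is the mate of [p] for the dualities [bl]; the two equations slide [p] across cups and caps,
    where it turns into [q]. *)
Lemma half_rotation : exists q : fam (at_ c') (compw (at_ a') (at_ b')),
  [/\ isd _ _ q,
      forall (N : psh D) (n : N Z), (p n • b' • a') ∙ ((cu (bl bb) (n · a) • a') ∙ cu (bl ba) n)
        = q N (n · c) ∙ cu (bl bc) n &
      forall (N : psh D) (n : N Z), ce (bl bb) n ∙ ((ce (bl ba) (n · b') • b) ∙ (q N n • a • b))
        = ce (bl bc) n ∙ p (n · c')].
Proof.
exists (fun N n => (ce (bl bc) n • b' • a') ∙ (p (n · c') • b' • a')
  ∙ (cu (bl bb) (n · c' · a) • a') ∙ cu (bl ba) (n · c')); split=> [|N n|N n].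
- apply: (isd_cmp (G := compw (compw (at_ a') (at_ a)) (at_ c'))).
    apply: (isd_cmp (G := compw (compw (at_ a') (compw (at_ b') (compw (at_ b) (at_ a)))) (at_ c'))).
      apply: (isd_cmp (G := compw (at_ a') (compw (at_ b') (compw (at_ c) (at_ c'))))).
        by isd_cast (isd_r (at_ a') (isd_r (at_ b') (ce_d (bl bc)))).
      by isd_cast (isd_l (at_ c') (isd_r (at_ a') (isd_r (at_ b') pd))).
    by isd_cast (isd_l (at_ c') (isd_l (at_ a) (isd_r (at_ a') (cu_d (bl bb))))).
  by isd_cast (isd_l (at_ c') (cu_d (bl ba))).
- rewrite -!cmpA cuN; rq (whf _ (cuN _ _)); rq (whf _ (whf _ (pN _))).
  by rq (whf1 _ (whf1 _ (zz1 (bl bc) _))); rewrite cmp1m.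
- rewrite !fmor_cmp -!cmpA.
  pose x := (ce (bl bc) n • b') ∙ ((p (n · c') • b') ∙ cu (bl bb) (n · c' · a)).
  transitivity (ce (bl bb) n ∙ (x • b)); last first.
    by rewrite /x !fmor_cmp; rq (ceN _ _); rq (ceN _ _); rewrite zz1 cmpm1.
  rewrite /x !fmor_cmp; congr (_ ∙ _).
  rq (whf _ (ceN _ _)); rq (whf _ (ceN _ _)); rq (whf _ (ceN _ _)).
  by rewrite (whf1 _ (zz1 (bl ba) _)) cmpm1.
Qed.

(** [pt] is the double dual of [p]: its mate for [bl], brought back with [br]. Without a pivotal
    structure the trace is not cyclic: moving [p] around the right loop turns it into [pt], and
    moving [pt] around the left loop turns it back into [p]. *)
Lemma rotation_exists : exists pt : fam (compw (at_ b) (at_ a)) (at_ c), isd _ _ pt /\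
  forall i : fam (at_ c) (compw (at_ b) (at_ a)), isd _ _ i ->
  forall (N : psh D) (n : N Z),
  ce (br ba) n ∙ (ptr bb (fun N n => i N n ∙ p n) n • a') ∙ cu (bl ba) n
    = ce (br bc) n ∙ ((pt N n ∙ i N n) • c') ∙ cu (bl bc) n /\
  ce (bl bb) n ∙ lptr ba (fun N n => i N n ∙ pt N n) (n · b') ∙ cu (br bb) n
    = ce (bl bc) n ∙ ((p (n · c') ∙ i N (n · c')) : mor (n · c' · c) (n · c' · c)) ∙ cu (br bc) n.
Proof.
have [q [qd q1 q2]] := half_rotation.
have qN (N : psh D) (n m : N Z) (u : mor n m) : q N m ∙ (u • c') = u • b' • a' ∙ q N n.
  exact: (proj1 qd).
exists (fun N n => (ce (br ba) n • c) ∙ (ce (br bb) (n · a) • a' • c) ∙ (q N (n · a · b) • c)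
  ∙ cu (br bc) (n · a · b)); split=> [|i idd N n].
  apply: (isd_cmp (G := compw (compw (at_ c) (at_ c')) (compw (at_ b) (at_ a)))).
    apply: (isd_cmp (G := compw (at_ c) (compw (compw (at_ a') (at_ b')) (compw (at_ b) (at_ a))))).
      apply: (isd_cmp (G := compw (at_ c) (compw (at_ a') (at_ a)))).
        by isd_cast (isd_r (at_ c) (ce_d (br ba))).
      by isd_cast (isd_l (at_ a) (isd_r (at_ c) (isd_r (at_ a') (ce_d (br bb))))).
    by isd_cast (isd_l (at_ a) (isd_l (at_ b) (isd_r (at_ c) qd))).
  by isd_cast (isd_l (at_ a) (isd_l (at_ b) (cu_d (br bc)))).
have iN (m m' : N Z) (u : mor m m') : i N m' ∙ (u • c) = u • a • b ∙ i N m.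
  exact: (proj1 idd).
split.
  rewrite /ptr !fmor_cmp -!cmpA q1; rq (esym (qN _ _ _ _)).
  rq (ceN _ _); rq (ceN _ _); rq (ceN _ _); rq (zz1 _ _); rewrite cmp1m.
  by [].
rewrite /lptr -!cmpA.
rq (cuN _ _); rewrite cuN; rq (whf _ (qN _ _ _ _)); rq (whf _ (qN _ _ _ _)).
rq (whf _ (whf _ (ceN _ _))); rq (whf1 _ (zz1 (br ba) _)); rewrite cmp1m.
rq (whf1 _ (whf1 _ (zz1 (br bb) _))); rewrite cmp1m; rq (iN _ _ _).
have q2' : ce (bl bb) n ∙ (ce (bl ba) (n · b') • b) ∙ (q N n • a • b) = ce (bl bc) n ∙ p (n · c').
  by rewrite -cmpA.
by rq q2'.
Qed.

End Rotation.

End Traces.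

(** * Nonvanishing of the global dimension *)

Section GlobalDimension.
Variables (k : closedFieldType) (char0 : [pchar k] =i pred0) (D : linbicat k) (Z : D).
Hypothesis fss : finite_semisimple1 (lhm Z Z).
Hypothesis adj : has_adjoints D.
Hypothesis Z1 : is_simple (one Z : lhm Z Z).
Let ss := proj1 fss.

Local Notation R := (reg Z).
Local Notation "'1o'" := (one Z : R Z).

Lemma scale_idm_inj (C : lincat k) (x : C) c d : ~ is_zero x ->
  c *: (idm x : lmor x x) = d *: (idm x : lmor x x) -> c = d.
Proof. by move=> xnz E; rewrite -(scalE xnz (erefl (c *: (idm x : lmor x x)))); apply: scalE. Qed.

Lemma fam_scalE (F : wfun Z) (phi : fam F F) : is_simple (wf F R 1o) -> isd F F phi ->
  forall (N : psh D) (n : N Z), phi N n = scal (phi R 1o : lmor _ _) *: (idm _ : lmor _ _) :> lmor _ _.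
Proof.
move=> Fs phid; have [c cP] := fam_scalar ss Fs phid.
by move=> N n; rewrite cP (scalE (proj1 Fs) (cP R 1o)).
Qed.

Definition tau (a b b' : hm Z Z) (bb : bidual b b') (f : lmor (1o · a · b) (1o · a · b)) : k :=
  scal (ce (br bb) (1o · a) ∙ (f • b') ∙ cu (bl bb) (1o · a) : lmor (1o · a) (1o · a)).

Lemma tau_lin (a b b' : hm Z Z) (bb : bidual b b') : is_simple (1o · a) -> scalar (@tau a b b' bb).
Proof.
move=> as_ c f g; rewrite /tau.
have -> : (c *: f + g) • b' = c *: (f • b' : lmor _ _) + (g • b' : lmor _ _).
  exact: (@lf_lin _ _ _ (pa R b') (1o · a · b) (1o · a · b)).
by rewrite mDr mZr mDl mZl (scal_lin ss).
Qed.

Section Rotation.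
Variables (a b c a' b' c' : hm Z Z) (ba : bidual a a') (bb : bidual b b') (bc : bidual c c').
Hypotheses (as_ : is_simple (1o · a)) (bs : is_simple (1o · b)) (cs : is_simple (1o · c)).
Variable p : lmor (1o · a · b) (1o · c).

(** Double rotation is an involution: the first identity describes [pt] by its pairing with every
    [i], and the second says that the same recipe applied to [pt] returns [p]. The left closing in
    the second identity of [rotation_exists] is turned into a right one by [closing_order]. *)
Lemma rotation_scalars : exists pt : lmor (1o · a · b) (1o · c),
  forall i : lmor (1o · c) (1o · a · b),
  bd ba * tau bb (i ∙ p) = bd bc * scal (pt ∙ i : lmor _ _) /\
  bd ba * tau bb (i ∙ pt) = bd bc * scal (p ∙ i : lmor _ _).
Proof.
pose P : fam (compw (at_ b) (at_ a)) (at_ c) := fun N n => ext (compw (at_ b) (at_ a)) (at_ c) p n.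
have Pd : isd _ _ P by apply: isd_ext.
have P1 : P R 1o = p by apply: ext_at1.
have [Q [Qd QP]] := rotation_exists ba bb bc Pd.
exists (Q R 1o) => i.
pose I : fam (at_ c) (compw (at_ b) (at_ a)) := fun N n => ext (at_ c) (compw (at_ b) (at_ a)) i n.
have Id : isd _ _ I by apply: isd_ext.
have I1 : I R 1o = i by apply: ext_at1.
have [q1 q2] := QP I Id R 1o.
have IPd := isd_cmp Id Pd; have IQd := isd_cmp Id Qd.
have PId := isd_cmp Pd Id; have QId := isd_cmp Qd Id.
split.
  apply: (scale_idm_inj (proj1 Z1)).
  move: q1; rewrite (fam_scalE (F := at_ a) as_ (ptr_isd bb IPd)) (fam_scalE (F := at_ c) cs QId).
  rewrite !paZ !fmor_id !mZr !mZl !cmpm1 !loopl !scalerA.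
  by move=> E; rewrite mulrC (mulrC (bd bc)) -I1 -P1; exact: E.
have E := closing_order (fam_scalE (F := at_ a) as_ (ptr_isd bb IQd)) (fam_scalE (F := at_ b) bs (lptr_isd ba IQd)) 1o.
apply: (scale_idm_inj (proj1 Z1)).
move: q2; rewrite (fam_scalE (F := at_ b) bs (lptr_isd ba IQd)) (fam_scalE (F := at_ c) cs PId).
rewrite !mZr !mZl !cmpm1 !loopr !scalerA.
by move=> E'; rewrite (mulrC (bd bc)) -I1 -P1; apply: etrans E'; rewrite [in RHS]mulrC; exact: E.
Qed.

End Rotation.


Lemma simple_expand_l (C : lincat k) (ssC : semisimple1 C) r (S : 'I_r -> C) (n : 'I_r -> nat) (e : C)
  (u : forall i, 'I_(n i) -> lmor (S i) e) (p : forall i, 'I_(n i) -> lmor e (S i)) :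
  (forall i, is_simple (S i)) -> (forall i j, isomorphic (S i) (S j) -> i = j) ->
  \sum_i \sum_l (u i l ∙ p i l : lmor e e) = idm e ->
  forall i (a : lmor e (S i)), a = \sum_l scal (a ∙ u i l : lmor (S i) (S i)) *: p i l.
Proof.
move=> Ss Sinj up i a.
rewrite -[LHS](cmpm1 (a : mor _ _)) -up cmp_sumr (big_only1 i) // => [|j ji _].
  rewrite cmp_sumr; apply: eq_bigr => l _.
  by rewrite cmpA {1}[(a ∙ u i l : lmor _ _)](schur_end ssC) // mZl cmp1m.
rewrite cmp_sumr big1 // => l _.
rewrite cmpA [(a ∙ _ : lmor _ _)](schur_noniso ssC) ?m0l //.
by move=> /Sinj E; rewrite E eqxx in ji.
Qed.

Variables (r : nat) (X X' : 'I_r -> hm Z Z) (b : forall i, bidual (X i) (X' i)).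
Hypotheses (Ss : forall i, is_simple (1o · X i)).
Hypotheses (Sinj : forall i j, isomorphic (1o · X i) (1o · X j) -> i = j).
Hypotheses (Scov : forall x : R Z, is_simple x -> exists i, isomorphic x (1o · X i)).
Let S i : R Z := 1o · X i.
Let d i := bd (b i).

(** [A] is the matrix of double rotation on [Hom(S j · X i, S l)] in the basis [p]: row [t] holds
    the coordinates of the rotated [p t]. *)
Lemma involution_matrix i j l (m : nat) (u : 'I_m -> lmor (S l) (S j · X i))
  (p : 'I_m -> lmor (S j · X i) (S l)) :
  (forall t t', p t ∙ u t' = (t == t')%:R *: (idm (S l) : lmor _ _) :> lmor _ _) ->
  (forall a : lmor (S j · X i) (S l), a = \sum_t scal (a ∙ u t : lmor (S l) (S l)) *: p t) ->
  let A : 'M[k]_m := \matrix_(t, t') (d j / d l * tau (b i) (u t' ∙ p t)) in A *m A = 1%:M.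
Proof.
move=> pu pexp A.
have H t := rotation_scalars (b j) (b i) (b l) (Ss j) (Ss i) (Ss l) (p t).
have Snz := proj1 (Ss l).
apply/matrixP => t t'; rewrite !mxE.
have [q qP] := H t.
have A1 s : A t s = scal (q ∙ u s : lmor (S l) (S l)).
  rewrite mxE mulrAC (proj1 (qP (u s))) mulrAC divff ?mul1r //; exact: bd_neq0.
have := proj2 (qP (u t')); rewrite pu (scalE Snz erefl) => E.
rewrite (eq_bigr (fun s => d j / d l * (scal (q ∙ u s : lmor (S l) (S l)) * tau (b i) (u t' ∙ p s)))); last first.
  by move=> s _; rewrite A1 mxE mulrCA.
rewrite -mulr_sumr.
have <- : tau (b i) (u t' ∙ q) = \sum_s (scal (q ∙ u s : lmor (S l) (S l)) * tau (b i) (u t' ∙ p s)).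
  rewrite {1}[q]pexp cmp_sumr scalar_sum; last exact: tau_lin (Ss j).
  apply: eq_bigr => s _; rewrite mZr scalarZ //; exact: tau_lin (Ss j).
by rewrite mulrAC E mulrAC divff ?mul1r //; apply: bd_neq0.
Qed.

(** The traces of the double rotations take the place of the fusion multiplicities. They are
    integers, and they satisfy both dimension identities of [sum_sq_neq0]. *)
Lemma global_dim_neq0 : \sum_i d i * d i != 0.
Proof.
have iso i j : exists (m : 'I_r -> nat) (u : forall l, 'I_(m l) -> lmor (S l) (S j · X i))
         (p : forall l, 'I_(m l) -> lmor (S j · X i) (S l)),
  (forall l t t', p l t ∙ u l t' = (t == t')%:R *: (idm (S l) : lmor _ _) :> lmor _ _) /\
  \sum_l \sum_t (u l t ∙ p l t : lmor (S j · X i) (S j · X i)) = idm (S j · X i).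
  by apply: (isotypic_decomposition ss Ss Sinj) => x _ xs _; apply: Scov.
pose m i j := sval (cid (iso i j)).
pose u i j : forall l, 'I_(m i j l) -> lmor (S l) (S j · X i) := sval (cid (svalP (cid (iso i j)))).
pose p i j : forall l, 'I_(m i j l) -> lmor (S j · X i) (S l) :=
  sval (cid (svalP (cid (svalP (cid (iso i j)))))).
have pu i j l t t' : @p i j l t ∙ @u i j l t' = (t == t')%:R *: (idm (S l) : lmor _ _) :> lmor _ _.
  exact: (proj1 (svalP (cid (svalP (cid (svalP (cid (iso i j)))))))).
have up i j : \sum_l \sum_t (@u i j l t ∙ @p i j l t : lmor (S j · X i) (S j · X i)) = idm (S j · X i).
  exact: (proj2 (svalP (cid (svalP (cid (svalP (cid (iso i j)))))))).
clearbody u p.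
pose A i j l : 'M[k]_(m i j l) := \matrix_(t, t') (d j / d l * tau (b i) (@u i j l t' ∙ @p i j l t)).
have pexp i j l (a : lmor (S j · X i) (S l)) : a = \sum_t scal (a ∙ @u i j l t : lmor (S l) (S l)) *: @p i j l t.
  exact: (simple_expand_l ss Ss Sinj (up i j)).
have AA i j l : A i j l *m A i j l = 1%:M by apply: involution_matrix.
pose T i j l := sval (cid (involution_mxtrace_int char0 (AA i j l))).
have TE i j l : \tr (A i j l) = (T i j l)%:~R := svalP (cid (involution_mxtrace_int char0 (AA i j l))).
have dnz i : d i != 0 by apply: bd_neq0.
apply: (sum_sq_neq0 char0 (d := d) (T := T)) => // [|i j|i l].
- have [i _] := Scov (Z1 : is_simple (1o : R Z)).
  exact: leq_ltn_trans (ltn_ord i).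
(* First identity: the strand [X i] is closed in the decomposition of [S j · X i] into simple
   objects. *)
- have : tau (b i) (idm (S j · X i)) = d i.
    rewrite /tau fmor_id cmpm1 loopl; apply: scalE; last by [].
    exact: (proj1 (Ss j)).
  rewrite -up scalar_sum; last exact: tau_lin (Ss j).
  move=> <-; rewrite mulr_suml; apply: eq_bigr => l _.
  rewrite scalar_sum; last exact: tau_lin (Ss j).
  rewrite -TE /mxtrace !mulr_suml; apply: eq_bigr => t _.
  by rewrite mxE mulrAC divfK // mulrC.
(* Second identity: the same for [S l · X' i]. Reciprocity turns [p] and [u] into maps [p1] and [u1]
   whose Gram matrix is a multiple of [A]. As [A] is its own inverse, the dual basis is explicit,
   and [Th] is the resulting resolution of the identity. *)
- pose U : R Z := S l · X' i.
  pose p1 j t : lmor (S j) U := (@p i j l t • X' i) ∙ cu (bl (b i)) (S j).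
  pose u1 j t : lmor U (S j) := ce (br (b i)) (S j) ∙ (@u i j l t • X' i).
  have up1 j t t' : u1 j t' ∙ p1 j t = tau (b i) (@u i j l t' ∙ @p i j l t) *: (idm (S j) : lmor _ _) :> lmor _ _.
    have E : u1 j t' ∙ p1 j t = ce (br (b i)) (S j) ∙ ((@u i j l t' ∙ @p i j l t) • X' i) ∙ cu (bl (b i)) (S j).
      by rewrite /u1 /p1 fmor_cmp !cmpA.
    by rewrite E [LHS](schur_end ss _ (Ss j)).
  pose c j t t' := d j / d l * A i j l t' t.
  pose Th : lmor U U := \sum_j \sum_t \sum_t' c j t t' *: (p1 j t ∙ u1 j t' : lmor U U).
  have Thp1 j0 s : Th ∙ p1 j0 s = p1 j0 s.
    rewrite /Th cmp_suml (big_only1 j0) // => [|j jj0 _]; last first.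
      rewrite cmp_suml big1 // => t _; rewrite cmp_suml big1 // => t' _.
      rewrite mZl -cmpA [(_ ∙ p1 j0 s : lmor _ _)](schur_noniso ss _ (Ss _) (Ss _)) ?m0r ?scaler0 //.
      by move=> /Sinj E; rewrite E eqxx in jj0.
    transitivity (\sum_t ((A i j0 l *m A i j0 l) s t *: p1 j0 t) : lmor _ _).
      rewrite cmp_suml; apply: eq_bigr => t _.
      rewrite cmp_suml mxE scaler_suml; apply: eq_bigr => t' _.
      rewrite mZl -cmpA up1 mZr cmpm1 scalerA.
      have -> // : c j0 t t' * tau (b i) (@u i j0 l t' ∙ @p i j0 l s) = A i j0 l s t' * A i j0 l t' t.
      by rewrite /c [A i j0 l s t']mxE mulrAC.
    rewrite AA (big_only1 s) // => [|t ts _]; first by rewrite mxE eqxx scale1r.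
    by rewrite mxE eq_sym (negbTE ts) scale0r.
  have Th1 : Th = idm U.
    apply: (mor_ext ss) => x h xs; rewrite cmp1m.
    have [j [f [g [gf fg]]]] := Scov xs.
    suff E : Th ∙ (h ∙ g) = h ∙ g by rewrite -[h]cmpm1 -gf (cmpA h) cmpA E.
    set q := h ∙ g.
    have qE : q = ((ce (bl (b i)) (S l) ∙ (q • X i)) • X' i) ∙ cu (bl (b i)) (S j).
      by rewrite fmor_cmp -cmpA -cuN cmpA zz2 cmp1m.
    have [g' gE] : exists g', q = \sum_s g' s *: p1 j s.
      eexists; rewrite qE [(ce _ _ ∙ _ : lmor _ _)]pexp pa_sum cmp_suml; apply: eq_bigr => s _.
      by rewrite paZ mZl.
    rewrite gE cmp_sumr; apply: eq_bigr => s _.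
    by rewrite mZr Thp1.
  have tau' : scal (ce (bl (b i)) (S l) ∙ (Th • X i) ∙ cu (br (b i)) (S l) : lmor (S l) (S l)) = d i.
    by rewrite Th1 fmor_id cmpm1 loopr; apply: scalE => //; apply: (proj1 (Ss l)).
  have pu1 j t t' : ce (bl (b i)) (S l) ∙ ((p1 j t ∙ u1 j t') • X i) ∙ cu (br (b i)) (S l)
      = (t == t')%:R *: (idm (S l) : lmor _ _) :> lmor _ _.
    rewrite -pu /p1 /u1 !fmor_cmp -!cmpA -cuN; rq (zz2 _ _); rewrite cmp1m.
    by rq (ceN _ _); rq (zz1 _ _); rewrite cmp1m.
  have Snz := proj1 (Ss l).
  have tlin : scalar (fun f : lmor U U => scal (ce (bl (b i)) (S l) ∙ (f • X i) ∙ cu (br (b i)) (S l) : lmor (S l) (S l))).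
    move=> x f g; rewrite (@lf_lin _ _ _ (pa R (X i)) U U).
    by rewrite mDr mZr mDl mZl (scal_lin ss (Ss l)).
  rewrite mulrC -tau' /Th (scalar_sum tlin) mulr_sumr; apply: eq_bigr => j _.
  rewrite -TE /mxtrace (scalar_sum tlin) mulr_sumr mulr_suml; apply: eq_bigr => t _.
  rewrite (scalar_sum tlin) (big_only1 t) // => [|t' tt' _]; last first.
    by rewrite (scalarZ tlin) pu1 eq_sym (negbTE tt') (scalE Snz erefl) mulr0.
  rewrite (scalarZ tlin) pu1 eqxx (scalE Snz erefl) mulr1 /c.
  by field; apply: dnz.
Qed.

End GlobalDimension.

Lemma dep_choice (A : Type) (B : A -> Type) (P : forall a, B a -> Prop) :
  (forall a, exists b, P a b) -> exists f : forall a, B a, forall a, P a (f a).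
Proof. by move=> H; exists (fun a => sval (cid (H a))) => a; apply: (svalP (cid (H a))). Qed.

(** Every constituent occurs in [y] exactly once, so [tr] weighs all blocks equally, and bases dual
    for it compose to the identity of [w] with no dimension factors. Both families come from bases
    of the multiplicity spaces of the [M j] in [w]. *)
Lemma trace_dual_basis (k : closedFieldType) (C : lincat k) (ss : semisimple1 C) q (M : 'I_q -> C)
  (y w : C) (u : forall j, lmor (M j) y) (v : forall j, lmor y (M j)) :
  (forall j, is_simple (M j)) -> (forall i j, isomorphic (M i) (M j) -> i = j) ->
  (forall j, v j ∙ u j = idm (M j)) -> \sum_j (u j ∙ v j : lmor y y) = idm y ->
  (forall x (f : lmor x w), is_simple x -> f != 0 -> exists j, isomorphic x (M j)) ->
  let tr (h : lmor y y) := \sum_j scal (v j ∙ h ∙ u j : lmor (M j) (M j)) in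
  exists (I : finType) (e : I -> lmor y w) (f : I -> lmor w y),
  [/\ forall a : lmor y w, a = \sum_l tr (f l ∙ a) *: e l,
      forall g : lmor w y, g = \sum_l tr (g ∙ e l) *: f l &
      \sum_l (e l ∙ f l : lmor w w) = idm w].
Proof.
move=> Ms Minj vu uv Mcov tr.
have vu0 i j : i != j -> v i ∙ u j = 0 :> lmor _ _.
  by move=> ij; apply: (schur_noniso ss) => // /Minj E; rewrite E eqxx in ij.
have [m [b [p [pb bp]]]] := isotypic_decomposition ss Ms Minj Mcov.
pose I : finType := {j : 'I_q & 'I_(m j)}.
exists I, (fun l => b (tag l) (tagged l) ∙ v (tag l)), (fun l => u (tag l) ∙ p (tag l) (tagged l)).
have trl j (h : lmor y (M j)) : tr (u j ∙ h) = scal (h ∙ u j : lmor (M j) (M j)).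
  rewrite /tr (big_only1 j) // => [|i ij _]; first by rewrite !cmpA vu cmp1m.
  by rewrite !cmpA vu0 // !m0l -(scale0r (0 : lmor _ _)) (scalarZ (scal_lin ss (Ms i))) mul0r.
have trr j (h : lmor (M j) y) : tr (h ∙ v j) = scal (v j ∙ h : lmor (M j) (M j)).
  rewrite /tr (big_only1 j) // => [|i ij _]; first by rewrite -!cmpA vu cmpm1.
  by rewrite -!cmpA vu0 1?eq_sym // !m0r -(scale0r (0 : lmor _ _)) (scalarZ (scal_lin ss (Ms i))) mul0r.
have sumI (V : lmodType k) (G : forall j, 'I_(m j) -> V) :
    \sum_(l : I) G (tag l) (tagged l) = \sum_j \sum_l G j l by rewrite sig_big_dep.
split=> [a|g|].
- rewrite [RHS](sumI _ (fun j l => tr (u j ∙ p j l ∙ a) *: (b j l ∙ v j : lmor _ _))).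
  rewrite -{1}[a]cmpm1 -uv cmp_sumr; apply: eq_bigr => j _.
  rewrite cmpA {1}[(a ∙ u j : lmor _ _)](simple_expand ss Ms Minj bp) cmp_suml.
  by apply: eq_bigr => l _; rewrite mZl -!cmpA trl -cmpA.
- rewrite [RHS](sumI _ (fun j l => tr (g ∙ (b j l ∙ v j)) *: (u j ∙ p j l : lmor _ _))).
  rewrite -{1}[g]cmp1m -uv cmp_suml; apply: eq_bigr => j _.
  rewrite -cmpA {1}[(v j ∙ g : lmor _ _)](simple_expand_l ss Ms Minj bp) cmp_sumr.
  by apply: eq_bigr => l _; rewrite mZr !cmpA trr !cmpA.
- rewrite [LHS](sumI _ (fun j l => b j l ∙ v j ∙ (u j ∙ p j l) : lmor _ _)).
  rewrite -bp; apply: eq_bigr => j _; apply: eq_bigr => l _.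
  by rewrite !cmpA -(cmpA (b j l)) vu cmpm1.
Qed.

(** * Families, 2-morphisms and internal endomorphism objects *)

Section FamiliesAsCells.
Variables (k : closedFieldType) (D : linbicat k) (Z : D).

Lemma isd_collapse (F : wfun Z) : isd F (at_ (wf F (reg Z) (one Z) : hm Z Z)) (collapse F).
Proof.
split=> [N n m u|N B n m].
  rewrite /collapse -cmpA -fmor_cmp puN fmor_cmp !cmpA; congr (_ ∙ _).
  apply: (cancel_l (wkP F m (one Z))); rewrite !cmpA (inv21 (wkP F m _)) cmp1m wkNl.
  by rewrite -cmpA (inv21 (wkP F n _)) cmpm1.
apply: (cancel_l (pwP m (wf F (reg Z) (one Z) : hm Z Z) n)).
rewrite cmpA collapse_act [in RHS]/=.
rewrite cmpA (inv21 (pwP m (wf F (reg Z) (one Z) : hm Z Z) n)).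
by rewrite cmp1m.
Qed.

Lemma fam_cell (X Y : hm Z Z) (phi : fam (at_ X) (at_ Y)) : isd (at_ X) (at_ Y) phi ->
  exists a : mor X Y, forall (N : psh D) (n : N Z), phi N n = n ◂ a.
Proof.
move=> phid; exists (lu Y ∙ (phi (reg Z) (one Z) : @mor (hm Z Z) _ _) ∙ lui X).
apply: (isd_uniq phid (isd_2mor _)) => /=.
apply: (cancel_l (luP Y)); rewrite luN -!cmpA (inv12 (luP X)) cmpm1.
by [].
Qed.

Lemma cell_inj (X Y : hm Z Z) (a b : mor X Y) :
  (one Z : reg Z Z) ◂ a = (one Z : reg Z Z) ◂ b -> a = b.
Proof. exact: one_l_inj. Qed.

Section Universal.
Variables (Q : psh D) (y : Q Z) (E : hm Z Z) (ev : mor (y · E) y).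
Hypothesis evP : forall (X : hm Z Z) (f : mor (y · X) y), exists! a : mor X E, ev ∙ (y ◂ a) = f.

(** [E] represents [X |-> Hom(y · X, y)]; contracting a word to a letter extends the universal
    property to families out of any word. *)
Lemma fam_ev (F : wfun Z) (f : mor (wf F Q y) y) :
  exists phi : fam F (at_ E), isd F (at_ E) phi /\ ev ∙ phi Q y = f.
Proof.
have [a [aP _]] := evP (f ∙ (fmor (wf F Q) (pui y) ∙ wk F y (one Z))).
exists (fun N n => n ◂ a ∙ collapse F n); split.
  exact: (isd_cmp (isd_2mor a) (isd_collapse F)).
by rewrite cmpA aP -cmpA (inv12 (collapse_iso F y)) cmpm1.
Qed.

Lemma fam_ev_uniq (F : wfun Z) (phi psi : fam F (at_ E)) : isd F (at_ E) phi -> isd F (at_ E) psi ->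
  ev ∙ phi Q y = ev ∙ psi Q y -> forall (N : psh D) (n : N Z), phi N n = psi N n.
Proof.
move=> phid psid E0 N n.
have ci (N' : psh D) (n' : N' Z) := collapse_iso F n'.
have invd := isd_inv (isd_collapse F) (fun N n => ci N n).
have [a aP] := fam_cell (isd_cmp phid invd).
have [b bP] := fam_cell (isd_cmp psid invd).
apply: (cancel_r (inverse_sym (ci N n))); rewrite [LHS]aP [RHS]bP.
suff -> : a = b by [].
have [a' [_ U]] := evP (ev ∙ phi Q y ∙ (fmor (wf F Q) (pui y) ∙ wk F y (one Z))).
rewrite -(U a); last by rewrite -aP !cmpA.
by rewrite -(U b) // -bP E0 !cmpA.
Qed.

End Universal.

End FamiliesAsCells.

(** * The Frobenius monad of internal endomorphisms *)

Section Casimir.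
Variables (k : closedFieldType) (D : linbicat k) (Z : D).
Hypotheses (ss : semisimple1 (lhm Z Z)) (Z1 : is_simple (one Z : lhm Z Z)).
Local Notation R := (reg Z).
Local Notation "'1o'" := (one Z : R Z).
Variables (r : nat) (X X' : 'I_r -> hm Z Z) (b : forall i, bidual (X i) (X' i)).
Hypotheses (Ss : forall i, is_simple (1o · X i)).
Hypotheses (Sinj : forall i j, isomorphic (1o · X i) (1o · X j) -> i = j).
Hypotheses (Scov : forall x : R Z, is_simple x -> exists i, isomorphic x (1o · X i)).

Lemma fam_test (F G : wfun Z) (phi psi : fam F G) : isd F G phi -> isd F G psi ->
  (forall i (a : fam (at_ (X i)) F), isd _ _ a ->
    forall (N : psh D) (n : N Z), phi N n ∙ a N n = psi N n ∙ a N n) ->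
  forall (N : psh D) (n : N Z), phi N n = psi N n.
Proof.
move=> phid psid H; apply: (isd_uniq phid psid); apply: (mor_ext ss) => z h zs.
have [i [f [g [gf fg]]]] := Scov zs.
apply: (cancel_r (f := g) (g := f)); first by [].
rewrite -!cmpA.
have := H i _ (isd_ext (F := at_ (X i)) (G := F) (h ∙ g)) R 1o.
by rewrite (ext_at1 (F := at_ (X i)) (G := F)).
Qed.

Lemma cap_isd i j (psi : fam (compw (at_ (X' j)) (at_ (X i))) (idw Z)) : isd _ _ psi ->
  isd (at_ (X i)) (at_ (X j)) (fun N n => (psi N n • X j) ∙ cu (br (b j)) (n · X i)).
Proof.
move=> psid; apply: (isd_cmp (G := compw (compw (at_ (X j)) (at_ (X' j))) (at_ (X i)))).
  by isd_cast (isd_r (at_ (X j)) psid).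
by isd_cast (isd_l (at_ (X i)) (cu_d (br (b j)))).
Qed.

Lemma cap_neq i j (psi : fam (compw (at_ (X' j)) (at_ (X i))) (idw Z)) : isd _ _ psi -> i != j ->
  forall (N : psh D) (n : N Z), (psi N n • X j) ∙ cu (br (b j)) (n · X i) = 0 :> lmor _ _.
Proof.
move=> psid ij; apply: (fam_eq0 (cap_isd psid)); apply: (schur_noniso ss _ (Ss i) (Ss j) _).
by move=> /Sinj E; rewrite E eqxx in ij.
Qed.

(** Bending the strand [X' i] makes [psi] an endomorphism of [X i], so [psi] is [c] times the counit
    of [br]. Closing it with the unit of [bl] then contributes the loop. *)
Lemma cap_scalar i (psi : fam (compw (at_ (X' i)) (at_ (X i))) (idw Z)) : isd _ _ psi ->
  exists c, forall (N : psh D) (n : N Z),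
  (psi N n • X i) ∙ cu (br (b i)) (n · X i) = c *: (idm (n · X i) : lmor _ _) :> lmor _ _ /\
  psi N n ∙ cu (bl (b i)) n = (c * bd (b i)) *: (idm n : lmor _ _) :> lmor _ _.
Proof.
move=> psid; have psiN (N : psh D) (n m : N Z) (u : mor n m) :
    psi N m ∙ (u • X i • X' i) = u ∙ psi N n by exact: (proj1 psid).
have [|c cP] := @fam_scalar _ _ _ ss (at_ (X i)) (fun N n => (psi N n • X i) ∙ cu (br (b i)) (n · X i)) (Ss i).
  exact: cap_isd.
exists c => N n; split; first exact: cP.
have -> : psi N n = c *: (ce (br (b i)) n : lmor _ _).
  have := congr1 (fun w => ce (br (b i)) n ∙ (w • X' i)) (cP N n).
  rewrite paZ fmor_id mZr cmpm1 fmor_cmp cmpA ceN -cmpA => <-.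
  by rewrite zz1 cmpm1.
by rewrite mZl loopl scalerA.
Qed.

Variables (Q : psh D) (y : Q Z) (E : hm Z Z) (ev : mor (y · E) y).
Hypothesis evP : forall (W : hm Z Z) (g : mor (y · W) y), exists! a : mor W E, ev ∙ (y ◂ a) = g.
Variables (tr : lmor y y -> k) (trlin : scalar tr).
Variables (I : 'I_r -> finType) (e : forall i, I i -> lmor y (y · X' i)) (f : forall i, I i -> lmor (y · X' i) y).
Hypotheses (eP : forall i (a : lmor y (y · X' i)), a = \sum_l tr (@f i l ∙ a) *: @e i l)
  (ef : forall i, \sum_l (@e i l ∙ @f i l : lmor _ _) = idm (y · X' i)).
Hypothesis trnd : forall W (g : lmor (y · W) y), (forall w : lmor y (y · W), tr (g ∙ w) = 0) -> g = 0.

Variables (mu : fam (compw (at_ E) (at_ E)) (at_ E)) (mu_d : isd _ _ (@mu)) (muE : ev ∙ mu y = ev ∙ (ev • E)).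
Variables (un : fam (idw Z) (at_ E)) (un_d : isd _ _ (@un)) (unE : ev ∙ un y = idm y).
Variables (t : fam (at_ E) (idw Z)) (t_d : isd _ _ (@t)).
Hypothesis tP : forall phi : fam (idw Z) (at_ E), isd _ _ phi -> forall (N : psh D) (n : N Z),
  t n ∙ phi N n = tr (ev ∙ phi Q y) *: (idm n : lmor n n) :> lmor n n.
Variables (fh : forall i, I i -> fam (at_ (X' i)) (at_ E)) (fh_d : forall i l, isd _ _ (@fh i l))
  (fhE : forall i l, ev ∙ @fh i l Q y = @f i l).
Variables (eh : forall i, I i -> fam (at_ (X i)) (at_ E)) (eh_d : forall i l, isd _ _ (@eh i l))
  (ehE : forall i l, ev ∙ @eh i l Q y = ce (bl (b i)) y ∙ (@e i l • X i)).

Let muN (N : psh D) (n m : N Z) (u : mor n m) : mu m ∙ (u • E • E) = u • E ∙ mu n.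
Proof. exact: (proj1 mu_d). Qed.
Let fhN i l (N : psh D) (n m : N Z) (u : mor n m) : @fh i l N m ∙ (u • X' i) = u • E ∙ @fh i l N n.
Proof. exact: (proj1 (@fh_d i l)). Qed.
Let ehN i l (N : psh D) (n m : N Z) (u : mor n m) : @eh i l N m ∙ (u • X i) = u • E ∙ @eh i l N n.
Proof. exact: (proj1 (@eh_d i l)). Qed.

Lemma mu_assoc (N : psh D) (n : N Z) : mu n ∙ (mu n • E) = mu n ∙ mu (n · E).
Proof.
move: N n; apply: (fam_ev_uniq evP (F := compw (at_ E) (compw (at_ E) (at_ E)))).
- exact: (isd_cmp mu_d (isd_r (at_ E) mu_d)).
- by isd_cast (isd_cmp mu_d (isd_l (at_ E) mu_d)).
rewrite /= !cmpA muE -[LHS]cmpA -fmor_cmp muE fmor_cmp -[RHS]cmpA.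
by rewrite -muN !cmpA muE.
Qed.

Lemma mu_unit_l (N : psh D) (n : N Z) : mu n ∙ (un n • E) = idm (n · E).
Proof.
move: N n; apply: (fam_ev_uniq evP (F := at_ E)).
- by isd_cast (isd_cmp mu_d (isd_r (at_ E) un_d)).
- exact: isd_id.
by rewrite /= cmpA muE -cmpA -fmor_cmp unE fmor_id.
Qed.

Lemma mu_unit_r (N : psh D) (n : N Z) : mu n ∙ un (n · E) = idm (n · E).
Proof.
move: N n; apply: (fam_ev_uniq evP (F := at_ E)).
- by isd_cast (isd_cmp mu_d (isd_l (at_ E) un_d)).
- exact: isd_id.
rewrite /= cmpA muE -cmpA.
have -> : (ev • E) ∙ un (y · E) = un y ∙ ev by rewrite [RHS](proj1 un_d).
by rewrite cmpA unE cmp1m cmpm1.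
Qed.

Definition kap : fam (compw (at_ E) (at_ E)) (idw Z) := fun N n => t n ∙ mu n.
(** The Casimir element, the copairing dual to the Frobenius form [kap]. The weights [bd (b i)]
    account for the loop by which the scalars of an open and of a closed strand differ in
    [cap_scalar]. *)
Definition cas : fam (idw Z) (compw (at_ E) (at_ E)) := fun N n =>
  \sum_i \sum_l bd (b i) *: (@eh i l N (n · E) ∙ (@fh i l N n • X i) ∙ cu (br (b i)) n : lmor _ _).

Lemma kap_d : isd _ _ kap. Proof. exact: isd_cmp. Qed.
Lemma cas_d : isd _ _ cas.
Proof.
apply: isd_sum => i; apply: isd_sum => l; apply: isd_scale.
apply: isd_cmp (cu_d (br (b i))); apply: (isd_cmp (G := compw (at_ (X i)) (at_ E))).
  exact: (isd_l (at_ E) (@eh_d i l)).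
exact: (isd_r (at_ (X i)) (@fh_d i l)).
Qed.
Lemma kapN (N : psh D) (n m : N Z) (u : mor n m) : kap m ∙ (u • E • E) = u ∙ kap n.
Proof. exact: (proj1 kap_d). Qed.
Lemma casN (N : psh D) (n m : N Z) (u : mor n m) : cas m ∙ u = u • E • E ∙ cas n.
Proof. exact: (proj1 cas_d). Qed.

(** The dual bases compose to the identity of [y · X' i], so each [i] leaves one loop of value
    [bd (b i)], next to the weight of the same value. *)
Lemma mu_cas (N : psh D) (n : N Z) :
  mu n ∙ cas n = (\sum_i bd (b i) * bd (b i)) *: (un n : lmor _ _) :> lmor _ _.
Proof.
move: N n; apply: (fam_ev_uniq evP (F := idw Z)).
- exact: (isd_cmp mu_d cas_d).
- exact: isd_scale.
rewrite mZr unE cmpA muE -cmpA /cas !cmp_sumr scaler_suml; apply: eq_bigr => i _.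
rewrite [in LHS]cmp_sumr cmp_sumr.
rewrite (eq_bigr (fun l => bd (b i) *: (ce (bl (b i)) y ∙ ((@e i l ∙ @f i l) • X i) ∙ cu (br (b i)) y : lmor y y))).
  rewrite -scaler_sumr -cmp_suml -cmp_sumr -[X in _ ∙ X ∙ _](lin_sum (@lf_lin _ _ _ (pa Q (X i)) _ _)) ef.
  by rewrite fmor_id cmpm1 loopr scalerA.
move=> l _; rewrite !mZr; congr (_ *: _).
rewrite -!cmpA; rq (esym (@ehN i l _ _ _ ev)); rewrite !cmpA ehE -!cmpA.
by rewrite fmor_cmp -fhE fmor_cmp -!cmpA.
Qed.

(** Tested on a map [a] from [X i], only the terms of index [i] survive, by Schur's lemma. With the
    weight, their scalars are the coefficients of the transpose [ab] of [a] in the basis [e], so the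
    sum rebuilds [a]. *)
Lemma zigzag_kap_cas (N : psh D) (n : N Z) : (kap n • E) ∙ cas (n · E) = idm (n · E).
Proof.
have zd : isd (at_ E) (at_ E) (fun N n => (kap n • E) ∙ cas (n · E)).
  apply: (isd_cmp (G := compw (compw (at_ E) (at_ E)) (at_ E))).
    by isd_cast (isd_r (at_ E) kap_d).
  by isd_cast (isd_l (at_ E) cas_d).
move: N n; apply: (fam_test zd (isd_id (at_ E))) => i a ad.
have aN (N : psh D) (n m : N Z) (u : mor n m) : a N m ∙ (u • X i) = u • E ∙ a N n by exact: (proj1 ad).
pose psi j l : fam (compw (at_ (X' j)) (at_ (X i))) (idw Z) :=
  fun N n => kap n ∙ @fh j l N (n · E) ∙ (a N n • X' j).
have psid j l : isd _ _ (psi j l).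
  apply: isd_cmp (isd_r (at_ (X' j)) ad); apply: (isd_cmp kap_d).
  exact: (isd_l (at_ E) (@fh_d j l)).
pose ab := ((ev ∙ a Q y) • X' i) ∙ cu (bl (b i)) y.
have tot N n : (kap n • E) ∙ cas (n · E) ∙ a N n =
    \sum_j \sum_l bd (b j) *: (@eh j l N n ∙ ((psi j l N n • X j) ∙ cu (br (b j)) (n · X i)) : lmor _ _) :> lmor _ _.
  rewrite /cas cmp_sumr cmp_suml; apply: eq_bigr => j _.
  rewrite cmp_sumr cmp_suml; apply: eq_bigr => l _.
  rewrite mZr mZl; congr (_ *: _); rewrite /psi !fmor_cmp -!cmpA cuN.
  by rq (esym (@ehN j l N _ _ (mu n))); rq (esym (@ehN j l N _ _ (t n))).
have scl l : exists c, forall (N : psh D) (n : N Z), (psi i l N n • X i) ∙ cu (br (b i)) (n · X i) = c *: (idm _ : lmor _ _) :> lmor _ _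
   /\ bd (b i) * c = tr (@f i l ∙ ab).
  have [c cP] := cap_scalar (psid i l); exists c => N n; have [c1 c2] := cP N n.
  split=> //; rewrite mulrC; apply: (@scale_idm_inj _ (R Z) 1o); first exact: (proj1 Z1).
  suff {c1 c2 N n} H (N : psh D) (n : N Z) : psi i l N n ∙ cu (bl (b i)) n = tr (@f i l ∙ ab) *: (idm n : lmor n n).
    by rewrite -H; have [_ ->] := cP R 1o.
  rewrite /psi /kap -!cmpA.
  have pd : isd (idw Z) (at_ E) (fun N n => mu n ∙ (@fh i l N (n · E) ∙ ((a N n • X' i) ∙ cu (bl (b i)) n))).
    apply: (isd_cmp mu_d); apply: (isd_cmp (G := compw (at_ (X' i)) (at_ E))).
      exact: (isd_l (at_ E) (@fh_d i l)).
    exact: (isd_cmp (isd_r (at_ (X' i)) ad) (cu_d (bl (b i)))).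
  suff -> : @f i l ∙ ab = ev ∙ (mu y ∙ (@fh i l Q (y · E) ∙ ((a Q y • X' i) ∙ cu (bl (b i)) y))).
    exact: tP pd N n.
  by rewrite !cmpA muE /ab fmor_cmp -[in LHS]fhE -!cmpA; rq (@fhN i l _ _ _ ev).
have final N n : \sum_l tr (@f i l ∙ ab) *: (@eh i l N n : lmor _ _) = a N n.
  move: N n; apply: (fam_ev_uniq evP (F := at_ (X i))) => //.
    by apply: isd_sum => l; apply: isd_scale.
  rewrite cmp_sumr.
  transitivity (ce (bl (b i)) y ∙ (ab • X i)).
    rewrite [ab in RHS]eP pa_sum cmp_sumr; apply: eq_bigr => l _.
    by rewrite mZr ehE paZ mZr.
  by rewrite /ab fmor_cmp cmpA ceN -cmpA zz1 cmpm1.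
move=> N n; rewrite tot cmp1m -final (big_only1 i) // => [|j ji _].
  apply: eq_bigr => l _; have [c cP] := scl l; have [c1 c2] := cP N n.
  by rewrite c1 mZr cmpm1 scalerA c2.
rewrite big1 // => l _.
by rewrite (cap_neq (psid j l)) 1?eq_sym // m0r scaler0.
Qed.

(** Nondegeneracy is inherited from [tr]: a test map [w] transposes to a map [g] from [X' i] to [E],
    and [kap] pairs [a] with [g] to the scalar [tr (ev ∙ a Q y ∙ w)]. *)
Lemma kap_nondegenerate (theta : fam (at_ E) (at_ E)) : isd _ _ theta ->
  (forall (N : psh D) (n : N Z), kap n ∙ theta N (n · E) = kap n) ->
  forall (N : psh D) (n : N Z), theta N n = idm (n · E).
Proof.
move=> thd H; apply: (fam_test thd (isd_id (at_ E))) => i a ad.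
apply: (fam_ev_uniq evP (F := at_ (X i))); [exact: isd_cmp | exact: isd_cmp (isd_id (at_ E)) ad |].
rewrite cmp1m; apply: (@subr0_eq (lmor (y · X i) y)); apply: trnd => w.
have -> (u v : lmor (y · X i) y) : tr ((u - v) ∙ w) = tr (u ∙ w) - tr (v ∙ w).
  rewrite mBl -scaleN1r addrC trlin mulN1r addrC.
  by [].
apply/eqP; rewrite subr_eq0; apply/eqP.
have [g [gd gE]] := fam_ev evP (F := at_ (X' i)) (ce (br (b i)) y ∙ (w • X' i)).
have wE : w = ((ev ∙ g Q y) • X i) ∙ cu (br (b i)) y.
  by rewrite gE fmor_cmp -cmpA -cuN cmpA zz2 cmp1m.
have gN (N : psh D) (n m : N Z) (u : mor n m) : g N m ∙ (u • X' i) = u • E ∙ g N n.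
  exact: (proj1 gd).
have key (a' : fam (at_ (X i)) (at_ E)) : isd _ _ a' -> forall (N : psh D) (n : N Z),
    kap n ∙ (a' N (n · E) ∙ ((g N n • X i) ∙ cu (br (b i)) n)) = tr (ev ∙ a' Q y ∙ w) *: (idm n : lmor n n) :> lmor n n.
  move=> a'd N n; rewrite /kap -!cmpA.
  have pd : isd (idw Z) (at_ E) (fun N n => mu n ∙ (a' N (n · E) ∙ ((g N n • X i) ∙ cu (br (b i)) n))).
    apply: (isd_cmp mu_d); apply: (isd_cmp (G := compw (at_ (X i)) (at_ E))).
      exact: (isd_l (at_ E) a'd).
    exact: (isd_cmp (isd_r (at_ (X i)) gd) (cu_d (br (b i)))).
  apply: (etrans (tP pd n)); apply: (congr1 (fun z : lmor y y => tr z *: (idm n : lmor n n))).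
  have a'N (u : mor (y · E) y) : a' Q y ∙ (u • X i) = u • E ∙ a' Q (y · E) by exact: (proj1 a'd).
  by rewrite !cmpA muE wE fmor_cmp -!cmpA; rq (a'N ev).
apply: (@scale_idm_inj _ (R Z) 1o); first exact: (proj1 Z1).
rewrite -(key _ ad) -(key (fun N n => theta N n ∙ a N n)) ?cmpA ?H //; exact: isd_cmp.
Qed.

(** By the first snake equation the left side does not change [kap], and [kap] is nondegenerate. *)
Lemma zigzag_cas_kap (N : psh D) (n : N Z) : kap (n · E) ∙ (cas n • E) = idm (n · E).
Proof.
move: N n; apply: kap_nondegenerate => [|N n].
  apply: (isd_cmp (G := compw (at_ E) (compw (at_ E) (at_ E)))).
    by isd_cast (isd_l (at_ E) kap_d).
  by isd_cast (isd_r (at_ E) cas_d).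
by rewrite cmpA -kapN -cmpA -fmor_cmp zigzag_kap_cas fmor_id cmpm1.
Qed.

(** The Frobenius coproduct. It is a bimodule map because, by [comulE], the Casimir element may be
    inserted on either side. *)
Definition comul : fam (at_ E) (compw (at_ E) (at_ E)) := fun N n => (mu n • E) ∙ cas (n · E).

Lemma comul_d : isd _ _ comul.
Proof.
apply: (isd_cmp (G := compw (compw (at_ E) (at_ E)) (at_ E))).
  by isd_cast (isd_r (at_ E) mu_d).
by isd_cast (isd_l (at_ E) cas_d).
Qed.

(* [phi] is recovered from [kap (phi • E)] by the first zigzag. *)
Lemma comulE (N : psh D) (n : N Z) : comul n = mu (n · E) ∙ (cas n • E).
Proof.
have recover (phi : fam (at_ E) (compw (at_ E) (at_ E))) : isd _ _ phi ->
    forall (N : psh D) (n : N Z), phi N n = ((kap (n · E) ∙ (phi N n • E)) • E) ∙ cas (n · E).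
  move=> phid {}N {}n; rewrite fmor_cmp -cmpA -casN cmpA zigzag_kap_cas cmp1m.
  by [].
have d2 : isd (at_ E) (compw (at_ E) (at_ E)) (fun N n => mu (n · E) ∙ (cas n • E)).
  apply: (isd_cmp (G := compw (at_ E) (compw (at_ E) (at_ E)))).
    by isd_cast (isd_l (at_ E) mu_d).
  by isd_cast (isd_r (at_ E) cas_d).
have h1 : kap (n · E) ∙ (comul n • E) = mu n.
  rewrite /comul fmor_cmp cmpA kapN -cmpA zigzag_cas_kap cmpm1.
  by [].
have h2 : kap (n · E) ∙ ((mu (n · E) ∙ (cas n • E)) • E) = mu n.
  rewrite fmor_cmp /kap -!cmpA; rq (mu_assoc (n · E)); rewrite muN.
  by rewrite cmpA -[t _ ∙ mu _]/(kap _) cmpA zigzag_cas_kap cmp1m.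
by rewrite (recover _ comul_d) [RHS](recover _ d2) h1 h2.
Qed.

Lemma comul_mu_l (N : psh D) (n : N Z) : comul n ∙ mu n = (mu n • E) ∙ comul (n · E).
Proof.
rewrite {1}/comul -cmpA casN cmpA -fmor_cmp mu_assoc fmor_cmp -cmpA.
by [].
Qed.

Lemma comul_mu_r (N : psh D) (n : N Z) : comul n ∙ mu n = mu (n · E) ∙ (comul n • E).
Proof.
rewrite !comulE fmor_cmp -cmpA -muN cmpA -mu_assoc -!cmpA.
by [].
Qed.

Lemma mu_comul (N : psh D) (n : N Z) :
  mu n ∙ comul n = (\sum_i bd (b i) * bd (b i)) *: (idm (n · E) : lmor _ _) :> lmor _ _.
Proof.
by rewrite /comul cmpA mu_assoc -cmpA mu_cas mZr mu_unit_r.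
Qed.

End Casimir.

Lemma pasc_inv (k : fieldType) (D : linbicat k) (N : psh D) W X Y Z (h : hm Y Z) (g : hm X Y) (f : hm W X) (n : N Z) :
  n ◂ asci h g f ∙ pw h (g ∘ f) n ∙ pw g f (n · h) = pw (h ∘ g) f n ∙ (pw h g n • f).
Proof.
apply: (cancel_l (inverse_pa2 n (ascP h g f))); rewrite [RHS]cmpA pasc -!cmpA.
by rewrite (cancelK _ (inverse_sym (inverse_pa2 n (ascP h g f)))).
Qed.

(** * From strict families back to monads in the 2-category *)

Section MonadOfFamilies.
Variables (k : closedFieldType) (D : linbicat k) (Z : D) (E : hm Z Z).
Variables (mu : fam (compw (at_ E) (at_ E)) (at_ E)) (mu_d : isd _ _ (@mu)).
Variables (un : fam (idw Z) (at_ E)) (un_d : isd _ _ (@un)).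
Variables (co : fam (at_ E) (compw (at_ E) (at_ E))) (co_d : isd _ _ (@co)).
Hypotheses (muA : forall (N : psh D) (n : N Z), mu n ∙ (mu n • E) = mu n ∙ mu (n · E))
  (mul : forall (N : psh D) (n : N Z), mu n ∙ (un n • E) = idm (n · E))
  (mur : forall (N : psh D) (n : N Z), mu n ∙ un (n · E) = idm (n · E))
  (muco : forall (N : psh D) (n : N Z), mu n ∙ co n = idm (n · E))
  (col : forall (N : psh D) (n : N Z), co n ∙ mu n = (mu n • E) ∙ co (n · E))
  (cor : forall (N : psh D) (n : N Z), co n ∙ mu n = mu (n · E) ∙ (co n • E)).

Lemma monad_of_fam : exists (m : mor (E ∘ E) E) (u : mor (one Z) E)
  (mA : m ∙ (m ⋆ idm E) = m ∙ (idm E ⋆ m) ∙ asc E E E)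
  (m1l : m ∙ (u ⋆ idm E) = lu E) (m1r : m ∙ (idm E ⋆ u) = ru E),
  [/\ separable (Monad mA m1l m1r),
      forall (N : psh D) (n : N Z), n ◂ m ∙ pw E E n = mu n &
      forall (N : psh D) (n : N Z), n ◂ u ∙ pu n = un n].
Proof.
have [m mP] := fam_cell (isd_cmp mu_d (isd_pwi E E)).
have [u uP] := fam_cell (isd_cmp un_d (isd_pui Z)).
have [c cP] := fam_cell (isd_cmp (isd_pw E E) co_d).
have mE (N : psh D) (n : N Z) : mu n = n ◂ m ∙ pw E E n.
  by rewrite -mP -cmpA (inv12 (pwP _ _ _)) cmpm1.
have uE (N : psh D) (n : N Z) : un n = n ◂ u ∙ pu n.
  by rewrite -uP -cmpA (inv12 (puP _)) cmpm1.
have cE (N : psh D) (n : N Z) : co n = pwi E E n ∙ (n ◂ c).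
  by rewrite -cP cmpA (inv12 (pwP _ _ _)) cmp1m.
pose N : psh D := reg Z; pose n : N Z := one Z.
have pwE X Y (n' : N Z) : pw X Y n' ∙ pwi X Y n' = idm _ := inv21 (pwP X Y n').
have mA : m ∙ (m ⋆ idm E) = m ∙ (idm E ⋆ m) ∙ asc E E E.
  apply: cell_inj; rewrite -/N -/n; apply: (cancel_r (pwP (E ∘ E) E n)).
  apply: (cancel_r (inverse_fmor (pa N E) (pwP E E n))).
  rewrite !pa2_cmp -!cmpA; rq (esym (pwNl m E n)); rewrite -fmor_cmp -mE.
  rewrite cmpA -mE; have := muA n.
  rewrite [mu (n · E)]mE [X in _ = X ∙ _ -> _]mE => ->.
  have -> : n ◂ asc E E E ∙ (pw (E ∘ E) E n ∙ (pw E E n • E)) = pw E (E ∘ E) n ∙ pw E E (n · E).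
    by rewrite cmpA; apply: pasc.
  rewrite -!cmpA; congr (_ ∙ _); rewrite !cmpA; congr (_ ∙ _).
  exact: pwNr.
have m1l : m ∙ (u ⋆ idm E) = lu E.
  apply: cell_inj; rewrite -/N -/n; apply: (cancel_r (pwP (one Z) E n)).
  apply: (cancel_r (inverse_fmor (pa N E) (puP n))).
  rewrite pa2_cmp plu -!cmpA; rq (esym (pwNl u E n)); rewrite -fmor_cmp -uE.
  by rewrite cmpA -mE mul.
have m1r : m ∙ (idm E ⋆ u) = ru E.
  apply: cell_inj; rewrite -/N -/n; apply: (cancel_r (pwP E (one Z) n)).
  apply: (cancel_r (puP (n · E))).
  rewrite pa2_cmp pru -!cmpA; rq (esym (pwNr E u n)); rewrite -uE.
  by rewrite cmpA -mE mur.
exists m, u, mA, m1l, m1r; split; [|by move=> N1 n1; rewrite -mE|by move=> N1 n1; rewrite -uE].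
exists c; split=> /=.
- apply: cell_inj; rewrite -/N -/n pa2_cmp pa2_id.
  by have := muco n; rewrite mE cE -cmpA (cancelK _ (inverse_sym (pwP E E n))).
- apply: cell_inj; rewrite -/N -/n; apply: (cancel_r (pwP E E n)).
  rewrite !pa2_cmp -!cmpA -mE; rq (esym (pwNr E c n)).
  rewrite -!cP -[LHS]cmpA (col n).
  have mE' : ((n ◂ m) • E) ∙ (pw E E n • E) = mu n • E by rewrite -fmor_cmp -mE.
  by rq (pasc_inv E E E n); rq (esym (pwNl m E n)); rq mE'.
- apply: cell_inj; rewrite -/N -/n; apply: (cancel_r (pwP E E n)).
  rewrite !pa2_cmp -!cmpA -mE; rq (esym (pwNl c E n)).
  rewrite -cP fmor_cmp -[LHS]cmpA (cor n).
  by rq (pasc E E E n); rq (esym (pwNr E m n)); rq (esym (mE _ (n · E))).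
Qed.

End MonadOfFamilies.

Definition orbit (k : fieldType) (D : linbicat k) (Q : psh D) (Y : D) (y : Q Y) (X : D) :
  linfunctor (lhm X Y) (Q X).
Proof.
unshelve refine (@Linfunctor k (lhm X Y) (Q X)
  (@Functor (lhm X Y) (Q X) (fun f => y · f) (fun _ _ a => y ◂ a) _ _) _).
- by move=> f; apply: pa2_id.
- by move=> *; apply: pa2_cmp.
- by move=> f g; apply: (pa2_lin y).
Defined.

Section EnrichedEnd.
Variables (k : closedFieldType) (char0 : [pchar k] =i pred0) (D : linbicat k) (Z : D).
Hypothesis fss : finite_semisimple1 (lhm Z Z).
Hypothesis adj : has_adjoints D.
Hypothesis Z1 : is_simple (one Z : lhm Z Z).
Variables (Q : psh D) (ssQ : semisimple1 (Q Z)) (q : nat) (M : 'I_q -> Q Z) (y : Q Z).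
Variables (u : forall j, lmor (M j) y) (v : forall j, lmor y (M j)).
Hypotheses (Ms : forall j, is_simple (M j)) (Minj : forall i j, isomorphic (M i) (M j) -> i = j).
Hypotheses (vu : forall j, v j ∙ u j = idm (M j)) (uv : \sum_j (u j ∙ v j : lmor y y) = idm y).
Hypothesis Mcov : forall (W : hm Z Z) (x : Q Z) (f : lmor x (y · W)),
  is_simple x -> f != 0 -> exists j, isomorphic x (M j).
Let ss := proj1 fss.

Theorem enriched_end_separable : exists (E : monad Z) (ev : mor (y · E) y),
  [/\ separable E,
      forall (W : hm Z Z) (f : mor (y · W) y), exists! a : mor W E, ev ∙ (y ◂ a) = f,
      ev ∙ (y ◂ mon_mul E) ∙ pw E E y = ev ∙ (ev • (E : hm Z Z)) &
      ev ∙ (y ◂ mon_unit E) ∙ pu y = idm y].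
Proof.
have [r [S0 [Ss0 Sinj0 Scov0]]] := simple_reps fss.
pose X i : hm Z Z := S0 i.
have Siso i : isomorphic (S0 i) (one Z ∘ X i : lhm Z Z) := one_act_iso _.
have Ss i : is_simple ((one Z : reg Z Z) · X i) by apply: simple_iso (Siso i) (Ss0 i).
have Sinj i j : isomorphic ((one Z : reg Z Z) · X i) ((one Z : reg Z Z) · X j) -> i = j.
  move=> ij; apply: Sinj0; apply: isomorphic_trans (Siso i) _.
  exact: isomorphic_trans ij (isomorphic_sym (Siso j)).
have Scov (x : reg Z Z) : is_simple x -> exists i, isomorphic x ((one Z : reg Z Z) · X i).
  move=> xs; have [i xi] := Scov0 x xs; exists i; exact: isomorphic_trans xi (Siso i).
have [X' /dep_choice [b _]] : exists X' : 'I_r -> hm Z Z, forall i, exists b : bidual (X i) (X' i), True.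
  apply: (dep_choice (P := fun i X' => exists b : bidual (X i) X', True)) => i.
  by have [X' [b]] := bidual_exists ss adj Z1 (Ss0 i); exists X', b.
have dim := global_dim_neq0 char0 fss Z1 b Ss Sinj Scov.
(* The value at [y] of the right adjoint of [W |-> y · W]. *)
have [E [ev evP]] : exists (E : hm Z Z) (ev : mor (y · E) y),
    forall (W : hm Z Z) (f : mor (y · W) y), exists! a : mor W E, ev ∙ (y ◂ a) = f.
  exact: (right_adjoint_object fss (orbit y Z) y).
pose tr (h : lmor y y) := \sum_j scal (v j ∙ h ∙ u j : lmor (M j) (M j)).
have trlin : scalar tr.
  move=> c g h; rewrite /tr mulr_sumr -big_split; apply: eq_bigr => j _ /=.
  by rewrite mDr mDl mZr mZl (scal_lin ssQ).
have dual (W : hm Z Z) : exists (I : finType) (e : I -> lmor y (y · W)) (f : I -> lmor (y · W) y),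
    [/\ forall a : lmor y (y · W), a = \sum_l tr (f l ∙ a) *: e l,
        forall g : lmor (y · W) y, g = \sum_l tr (g ∙ e l) *: f l &
        \sum_l (e l ∙ f l : lmor _ _) = idm (y · W)].
  have [I [e [f fP]]] := trace_dual_basis ssQ Ms Minj vu uv (fun x f => @Mcov W x f).
  by exists I, e, f.
clearbody tr.
have [I /dep_choice [e /dep_choice [f efP]]] := dep_choice (fun i => dual (X' i)).
have eP i (a : lmor y (y · X' i)) : a = \sum_l tr (@f i l ∙ a) *: @e i l.
  by have [h _ _] := efP i.
have ef i : \sum_l (@e i l ∙ @f i l : lmor _ _) = idm (y · X' i).
  by have [_ _ h] := efP i.
have trnd W (g : lmor (y · W) y) : (forall w : lmor y (y · W), tr (g ∙ w) = 0) -> g = 0.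
  move=> g0; have [J [e' [f' [_ h _]]]] := dual W.
  by rewrite [g]h big1 // => l _; rewrite g0 scale0r.
have [mu [mu_d muE]] := fam_ev evP (F := compw (at_ E) (at_ E)) (ev ∙ (ev • E)).
have [un [un_d unE]] := fam_ev evP (F := idw Z) (idm y).
(* Since [one Z] is simple, [functional_rep] makes a map from [E] to [one Z] out of any functional
   on [Hom(one Z, E)], that is, on [End y]; here the functional is [tr]. *)
have [t [t_d tP]] : exists t : fam (at_ E) (idw Z), isd _ _ t /\
    forall phi : fam (idw Z) (at_ E), isd _ _ phi -> forall (N : psh D) (n : N Z),
    t N n ∙ phi N n = tr (ev ∙ phi Q y) *: (idm n : lmor n n) :> lmor n n.
  pose L (a : lmor (one Z : lhm Z Z) (one Z ∘ E)) : k := tr (ev ∙ ext (idw Z) (at_ E) a y).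
  have Llin : scalar L.
    move=> c a a'; rewrite /L -trlin; congr tr; rewrite -mZr -mDr; congr (_ ∙ _).
    rewrite /ext [y ◂ _](pa2_lin y c a a').
    by rewrite /= !cmpm1 mDr mZr mDl mZl.
  have [t0 t0P] := functional_rep ss Z1 Llin.
  exists (fun N n => ext (at_ E) (idw Z) t0 n); split=> [|phi phid]; first exact: isd_ext.
  apply: (isd_uniq (isd_cmp (isd_ext _) phid) (isd_scale _ (isd_id (idw Z)))).
  rewrite (ext_at1 (F := at_ E) (G := idw Z)) t0P /L.
  by rewrite (ext_uniq phid).
have [fh fhP] := dep_choice (fun i => dep_choice (fun l => fam_ev evP (F := at_ (X' i)) (@f i l))).
have [eh ehP] := dep_choice (fun i => dep_choice (fun l =>
  fam_ev evP (F := at_ (X i)) (ce (bl (b i)) y ∙ (@e i l • X i)))).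
have fh_d i l : isd _ _ (@fh i l) by have [] := fhP i l.
have fhE i l : ev ∙ @fh i l Q y = @f i l by have [] := fhP i l.
have eh_d i l : isd _ _ (@eh i l) by have [] := ehP i l.
have ehE i l : ev ∙ @eh i l Q y = ce (bl (b i)) y ∙ (@e i l • X i) by have [] := ehP i l.
have muA := mu_assoc evP mu_d muE.
have mul := mu_unit_l evP mu_d muE un_d unE.
have mur := mu_unit_r evP mu_d muE un_d unE.
pose dd := \sum_i bd (b i) * bd (b i).
pose co0 := comul b mu fh eh.
have co0_d := comul_d b mu_d fh_d eh_d.
have [mm [uu [mA [m1l [m1r [sep mmE uuE]]]]]] : exists (m : mor (E ∘ E) E) (u : mor (one Z) E)
  (mA : m ∙ (m ⋆ idm E) = m ∙ (idm E ⋆ m) ∙ asc E E E)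
  (m1l : m ∙ (u ⋆ idm E) = lu E) (m1r : m ∙ (idm E ⋆ u) = ru E),
  [/\ separable (Monad mA m1l m1r),
      forall (N : psh D) (n : N Z), n ◂ m ∙ pw E E n = mu N n &
      forall (N : psh D) (n : N Z), n ◂ u ∙ pu n = un N n].
  (* The product after [co0] is multiplication by the global dimension [dd], whence the factor
     [dd^-1] in the section. *)
  apply: (monad_of_fam (co := fun N n => dd^-1 *: (co0 N n : lmor _ _)) mu_d un_d _ muA mul mur).
  - exact: isd_scale.
  - move=> N n; rewrite mZr (mu_comul evP ef mu_d muE un_d unE fh_d fhE eh_d ehE).
    by rewrite scalerA mulVf // scale1r.
  - move=> N n; rewrite mZl mZr (comul_mu_l b evP mu_d muE fh_d eh_d).
    by [].
  - move=> N n; rewrite mZl paZ mZr (comul_mu_r ss Z1 Ss Sinj Scov evP trlin eP trnd mu_d muE t_d tP fh_d fhE eh_d ehE).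
    by [].
exists (Monad mA m1l m1r), ev; split=> //=; first by rewrite -cmpA mmE muE.
by rewrite -cmpA uuE unE.
Qed.

End EnrichedEnd.

(** * Splitting and fully faithful points *)

Section Mates.
Variables (k : fieldType) (D : linbicat k) (Q : psh D).

(** Relates the counit formed in the represented presheaf, at [e], to the counit formed in [Q], at
    [y · e]. *)
Lemma act_reg_cap X Y Z (l : hm X Y) (r : hm Y X) (eps : mor (l ∘ r) (one Y)) (y : Q Z) (e : hm Y Z) :
  y ◂ (capf eps (e : reg Z Y) : @mor (hm Y Z) _ _)
  = capf eps (y · e) ∙ (pwi e l y • r) ∙ pwi (e ∘ l) r y.
Proof.
rewrite {1}/capf /= !pa2_cmp.
apply: (cancel_r (pwP (e ∘ l) r y)).
apply: (cancel_r (inverse_fmor (pa Q r) (pwP e l y))).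
rewrite -!cmpA (cancelK _ (pwP (e ∘ l) r y)) (whf1 _ (inv12 (pwP e l y))) cmpm1.
rq (pasc e l r y); rewrite /capf -?cmpA; rq (esym (pwNr e eps y)).
by rewrite -(pui_pwi e y) -?cmpA (cancelK _ (pwP e (one Y) y)).
Qed.

Lemma act_reg_cup X Y Z (r : hm Y X) (l : hm X Y) (eta : mor (one X) (r ∘ l)) (y : Q Z) (e : hm X Z) :
  y ◂ (cupf eta (e : reg Z X) : @mor (hm X Z) _ _)
  = pw (e ∘ r) l y ∙ (pw e r y • l) ∙ cupf eta (y · e).
Proof.
rewrite {1}/cupf /= !pa2_cmp /cupf -?cmpA -pw_pu; rq (esym (pwNr e eta y)).
apply: (cancel_l (inverse_pa2 y (ascP e r l))).
rewrite (cancelK _ (inverse_sym (inverse_pa2 y (ascP e r l)))); rq (pasc e r l y).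
by rewrite (cancelK _ (inverse_sym (pwP r l (y · e)))).
Qed.

(** [e] is the internal Hom from [y] to [t], with evaluation [ev]. *)
Definition universal Z T (y : Q Z) (e : hm T Z) (t : Q T) (ev : mor (y · e) t) : Prop :=
  forall (v : hm T Z) (f : mor (y · v) t), exists! b : mor v e, ev ∙ (y ◂ b) = f.

(** Internal Homs commute with the action of an [l] that has a right adjoint [r]: maps from [y · v]
    to [t · l] are maps from [y · v · r] to [t]. [flat] and [sharp] are the same transposition
    inside [D]. *)
Lemma universal_transfer Z T W (y : Q Z) (e : hm T Z) (t : Q T) (ev : mor (y · e) t)
  (l : hm W T) (r : hm T W) eta eps : @adjunction k D _ _ l r eta eps ->
  universal ev -> universal ((ev • l) ∙ pwi e l y).
Proof.
move=> adj U v f.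
pose flat (b : mor v (e ∘ l)) : mor (v ∘ r) e := capf (N := reg Z) eps (e : reg Z T) ∙ (b ⋆ idm r).
pose sharp (b : mor (v ∘ r) e) : mor v (e ∘ l) := (b ⋆ idm l) ∙ cupf (N := reg Z) eta (v : reg Z W).
have flatK b : sharp (flat b) = b.
  rewrite /sharp /flat hc2_cmpl -cmpA.
  have := cupfN (N := reg Z) (r := r) (l := l) eta (b : @mor (reg Z W) _ _); rewrite /= => <-.
  by rewrite cmpA; have := zigzag_l adj (e : reg Z T); rewrite /= => ->; rewrite cmp1m.
have flatE b : ev ∙ (y ◂ flat b) = capf eps t ∙ (((ev • l) ∙ pwi e l y ∙ (y ◂ b)) • r) ∙ pwi v r y.
  rewrite /flat pa2_cmp act_reg_cap; move: (capfN eps ev).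
  generalize (capf eps t) (capf eps (y · e)) => c c' cN.
  by rewrite !fmor_cmp -!cmpA; rq (pwiNl b r y); rq cN.
have sharpE b : (ev • l) ∙ pwi e l y ∙ (y ◂ sharp b) = ((ev ∙ (y ◂ b) ∙ pw v r y) • l) ∙ cupf eta (y · v).
  rewrite /sharp pa2_cmp act_reg_cup; generalize (cupf eta (y · v)) => c.
  by rewrite !fmor_cmp -!cmpA; rq (pwiNl b l y); rewrite (cancelK _ (pwP _ _ _)).
have [b [bE bU]] := U (v ∘ r) (capf eps t ∙ (f • r) ∙ pwi v r y).
exists (sharp b); split.
  rewrite sharpE bE -[X in X • l]cmpA (inv12 (pwP v r y)) cmpm1 fmor_cmp -[LHS]cmpA.
  by rewrite -(cupfN eta f) [LHS]cmpA (zigzag_l adj) cmp1m.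
move=> c cE; rewrite -[c]flatK; congr sharp; apply: bU.
by rewrite flatE cE.
Qed.

End Mates.

Definition fully_faithful_at (k : fieldType) (D : linbicat k) (Q : psh D) (X : D) (x : Q X) : Prop :=
  forall (W : D) (f g : hm W X) (h : mor (x · f) (x · g)), exists! a : mor f g, x ◂ a = h.

Section SplitAction.
Variables (k : fieldType) (D : linbicat k) (adj : has_adjoints D) (Q : psh D) (Z X : D) (y : Q Z).
Variables (i : hm X Z) (r : hm Z X) (eta : mor (one Z) (i ∘ r)) (eps : mor (r ∘ i) (one X)).
Variable s : mor (one X) (r ∘ i).
Hypotheses (epss : eps ∙ s = idm (one X)).
Variable act : mor (y · i · r) y.
Hypotheses (act_cup : act ∙ cupf eta y = idm y)
  (act_act : act ∙ (act • i • r) = act ∙ (capf eps (y · i) • r))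
  (actU : universal (act ∙ pwi i r y)).

Lemma cap_cup (N : psh D) (n : N X) : capf eps n ∙ cupf s n = idm n.
Proof.
rewrite /capf /cupf -!cmpA (cancelK _ (inverse_sym (pwP r i n))).
by rewrite (cmpA (n ◂ eps)) -pa2_cmp epss pa2_id cmp1m (inv12 (puP n)).
Qed.

Let p : mor (y · i) (y · i) := (act • i) ∙ cupf s (y · i).

(** [p] is the separability idempotent. Its image is the relative tensor product of [y] with [i]
    over the monad, a coequalizer that splits thanks to [s]. *)
Lemma split_action_idem : p ∙ p = p.
Proof.
have := cupfN s (capf eps (y · i)); have := cupfN s (act • i); have := cap_cup (y · i).
rewrite /p; move: (@cupf _ _ _ _ _ _ _ s) (capf eps (y · i)) act_act => u c aa cu1 uN1 uN2.
rewrite -!cmpA; rq uN1; rq (whf (pa Q i) aa); rq (esym uN2).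
by rewrite cu1 cmpm1.
Qed.

Variables (x : Q X) (a : mor (y · i) x) (b : mor x (y · i)).
Hypotheses (ab : a ∙ b = idm x) (ba : b ∙ a = p).

Let ap : a ∙ p = a.
Proof. by rewrite -ba cmpA ab cmp1m. Qed.

(** The quotient map [a] coequalizes the action on [y] and the action on [i]. *)
Lemma split_action_absorb : a ∙ capf eps (y · i) = a ∙ (act • i).
Proof.
have := cupfN s (capf eps (y · i)); have := cupfN s (act • i); have := ap.
rewrite /p; move: (@cupf _ _ _ _ _ _ _ s) (capf eps (y · i)) act_act => u c aa a1 uN1 uN2.
rewrite -{1}a1 -!cmpA uN2; rq (esym (whf (pa Q i) aa)); rq (esym uN1).
by rewrite !cmpA -(cmpA a) a1.
Qed.

Lemma split_action_retract : (act ∙ (b • r)) ∙ ((a • r) ∙ cupf eta y) = idm y.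
Proof.
rewrite -cmpA (cmpA (b • r)) -fmor_cmp ba /p fmor_cmp.
have := cap_cup (y · i); move: (cupf s _) (capf eps _) act_act (cupf eta y) act_cup => u c aa u' au' cu1.
rewrite -cmpA !cmpA aa -(cmpA act (c • r)) -fmor_cmp cu1 fmor_id cmpm1.
by [].
Qed.

(** By transfer, [i ∘ r ∘ i] is the internal Hom from [y] to [y · i]. The retract [x] of [y · i]
    then matches the retract [i] of [i ∘ r ∘ i] given by [eps] and [s]. *)
Lemma split_action_universal : universal a.
Proof.
have [_ [i' [eta' [eps' adj']]]] := adj i.
have U := universal_transfer adj' actU.
have TE : ((act ∙ pwi i r y) • i) ∙ pwi (i ∘ r) i y ∙ (y ◂ (cupf s (i : reg Z X) : @mor (hm X Z) _ _)) = p.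
  rewrite act_reg_cup /p; generalize (cupf s (y · i)) => u.
  rewrite fmor_cmp -!cmpA (cancelK _ (pwP (i ∘ r) i y)).
  by rq (whf1 (pa Q i) (inv12 (pwP i r y))); rewrite cmp1m.
have CE : a ∙ (y ◂ (capf eps (i : reg Z X) : @mor (hm X Z) _ _)) = a ∙ (((act ∙ pwi i r y) • i) ∙ pwi (i ∘ r) i y).
  rewrite act_reg_cap; have := split_action_absorb; generalize (capf eps (y · i)) => c ac.
  by rewrite fmor_cmp -!cmpA; rq ac.
move=> v g; have [c [cE _]] := U v (b ∙ g).
exists (capf eps (i : reg Z X) ∙ c); split.
  by rewrite pa2_cmp cmpA CE -cmpA cE cmpA ab cmp1m.
move=> b' b'E.
have [d [_ dU]] := U v (p ∙ (y ◂ b')).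
have E1 := dU (cupf s (i : reg Z X) ∙ b').
have E2 := dU c.
have E3 : c = cupf s (i : reg Z X) ∙ b'.
  rewrite -E1 ?E2 //; last by rewrite pa2_cmp cmpA TE.
  by rewrite cE -ba -b'E cmpA.
rewrite E3 cmpA; have := @cap_cup (reg Z) i; rewrite /= => ->.
by rewrite cmp1m.
Qed.

(** The 2-morphism is [g] whiskered with [r], where [s] inserts [r ∘ i] before and [eps] removes it
    after; in strict form it is the action of [g] on [m · r]. *)
Lemma cell_act W (f f' : hm W X) (g : mor (i ∘ f) (i ∘ f')) (N : psh D) (m : N X) :
  m ◂ (lu f' ∙ (eps ⋆ idm f') ∙ asci r i f' ∙ (idm r ⋆ g) ∙ asc r i f ∙ (s ⋆ idm f) ∙ lui f)
  = (capf eps m • f') ∙ (pwi i f' (m · r) ∙ (m · r ◂ g) ∙ pw i f (m · r)) ∙ (cupf s m • f).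
Proof.
rewrite !pa2_cmp -pw_pu_l /capf /cupf !fmor_cmp -!cmpA.
rq (esym (pwNl s f m)).
have E : (m ◂ s) • f = (pw r i m • f) ∙ ((pwi r i m • f) ∙ ((m ◂ s) • f)).
  by rewrite cmpA (whf1 _ (inv21 (pwP r i m))) cmp1m.
rewrite [in LHS]E -!cmpA; rq (pasc r i f m); rq (esym (pwNr r g m)).
have -> : m · r ◂ g ∙ (pw i f (m · r) ∙ ((pwi r i m • f) ∙ (((m ◂ s) • f) ∙ (pu m • f)))) =
  pw i f' (m · r) ∙ (pwi i f' (m · r) ∙ (m · r ◂ g ∙ (pw i f (m · r) ∙ ((pwi r i m • f) ∙ (((m ◂ s) • f) ∙ (pu m • f)))))).
  by rewrite (cancelK _ (inverse_sym (pwP i f' (m · r)))).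
rq (pasc_inv r i f' m); rq (esym (pwNl eps f' m)); rewrite -pui_pwi_l -!cmpA.
by rewrite (cancelK _ (pwP (one X) f' m)) (cancelK _ (pwP i f' (m · r))).
Qed.

(** Whiskering further with [r] and conjugating by [s] and [eps] gives [c] back, because [s] splits
    [eps]. *)
Lemma whisker_split_inj W (f f' : hm W X) (c c' : mor f f') : idm i ⋆ c = idm i ⋆ c' -> c = c'.
Proof.
move=> E; pose T (g : mor (i ∘ f) (i ∘ f')) :=
  lu f' ∙ (eps ⋆ idm f') ∙ asci r i f' ∙ (idm r ⋆ g) ∙ asc r i f ∙ (s ⋆ idm f) ∙ lui f.
suff TE c0 : T (idm i ⋆ c0) = c0 by rewrite -[c]TE E TE.
suff H (N : psh D) (m : N X) : m ◂ T (idm i ⋆ c0) = m ◂ c0 by exact: one_l_inj (H (reg X) (one X)).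
rewrite /T cell_act pwiNr -[in LHS](cmpA (m · r · i ◂ c0)) (inv12 (pwP i f (m · r))) cmpm1.
have := cap_cup m; move: (capf eps m) (cupf s m) => C U CU.
by rewrite -cmpA pa2N cmpA -fmor_cmp CU fmor_id cmp1m.
Qed.

(** Precomposed with [a], a map from [x · f] to [x · f'] becomes a map from [y · (i ∘ f)], so it
    comes from some [g] between [i ∘ f] and [i ∘ f'] by the universal property. Whiskering [g] with
    [r] and conjugating by [s] and [eps] gives the required [c]. *)
Lemma split_action_ff : fully_faithful_at x.
Proof.
move=> W f f' h; have [_ [f'r [eta' [eps' adj']]]] := adj f'.
have U := universal_transfer adj' split_action_universal.
have [g [gE gU]] := U (i ∘ f) (h ∙ (a • f) ∙ pwi i f y).
pose c := lu f' ∙ (eps ⋆ idm f') ∙ asci r i f' ∙ (idm r ⋆ g) ∙ asc r i f ∙ (s ⋆ idm f) ∙ lui f.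
have epi (u v : mor (x · f) (x · f')) : u ∙ (a • f) = v ∙ (a • f) -> u = v.
  by move=> E; rewrite -[u]cmpm1 -[v]cmpm1 -(whf1 (pa Q f) ab) !cmpA E.
have cE : x ◂ c = h.
  apply: epi; rewrite pa2N /c cell_act.
  pose G (m : Q Z) := pwi i f' m ∙ (m ◂ g) ∙ pw i f m.
  rewrite -[X in _ ∙ X ∙ _]/(G (y · i · r)).
  have GN : G y ∙ (act • i • f) = (act • i • f') ∙ G (y · i · r).
    by rewrite /G -!cmpA pwN; rq (pa2N g act); rq (pwiN i f' act).
  have GE : (a • f') ∙ G y = h ∙ (a • f).
    by rewrite /G !cmpA gE -cmpA (inv12 (pwP i f y)) cmpm1.
  move: split_action_absorb ap; rewrite /p; move: (G _) (G _) GN GE (capf eps _) (cupf s _).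
  move=> G1 G2 GN GE c' u ac a1; rewrite -!cmpA; rq (whf (pa Q f') ac); rq (esym GN); rq GE.
  by rewrite -!fmor_cmp a1.
exists c; split=> // c' c'E; apply: whisker_split_inj.
have iE c0 : x ◂ c0 = h -> g = idm i ⋆ c0.
  by move=> c0E; apply: gU; rewrite -cmpA pwiNr cmpA -pa2N c0E.
by rewrite -(iE c) // -(iE c').
Qed.

End SplitAction.

Section SplitMonad.
Variables (k : fieldType) (D : linbicat k) (Z X : D) (E : monad Z).
Variables (i : hm X Z) (r : hm Z X) (eta : mor (one Z) (i ∘ r)) (eps : mor (r ∘ i) (one X)).
Variable phi : mor (E : hm Z Z) (i ∘ r).
Hypothesis phi_mul : phi ∙ mon_mul E = (idm i ⋆ (lu r ∙ (eps ⋆ idm r) ∙ asci r i r))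
  ∙ asc i r (i ∘ r) ∙ (phi ⋆ phi).

(** Compatibility of [phi] with products, in strict form: the product of [E] becomes the contraction
    of [r] against [i] by [eps]. *)
Lemma split_monad_mul (N : psh D) (n : N Z) :
  pwi i r n ∙ (n ◂ phi) ∙ (n ◂ mon_mul E ∙ pw E E n)
  = (capf eps (n · i) • r) ∙ ((pwi i r (n · i · r) ∙ (n · i · r ◂ phi)) ∙ ((pwi i r n ∙ (n ◂ phi)) • (E : hm Z Z))).
Proof.
have K (m : N X) : m ◂ (lu r ∙ (eps ⋆ idm r) ∙ asci r i r) ∙ pw r (i ∘ r) m
    = (capf eps m • r) ∙ pwi i r (m · r).
  rewrite !pa2_cmp /capf !fmor_cmp -!cmpA -pui_pwi_l.
  apply: (cancel_r (pwP i r (m · r))); rewrite -!cmpA.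
  rewrite (inv12 (pwP i r (m · r))) cmpm1; rq (pasc_inv r i r m); rq (esym (pwNl eps r m)).
  by rewrite (cancelK _ (pwP (one X) r m)).
have A : n ◂ asc i r (i ∘ r) ∙ pw (i ∘ r) (i ∘ r) n
    = pw i (r ∘ (i ∘ r)) n ∙ pw r (i ∘ r) (n · i) ∙ (pwi i r n • (i ∘ r)).
  apply: (cancel_r (inverse_fmor (pa N (i ∘ r)) (pwP i r n))).
  by rewrite pasc -!cmpA (whf1 _ (inv12 (pwP i r n))) cmpm1.
move: (K (n · i)) phi_mul; move: (capf eps (n · i)) (lu r ∙ _ ∙ _) => c Kc {}K phiE.
rewrite -cmpA (cmpA (n ◂ phi)) -pa2_cmp phiE -(hc2_rl phi phi) !pa2_cmp fmor_cmp -!cmpA.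
rq (esym (pwNl phi E n)); rq (esym (pwNr (i ∘ r) phi n)); rq A; rq (esym (pwNr i Kc n)).
by rewrite (cancelK _ (pwP i r n)); rq K; rq (pa2N phi (pwi i r n)).
Qed.

End SplitMonad.

(** Both retractions are kept for later: [x] is a retract of [y · i] and inherits orthogonality from
    [y], while [y] is a retract of [x · r], so that [x] reaches the summands of [y]. *)
Theorem split_end (k : fieldType) (D : linbicat k) (adj : has_adjoints D) (Q : psh D) (Z : D)
  (idem : forall X, idempotent_complete1 (Q X)) (y : Q Z) (E : monad Z) (ev : mor (y · E) y) :
  universal ev -> ev ∙ (y ◂ mon_mul E) ∙ pw E E y = ev ∙ (ev • (E : hm Z Z)) ->
  ev ∙ (y ◂ mon_unit E) ∙ pu y = idm y -> separably_splits E ->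
  exists (X : D) (x : Q X) (i : hm X Z) (r : hm Z X) (a : mor (y · i) x) (b : mor x (y · i))
    (a' : mor (x · r) y) (b' : mor y (x · r)),
  [/\ fully_faithful_at x, a ∙ b = idm x & a' ∙ b' = idm y].
Proof.
move=> evU evM ev1 [X [i [r [eta [eps [_ [s epss] [phi [[psi phiP] phi1 phiM]]]]]]]].
pose act : mor (y · i · r) y := ev ∙ (y ◂ psi ∙ pw i r y).
pose ph (N : psh D) (n : N Z) := pwi i r n ∙ (n ◂ phi).
have phP (N : psh D) (n : N Z) : inverse (ph N n) (n ◂ psi ∙ pw i r n).
  apply: inverse_cmp; first exact: inverse_pa2.
  by apply: inverse_sym; apply: pwP.
have phN (N : psh D) (n m : N Z) (u : mor n m) : ph N m ∙ (u • (E : hm Z Z)) = u • i • r ∙ ph N n.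
  by rewrite /ph -cmpA pa2N !cmpA pwiN.
have actph : act ∙ ph Q y = ev by rewrite /act -cmpA (inv12 (phP Q y)) cmpm1.
have act_cup : act ∙ cupf eta y = idm y.
  rewrite /cupf -phi1 pa2_cmp -[RHS]ev1 -[in RHS]actph /ph !cmpA.
  by [].
have act_act : act ∙ (act • i • r) = act ∙ (capf eps (y · i) • r).
  have inv := inverse_cmp (inverse_fmor (pa Q (E : hm Z Z)) (phP Q y)) (phP Q (y · i · r)).
  apply: (cancel_r inv); have := split_monad_mul phiM y; rewrite -/(ph _ _) -/(ph _ _).
  move: (capf eps _) => c SM; clear inv phP; clearbody act ph.
  rewrite -!cmpA; rq (esym (phN _ _ _ act)); rq actph; rewrite -fmor_cmp actph.
  by rq (esym SM); rq actph; rewrite -evM -cmpA.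
have actU : universal (act ∙ pwi i r y).
  move=> v f; have [c [cE cU]] := evU v f; exists (phi ∙ c); split=> [|d dE].
    rewrite pa2_cmp -cE -actph /ph !cmpA.
    by [].
  rewrite (cU (psi ∙ d)) ?cmpA ?(inv21 phiP) ?cmp1m // pa2_cmp -dE /act.
  by rewrite -!cmpA (cancelK _ (inverse_sym (pwP i r y))).
pose p := (act • i) ∙ cupf s (y · i).
have [x [a [b [ab ba]]]] := idem X _ p (split_action_idem epss act_act).
exists X, x, i, r, a, b, (act ∙ (b • r)), ((a • r) ∙ cupf eta y); split=> //.
  exact: (split_action_ff adj epss act_act actU ab ba).
exact: (split_action_retract epss act_cup act_act ba).
Qed.

(** * Representability *)

Section SimplePoint.
Variables (k : closedFieldType) (D : linbicat k) (lss : locally_semisimple D).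
Hypothesis splits : forall (Y : D) (E : monad Y), separable E -> separably_splits E.

(** A retract of the unit is idempotent: [io] has a left inverse, so its two whiskerings with [u]
    agree, and product and coproduct become inverse isomorphisms between [u ∘ u] and [u]. *)
Lemma retract_of_one_separable (Z : D) (u : hm Z Z) (io : mor u (one Z)) (p : mor (one Z) u) :
  p ∙ io = idm u -> exists E : monad Z, (E : hm Z Z) = u /\ separable E.
Proof.
move=> pio.
pose I : fam (at_ u) (idw Z) := fun N n => pui n ∙ (n ◂ io).
pose P : fam (idw Z) (at_ u) := fun N n => n ◂ p ∙ pu n.
have Id : isd _ _ I := isd_cmp (isd_pui Z) (isd_2mor io).
have Pd : isd _ _ P := isd_cmp (isd_2mor p) (isd_pu Z).
have PI (N : psh D) (n : N Z) : P N n ∙ I N n = idm (n · u).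
  by rewrite /P /I -!cmpA (cancelK _ (inverse_sym (puP n))) -pa2_cmp pio pa2_id.
clearbody P I.
have IN (N : psh D) (n m : N Z) (f : mor n m) : I N m ∙ (f • u) = f ∙ I N n by exact: (proj1 Id).
have PN (N : psh D) (n m : N Z) (f : mor n m) : P N m ∙ f = (f • u) ∙ P N n by exact: (proj1 Pd).
have II (N : psh D) (n : N Z) : I N (n · u) = I N n • u.
  have h : I N n ∙ I N (n · u) = I N n ∙ (I N n • u) by rewrite IN.
  have := congr1 (fun w => P N n ∙ w) h; rewrite /= !cmpA PI cmp1m => ->.
  by rewrite cmp1m.
have r1 (N : psh D) (n : N Z) : I N (n · u) ∙ P N (n · u) = idm (n · u).
  by rewrite II -PN PI.
have [m [e [mA [m1l [m1r [sep _ _]]]]]] : exists (m : mor (u ∘ u) u) (e : mor (one Z) u)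
  (mA : m ∙ (m ⋆ idm u) = m ∙ (idm u ⋆ m) ∙ asc u u u)
  (m1l : m ∙ (e ⋆ idm u) = lu u) (m1r : m ∙ (idm u ⋆ e) = ru u),
  [/\ separable (Monad mA m1l m1r),
      forall (N : psh D) (n : N Z), n ◂ m ∙ pw u u n = I N (n · u) &
      forall (N : psh D) (n : N Z), n ◂ e ∙ pu n = P N n].
  apply: (monad_of_fam (mu := fun N n => I N (n · u)) (co := fun N n => P N (n · u)) _ Pd).
  - by isd_cast (isd_l (at_ u) Id).
  - by isd_cast (isd_l (at_ u) Pd).
  - by move=> N n; rewrite IN.
  - by move=> N n; rewrite IN PI.
  - by [].
  - by [].
  - by move=> N n; rewrite PI -II r1.
  - by move=> N n; rewrite PI IN PI.
by exists (Monad mA m1l m1r).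
Qed.

(** [one Z] need not be simple. A simple summand of it that acts nontrivially on [z] is a separable
    monad, and splitting it gives [X]. An endomorphism of [one X] is a scalar: whiskered with [i]
    and [r] it becomes an endomorphism of the simple [i ∘ r], and the split counit [eps] removes
    both whiskerings. *)
Lemma simple_point (Q : psh D) (Z : D) (z : Q Z) : ~ is_zero z ->
  exists (X : D) (g : hm X Z), is_simple (one X : lhm X X) /\ ~ is_zero (z · g).
Proof.
move=> znz; have [q [S [Ss [io [p [pio _ iop]]]]]] := ss1_dsum (lss Z Z) (one Z).
have [j zj] : exists j, ~ is_zero (z · (S j : hm Z Z)).
  apply: contrapT => H; apply: znz; apply: (is_zero_iso (x := z · one Z)).
    by exists (pui z), (pu z); apply: inverse_sym; apply: puP.
  apply: is_zero_idm; rewrite -pa2_id -iop pa2_sum big1 // => j _.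
  have zj : is_zero (z · (S j : hm Z Z)) by apply: contrapT => zj; apply: H; exists j.
  by rewrite pa2_cmp [(z ◂ p j : lmor _ _)](proj2 (zj _)) m0r.
have [E [Eu sep]] := retract_of_one_separable (pio j).
have [X [i [r [eta [eps [adj [s epss] [phi [phii _ _]]]]]]]] := splits sep.
have iru : isomorphic (E : hm Z Z) (i ∘ r) by exists phi.
have irs : is_simple (i ∘ r : lhm Z Z).
  by apply: (@simple_iso _ (lhm Z Z) (E : hm Z Z) _ iru); rewrite Eu; apply: Ss.
have zinz : ~ is_zero (z · i).
  move=> zi; apply: zj; apply: (is_zero_iso (x := z · i · r)).
    apply: (isomorphic_trans (y := z · (i ∘ r))).
      by exists (pw i r z), (pwi i r z); apply: pwP.
    rewrite -Eu; have [psi phiP] := phii; exists (z ◂ psi), (z ◂ phi).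
    exact/inverse_pa2/inverse_sym.
  by apply: is_zero_idm; rewrite -fmor_id [idm (z · i)](proj1 (zi _)) pa0.
exists X, i; split=> //.
apply: (simple_of_end (lss X X)) => [onz|f].
  apply: zinz; apply: is_zero_idm; rewrite -(inv12 (puP (z · i))).
  rewrite -[pu _]cmp1m -pa2_id [idm (one X)](proj1 (onz _)) pa20 m0l m0r.
  by [].
pose F (N : psh D) (m : N X) : lmor m m := pui m ∙ (m ◂ f) ∙ pu m.
have FN (N : psh D) (m m' : N X) (h : mor m m') : F N m' ∙ h = h ∙ F N m.
  rewrite /F -!cmpA puN; rq (pa2N f h); rewrite !cmpA; congr (_ ∙ _ ∙ _).
  by rewrite puiN.
pose fr := lu r ∙ (f ⋆ idm r) ∙ lui r.
have frE (N : psh D) (m : N X) : m ◂ fr = F N m • r.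
  rewrite /fr /F !pa2_cmp -pw_pu_l !fmor_cmp -!cmpA; rq (esym (pwNl f r m)).
  by rewrite -pui_pwi_l -!cmpA (cancelK _ (pwP (one X) r m)).
have [c cE] : exists c, (idm i ⋆ fr) = c *: (idm (i ∘ r) : @lmor k (lhm Z Z) _ _).
  exists (scal (idm i ⋆ fr : @lmor k (lhm Z Z) _ _)).
  exact: (schur_end (lss Z Z) _ irs).
exists c.
have F1 (N : psh D) (n : N Z) : F N (n · i) • r = c *: (idm _ : lmor _ _) :> lmor _ _.
  rewrite -frE -[LHS]cmp1m -(inv12 (pwP i r n)) -cmpA pwNr cE pa2Z pa2_id.
  by rewrite mZl cmp1m mZr (inv12 (pwP i r n)).
have cc (N : psh D) (n : N X) : capf eps n ∙ cupf s n = idm n by apply: cap_cup.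
have F2 (N : psh D) (n : N Z) : F N (n · i) = c *: (idm _ : lmor _ _) :> lmor _ _.
  rewrite -[LHS]cmpm1 -(cc N (n · i)) cmpA -(capfN eps (F N (n · i))) F1.
  by rewrite paZ fmor_id mZr cmpm1 mZl cc.
have F3 (N : psh D) (m : N X) : F N m = c *: (idm _ : lmor _ _) :> lmor _ _.
  by rewrite -[LHS]cmpm1 -(cc N m) cmpA FN F2 mZr cmpm1 mZl cc.
apply: one_l_inj; have E1 := F3 (reg X) (one X).
have : (one X : reg X X) ◂ f = pu (one X : reg X X) ∙ F (reg X) (one X) ∙ pui (one X : reg X X).
  rewrite /F -!cmpA (cancelK _ (inverse_sym (puP (one X : reg X X)))) (inv21 (puP (one X : reg X X))).
  by rewrite cmpm1.
rewrite E1 mZr mZl cmpm1 (inv21 (puP _)) => E2; apply: (etrans E2).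
by rewrite -pa2_id -pa2Z.
Qed.

End SimplePoint.

Section FullyFaithful.
Variables (k : fieldType) (D : linbicat k) (Q : psh D) (X : D) (x : Q X).
Hypothesis xff : fully_faithful_at x.

Lemma ff_inj W (f g : hm W X) (a b : mor f g) : x ◂ a = x ◂ b -> a = b.
Proof. by move=> E; have [c [_ U]] := xff (x ◂ b); rewrite -(U a) // (U b). Qed.

Lemma ff_full W (f g : hm W X) (h : mor (x · f) (x · g)) : exists a : mor f g, x ◂ a = h.
Proof. by have [c [cE _]] := xff h; exists c. Qed.

Lemma ff_iso W (f g : hm W X) : isomorphic (x · f) (x · g) -> isomorphic f g.
Proof.
move=> [h [h' [h'h hh']]]; have [a aE] := ff_full h; have [b bE] := ff_full h'.
by exists a, b; split; apply: ff_inj; rewrite pa2_cmp pa2_id aE bE.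
Qed.

(** The idempotent [b ∙ a] comes from an idempotent of [v], which splits in [Hom(W, X)]. *)
Lemma ff_retract W (v : hm W X) (z : Q W) (a : mor (x · v) z) (b : mor z (x · v)) :
  idempotent_complete1 (hm W X) -> a ∙ b = idm z -> exists h : hm W X, isomorphic z (x · h).
Proof.
move=> idem ab; have [e eE] := ff_full (b ∙ a).
have [h [p [q [pq qp]]]] : exists (h : hm W X) (p : mor v h) (q : mor h v), p ∙ q = idm h /\ q ∙ p = e.
  apply: idem; apply: ff_inj; rewrite pa2_cmp eE -cmpA (cmpA a) ab cmp1m.
  by [].
exists h, (x ◂ p ∙ b), (a ∙ (x ◂ q)); split.
  by rewrite -cmpA (cmpA (x ◂ q)) -pa2_cmp qp eE -!cmpA ab cmpm1.
rewrite -cmpA (cmpA b) -eE -qp -!pa2_cmp -pa2_id; congr (x ◂ _).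
by rewrite -!cmpA pq cmpm1.
Qed.

End FullyFaithful.

(** Links two notions of simplicity: the fusion arguments need [one Z] simple, while finiteness of
    [D] counts objects without proper fully faithful 1-morphisms. For fully faithful [f] from a
    nonzero object, the counit into [one Z] is nonzero, hence split, which makes [one Z] isomorphic
    to some [f ∘ g]. *)
Lemma simple2_of_simple_one (k : closedFieldType) (D : linbicat k) (hD : semisimple2 D) (Z : D) :
  is_simple (one Z : lhm Z Z) -> is_simple2 Z.
Proof.
have [lss adj _ [idem _]] := hD => Z1; split=> [|X f fff]; first exact: (proj1 Z1).
have xff : fully_faithful_at (f : reg Z X).
  move=> W g h b; have [T TK KT] := fff W g h; exists (T b); split=> [|c <-]; first exact: KT.
  exact: TK.
have [[X0|Xnz] _] := (pselect (is_zero2 X), tt); [by left | right].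
have [_ [f' [eta [eps ad]]]] := adj _ _ f.
(* If [eps] vanished, the snake equation would make [idm f] zero, and faithfulness would make [X]
   zero. *)
have [s sE] : exists s : mor (one Z) (f ∘ f'), eps ∙ s = idm (one Z).
  apply: (simple_section (lss Z Z) Z1); apply/eqP => eps0; apply: Xnz; apply: is_zero_idm.
  apply: (ff_inj xff); rewrite [RHS]pa20 pa2_id.
  have f0 : (idm f : @lmor k (lhm X Z) _ _) = 0.
    rewrite -(proj1 ad) [_ ⋆ _](_ : _ = 0 :> @lmor k (lhm X Z) _ _); last first.
      rewrite eps0; exact: (lin0 (@lb_hcl _ D _ _ _ (f ∘ f') (one Z) f f (idm f))).
    by rewrite (m0r (D := lhm X Z)) !(m0l (D := lhm X Z)).
  have fz := is_zero_idm f0.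
  have fo : isomorphic (f : lhm X Z) (f ∘ one X) by exists (rui f), (ru f); apply/inverse_sym/ruP.
  exact: (proj1 (is_zero_iso fo fz _)).
have [g [h hP]] : exists g : hm Z X, isomorphic (one Z : reg Z Z) ((f : reg Z X) · g).
  exact: (ff_retract xff (v := f') (idem _ _) sE).
exists g; split; last by apply: isomorphic_sym; exists h.
apply: (ff_iso xff); apply: (isomorphic_trans (y := (f ∘ g) ∘ f : reg Z X)).
  by exists (asci f g f), (asc f g f); apply/inverse_sym/ascP.
apply: (isomorphic_trans (y := one Z ∘ f : reg Z X)).
  have [h' hh] := hP; exists (h' ⋆ idm f), (h ⋆ idm f).
  by apply: inverse_hc2 (inverse_sym hh) (inverse_id f).
apply: (isomorphic_trans (y := f : reg Z X)); first by exists (lu f), (lui f); apply: luP.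
by exists (rui f), (ru f); apply/inverse_sym/ruP.
Qed.

(** * Fully faithful points on direct sums *)

Section DirectSumLift.
Variables (k : fieldType) (D : linbicat k) (S A A' : D).
Variables (io : hm A S) (rh : hm S A) (j : mor (io ∘ rh) (one S)) (q : mor (one S) (io ∘ rh)).
Variables (io' : hm A' S) (rh' : hm S A') (j' : mor (io' ∘ rh') (one S)) (q' : mor (one S) (io' ∘ rh')).
Hypotheses (qj : q ∙ j = idm (io ∘ rh))
  (jq : (j ∙ q : @lmor k (lhm S S) _ _) + (j' ∙ q' : @lmor k (lhm S S) _ _) = idm (one S))
  (io_rh' : is_zero (rh ∘ io' : lhm A' A)) (rh'_io : is_zero (rh' ∘ io : lhm A A')).
Variables (t : mor (rh ∘ io) (one A)) (t' : mor (one A) (rh ∘ io)).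
Hypothesis tP : inverse t t'.

Let zero_act (N : psh D) B B' (h : hm B B') (n : N B') : is_zero (h : lhm B B') -> is_zero (n · h).
Proof.
by move=> hz; apply: is_zero_idm; rewrite -pa2_id [idm h](proj1 (hz _)) pa20.
Qed.

Lemma capf_cupf X Y (l : hm X Y) (r : hm Y X) (e : mor (l ∘ r) (one Y)) (u : mor (one Y) (l ∘ r)) (N : psh D) (n : N Y) :
  capf e n ∙ cupf u n = pui n ∙ (n ◂ (e ∙ u)) ∙ pu n.
Proof.
by rewrite /capf /cupf -!cmpA (cancelK _ (inverse_sym (pwP l r n))) (cmpA (n ◂ e)) -pa2_cmp.
Qed.

Lemma cupf_capf X Y (l : hm X Y) (r : hm Y X) (e : mor (l ∘ r) (one Y)) (u : mor (one Y) (l ∘ r)) (N : psh D) (n : N Y) :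
  cupf u n ∙ capf e n = pwi l r n ∙ (n ◂ (u ∙ e)) ∙ pw l r n.
Proof.
by rewrite /capf /cupf -!cmpA (cancelK _ (inverse_sym (puP n))) (cmpA (n ◂ u)) -pa2_cmp.
Qed.

Lemma dsum_cup_cap (N : psh D) (n : N S) :
  (capf j n ∙ cupf q n : lmor n n) + (capf j' n ∙ cupf q' n : lmor n n) = idm n.
Proof.
rewrite !capf_cupf -mDl -mDr -(linD (pa2_lin n)) jq pa2_id cmpm1.
exact: inv12 (puP n).
Qed.

(** The obvious candidate is [b] whiskered with [io] and conjugated by [q] and [j]. But the
    isomorphism [t] need not satisfy the snake equations with [j] and [q]; the defect is an
    endomorphism [ka] of [rh] with right inverse [ka'], and [b] is first corrected by these two. *)
Lemma dsum_lift W (f g : hm W S) (b : mor (rh ∘ f) (rh ∘ g)) :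
  exists a : mor f g, idm rh ⋆ a = b /\ idm rh' ⋆ a = 0 :> @lmor k (lhm W A') _ _.
Proof.
have [cj cjE] : exists c : mor (rh ∘ io ∘ rh) rh, forall (N : psh D) (m : N A),
    m ◂ c = capf j (m · rh) ∙ (pwi rh io m • rh) ∙ pwi (rh ∘ io) rh m.
  by exists (capf j (rh : reg A S)) => N m; apply: act_reg_cap.
have [cq cqE] : exists c : mor rh (rh ∘ io ∘ rh), forall (N : psh D) (m : N A),
    m ◂ c = pw (rh ∘ io) rh m ∙ (pw rh io m • rh) ∙ cupf q (m · rh).
  by exists (cupf q (rh : reg A S)) => N m; apply: act_reg_cup.
pose ka := cj ∙ (t' ⋆ idm rh) ∙ lui rh : mor rh rh.
pose ka' := lu rh ∙ (t ⋆ idm rh) ∙ cq : mor rh rh.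
have kaE (N : psh D) (m : N A) : m ◂ ka = capf j (m · rh) ∙ (cupf t' m • rh).
  rewrite /ka !pa2_cmp cjE -pw_pu_l; generalize (capf j (m · rh)) => c.
  rewrite /cupf !fmor_cmp -!cmpA; rq (esym (pwNl t' rh m)).
  by rewrite (cancelK _ (pwP (rh ∘ io) rh m)).
have kaE' (N : psh D) (m : N A) : m ◂ ka' = (capf t m • rh) ∙ cupf q (m · rh).
  rewrite /ka' !pa2_cmp cqE; generalize (cupf q (m · rh)) => c.
  rewrite /capf !fmor_cmp -!cmpA; rq (esym (pwNl t rh m)).
  by rewrite -pui_pwi_l -!cmpA (cancelK _ (pwP (one A) rh m)).
clearbody ka ka'.
pose b' := (ka' ⋆ idm g) ∙ b ∙ (ka ⋆ idm f).
pose a := lu g ∙ (j ⋆ idm g) ∙ asci io rh g ∙ (idm io ⋆ b') ∙ asc io rh f ∙ (q ⋆ idm f) ∙ lui f.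
pose B (b0 : mor (rh ∘ f) (rh ∘ g)) (N : psh D) (m : N A) := pwi rh g m ∙ (m ◂ b0) ∙ pw rh f m.
have aE (N : psh D) (n : N S) : n ◂ a = (capf j n • g) ∙ B b' N (n · io) ∙ (cupf q n • f).
  by rewrite /a cell_act.
have BN b0 (N : psh D) (m m' : N A) (u : mor m m') : B b0 N m' ∙ (u • rh • f) = (u • rh • g) ∙ B b0 N m.
  by rewrite /B -!cmpA pwN; rq (pa2N b0 u); rq (pwiN rh g u).
have b'E (N : psh D) (m : N A) : B b' N m = ((m ◂ ka') • g) ∙ B b N m ∙ ((m ◂ ka) • f).
  rewrite /B /b' !pa2_cmp -!cmpA -pwNl; rq (pwiNl ka' g m).
  by [].
have T1 (N : psh D) (m : N A) : capf t m ∙ cupf t' m = idm m.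
  by rewrite capf_cupf (inv21 tP) pa2_id cmpm1 (inv12 (puP m)).
have T2 (N : psh D) (m : N A) : cupf t' m ∙ capf t m = idm _.
  by rewrite cupf_capf (inv12 tP) pa2_id cmpm1 (inv12 (pwP rh io m)).
have Q1 (N : psh D) (n : N S) : cupf q n ∙ capf j n = idm _.
  by rewrite cupf_capf qj pa2_id cmpm1 (inv12 (pwP io rh n)).
have J1 (N : psh D) (m : N A) : capf j (m · rh) ∙ cupf q (m · rh) = idm (m · rh).
  rewrite -(dsum_cup_cap (m · rh)).
  have z : is_zero (m · rh · io').
    apply: (is_zero_iso (x := m · (rh ∘ io'))); last exact: zero_act.
    by exists (pwi rh io' m), (pw rh io' m); apply/inverse_sym/pwP.
  have -> : cupf q' (m · rh) = 0 :> lmor _ _.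
    have h (w : lmor (m · rh) (m · rh · io' · rh')) : w = 0.
      rewrite -[w]cmp1m -fmor_id [idm (m · rh · io')](proj1 (z _)) pa0 m0l.
      by [].
    exact: h.
  by rewrite m0r addr0.
have K1 (N : psh D) (m : N A) : m ◂ ka ∙ (m ◂ ka') = idm _.
  rewrite kaE kaE' -[LHS]cmpA (cmpA (cupf t' m • rh)) -(fmor_cmp (pa N rh)) T2 fmor_id cmp1m.
  exact: J1.
have inj (N : psh D) (m : N A) : m · rh ◂ a = B b N m.
  have E : B b' N (m · rh · io) = (cupf t' m • rh • g) ∙ B b' N m ∙ (capf t m • rh • f).
    by rewrite -BN -cmpA -!fmor_cmp T2 !fmor_id cmpm1.
  rewrite aE E (b'E N m); move: (B b N m) (kaE N m) (kaE' N m) (K1 N m).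
  move: (capf j _) (cupf q _) (cupf t' _) (capf t _) => c1 c2 c3 c4 Bm e1 e2 K.
  rewrite !cmpA -(fmor_cmp (pa N g)) -e1 -!cmpA -(fmor_cmp (pa N f)) -e2.
  by rewrite -(fmor_cmp (pa N f)) K fmor_id cmpm1 cmpA -(fmor_cmp (pa N g)) K fmor_id cmp1m.
have act0 (N : psh D) (m : N A') : m · rh' ◂ a = 0 :> lmor _ _.
  have z : is_zero (m · rh' · io).
    apply: (is_zero_iso (x := m · (rh' ∘ io))); last exact: zero_act.
    by exists (pwi rh' io m), (pw rh' io m); apply/inverse_sym/pwP.
  rewrite aE; have -> : B b' N (m · rh' · io) = 0 :> lmor _ _.
    rewrite -[LHS]cmpm1 -(fmor_id (pa N f)) -(fmor_id (pa N rh)) [idm (m · rh' · io)](proj1 (z _)) !pa0 m0r.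
    by [].
  by rewrite m0r m0l.
have wh B' (h : hm S B') (c : mor f g) (N : psh D) (m : N B') :
    m ◂ (idm h ⋆ c) = pw h g m ∙ (m · h ◂ c) ∙ pwi h f m.
  by rewrite pwNr -cmpA (inv21 (pwP h f m)) cmpm1.
exists a; split.
  suff H (N : psh D) (m : N A) : m ◂ (idm rh ⋆ a) = m ◂ b by exact: one_l_inj (H (reg A) (one A)).
  rewrite wh inj /B -!cmpA (inv21 (pwP rh f m)) cmpm1.
  by rewrite (cancelK _ (inverse_sym (pwP rh g m))).
suff H (N : psh D) (m : N A') : m ◂ (idm rh' ⋆ a) = m ◂ (0 : @lmor k (lhm W A') (rh' ∘ f) (rh' ∘ g)).
  exact: one_l_inj (H (reg A') (one A')).
by rewrite wh act0 m0r m0l pa20.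
Qed.

End DirectSumLift.

(** The point is [x1 · r1] plus [x2 · r2]. By orthogonality a map between its restrictions is block
    diagonal; each block lifts by full faithfulness of one summand, and [dsum_lift] extends the lift
    by zero. *)
Lemma direct_sum_ff (k : fieldType) (D : linbicat k) (Q : psh D) (addQ : forall X, additive1 (Q X))
  (A1 A2 S : D) (x1 : Q A1) (x2 : Q A2) :
  is_dsum_ob A1 A2 S -> fully_faithful_at x1 -> fully_faithful_at x2 ->
  (forall W (v : hm W A1) (w : hm W A2) (h : lmor (x1 · v) (x2 · w)), h = 0) ->
  (forall W (v : hm W A1) (w : hm W A2) (h : lmor (x2 · w) (x1 · v)), h = 0) ->
  exists (x : Q S) (r1 : hm S A1) (r2 : hm S A2) (u1 : mor (x1 · r1) x) (u2 : mor (x2 · r2) x)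
    (v1 : mor x (x1 · r1)) (v2 : mor x (x2 · r2)) (i1 : hm A1 S) (i2 : hm A2 S),
  [/\ fully_faithful_at x, v1 ∙ u1 = idm _, v2 ∙ u2 = idm _,
      isomorphic (r1 ∘ i1) (one A1) & isomorphic (r2 ∘ i2) (one A2)].
Proof.
move=> [i1 [i2 [r1 [r2 [[t1 t2] z12 z21 [j1 [j2 [q1 [q2 [qj1 qj2 _ _ jq]]]]]]]]]] ff1 ff2 o12 o21.
have [x [u1 [u2 [v1 [v2 [vu1 vu2 vu21 vu12 uv]]]]]] := proj2 (addQ S) (x1 · r1) (x2 · r2).
exists x, r1, r2, u1, u2, v1, v2, i1, i2; split=> //.
have jq' : (j2 ∙ q2 : @lmor k (lhm S S) _ _) + (j1 ∙ q1 : @lmor k (lhm S S) _ _) = idm (one S).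
  by rewrite addrC.
have [T1 [T1' tP1]] := t1; have [T2 [T2' tP2]] := t2.
have o12' W (f g : hm W S) (h : lmor (x1 · r1 · f) (x2 · r2 · g)) : h = 0.
  have E := o12 _ _ _ (pw r2 g x2 ∙ h ∙ pwi r1 f x1 : lmor _ _).
  rewrite -[h]cmp1m -(inv12 (pwP r2 g x2)) -[LHS]cmpm1 -(inv12 (pwP r1 f x1)).
  have -> : pwi r2 g x2 ∙ pw r2 g x2 ∙ h ∙ (pwi r1 f x1 ∙ pw r1 f x1) =
     pwi r2 g x2 ∙ (pw r2 g x2 ∙ h ∙ pwi r1 f x1) ∙ pw r1 f x1 by rewrite !cmpA.
  by rewrite E m0r m0l.
have o21' W (f g : hm W S) (h : lmor (x2 · r2 · f) (x1 · r1 · g)) : h = 0.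
  have E := o21 _ _ _ (pw r1 g x1 ∙ h ∙ pwi r2 f x2 : lmor _ _).
  rewrite -[h]cmp1m -(inv12 (pwP r1 g x1)) -[LHS]cmpm1 -(inv12 (pwP r2 f x2)).
  have -> : pwi r1 g x1 ∙ pw r1 g x1 ∙ h ∙ (pwi r2 f x2 ∙ pw r2 f x2) =
     pwi r1 g x1 ∙ (pw r1 g x1 ∙ h ∙ pwi r2 f x2) ∙ pw r2 f x2 by rewrite !cmpA.
  by rewrite E m0r m0l.
have wh W (f g : hm W S) (c : mor f g) B (r : hm S B) (m : Q B) :
    m · r ◂ c = pwi r g m ∙ (m ◂ (idm r ⋆ c)) ∙ pw r f m.
  by rewrite pwiNr -cmpA (inv12 (pwP r f m)) cmpm1.
have uvf W (f : hm W S) : ((u1 • f) ∙ (v1 • f) : lmor (x · f) (x · f)) + ((u2 • f) ∙ (v2 • f) : lmor _ _) = idm (x · f).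
  by rewrite -!fmor_cmp -(linD (@lf_lin _ _ _ (pa Q f) x x)) uv fmor_id.
(* The off-diagonal blocks vanish by orthogonality. *)
have diag W (f g : hm W S) (h h' : lmor (x · f) (x · g)) :
  (v1 • g) ∙ h ∙ (u1 • f) = (v1 • g) ∙ h' ∙ (u1 • f) -> (v2 • g) ∙ h ∙ (u2 • f) = (v2 • g) ∙ h' ∙ (u2 • f) -> h = h'.
  move=> e1 e2.
  have decomp (h0 : lmor (x · f) (x · g)) : h0 =
     ((u1 • g) ∙ ((v1 • g) ∙ h0 ∙ (u1 • f)) ∙ (v1 • f) : lmor (x · f) (x · g)) +
     ((u2 • g) ∙ ((v2 • g) ∙ h0 ∙ (u2 • f)) ∙ (v2 • f) : lmor (x · f) (x · g)).
    rewrite -{1}[h0]cmp1m -{1}(uvf W g) mDl -[X in X + _]cmpm1 -[X in _ + X]cmpm1.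
    rewrite -{1 2}(uvf W f) !mDr -!cmpA.
    have -> : (v1 • g) ∙ (h0 ∙ ((u2 • f) ∙ (v2 • f))) = 0 :> lmor _ _.
      by rewrite 2!cmpA [_ ∙ _ ∙ (u2 • f)](o21' _ _ _ _) m0l.
    have -> : (v2 • g) ∙ (h0 ∙ ((u1 • f) ∙ (v1 • f))) = 0 :> lmor _ _.
      by rewrite 2!cmpA [_ ∙ _ ∙ (u1 • f)](o12' _ _ _ _) m0l.
    by rewrite !m0r addr0 add0r.
  by rewrite [h]decomp [h']decomp e1 e2.
have blk1 W (f g : hm W S) (c : mor f g) : (v1 • g) ∙ (x ◂ c) ∙ (u1 • f) = x1 · r1 ◂ c.
  by rewrite -cmpA pa2N cmpA -fmor_cmp vu1 fmor_id cmp1m.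
have blk2 W (f g : hm W S) (c : mor f g) : (v2 • g) ∙ (x ◂ c) ∙ (u2 • f) = x2 · r2 ◂ c.
  by rewrite -cmpA pa2N cmpA -fmor_cmp vu2 fmor_id cmp1m.
have inj W (f g : hm W S) (c c' : mor f g) : idm r1 ⋆ c = idm r1 ⋆ c' -> idm r2 ⋆ c = idm r2 ⋆ c' -> c = c'.
  move=> e1 e2.
  suff H (N : psh D) (m : N S) : m ◂ c = m ◂ c' by exact: one_l_inj (H (reg S) (one S)).
  have wh' (d : mor f g) B (r : hm S B) (n : N B) : n · r ◂ d = pwi r g n ∙ (n ◂ (idm r ⋆ d)) ∙ pw r f n.
    by rewrite pwiNr -cmpA (inv12 (pwP r f n)) cmpm1.
  have one_f := dsum_cup_cap jq m.
  have fE (d : mor f g) : m ◂ d = ((capf j1 m • g) ∙ (m · i1 · r1 ◂ d) ∙ (cupf q1 m • f) : lmor _ _)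
      + ((capf j2 m • g) ∙ (m · i2 · r2 ◂ d) ∙ (cupf q2 m • f) : lmor _ _).
    rewrite -!pa2N -!cmpA -!fmor_cmp -mDr -(linD (@lf_lin _ _ _ (pa N f) m m)) one_f fmor_id cmpm1.
    by [].
  by rewrite [LHS]fE [RHS]fE !wh' e1 e2.
move=> W f g h.
have [b1 b1E] := ff_full ff1 (pw r1 g x1 ∙ ((v1 • g) ∙ h ∙ (u1 • f)) ∙ pwi r1 f x1).
have [b2 b2E] := ff_full ff2 (pw r2 g x2 ∙ ((v2 • g) ∙ h ∙ (u2 • f)) ∙ pwi r2 f x2).
have [a1 [a1E a1E']] := dsum_lift qj1 jq z21 z12 tP1 b1.
have [a2 [a2E a2E']] := dsum_lift qj2 jq' z12 z21 tP2 b2.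
pose a : mor f g := (a1 : @lmor k (lhm W S) f g) + a2.
have ra1 : idm r1 ⋆ a = b1.
  rewrite /a [_ ⋆ _](linD (@lb_hcr _ D _ _ _ r1 r1 f g (idm r1))) a1E a2E'.
  exact: (@addr0 (@lmor k (lhm W A1) _ _) b1).
have ra2 : idm r2 ⋆ a = b2.
  rewrite /a [_ ⋆ _](linD (@lb_hcr _ D _ _ _ r2 r2 f g (idm r2))) a2E a1E'.
  exact: (@add0r (@lmor k (lhm W A2) _ _) b2).
exists a; split.
  apply: diag; rewrite ?blk1 ?blk2 wh ?ra1 ?ra2 ?b1E ?b2E -!cmpA (inv12 (pwP _ _ _)) cmpm1.
    by rewrite (cancelK _ (pwP _ _ _)).
  by rewrite (cancelK _ (pwP _ _ _)).
move=> c cE; apply: inj; rewrite ?ra1 ?ra2.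
  apply: (ff_inj ff1); rewrite b1E -cE blk1 wh -!cmpA (inv21 (pwP _ _ _)) cmpm1.
  by rewrite (cancelK _ (inverse_sym (pwP _ _ _))).
apply: (ff_inj ff2); rewrite b2E -cE blk2 wh -!cmpA (inv21 (pwP _ _ _)) cmpm1.
by rewrite (cancelK _ (inverse_sym (pwP _ _ _))).
Qed.

(** * Points that reach every object *)

Section Representability.
Variables (k : closedFieldType) (char0 : [pchar k] =i pred0) (D : linbicat k).
Hypothesis hD : finite_semisimple2 D.
Variables (Q : psh D) (fsQ : forall X, finite_semisimple1 (Q X)).

Let ssQ X : semisimple1 (Q X) := proj1 (fsQ X).
Let adj : has_adjoints D := ss2_adj (fss2_ss hD).

(** For simple [z] the map [h] splits, so [z] is a retract of [x · v]; if [x] is fully faithful, [z]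
    is then isomorphic to a value of [x · -]. *)
Definition reach X (x : Q X) Z (z : Q Z) := exists (v : hm Z X) (h : lmor (x · v) z), h != 0.

Lemma comp_section_neq0 (C : lincat k) (a b c : C) (h : lmor b c) (p : mor a b) (s : mor b a) :
  p ∙ s = idm b -> h != 0 -> (h ∙ p : lmor a c) != 0.
Proof.
move=> ps; apply: contraNneq => E.
by rewrite -[h]cmpm1 -ps cmpA E m0l.
Qed.

Lemma reach_simple X (x : Q X) Z (a z : Q Z) (g : lmor a z) :
  is_simple a -> g != 0 -> reach x a -> reach x z.
Proof.
move=> as_ gnz [v [h hnz]]; have [s hs] := simple_section (ssQ Z) as_ hnz.
by exists v, (g ∙ h); apply: comp_section_neq0 hs gnz.
Qed.

(** A nonzero map into [z · g] transposes, along the right adjoint of [g], to a nonzero map into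
    [z]. *)
Lemma reach_act X (x : Q X) Y Z (z : Q Z) (g : hm Y Z) : reach x (z · g) -> reach x z.
Proof.
move=> [v [h hnz]]; have [_ [g' [eta [eps ad]]]] := adj g.
exists (v ∘ g'), (capf eps z ∙ (h • g') ∙ pwi v g' x); apply: (comp_section_neq0 (inv12 (pwP v g' x))).
apply: contraNneq hnz => E; have := cupfN eta h; have := zigzag_l ad z.
move=> zz uN; have -> : h = ((capf eps z ∙ (h • g')) • g) ∙ cupf eta (x · v).
  by rewrite fmor_cmp -[RHS]cmpA -uN [RHS]cmpA zz cmp1m.
by rewrite E pa0 m0l.
Qed.

Lemma reach_iso X (x : Q X) Z (z z' : Q Z) : isomorphic z z' -> reach x z -> reach x z'.
Proof.
move=> [f [f' [f'f _]]] [v [h hnz]]; exists v, (f ∙ h); apply: contraNneq hnz => E.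
by rewrite -[h]cmp1m -f'f -cmpA E m0r.
Qed.

Lemma nonzero_back (C : lincat k) (ss : semisimple1 C) (a b : C) :
  (forall g : lmor b a, g = 0) -> forall f : lmor a b, f = 0.
Proof.
move=> H f; have [n [S [Ss [i [p [pi _ ip]]]]]] := ss1_dsum ss b.
rewrite -[f]cmp1m -ip cmp_suml big1 // => j _; rewrite -cmpA.
have [->|pf] := eqVneq (p j ∙ f : lmor _ _) 0; first exact: m0r.
have [s ps] := simple_section ss (Ss j) pf.
have := idm_neq0 (proj1 (Ss j)).
rewrite -(cmp1m (idm (S j))) -{1}ps -(pi j) -!cmpA (cmpA s) [s ∙ p j](H _) m0l !m0r.
by rewrite eqxx.
Qed.

Lemma nonzero_constituent (C : lincat k) (ss : semisimple1 C) (z : C) : ~ is_zero z ->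
  exists (a : C) (g : lmor a z), is_simple a /\ g != 0.
Proof.
move=> znz; have [n [S [Ss [i [p [pi _ ip]]]]]] := ss1_dsum ss z.
apply: contrapT => H; apply: znz; apply: is_zero_idm; rewrite -ip big1 // => j _.
have [->|inz] := eqVneq (i j : lmor _ _) 0; first exact: m0l.
by case: H; exists (S j), (i j).
Qed.

Definition hits X (x : Q X) Z := forall z : Q Z, ~ is_zero z -> reach x z.

Lemma hits_retract X (x : Q X) Y Y' (f : hm Y' Y) (g : hm Y Y') :
  isomorphic (f ∘ g) (one Y) -> hits x Y' -> hits x Y.
Proof.
move=> fg H z znz; apply: (reach_act (g := f)); apply: H => zf; apply: znz.
apply: (is_zero_iso (x := z · f · g)).
  apply: (isomorphic_trans (y := z · (f ∘ g))).
    by exists (pw f g z), (pwi f g z); apply: pwP.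
  apply: (isomorphic_trans (y := z · one Y)).
    by have [h [h' hh]] := fg; exists (z ◂ h), (z ◂ h'); apply: inverse_pa2.
  by exists (pui z), (pu z); apply/inverse_sym/puP.
by apply: is_zero_idm; rewrite -fmor_id [idm (z · f)](proj1 (zf _)) pa0.
Qed.

(** [y] is the sum of one copy of each simple object of [Q Z] that [x] does not reach. No [x · v]
    maps nontrivially to any [y · W], since such a map would transpose to one into [y]. So the
    constituents of [y · W] are again unreached, which is the stability needed for the Frobenius
    argument, and the point obtained from [y] is orthogonal to [x]. *)
Lemma extend_cover X (x : Q X) Z : fully_faithful_at x -> is_simple (one Z : lhm Z Z) ->
  exists X' (x' : Q X'), [/\ fully_faithful_at x', hits x' Z & forall Y, hits x Y -> hits x' Y].
Proof.
move=> xff Z1; have [r [T [Ts Tinj Tcov]]] := simple_reps (fsQ Z).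
pose U := [set i | ~~ `[< reach x (T i) >]].
pose M (j : 'I_#|U|) := T (enum_val j).
have MU j : ~ reach x (M j) by have := enum_valP j; rewrite inE => /asboolPn.
have [y [u [p [pu1 _ up]]]] := dsum_exists (ss1_additive (ssQ Z)) M.
have xy : ~ reach x y.
  move=> [v [h hnz]]; move/eqP: hnz; apply.
  rewrite -[h]cmp1m -up cmp_suml big1 // => j _; rewrite -cmpA.
  have [->|ph] := eqVneq (p j ∙ h : lmor _ _) 0; first exact: m0r.
  by case: (MU j); exists v, (p j ∙ h).
have xyW W (v : hm W X) (g : hm W Z) (h : lmor (x · v) (y · g)) : h = 0.
  apply/eqP; apply: contraT => hnz; case: xy; apply: (reach_act (g := g)).
  by exists v, h.
have Mcov W (a : Q Z) (f : lmor a (y · W)) : is_simple a -> f != 0 -> exists j, isomorphic a (M j).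
  move=> as_ fnz; have [i ai] := Tcov a as_.
  have iU : i \in U.
    rewrite inE; apply/asboolPn => /(reach_iso (isomorphic_sym ai)) /(reach_simple as_ fnz).
    by move=> /reach_act /xy.
  by exists (enum_rank_in iU i); rewrite /M enum_rankK_in.
have Minj i j : isomorphic (M i) (M j) -> i = j by move=> /Tinj /enum_val_inj.
have [E [ev [sep evU evM ev1]]] := enriched_end_separable char0 (fss2_local hD Z Z) adj Z1 (ssQ Z)
  (fun j => Ts _) Minj pu1 up Mcov.
have [X' [x' [i [r' [a [b [a' [b' [ff' ab ab']]]]]]]]] := split_end adj (fun X => ss1_idem (ssQ X))
  evU evM ev1 (proj2 (ss2_idem (fss2_ss hD)) _ _ sep).
have o1 W (v : hm W X) (w : hm W X') (h : lmor (x · v) (x' · w)) : h = 0.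
  have E0 := xyW _ _ _ (pw i w y ∙ (b • w) ∙ h : lmor _ _).
  rewrite -[h]cmp1m -fmor_id -ab fmor_cmp -[(b • w)]cmp1m -(inv12 (pwP i w y)) -!cmpA (cmpA (pw _ _ _)) E0.
  by rewrite !m0r.
have o2 W (v : hm W X) (w : hm W X') : forall h : lmor (x' · w) (x · v), h = 0.
  by apply: nonzero_back (ssQ W) _ _ _ => h; apply: o1.
have [S dS] := add2_dsum (ss2_additive (fss2_ss hD)) X X'.
have [x2 [r1 [r2 [u1 [u2 [v1 [v2 [i1 [i2 [ff2 vu1 vu2 t1 t2]]]]]]]]]] :=
  direct_sum_ff (fun X => ss1_additive (ssQ X)) dS xff ff' o1 o2.
(* Restricting [x2] along [i0] gives [w] back as a retract, so [x2] reaches whatever [w] reaches. *)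
have sum_reach A (w : Q A) (r0 : hm S A) (i0 : hm A S) (v0 : mor x2 (w · r0)) (u0 : mor (w · r0) x2) :
  v0 ∙ u0 = idm _ -> isomorphic (r0 ∘ i0) (one A) -> forall Y (z : Q Y), reach w z -> reach x2 z.
  move=> vu [t [t' tP]] Y z [v [h hnz]].
  exists (i0 ∘ v); pose c := pui w ∙ (w ◂ t) ∙ pw r0 i0 w.
  exists (h ∙ ((c ∙ (v0 • i0)) • v) ∙ pwi i0 v x2).
  have c' : c ∙ (pwi r0 i0 w ∙ (w ◂ t') ∙ pu w) = idm w.
    rewrite /c -!cmpA (cancelK _ (inverse_sym (pwP r0 i0 w))) (cmpA (w ◂ t)) -pa2_cmp.
    by rewrite (inv21 tP) pa2_id cmp1m (inv12 (puP w)).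
  apply: (comp_section_neq0 (inv12 (pwP i0 v x2))); move: c (pwi r0 i0 w ∙ _ ∙ _) c' => c c' cc'.
  apply: (comp_section_neq0 (s := ((u0 • i0) ∙ c') • v)) => //.
  by rewrite -fmor_cmp -cmpA (cmpA (v0 • i0)) -fmor_cmp vu fmor_id cmp1m cc' fmor_id.
have reach1 := sum_reach _ _ _ _ _ _ vu1 t1; have reach2 := sum_reach _ _ _ _ _ _ vu2 t2.
exists S, x2; split=> // [z znz|Y H z znz]; last exact/reach1/H.
have [c [g [cs gnz]]] := nonzero_constituent (ssQ Z) znz.
have [l cl] := Tcov c cs; have [hit|nhit] := pselect (reach x (T l)).
  exact/reach1/(reach_simple cs gnz)/(reach_iso (isomorphic_sym cl)).
have lU : l \in U by rewrite inE; apply/asboolPn.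
apply/reach2/(reach_simple cs gnz)/(reach_iso (isomorphic_sym cl)).
have -> : T l = M (enum_rank_in lU l) by rewrite /M enum_rankK_in.
move: (enum_rank_in lU l) => j; exists r', (p j ∙ a'); apply: (comp_section_neq0 ab').
apply: contraNneq (idm_neq0 (proj1 (Ts (enum_val j)))) => E0.
by rewrite -[idm _](pu1 j) E0 m0l.
Qed.

Lemma cover_all : exists X (x : Q X), fully_faithful_at x /\ forall Z, hits x Z.
Proof.
have lss := ss2_local (fss2_ss hD).
have [n [S Scov]] := fss2_simples hD.
suff [X [x [xff xhit]]] : exists X (x : Q X), fully_faithful_at x /\
    forall j (Y : D), is_simple (one Y : lhm Y Y) -> equivalent Y (S j) -> hits x (S j).
  exists X, x; split=> // Z z znz.
  have [Y [g [Y1 zg]]] := simple_point lss (proj2 (ss2_idem (fss2_ss hD))) znz.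
  have [j Yj] := Scov Y (simple2_of_simple_one (fss2_ss hD) Y1).
  apply: (reach_act (g := g)); have [f [f' [f'f _]]] := Yj.
  exact: (hits_retract f'f (xhit j Y Y1 Yj)).
suff H m : (m <= n)%N -> exists X (x : Q X), fully_faithful_at x /\
    forall (j : 'I_n) (Y : D), (j < m)%N -> is_simple (one Y : lhm Y Y) -> equivalent Y (S j) -> hits x (S j).
  by have [X [x [xff xH]]] := H n (leqnn n); exists X, x; split=> // j Y; apply: xH (ltn_ord j).
elim: m => [_|m IH mn].
  (* The induction starts at the zero object: all Hom-categories into it consist of zero objects, so
     any point over it is fully faithful. *)
  have [O Oz] := add2_zero (ss2_additive (fss2_ss hD)).
  have [x0 _] := proj1 (ss1_additive (ssQ O)).
  exists O, x0; split=> // W f g h.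
  have z0 (v : hm W O) : is_zero (v : lhm W O).
    apply: (is_zero_iso (x := one O ∘ v : lhm W O)).
      by exists (lu v), (lui v); apply: luP.
    apply: is_zero_idm; rewrite -hc2_id [idm (one O)](proj1 (Oz _)).
    exact: (lin0 (@lb_hcl _ D _ _ _ _ _ v v (idm v))).
  exists (0 : @lmor k (lhm W O) f g); split=> [|a _]; last exact/esym/(proj1 (z0 f g)).
  rewrite pa20 -[h]cmpm1 -pa2_id [idm f](proj1 (z0 f f)) pa20 m0r.
  by [].
have [X [x [xff xH]]] := IH (ltnW mn); pose j0 := Ordinal mn.
(* An entry of the list that is not equivalent to an object with simple unit can be skipped, since
   [simple_point] never leads to it. *)
have [[Y [Y1 Yj]]|N] := pselect (exists Y : D, is_simple (one Y : lhm Y Y) /\ equivalent Y (S j0)); last first.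
  exists X, x; split=> // j Y; rewrite ltnS leq_eqVlt => /orP [/eqP jm|jm] Y1 Yj; last exact: xH Yj.
  by case: N; exists Y; have <- : j = j0 by apply: val_inj.
have [X' [x' [xff' hY hX]]] := extend_cover xff Y1.
exists X', x'; split=> // j Y'; rewrite ltnS leq_eqVlt => /orP [/eqP jm|jm] Y1' Yj'; last first.
  exact/hX/(xH j Y').
have -> : j = j0 by apply: val_inj.
have [f [f' [_ ff']]] := Yj; exact: (hits_retract ff' hY).
Qed.

(** Each simple summand of [z] is reached, hence isomorphic to some [x · h j] by [ff_retract]; the
    direct sum of the [h j] then gives [z]. *)
Theorem psh_representable : exists X (x : Q X), fully_faithful_at x /\
  forall Z (z : Q Z), exists h : hm Z X, isomorphic z (x · h).
Proof.
have [X [x [xff xhit]]] := cover_all; exists X, x; split=> // Z z.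
have idem := ss1_idem (ss2_local (fss2_ss hD) Z X).
have [n [S [Ss [i [p [pi pi0 ip]]]]]] := ss1_dsum (ssQ Z) z.
have [h hP] : exists h : 'I_n -> hm Z X, forall j, isomorphic (S j) (x · h j).
  apply: (dep_choice (P := fun j h => isomorphic (S j) (x · h))) => j; have [v [g gnz]] := xhit Z (S j) (proj1 (Ss j)).
  have [s gs] := simple_section (ssQ Z) (Ss j) gnz.
  exact: (ff_retract xff idem gs).
have [H [u [q [qu qu0 uq]]]] := dsum_exists (ss1_additive (ss2_local (fss2_ss hD) Z X)) (h : 'I_n -> lhm Z X).
have [f fP] := dep_choice hP; have [g gP] := dep_choice fP.
exists H, (\sum_j (x ◂ u j ∙ f j ∙ p j : lmor z (x · H))), (\sum_j (i j ∙ g j ∙ (x ◂ q j) : lmor (x · H) z)); split.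
  rewrite cmp_suml -ip; apply: eq_bigr => j _; rewrite cmp_sumr (big_only1 j) // => [|l lj _].
    by rewrite -!cmpA (cmpA (x ◂ q j)) -pa2_cmp qu pa2_id cmp1m (cancelK _ (gP j)).
  rewrite -!cmpA (cmpA (x ◂ q j)) -pa2_cmp qu0 // pa20 m0l !m0r.
  by [].
rewrite cmp_suml -pa2_id -uq pa2_sum; apply: eq_bigr => j _; rewrite cmp_sumr (big_only1 j) // => [|l lj _].
  rewrite -!cmpA (cmpA (p j)) pi cmp1m (cmpA (f j)) (inv21 (gP j)) cmp1m pa2_cmp.
  by [].
by rewrite -!cmpA (cmpA (p j)) pi0 // m0l !m0r.
Qed.

End Representability.

(** * Pointwise equivalences *)

(* The component form of a transformation into [twoVect] that is an equivalence
   at every object; [s] is built by choosing preimages. *)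
Section PointwiseInverse.
Variables (k : fieldType) (B : bicategory) (G P : B -> lincat k).
Variables (T : forall X, linfunctor (G X) (P X)).
Hypotheses (Tff : forall X (y y' : G X) (h : mor (T X y) (T X y')), exists! a, fmor (T X) a = h)
  (Tes : forall X (z : P X), exists y, isomorphic (T X y) z).
Variables (Gu : forall X Y (u : hm X Y), linfunctor (G X) (G Y))
  (Pu : forall X Y (u : hm X Y), linfunctor (P X) (P Y)).
Variables (Ga : forall X Y (u v : hm X Y) (a : mor u v), nattrans (Gu u) (Gu v))
  (Pa : forall X Y (u v : hm X Y) (a : mor u v), nattrans (Pu u) (Pu v)).
Variables (Gc : forall X Y Z (v : hm Y Z) (u : hm X Y), nattrans (lf_comp (Gu v) (Gu u)) (Gu (v ∘ u)))
  (Pc : forall X Y Z (v : hm Y Z) (u : hm X Y), nattrans (lf_comp (Pu v) (Pu u)) (Pu (v ∘ u))).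
Variables (G1 : forall X, nattrans (lf_id (G X)) (Gu (one X)))
  (P1 : forall X, nattrans (lf_id (P X)) (Pu (one X))).
Variable tu : forall X Y (u : hm X Y) (y : G X), mor (Pu u (T X y)) (T Y (Gu u y)).
Hypotheses
  (tu_iso : forall X Y (u : hm X Y) y, is_iso (tu u y))
  (tu_nat : forall X Y (u : hm X Y) y y' (b : mor y y'),
     tu u y' ∙ fmor (Pu u) (fmor (T X) b) = fmor (T Y) (fmor (Gu u) b) ∙ tu u y)
  (tuN : forall X Y (u v : hm X Y) (a : mor u v) y, fmor (T Y) (Ga a y) ∙ tu u y = tu v y ∙ Pa a (T X y))
  (tu1 : forall X y, tu (one X) y ∙ P1 X (T X y) = fmor (T X) (G1 X y))
  (tuc : forall X Y Z (v : hm Y Z) (u : hm X Y) y,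
     tu (v ∘ u) y ∙ Pc v u (T X y) = fmor (T Z) (Gc v u y) ∙ tu v (Gu u y) ∙ fmor (Pu v) (tu u y)).

Let tinj X (y y' : G X) (a b : mor y y') : fmor (T X) a = fmor (T X) b -> a = b.
Proof. by move=> E; have [c [_ U]] := Tff (fmor (T X) b); rewrite -(U a) // (U b). Qed.

Lemma pointwise_inverse : exists (S : forall X, linfunctor (P X) (G X))
  (e : forall X (z : P X), mor (T X (S X z)) z) (d : forall X (y : G X), mor (S X (T X y)) y)
  (m : forall X Y (u : hm X Y) (z : P X), mor (Gu u (S X z)) (S Y (Pu u z))),
  [/\ [/\ forall X z, is_iso (e X z), forall X y, is_iso (d X y),
      forall X z z' (h : mor z z'), e X z' ∙ fmor (T X) (fmor (S X) h) = h ∙ e X z &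
      forall X y y' (h : mor y y'), d X y' ∙ fmor (S X) (fmor (T X) h) = h ∙ d X y],
      [/\ forall X Y (u : hm X Y) z, is_iso (m X Y u z) &
      forall X Y (u : hm X Y) z z' (b : mor z z'),
        m X Y u z' ∙ fmor (Gu u) (fmor (S X) b) = fmor (S Y) (fmor (Pu u) b) ∙ m X Y u z],
      [/\ forall X Y (u v : hm X Y) (a : mor u v) z,
        fmor (S Y) (Pa a z) ∙ m X Y u z = m X Y v z ∙ Ga a (S X z),
      forall X z, m X X (one X) z ∙ G1 X (S X z) = fmor (S X) (P1 X z) &
      forall X Y Z (v : hm Y Z) (u : hm X Y) z, m X Z (v ∘ u) z ∙ Gc v u (S X z)
        = fmor (S Z) (Pc v u z) ∙ m Y Z v (Pu u z) ∙ fmor (Gu v) (m X Y u z)] &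
      [/\ forall X Y (u : hm X Y) z, e Y (Pu u z) ∙ fmor (T Y) (m X Y u z) ∙ tu u (S X z) = fmor (Pu u) (e X z) &
      forall X Y (u : hm X Y) y, d Y (Gu u y) ∙ fmor (S Y) (tu u y) ∙ m X Y u (T X y) = fmor (Gu u) (d X y)]].
Proof.
have [s0 H0] := dep_choice (fun X => dep_choice (@Tes X)).
have [e0 He] := dep_choice (fun X => dep_choice (H0 X)).
have [e' eP] := dep_choice (fun X => dep_choice (He X)).
have [L LP] := dep_choice (fun X => dep_choice (fun y => dep_choice (fun y' => dep_choice (@Tff X y y')))).
have LE X y y' (h : mor (T X y) (T X y')) : fmor (T X) (L X y y' h) = h by case: (LP X y y' h).
have [S [e [eI SE]]] : exists (S : forall X, linfunctor (P X) (G X)) (e : forall X (z : P X), mor (T X (S X z)) z),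
    (forall X z, is_iso (e X z)) /\
    forall X z z' (h : mor z z'), e X z' ∙ fmor (T X) (fmor (S X) h) = h ∙ e X z.
  unshelve eexists.
    move=> X; unshelve refine (@Linfunctor k (P X) (G X) (@Functor (P X) (G X) (s0 X)
      (fun z z' h => L X _ _ (e' X z' ∙ h ∙ e0 X z)) _ _) _).
    - move=> z; apply: tinj; rewrite LE cmpm1 (inv12 (eP X z)) fmor_id.
      by [].
    - move=> z z' z'' h h'; apply: tinj; rewrite fmor_cmp !LE -!cmpA.
      by rewrite (cancelK _ (inverse_sym (eP X z'))).
    - move=> z z' c h h' /=; apply: tinj; rewrite (lf_lin (T X)) !LE mDr mDl mZr mZl.
      by [].
  exists e0; split=> [X z|X z z' h /=]; first by exists (e' X z); apply: eP.
  by rewrite LE -!cmpA (cancelK _ (inverse_sym (eP X z'))).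
move=> {s0 H0 e0 He e' eP}.
have [e' eP] := dep_choice (fun X => dep_choice (eI X)).
have ecan X z w (f g : mor w (T X (S X z))) : e X z ∙ f = e X z ∙ g -> f = g by apply: cancel_l (eP X z).
have ti X Y (u : hm X Y) y := cid (tu_iso u y).
(* [m] is the solution of the equation [mE], which the modification axiom will demand. Its laws
   follow from that equation after cancelling the isomorphisms [e] and [tu]. *)
pose m X Y (u : hm X Y) z : mor (Gu u (S X z)) (S Y (Pu u z)) :=
  L Y _ _ (e' Y (Pu u z) ∙ fmor (Pu u) (e X z) ∙ sval (ti X Y u (S X z))).
have mE X Y (u : hm X Y) z : e Y (Pu u z) ∙ fmor (T Y) (m X Y u z) ∙ tu u (S X z) = fmor (Pu u) (e X z).
  rewrite LE -!cmpA (cancelK _ (inverse_sym (eP _ _))) (inv12 (svalP (ti X Y u (S X z)))).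
  by rewrite cmpm1.
have tcan X Y (u : hm X Y) z w (f g : mor (T Y (Gu u z)) w) : f ∙ tu u z = g ∙ tu u z -> f = g.
  exact: cancel_r (svalP (ti X Y u z)).
have isoL X y y' (f : mor y y') : is_iso (fmor (T X) f) -> is_iso f.
  move=> [g [gf fg]]; exists (L X _ _ g); split; apply: tinj; rewrite fmor_cmp LE fmor_id ?gf ?fg.
    by [].
  by [].
clearbody m.
have [d dE] : exists d : forall X (y : G X), mor (S X (T X y)) y, forall X y, fmor (T X) (d X y) = e X (T X y).
  by exists (fun X y => L X _ _ (e X (T X y))) => X y; rewrite LE.
exists S, e, d, m; split; split.
- by [].
- by move=> X y; apply: isoL; rewrite dE.
- by [].
- by move=> X y y' h; apply: tinj; rewrite !fmor_cmp !dE SE.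
- move=> X Y u z; apply: isoL.
  have [t' tt] := tu_iso u (S X z); have [w ww] := is_iso_fmor (Pu u) (eI X z).
  have -> : fmor (T Y) (m X Y u z) = e' Y (Pu u z) ∙ fmor (Pu u) (e X z) ∙ t'.
    apply: (ecan); apply: (tcan); rewrite mE -!cmpA (cancelK _ (inverse_sym (eP _ _))) (inv12 tt).
    by rewrite cmpm1.
  eexists; apply: inverse_cmp; first exact: inverse_sym tt.
  by apply: inverse_cmp; [exact: ww | exact: inverse_sym (eP _ _)].
- move=> X Y u z z' b; apply: tinj; apply: ecan; apply: tcan; rewrite !fmor_cmp.
  rewrite -!cmpA -tu_nat; rq (mE X Y u z'); rewrite -fmor_cmp SE fmor_cmp.
  by rq (SE Y _ _ (fmor (Pu u) b)); rq (mE X Y u z).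
- move=> X Y u v a z; apply: tinj; apply: ecan; apply: tcan; rewrite !fmor_cmp -!cmpA.
  rq (SE Y _ _ (Pa a z)); rewrite tuN; rq (mE X Y v z); rq (mE X Y u z).
  by rewrite ncompN.
- move=> X z; apply: tinj; apply: ecan; rewrite !fmor_cmp -tu1 SE.
  rq (mE X X (one X) z).
  by have := ncompN (P1 X) (e X z) => /= ->.
- move=> X Y Z v u z; apply: tinj; apply: ecan; apply: tcan; rewrite !fmor_cmp -!cmpA.
  apply: (cancel_r (inverse_fmor (Pu v) (svalP (ti X Y u (S X z))))); move: (tuc v u (S X z)) => E.
  rewrite -!cmpA; rq (esym E); rq (mE X Z (v ∘ u) z); rq (esym (tu_nat v (m X Y u z))).
  rq (SE Z _ _ (Pc v u z)); rq (mE Y Z v (Pu u z)); rewrite -!fmor_cmp cmpA mE.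
  exact: esym (ncompN (Pc v u) (e X z)).
- exact: mE.
- move=> X Y u y; apply: tinj; apply: tcan; rewrite !fmor_cmp dE -!cmpA.
  by rq (SE Y _ _ (tu u y)); rq (mE X Y u (T X y)); rewrite -tu_nat dE.
Qed.

End PointwiseInverse.

Lemma fmor_id2 (C C' C'' : category) (F : functor C' C'') (G : functor C C') (x : C) :
  fmor F (fmor G (idm x)) = idm (F (G x)).
Proof. by rewrite !fmor_id. Qed.

(** Coherence cells of [twoVect] have identity components; this clears them from the pointwise form
    of the modification equation. *)
Lemma strip_ids (C : category) (a b c d : C) (f : mor c d) (i1 : mor c c) (g : mor b c) (h : mor a b) (i2 : mor a a) (w : mor a d) :
  i1 = idm c -> i2 = idm a -> f ∙ g ∙ h = w ->
  idm d ∙ idm d ∙ (idm d ∙ w) = f ∙ i1 ∙ (idm c ∙ (idm c ∙ g) ∙ idm b ∙ (h ∙ i2) ∙ idm a).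
Proof. by move=> -> -> <-; rewrite !cmp1m !cmpm1 !cmpA. Qed.

Lemma modif_iso_to_id (k : fieldType) (B : bicategory) (F G : pseudofunctor B (twoVect k))
  (s : pstrans_data F G) (t : pstrans_data G F) :
  let S X : linfunctor (F X) (G X) := pt1 s X in let T X : linfunctor (G X) (F X) := pt1 t X in
  let Fu X Y (u : hm X Y) : linfunctor (F X) (F Y) := pf1 F u in
  let Gu X Y (u : hm X Y) : linfunctor (G X) (G Y) := pf1 G u in
  let su X Y (u : hm X Y) : nattrans (lf_comp (Gu X Y u) (S X)) (lf_comp (S Y) (Fu X Y u)) := pt2 s u in
  let tu X Y (u : hm X Y) : nattrans (lf_comp (Fu X Y u) (T X)) (lf_comp (T Y) (Gu X Y u)) := pt2 t u in
  forall e : forall X (z : (F X : fsscat k)), mor (T X (S X z)) z,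
  (forall X z, is_iso (e X z)) ->
  (forall X z z' (h : mor z z'), e X z' ∙ fmor (T X) (fmor (S X) h) = h ∙ e X z) ->
  (forall X Y (u : hm X Y) z, e Y (Fu X Y u z) ∙ fmor (T Y) (su X Y u z) ∙ tu X Y u (S X z) = fmor (Fu X Y u) (e X z)) ->
  modif_iso (comp_ptd t s) (id_ptd F).
Proof.
move=> S T Fu Gu su tu e eI eN em.
exists (fun X => @Nattrans _ _ (lf_comp (T X) (S X)) (lf_id (F X)) (e X) (fun z z' b => eN X z z' b)).
split=> [X|X Y u]; first by apply: nt_is_iso => z; apply: eI.
apply: nattransP => z.
rewrite /=; apply: strip_ids.
- rewrite /=; exact: fmor_id2.
- rewrite /=; exact: fmor_id2.
- rewrite /=; have := em X Y u z; rewrite /Fu /Gu /su /tu /S /T /= => E; exact: E.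
Qed.

Section PointwiseEquivalence.
Variables (k : fieldType) (B : bicategory) (G P : pseudofunctor B (twoVect k)) (t : pstrans_data G P).
Hypotheses (tP : is_pstrans t).
Let T X : linfunctor (G X) (P X) := pt1 t X.
Hypotheses (Tff : forall X (y y' : (G X : fsscat k)) (h : mor (T X y) (T X y')), exists! a, fmor (T X) a = h)
  (Tes : forall X (z : (P X : fsscat k)), exists y, isomorphic (T X y) z).

Let Gu X Y (u : hm X Y) : linfunctor (G X) (G Y) := pf1 G u.
Let Pu X Y (u : hm X Y) : linfunctor (P X) (P Y) := pf1 P u.
Let tu X Y (u : hm X Y) : nattrans (lf_comp (Pu u) (T X)) (lf_comp (T Y) (Gu u)) := pt2 t u.
Let Ga X Y (u v : hm X Y) (a : mor u v) : nattrans (Gu u) (Gu v) := pf2 G a.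
Let Pa X Y (u v : hm X Y) (a : mor u v) : nattrans (Pu u) (Pu v) := pf2 P a.
Let Gc X Y Z (v : hm Y Z) (u : hm X Y) : nattrans (lf_comp (Gu v) (Gu u)) (Gu (v ∘ u)) := pfc G v u.
Let Pc X Y Z (v : hm Y Z) (u : hm X Y) : nattrans (lf_comp (Pu v) (Pu u)) (Pu (v ∘ u)) := pfc P v u.
Let G1 X : nattrans (lf_id (G X)) (Gu (one X)) := pfu G X.
Let P1 X : nattrans (lf_id (P X)) (Pu (one X)) := pfu P X.

Let tuN X Y (u v : hm X Y) (a : mor u v) y : fmor (T Y) (Ga a y) ∙ tu u y = tu v y ∙ Pa a (T X y).
Proof.
have : idm (T Y (Gu v y)) ∙ fmor (T Y) (Ga a y) ∙ tu u y = tu v y ∙ (Pa a (T X y) ∙ fmor (Pu u) (idm (T X y))).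
  exact: (congr1 (fun s : nattrans _ _ => s y) (pt2N tP a)).
by rewrite (cmp1m (fmor (T Y) _)) (fmor_id (Pu u)) (cmpm1 (Pa a _)).
Qed.

Let tu1 X y : tu (one X) y ∙ P1 X (T X y) = fmor (T X) (G1 X y).
Proof.
have : tu (one X) y ∙ (P1 X (T X y) ∙ idm (T X y)) = idm (T X (Gu (one X) y)) ∙ fmor (T X) (G1 X y) ∙ idm (T X y) ∙ idm (T X y).
  exact: (congr1 (fun s : nattrans _ _ => s y) (pt2_one tP X)).
by rewrite (cmpm1 (P1 X _)) (cmp1m (fmor (T X) _)) !(cmpm1 (fmor (T X) _)).
Qed.

Let tuc X Y Z (v : hm Y Z) (u : hm X Y) y :
  tu (v ∘ u) y ∙ Pc v u (T X y) = fmor (T Z) (Gc v u y) ∙ tu v (Gu u y) ∙ fmor (Pu v) (tu u y).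
Proof.
have : tu (v ∘ u) y ∙ (Pc v u (T X y) ∙ fmor (Pu v) (fmor (Pu u) (idm (T X y)))) =
   idm _ ∙ fmor (T Z) (Gc v u y) ∙ idm _ ∙ (tu v (Gu u y) ∙ fmor (Pu v) (fmor (T Y) (idm (Gu u y)))) ∙ idm _
     ∙ (idm _ ∙ fmor (Pu v) (tu u y)) ∙ idm _.
  exact: (congr1 (fun s : nattrans _ _ => s y) (pt2_hc tP v u)).
rewrite (fmor_id (Pu u)) (fmor_id (Pu v)) (fmor_id (T Y)) (fmor_id (Pu v)) (cmpm1 (Pc _ _ _)).
by rewrite (cmp1m (fmor (T Z) _)) (cmpm1 (fmor (T Z) _)) (cmpm1 (tu v _)) (cmp1m (fmor (Pu v) _)) (cmpm1 (fmor (T Z) _ ∙ _)) cmpm1.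
Qed.

Let tuiso X Y (u : hm X Y) y : is_iso (tu u y).
Proof.
have [w [w1 w2]] := pt2P tP u; exists ((w : nattrans (lf_comp (T Y) (Gu u)) (lf_comp (Pu u) (T X))) y).
split; first exact: (congr1 (fun s : nattrans _ _ => s y) w1).
exact: (congr1 (fun s : nattrans _ _ => s y) w2).
Qed.

Lemma pf_equivalent_pointwise : pf_equivalent P G.
Proof.
have [S [e [d [m [[eI dI eN dN] [mI mN] [ma m1 mc] [em dm]]]]]] := pointwise_inverse Tff Tes (Pa := Pa) (Ga := Ga) (P1 := P1) (Pc := Pc) (G1 := G1) (Gc := Gc) (tu := fun X Y u y => tu u y)
  tuiso (fun X Y u y y' b => ncompN (tu u) b) tuN tu1 tuc.
pose mm X Y (u : hm X Y) : nattrans (lf_comp (Gu u) (S X)) (lf_comp (S Y) (Pu u)) :=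
  @Nattrans _ _ (lf_comp (Gu u) (S X)) (lf_comp (S Y) (Pu u)) (m X Y u) (fun z z' b => mN X Y u z z' b).
pose s : pstrans_data P G := @PstransData _ _ P G S mm.
have sP : is_pstrans s.
  split.
  - by move=> X Y u; apply: nt_is_iso => z; apply: mI.
  - move=> X Y u v a; apply: nattransP => z.
    suff E : idm (S Y (Pu v z)) ∙ fmor (S Y) (Pa a z) ∙ m X Y u z = m X Y v z ∙ (Ga a (S X z) ∙ fmor (Gu u) (idm (S X z))) by exact: E.
    rewrite (cmp1m (fmor (S Y) _)) (fmor_id (Gu u)) (cmpm1 (Ga a _)); exact: ma.
  - move=> X; apply: nattransP => z.
    suff E : m X X (one X) z ∙ (G1 X (S X z) ∙ idm (S X z)) = idm (S X (Pu (one X) z)) ∙ fmor (S X) (P1 X z) ∙ idm (S X z) ∙ idm (S X z).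
      exact: E.
    rewrite (cmpm1 (G1 X _)) (cmp1m (fmor (S X) _)) !(cmpm1 (fmor (S X) _)); exact: m1.
  - move=> X Y Z v u; apply: nattransP => z.
    suff E : m X Z (v ∘ u) z ∙ (Gc v u (S X z) ∙ fmor (Gu v) (fmor (Gu u) (idm (S X z)))) =
     idm _ ∙ fmor (S Z) (Pc v u z) ∙ idm _ ∙ (m Y Z v (Pu u z) ∙ fmor (Gu v) (fmor (S Y) (idm (Pu u z)))) ∙ idm _
     ∙ (idm _ ∙ fmor (Gu v) (m X Y u z)) ∙ idm _ by exact: E.
    rewrite (fmor_id (Gu u)) (fmor_id (Gu v)) (fmor_id (S Y)) (fmor_id (Gu v)) (cmpm1 (Gc _ _ _)).
    rewrite (cmp1m (fmor (S Z) _)) (cmpm1 (fmor (S Z) _)) (cmpm1 (m Y Z v _)) (cmp1m (fmor (Gu v) _)) (cmpm1 (fmor (S Z) _ ∙ _)) cmpm1.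
    exact: mc.
exists s, t; split=> //; first exact: (@modif_iso_to_id _ _ _ _ s t e eI eN em).
exact: (@modif_iso_to_id _ _ _ _ t s d dI dN dm).
Qed.

End PointwiseEquivalence.

(** * Actions and bimodules *)

(* A pseudofunctor from [B] to linear categories, in components. *)
Record action (k : fieldType) (B : bicategory) : Type := Action {
  ac :> B -> lincat k;
  au : forall {X Y : B} (u : hm X Y), linfunctor (ac X) (ac Y);
  a2 : forall {X Y : B} {u v : hm X Y} (a : mor u v) (z : ac X), mor (au u z) (au v z);
  aw : forall {X Y Z : B} (v : hm Y Z) (u : hm X Y) (z : ac X), mor (au v (au u z)) (au (v ∘ u) z);
  awi : forall {X Y Z : B} (v : hm Y Z) (u : hm X Y) (z : ac X), mor (au (v ∘ u) z) (au v (au u z));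
  a1 : forall {X : B} (z : ac X), mor z (au (one X) z);
  a1i : forall {X : B} (z : ac X), mor (au (one X) z) z;
  awP : forall X Y Z (v : hm Y Z) (u : hm X Y) z, inverse (aw v u z) (awi v u z);
  a1P : forall X (z : ac X), inverse (a1 z) (a1i z);
  a2N : forall X Y (u v : hm X Y) (a : mor u v) z z' (f : mor z z'),
    a2 a z' ∙ fmor (au u) f = fmor (au v) f ∙ a2 a z;
  a2_id : forall X Y (u : hm X Y) z, a2 (idm u) z = idm (au u z);
  a2_cmp : forall X Y (u v w : hm X Y) (b : mor v w) (a : mor u v) z, a2 (b ∙ a) z = a2 b z ∙ a2 a z;
  awNz : forall X Y Z (v : hm Y Z) (u : hm X Y) z z' (f : mor z z'),
    aw v u z' ∙ fmor (au v) (fmor (au u) f) = fmor (au (v ∘ u)) f ∙ aw v u z;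
  awN : forall X Y Z (v v' : hm Y Z) (u u' : hm X Y) (b : mor v v') (a : mor u u') z,
    aw v' u' z ∙ (a2 b (au u' z) ∙ fmor (au v) (a2 a z)) = a2 (b ⋆ a) z ∙ aw v u z;
  a1N : forall X (z z' : ac X) (f : mor z z'), a1 z' ∙ f = fmor (au (one X)) f ∙ a1 z;
  aasc : forall W X Y Z (w : hm Y Z) (v : hm X Y) (u : hm W X) z,
    a2 (asc w v u) z ∙ (aw (w ∘ v) u z ∙ aw w v (au u z)) = aw w (v ∘ u) z ∙ fmor (au w) (aw v u z);
  alu : forall X Y (u : hm X Y) z, a2 (lu u) z ∙ (aw (one Y) u z ∙ a1 (au u z)) = idm (au u z);
  aru : forall X Y (u : hm X Y) z, a2 (ru u) z ∙ (aw u (one X) z ∙ fmor (au u) (a1 z)) = idm (au u z) }.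

Arguments au {k B} A {X Y} u : rename.
Arguments a2 {k B A X Y u v} a z : rename.
Arguments aw {k B A X Y Z} v u z : rename.
Arguments awi {k B} A {X Y Z} v u z : rename.
Arguments a1 {k B A X} z : rename.

Section Joins.
Variables (k : fieldType) (B : bicategory) (A : action k B).

(* [locked] keeps associativity rewriting from unfolding joins. *)
Definition jn W X Y (v : hm X Y) (u : hm W X) (w : hm W Y) (th : mor (v ∘ u) w) (z : A W) :
  mor (au A v (au A u z)) (au A w z) := locked (a2 th z ∙ aw v u z).

Section Laws.
Variables (W X Y : B) (v : hm X Y) (u : hm W X) (w : hm W Y) (th : mor (v ∘ u) w).

Lemma jnN z z' (f : mor z z') : jn th z' ∙ fmor (au A v) (fmor (au A u) f) = fmor (au A w) f ∙ jn th z.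
Proof. by rewrite /jn -!lock -!cmpA awNz; rq (a2N th f). Qed.

Lemma jn_post w' (ga : mor w w') z : a2 ga z ∙ jn th z = jn (ga ∙ th) z.
Proof. by rewrite /jn -!lock a2_cmp cmpA. Qed.

Lemma jn_inner u' (al : mor u' u) z : jn th z ∙ fmor (au A v) (a2 al z) = jn (th ∙ (idm v ⋆ al)) z.
Proof. by rewrite /jn -!lock a2_cmp -!cmpA -awN a2_id cmp1m. Qed.

Lemma jn_outer v' (be : mor v' v) z : jn th z ∙ a2 be (au A u z) = jn (th ∙ (be ⋆ idm u)) z.
Proof. by rewrite /jn -!lock a2_cmp -!cmpA -awN a2_id fmor_id cmpm1. Qed.

Lemma jn_iso z : is_iso th -> is_iso (jn th z).
Proof.
move=> [ti [t1 t2]]; exists (awi A v u z ∙ a2 ti z); rewrite /jn -lock; apply: inverse_cmp (awP v u z) _.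
by split; rewrite -a2_cmp ?t1 ?t2 a2_id.
Qed.

End Laws.

(** Coherence of iterated actions is reduced to an equation between 2-morphisms of [B], in which the
    point [z] no longer occurs. *)
Lemma jn_assoc W X Y Z (w : hm Y Z) (v : hm X Y) (u : hm W X) p q T
  (th1 : mor (v ∘ u) p) (th2 : mor (w ∘ p) T) (th1' : mor (w ∘ v) q) (th2' : mor (q ∘ u) T) (z : A W) :
  th2 ∙ (idm w ⋆ th1) ∙ asc w v u = th2' ∙ (th1' ⋆ idm u) ->
  jn th2 z ∙ fmor (au A w) (jn th1 z) = jn th2' z ∙ jn th1' (au A u z).
Proof.
move=> E; have -> : jn th2' z ∙ jn th1' (au A u z) = a2 (th2' ∙ (th1' ⋆ idm u)) z ∙ (aw (w ∘ v) u z ∙ aw w v (au A u z)).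
  by rewrite {2}/jn -lock cmpA jn_outer /jn -!lock -!cmpA.
rewrite -E {2}/jn -lock fmor_cmp cmpA jn_inner /jn -!lock !a2_cmp -!cmpA; rq (esym (aasc w v u z)).
by rewrite aasc.
Qed.

Lemma jn_unit_l X Y (u w : hm X Y) (th : mor (one Y ∘ u) w) (z : A X) :
  jn th z ∙ a1 (au A u z) = a2 (th ∙ lui u) z.
Proof.
have -> : th = th ∙ lui u ∙ lu u by rewrite -cmpA (inv12 (luP u)) cmpm1.
by rewrite /jn -!lock a2_cmp -!cmpA alu cmpm1 (inv21 (luP u)) cmpm1.
Qed.

Lemma jn_unit_r X Y (u w : hm X Y) (th : mor (u ∘ one X) w) (z : A X) :
  jn th z ∙ fmor (au A u) (a1 z) = a2 (th ∙ rui u) z.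
Proof.
have -> : th = th ∙ rui u ∙ ru u by rewrite -cmpA (inv12 (ruP u)) cmpm1.
by rewrite /jn -!lock a2_cmp -!cmpA aru cmpm1 (inv21 (ruP u)) cmpm1.
Qed.

End Joins.

Lemma strip_asc (C : category) (x y z w s : C) (a : mor z w) (b : mor y z) (c : mor x y) (i : mor x x)
  (d : mor s w) (e : mor x s) :
  a ∙ b ∙ (c ∙ i) = d ∙ (idm s ∙ e) ∙ idm x -> i = idm x -> a ∙ (b ∙ c) = d ∙ e.
Proof. by move=> E ii; rewrite ii !cmpm1 cmp1m in E; rewrite cmpA. Qed.

Lemma strip_lu (C : category) (x y z w : C) (a : mor z w) (b : mor y z) (c : mor x y) (i : mor x x) (h : mor x w) :
  a ∙ b ∙ (c ∙ i) = h -> i = idm x -> a ∙ (b ∙ c) = h.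
Proof. by move=> <- ->; rewrite cmpm1 !cmpA. Qed.

Lemma strip_ru (C : category) (x y z w : C) (a : mor z w) (b : mor y z) (c : mor x y) (h : mor x w) :
  a ∙ b ∙ (idm y ∙ c) = h -> a ∙ (b ∙ c) = h.
Proof. by move=> <-; rewrite cmp1m !cmpA. Qed.

Section ActionOfPseudofunctor.
Variables (k : fieldType) (B : bicategory) (P : pseudofunctor B (twoVect k)).
Let Pu X Y (u : hm X Y) : linfunctor (P X) (P Y) := pf1 P u.
Let Pa X Y (u v : hm X Y) (a : mor u v) : nattrans (Pu u) (Pu v) := pf2 P a.
Let Pc X Y Z (v : hm Y Z) (u : hm X Y) : nattrans (lf_comp (Pu v) (Pu u)) (Pu (v ∘ u)) := pfc P v u.
Let P1 X : nattrans (lf_id (P X)) (Pu (one X)) := pfu P X.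

Let Pc_iso X Y Z (v : hm Y Z) (u : hm X Y) z : is_iso (Pc v u z).
Proof.
have [w [w1 w2]] := pfcP P v u; exists ((w : nattrans (Pu (v ∘ u)) (lf_comp (Pu v) (Pu u))) z).
split; first exact: (congr1 (fun s : nattrans _ _ => s z) w1).
exact: (congr1 (fun s : nattrans _ _ => s z) w2).
Qed.

Let P1_iso X z : is_iso (P1 X z).
Proof.
have [w [w1 w2]] := pfuP P X; exists ((w : nattrans (Pu (one X)) (lf_id (P X))) z).
split; first exact: (congr1 (fun s : nattrans _ _ => s z) w1).
exact: (congr1 (fun s : nattrans _ _ => s z) w2).
Qed.

Definition action_of : action k B.
Proof.
unshelve refine (@Action k B (fun X => P X : fsscat k) Pu (fun X Y u v a z => Pa a z) (fun X Y Z v u z => Pc v u z)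
  (fun X Y Z v u z => sval (cid (Pc_iso v u z))) (fun X z => P1 X z) (fun X z => sval (cid (P1_iso z)))
  _ _ _ _ _ _ _ _ _ _ _).
- by move=> X Y Z v u z; apply: (svalP (cid (Pc_iso v u z))).
- by move=> X z; apply: (svalP (cid (P1_iso z))).
- by move=> X Y u v a z z' f; apply: ncompN.
- by move=> X Y u z; apply: (congr1 (fun s : nattrans (Pu u) (Pu u) => s z) (fmor_id (pf1 P) u)).
- by move=> X Y u v w b a z; apply: (congr1 (fun s : nattrans (Pu u) (Pu w) => s z) (fmor_cmp (pf1 P) b a)).
- by move=> X Y Z v u z z' f; apply: (ncompN (Pc v u) f).
- by move=> X Y Z v v' u u' b a z; have := congr1 (fun s : nattrans _ _ => s z) (pfcN P b a); rewrite /=; apply.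
- by move=> X z z' f; apply: (ncompN (P1 X) f).
- move=> W X Y Z w v u z; have := congr1 (fun s : nattrans _ _ => s z) (pf_asc P w v u).
  by rewrite /= => E; apply: (strip_asc E); rewrite /=; exact: fmor_id2.
- move=> X Y u z; have := congr1 (fun s : nattrans _ _ => s z) (pf_lu P u); rewrite /= => E.
  by apply: (strip_lu E).
- move=> X Y u z; have := congr1 (fun s : nattrans _ _ => s z) (pf_ru P u); rewrite /= => E.
  by apply: (strip_ru E).
Defined.

End ActionOfPseudofunctor.

Section Bimodule.
Variables (k : fieldType) (C D : linbicat k).
Local Notation DC := (prod_bicat (op_bicat D) C).
Variable A : action k DC.

Definition bu X Y c c' (f : @hm D X Y) (g : @hm C c c') : @hm DC (Y, c) (X, c') := (f, g).
Definition b2 X Y c c' (f f' : @hm D X Y) (g g' : @hm C c c') (a : mor f f') (b : mor g g') :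
  @mor (@hm DC (Y, c) (X, c')) (bu f g) (bu f' g') := (a, b).

Hypothesis A_lin : forall c (X Y : D) (f g : @hm D X Y) (n : A (Y, c)),
  linear (fun a : @lmor k (lhm X Y) f g => a2 (b2 a (idm (one c))) n : lmor (au A (bu f (one c)) n) (au A (bu g (one c)) n)).

Lemma b2_cmp X Y c c' (f f' f'' : @hm D X Y) (g g' g'' : @hm C c c')
  (a' : mor f' f'') (b' : mor g' g'') (a : mor f f') (b : mor g g') :
  b2 a' b' ∙ b2 a b = b2 (a' ∙ a) (b' ∙ b).
Proof. by []. Qed.

(* [jp] joins the actions of [(f, g)] and [(f', g')] into that of [(f'', g'')]. *)
Definition jp X Y Z c c' c'' (f : @hm D Y Z) (g : @hm C c c') (f' : @hm D X Y) (g' : @hm C c' c'')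
  (f'' : @hm D X Z) (g'' : @hm C c c'') (a : mor (f ∘ f') f'') (b : mor (g' ∘ g) g'') (z : A (Z, c)) :
  mor (au A (bu f' g') (au A (bu f g) z)) (au A (bu f'' g'') z) :=
  jn (v := bu f' g') (u := bu f g) (w := bu f'' g'') (a, b) z.

Lemma jp_assoc W X Y Z c0 c1 c2 c3 (f1 : @hm D Y Z) (g1 : @hm C c0 c1) (f2 : @hm D X Y) (g2 : @hm C c1 c2)
  (f3 : @hm D W X) (g3 : @hm C c2 c3) (fp : @hm D X Z) (gp : @hm C c0 c2) (fq : @hm D W Y) (gq : @hm C c1 c3)
  (ft : @hm D W Z) (gt : @hm C c0 c3)
  (a1 : mor (f1 ∘ f2) fp) (b1 : mor (g2 ∘ g1) gp) (a2 : mor (fp ∘ f3) ft) (b2 : mor (g3 ∘ gp) gt)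
  (a1' : mor (f2 ∘ f3) fq) (b1' : mor (g3 ∘ g2) gq) (a2' : mor (f1 ∘ fq) ft) (b2' : mor (gq ∘ g1) gt) (z : A (Z, c0)) :
  a2 ∙ (a1 ⋆ idm f3) ∙ asci f1 f2 f3 = a2' ∙ (idm f1 ⋆ a1') ->
  b2 ∙ (idm g3 ⋆ b1) ∙ asc g3 g2 g1 = b2' ∙ (b1' ⋆ idm g1) ->
  jp a2 b2 z ∙ fmor (au A (bu f3 g3)) (jp a1 b1 z) = jp a2' b2' z ∙ jp a1' b1' (au A (bu f1 g1) z).
Proof. by move=> E1 E2; apply: jn_assoc; congr pair. Qed.

Lemma jp_iso X Y Z c c' c'' (f : @hm D Y Z) (g : @hm C c c') (f' : @hm D X Y) (g' : @hm C c' c'')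
  (f'' : @hm D X Z) (g'' : @hm C c c'') (a : mor (f ∘ f') f'') (b : mor (g' ∘ g) g'') (z : A (Z, c)) :
  is_iso a -> is_iso b -> is_iso (jp a b z).
Proof. by move=> ai bi; apply: jn_iso; apply: is_iso_prod. Qed.

Lemma jpN X Y Z c c' c'' (f : @hm D Y Z) (g : @hm C c c') (f' : @hm D X Y) (g' : @hm C c' c'')
  (f'' : @hm D X Z) (g'' : @hm C c c'') (a : mor (f ∘ f') f'') (b : mor (g' ∘ g) g'') (z z' : A (Z, c)) (h : mor z z') :
  jp a b z' ∙ fmor (au A (bu f' g')) (fmor (au A (bu f g)) h) = fmor (au A (bu f'' g'')) h ∙ jp a b z.
Proof. exact: jnN. Qed.

Lemma jp_post X Y Z c c' c'' (f : @hm D Y Z) (g : @hm C c c') (f' : @hm D X Y) (g' : @hm C c' c'')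
  (f'' : @hm D X Z) (g'' : @hm C c c'') (a : mor (f ∘ f') f'') (b : mor (g' ∘ g) g'') (z : A (Z, c)) f0 g0 (a' : mor f'' f0) (b' : mor g'' g0) :
  a2 (b2 a' b') z ∙ jp a b z = jp (a' ∙ a) (b' ∙ b) z.
Proof. exact: jn_post. Qed.

Lemma jp_inner X Y Z c c' c'' (f : @hm D Y Z) (g : @hm C c c') (f' : @hm D X Y) (g' : @hm C c' c'')
  (f'' : @hm D X Z) (g'' : @hm C c c'') (a : mor (f ∘ f') f'') (b : mor (g' ∘ g) g'') (z : A (Z, c)) f0 g0 (a' : mor f0 f) (b' : mor g0 g) :
  jp a b z ∙ fmor (au A (bu f' g')) (a2 (b2 a' b') z) = jp (a ∙ (a' ⋆ idm f')) (b ∙ (idm g' ⋆ b')) z.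
Proof. exact: jn_inner. Qed.

Lemma jp_outer X Y Z c c' c'' (f : @hm D Y Z) (g : @hm C c c') (f' : @hm D X Y) (g' : @hm C c' c'')
  (f'' : @hm D X Z) (g'' : @hm C c c'') (a : mor (f ∘ f') f'') (b : mor (g' ∘ g) g'') (z : A (Z, c)) f0 g0 (a' : mor f0 f') (b' : mor g0 g') :
  jp a b z ∙ a2 (b2 a' b') (au A (bu f g) z) = jp (a ∙ (idm f ⋆ a')) (b ∙ (b' ⋆ idm g)) z.
Proof. exact: jn_outer. Qed.

Lemma jp_unit_l Y Z c c' (f f'' : @hm D Y Z) (g g'' : @hm C c c') (a : mor (f ∘ one Y) f'') (b : mor (one c' ∘ g) g'') (z : A (Z, c)) :
  jp a b z ∙ a1 (au A (bu f g) z) = a2 (b2 (a ∙ rui f) (b ∙ lui g)) z.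
Proof. exact: jn_unit_l. Qed.

Lemma jp_unit_r Y Z c c' (f f'' : @hm D Y Z) (g g'' : @hm C c c') (a : mor (one Z ∘ f) f'') (b : mor (g ∘ one c) g'') (z : A (Z, c)) :
  jp a b z ∙ fmor (au A (bu f g)) (a1 z) = a2 (b2 (a ∙ lui f) (b ∙ rui g)) z.
Proof. exact: jn_unit_r. Qed.

Lemma b2_id X Y c c' (f : @hm D X Y) (g : @hm C c c') (z : A (Y, c)) : a2 (b2 (idm f) (idm g)) z = idm (au A (bu f g) z).
Proof. exact: a2_id. Qed.

Let lu1 (c : C) : lu (one c) = ru (one c) := lu_one c.

Let JI c X Y Z (f : @hm D Y Z) (g : @hm D X Y) (n : A (Z, c)) : is_iso (jp (idm (f ∘ g)) (lu (one c)) n).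
Proof. by apply: jp_iso; [apply: is_iso_id | exists (lui (one c)); apply: luP]. Qed.

(** The presheaf [A(-, c)]. A composite acts through [one c ∘ one c], hence the unitor in [pw]; the
    coherence laws use that [lu] and [ru] agree at [one c]. *)
Definition act_psh (c : C) : psh D.
Proof.
refine (@Psh k D (fun Y => A (Y, c)) (fun X Y f => au A (bu f (one c))) (fun X Y f g a n => a2 (b2 a (idm (one c))) n)
  (fun X Y Z f g n => jp (idm (f ∘ g)) (lu (one c)) n) (fun X Y Z f g n => sval (cid (JI f g n))) (fun X n => a1 n) (fun X n => a1i n) _ _ _ _ _ _ _ _ _ _ _ _ _).
- by move=> X Y Z f g n; apply: (svalP (cid (JI f g n))).
- by move=> X n; apply: a1P.
- by move=> X Y f g a n m u; apply: a2N.
- by move=> X Y f n; apply: b2_id.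
- by move=> X Y f g h b a n; rewrite -a2_cmp b2_cmp cmp1m.
- by move=> X Y f g n; apply: A_lin.
- by move=> X Y Z f g n m u; apply: jpN.
- move=> X Y Z f f' a g n; rewrite jp_inner jp_post.
  by rewrite hc2_id !cmp1m !cmpm1.
- move=> X Y Z f g g' b n; rewrite jp_outer jp_post.
  by rewrite hc2_id !cmp1m !cmpm1.
- by move=> X n m u; apply: a1N.
- move=> W X Y Z h g f n; rewrite jp_post cmpm1 cmp1m; apply: jp_assoc.
    by rewrite hc2_id cmpm1 (inv21 (ascP h g f)) hc2_id cmp1m.
  by rewrite -[LHS]cmpA triangle lu1.
- move=> X Y f n; rewrite jp_post jp_unit_r cmpm1 cmp1m (inv21 (luP f)) lu1 (inv21 (ruP _)).
  exact: b2_id.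
- move=> X Y f n; rewrite jp_post jp_unit_l cmpm1 cmp1m (inv21 (ruP f)) (inv21 (luP _)).
  exact: b2_id.
Defined.

End Bimodule.

(** A pseudofunctor on the product, cut into an action of [D] and one of [C] that commute up to the
    interchange [bs]. In this form each fibre over [C] is a presheaf, to which representability
    applies. *)
Record bimod (k : fieldType) (C D : linbicat k) : Type := Bimod {
  bq :> C -> psh D;
  bm : forall {c c' : C} (g : hm c c') (d : D), linfunctor (bq c d) (bq c' d);
  bm2 : forall {c c' : C} {g g' : hm c c'} (b : mor g g') {d : D} (z : bq c d), mor (bm g d z) (bm g' d z);
  bs : forall {c c' : C} (g : hm c c') {d d' : D} (f : hm d' d) (z : bq c d), mor (bm g d z · f) (bm g d' (z · f));
  bw : forall {c c' c'' : C} (g' : hm c' c'') (g : hm c c') {d : D} (z : bq c d),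
    mor (bm g' d (bm g d z)) (bm (g' ∘ g) d z);
  bo : forall {c : C} {d : D} (z : bq c d), mor z (bm (one c) d z);
  bsI : forall c c' (g : hm c c') d d' (f : hm d' d) (z : bq c d), is_iso (bs g f z);
  bwI : forall c c' c'' (g' : hm c' c'') (g : hm c c') d (z : bq c d), is_iso (bw g' g z);
  boI : forall c d (z : bq c d), is_iso (bo z);
  bm2N : forall c c' (g g' : hm c c') (b : mor g g') d (z z' : bq c d) (h : mor z z'),
    bm2 b z' ∙ fmor (bm g d) h = fmor (bm g' d) h ∙ bm2 b z;
  bm2_id : forall c c' (g : hm c c') d (z : bq c d), bm2 (idm g) z = idm (bm g d z);
  bm2_cmp : forall c c' (g g' g'' : hm c c') (b' : mor g' g'') (b : mor g g') d (z : bq c d),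
    bm2 (b' ∙ b) z = bm2 b' z ∙ bm2 b z;
  bm2_lin : forall c c' (g g' : hm c c') d (z : bq c d),
    linear (fun b : @lmor k (lhm c c') g g' => bm2 b z : lmor (bm g d z) (bm g' d z));
  bsN : forall c c' (g : hm c c') d d' (f : hm d' d) (z z' : bq c d) (h : mor z z'),
    bs g f z' ∙ (fmor (bm g d) h • f) = fmor (bm g d') (h • f) ∙ bs g f z;
  bsNf : forall c c' (g : hm c c') d d' (f f' : hm d' d) (a : mor f f') (z : bq c d),
    bs g f' z ∙ (bm g d z ◂ a) = fmor (bm g d') (z ◂ a) ∙ bs g f z;
  bsNg : forall c c' (g g' : hm c c') (b : mor g g') d d' (f : hm d' d) (z : bq c d),
    bs g' f z ∙ (bm2 b z • f) = bm2 b (z · f) ∙ bs g f z;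
  bs_pw : forall c c' (g : hm c c') d d' d'' (f : hm d' d) (f' : hm d'' d') (z : bq c d),
    bs g (f ∘ f') z ∙ pw f f' (bm g d z) = fmor (bm g d'') (pw f f' z) ∙ bs g f' (z · f) ∙ (bs g f z • f');
  bs_pu : forall c c' (g : hm c c') d (z : bq c d), bs g (one d) z ∙ pu (bm g d z) = fmor (bm g d) (pu z);
  bs_bw : forall c c' c'' (g' : hm c' c'') (g : hm c c') d d' (f : hm d' d) (z : bq c d),
    bs (g' ∘ g) f z ∙ (bw g' g z • f) = bw g' g (z · f) ∙ fmor (bm g' d') (bs g f z) ∙ bs g' f (bm g d z);
  bs_bo : forall c d d' (f : hm d' d) (z : bq c d), bs (one c) f z ∙ (bo z • f) = bo (z · f);
  bwNz : forall c c' c'' (g' : hm c' c'') (g : hm c c') d (z z' : bq c d) (h : mor z z'),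
    bw g' g z' ∙ fmor (bm g' d) (fmor (bm g d) h) = fmor (bm (g' ∘ g) d) h ∙ bw g' g z;
  bwNl : forall c c' c'' (g1 g2 : hm c' c'') (b : mor g1 g2) (g : hm c c') d (z : bq c d),
    bw g2 g z ∙ bm2 b (bm g d z) = bm2 (b ⋆ idm g) z ∙ bw g1 g z;
  bwNr : forall c c' c'' (g' : hm c' c'') (g1 g2 : hm c c') (b : mor g1 g2) d (z : bq c d),
    bw g' g2 z ∙ fmor (bm g' d) (bm2 b z) = bm2 (idm g' ⋆ b) z ∙ bw g' g1 z;
  boN : forall c d (z z' : bq c d) (h : mor z z'), bo z' ∙ h = fmor (bm (one c) d) h ∙ bo z;
  basc : forall c0 c1 c2 c3 (g3 : hm c2 c3) (g2 : hm c1 c2) (g1 : hm c0 c1) d (z : bq c0 d),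
    bm2 (asc g3 g2 g1) z ∙ bw (g3 ∘ g2) g1 z ∙ bw g3 g2 (bm g1 d z) = bw g3 (g2 ∘ g1) z ∙ fmor (bm g3 d) (bw g2 g1 z);
  blu : forall c c' (g : hm c c') d (z : bq c d), bm2 (lu g) z ∙ bw (one c') g z ∙ bo (bm g d z) = idm (bm g d z);
  bru : forall c c' (g : hm c c') d (z : bq c d), bm2 (ru g) z ∙ bw g (one c) z ∙ fmor (bm g d) (bo z) = idm (bm g d z) }.

Arguments bm {k C D} Q {c c'} g d : rename.
Arguments bm2 {k C D} Q {c c' g g'} b {d} z : rename.
Arguments bs {k C D} Q {c c'} g {d d'} f z : rename.
Arguments bw {k C D} Q {c c' c''} g' g {d} z : rename.
Arguments bo {k C D} Q {c d} z : rename.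

Section BimoduleOfAction.
Variables (k : fieldType) (C D : linbicat k).
Variable A : action k (prod_bicat (op_bicat D) C).
Hypothesis A_lin : forall c (X Y : D) (f g : @hm D X Y) (n : A (Y, c)),
  linear (fun a : @lmor k (lhm X Y) f g => a2 (b2 a (idm (one c))) n : lmor (au A (bu f (one c)) n) (au A (bu g (one c)) n)).
Hypothesis A_lin' : forall c c' (d : D) (g g' : @hm C c c') (n : A (d, c)),
  linear (fun b : @lmor k (lhm c c') g g' => a2 (b2 (idm (one d)) b) n : lmor (au A (bu (one d) g) n) (au A (bu (one d) g') n)).

Let lu1 (B : bicategory) (c : B) : lu (one c) = ru (one c) := lu_one c.
Let iid (B : category) (x : B) : is_iso (idm x) := is_iso_id x.
Let ilu (B : bicategory) (X Y : B) (f : hm X Y) : is_iso (lu f) := ex_intro _ _ (luP f).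
Let iru (B : bicategory) (X Y : B) (f : hm X Y) : is_iso (ru f) := ex_intro _ _ (ruP f).

(** The action of [(f, g)] factors in two ways: with [f] first for [spl], with [g] first for
    [spr]. *)
Definition spl c c' (g : @hm C c c') d d' (f : @hm D d' d) (z : A (d, c)) :
  mor (au A (bu (one d') g) (au A (bu f (one c)) z)) (au A (bu f g) z) := jp (ru f) (ru g) z.
Definition spr c c' (g : @hm C c c') d d' (f : @hm D d' d) (z : A (d, c)) :
  mor (au A (bu f (one c')) (au A (bu (one d) g) z)) (au A (bu f g) z) := jp (lu f) (lu g) z.

Lemma spl_iso c c' (g : @hm C c c') d d' (f : @hm D d' d) (z : A (d, c)) : is_iso (spl g f z).
Proof. exact: jp_iso. Qed.
Lemma spr_iso c c' (g : @hm C c c') d d' (f : @hm D d' d) (z : A (d, c)) : is_iso (spr g f z).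
Proof. exact: jp_iso. Qed.

Definition spli c c' (g : @hm C c c') d d' (f : @hm D d' d) (z : A (d, c)) := sval (cid (spl_iso g f z)).
Lemma splP c c' (g : @hm C c c') d d' (f : @hm D d' d) (z : A (d, c)) : inverse (spl g f z) (spli g f z).
Proof. exact: svalP (cid (spl_iso g f z)). Qed.

(* The interchange of the actions of [g] and [f]. *)
Definition swp c c' (g : @hm C c c') d d' (f : @hm D d' d) (z : A (d, c)) :
  mor (au A (bu f (one c')) (au A (bu (one d) g) z)) (au A (bu (one d') g) (au A (bu f (one c)) z)) :=
  locked (spli g f z ∙ spr g f z).

Lemma swpE c c' (g : @hm C c c') d d' (f : @hm D d' d) (z : A (d, c)) : spl g f z ∙ swp g f z = spr g f z.
Proof. by rewrite /swp -lock cmpA (inv21 (splP g f z)) cmp1m. Qed.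

Lemma spr_f c c' (g : @hm C c c') d d' (f f' : @hm D d' d) (a : mor f f') (z : A (d, c)) :
  spr g f' z ∙ a2 (b2 a (idm (one c'))) (au A (bu (one d) g) z) = a2 (b2 a (idm g)) z ∙ spr g f z.
Proof. by rewrite /spr jp_outer jp_post hc2_id cmpm1 cmp1m luN. Qed.
Lemma spl_f c c' (g : @hm C c c') d d' (f f' : @hm D d' d) (a : mor f f') (z : A (d, c)) :
  spl g f' z ∙ fmor (au A (bu (one d') g)) (a2 (b2 a (idm (one c))) z) = a2 (b2 a (idm g)) z ∙ spl g f z.
Proof. by rewrite /spl jp_inner jp_post hc2_id cmpm1 cmp1m ruN. Qed.
Lemma spr_g c c' (g g' : @hm C c c') (b : mor g g') d d' (f : @hm D d' d) (z : A (d, c)) :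
  spr g' f z ∙ fmor (au A (bu f (one c'))) (a2 (b2 (idm (one d)) b) z) = a2 (b2 (idm f) b) z ∙ spr g f z.
Proof. by rewrite /spr jp_inner jp_post hc2_id cmpm1 cmp1m luN. Qed.
Lemma spl_g c c' (g g' : @hm C c c') (b : mor g g') d d' (f : @hm D d' d) (z : A (d, c)) :
  spl g' f z ∙ a2 (b2 (idm (one d')) b) (au A (bu f (one c)) z) = a2 (b2 (idm f) b) z ∙ spl g f z.
Proof. by rewrite /spl jp_outer jp_post hc2_id cmpm1 cmp1m ruN. Qed.

(** Both sides are compared after joining everything into the single action of [(f ∘ f', g)], where
    each rebracketing is an instance of [jp_assoc]. *)
Lemma swp_pw c c' (g : @hm C c c') d d' d'' (f : @hm D d' d) (f' : @hm D d'' d') (z : A (d, c)) :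
  swp g (f ∘ f') z ∙ jp (idm (f ∘ f')) (lu (one c')) (au A (bu (one d) g) z)
  = fmor (au A (bu (one d'') g)) (jp (idm (f ∘ f')) (lu (one c)) z) ∙ swp g f' (au A (bu f (one c)) z)
    ∙ fmor (au A (bu f' (one c'))) (swp g f z).
Proof.
have n1 : jp (idm (f ∘ f')) (lu g) z ∙ fmor (au A (bu f' (one c'))) (spr g f z)
    = spr g (f ∘ f') z ∙ jp (idm (f ∘ f')) (lu (one c')) (au A (bu (one d) g) z).
  apply: jp_assoc; first by rewrite cmp1m lu_hc' hc2_id cmpm1.
  by rewrite -cmpA triangle lu1.
have n2 : jp (idm (f ∘ f')) (lu g) z ∙ fmor (au A (bu f' (one c'))) (spl g f z)
    = jp (idm (f ∘ f')) (ru g) z ∙ spr g f' (au A (bu f (one c)) z).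
  apply: jp_assoc; first by rewrite !cmp1m triangle'.
  by rewrite -cmpA ru_hc -ruN.
have n3 : spl g (f ∘ f') z ∙ fmor (au A (bu (one d'') g)) (jp (idm (f ∘ f')) (lu (one c)) z)
    = jp (idm (f ∘ f')) (ru g) z ∙ spl g f' (au A (bu f (one c)) z).
  apply: jp_assoc; last by rewrite -cmpA triangle.
  by rewrite hc2_id cmpm1 cmp1m -ru_hc -cmpA (inv21 (ascP _ _ _)) cmpm1.
apply: (cancel_l (splP g (f ∘ f') z)).
rewrite cmpA swpE -n1 [RHS]cmpA [X in _ = X ∙ _]cmpA n3 -(cmpA (jp _ (ru g) z)) swpE -n2.
by rewrite -[RHS]cmpA -fmor_cmp swpE.
Qed.

Lemma swp_bw c c' c'' (g' : @hm C c' c'') (g : @hm C c c') d d' (f : @hm D d' d) (z : A (d, c)) :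
  swp (g' ∘ g) f z ∙ fmor (au A (bu f (one c''))) (jp (lu (one d)) (idm (g' ∘ g)) z)
  = jp (lu (one d')) (idm (g' ∘ g)) (au A (bu f (one c)) z) ∙ fmor (au A (bu (one d') g')) (swp g f z)
    ∙ swp g' f (au A (bu (one d) g) z).
Proof.
have w1 : jp (ru f) (idm (g' ∘ g)) z ∙ fmor (au A (bu (one d') g')) (spl g f z)
   = spl (g' ∘ g) f z ∙ jp (lu (one d')) (idm (g' ∘ g)) (au A (bu f (one c)) z).
  apply: jp_assoc; first by rewrite -cmpA triangle'.
  by rewrite cmp1m ru_hc hc2_id cmpm1.
have w2 : spr (g' ∘ g) f z ∙ fmor (au A (bu f (one c''))) (jp (lu (one d)) (idm (g' ∘ g)) z)
   = jp (lu f) (idm (g' ∘ g)) z ∙ spr g' f (au A (bu (one d) g) z).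
  apply: jp_assoc; first by rewrite lu1 -cmpA triangle'.
  by rewrite hc2_id cmpm1 cmp1m lu_hc.
have w3 : jp (ru f) (idm (g' ∘ g)) z ∙ fmor (au A (bu (one d') g')) (spr g f z)
   = jp (lu f) (idm (g' ∘ g)) z ∙ spl g' f (au A (bu (one d) g) z).
  apply: jp_assoc; first by rewrite -cmpA lu_hc' luN.
  by rewrite !cmp1m triangle.
apply: (cancel_l (splP (g' ∘ g) f z)); rewrite cmpA swpE w2.
rewrite [RHS]cmpA [X in _ = X ∙ _]cmpA -w1 -(cmpA (jp (ru f) _ z)) -fmor_cmp swpE w3.
by rewrite -[RHS]cmpA swpE.
Qed.

Definition bimod_of : bimod C D.
Proof.
refine (@Bimod k C D (act_psh A_lin) (fun c c' g d => au A (bu (one d) g)) (fun c c' g g' b d z => a2 (b2 (idm (one d)) b) z)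
  (fun c c' g d d' f z => swp g f z) (fun c c' c'' g' g d z => jp (lu (one d)) (idm (g' ∘ g)) z) (fun c d z => a1 z)
  _ _ _ _ _ _ _ _ _ _ _ _ _ _ _ _ _ _ _ _ _).
- move=> c c' g d d' f z; rewrite /swp -lock; apply: is_iso_cmp; last exact: spr_iso.
  by exists (spl g f z); apply/inverse_sym/splP.
- by move=> *; apply: jp_iso.
- by move=> c d z; exists (a1i z); apply: a1P.
- by move=> *; apply: a2N.
- by move=> *; apply: b2_id.
- by move=> c c' g g' g'' b' b d z; rewrite -a2_cmp b2_cmp cmp1m.
- by move=> *; apply: A_lin'.
- move=> c c' g d d' f z z' h; apply: (cancel_l (splP g f z')).
  rewrite [LHS]cmpA [RHS]cmpA [X in X ∙ _ = _]swpE [LHS]jpN [X in _ = X ∙ _]jpN -[RHS]cmpA.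
  by rewrite [X in _ = _ ∙ X]swpE.
- move=> c c' g d d' f f' a z; apply: (cancel_l (splP g f' z)).
  rewrite [LHS]cmpA [RHS]cmpA [X in X ∙ _ = _]swpE [LHS]spr_f [X in _ = X ∙ _]spl_f -[RHS]cmpA.
  by rewrite [X in _ = _ ∙ X]swpE.
- move=> c c' g g' b d d' f z; apply: (cancel_l (splP g' f z)).
  rewrite [LHS]cmpA [RHS]cmpA [X in X ∙ _ = _]swpE [LHS]spr_g [X in _ = X ∙ _]spl_g -[RHS]cmpA.
  by rewrite [X in _ = _ ∙ X]swpE.
- by move=> c c' g d d' d'' f f' z; apply: swp_pw.
- move=> c c' g d z; apply: (cancel_l (splP g (one d) z)).
  rewrite [LHS]cmpA [X in X ∙ _ = _]swpE [LHS]jp_unit_l [RHS]jp_unit_r lu1 (inv21 (ruP _)) (inv21 (luP _)).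
  by rewrite -lu1 (inv21 (luP _)) (inv21 (ruP _)).
- by move=> *; apply: swp_bw.
- move=> c d d' f z; apply: (cancel_l (splP (one c) f z)).
  rewrite [LHS]cmpA [X in X ∙ _ = _]swpE [LHS]jp_unit_r [RHS]jp_unit_l (inv21 (ruP _)) (inv21 (luP _)).
  by rewrite lu1 (inv21 (ruP _)) -lu1 (inv21 (luP _)).
- by move=> *; apply: jpN.
- move=> c c' c'' g1 g2 b g d z; rewrite [LHS]jp_outer [RHS]jp_post.
  by rewrite hc2_id !cmp1m !cmpm1.
- move=> c c' c'' g' g1 g2 b d z; rewrite [LHS]jp_inner [RHS]jp_post.
  by rewrite hc2_id !cmp1m !cmpm1.
- by move=> *; apply: a1N.
- move=> c0 c1 c2 c3 g3 g2 g1 d z; rewrite [X in X ∙ _]jp_post; apply/esym/jp_assoc.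
    by rewrite cmp1m -cmpA [X in _ ∙ ((X ⋆ _) ∙ _)]lu1 triangle'.
  by rewrite hc2_id !cmp1m hc2_id !cmpm1.
- move=> c c' g d z; rewrite [X in X ∙ _]jp_post [LHS]jp_unit_l cmp1m cmpm1 (inv21 (luP _)) lu1 (inv21 (ruP _)).
  exact: b2_id.
- move=> c c' g d z; rewrite [X in X ∙ _]jp_post [LHS]jp_unit_r cmp1m cmpm1 (inv21 (ruP _)) (inv21 (luP _)).
  exact: b2_id.
Defined.

End BimoduleOfAction.

(** * The representing pseudofunctor *)

Lemma ff_reflect_iso (k : fieldType) (D : linbicat k) (Q : psh D) (X : D) (x : Q X) (xff : fully_faithful_at x)
  W (f g : hm W X) (a : mor f g) : is_iso (x ◂ a) -> is_iso a.
Proof.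
move=> [h [h1 h2]]; have [b bE] := ff_full xff h.
by exists b; split; apply: (ff_inj xff); rewrite pa2_cmp pa2_id bE.
Qed.

(** [F g] is chosen to represent the image of [x c] under [g], with comparison [ph]. The values of
    [F] on 2-morphisms, its compositors and its units are then defined as the solutions of the last
    three equations, in this order. *)
Lemma represent_pf (k : fieldType) (C D : linbicat k) (Q : bimod C D) (F0 : C -> D) (x : forall c, Q c (F0 c)) :
  (forall c, fully_faithful_at (x c)) ->
  (forall c Z (z : Q c Z), exists h : hm Z (F0 c), isomorphic z (x c · h)) ->
  exists (F : pseudofunctor C D) (y : forall c, Q c (F c))
    (ph : forall c c' (g : hm c c'), mor (y c' · pf1 F g) (bm Q g (F c) (y c))),
  [/\ forall c, fully_faithful_at (y c), forall c Z (z : Q c Z), exists h : hm Z (F c), isomorphic z (y c · h),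
      forall c c' (g : hm c c'), is_iso (ph c c' g) &
      [/\ forall c c' (g g' : hm c c') (b : mor g g'), ph c c' g' ∙ (y c' ◂ pf2 F b) = bm2 Q b (y c) ∙ ph c c' g,
      forall c c' c'' (g' : hm c' c'') (g : hm c c'),
        ph c c'' (g' ∘ g) ∙ (y c'' ◂ pfc F g' g) ∙ pw (pf1 F g') (pf1 F g) (y c'')
        = bw Q g' g (y c) ∙ fmor (bm Q g' (F c)) (ph c c' g) ∙ bs Q g' (pf1 F g) (y c') ∙ (ph c' c'' g' • pf1 F g) &
      forall c, ph c c (one c) ∙ (y c ◂ pfu F c) ∙ pu (y c) = bo Q (y c)]].
Proof.
move=> xff xes.
have [F1 H1] := dep_choice (fun c => dep_choice (fun c' => dep_choice (fun g : hm c c' => xes c' _ (bm Q g (F0 c) (x c))))).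
have [ph [phi phP]] : exists (ph : forall c c' (g : hm c c'), mor (x c' · F1 c c' g) (bm Q g (F0 c) (x c)))
    (phi : forall c c' (g : hm c c'), mor (bm Q g (F0 c) (x c)) (x c' · F1 c c' g)), forall c c' g, inverse (ph c c' g) (phi c c' g).
  have [ph Hph] := dep_choice (fun c => dep_choice (fun c' => dep_choice (fun g : hm c c' => isomorphic_sym (H1 c c' g)))).
  have [phi phP] := dep_choice (fun c => dep_choice (fun c' => dep_choice (fun g : hm c c' => Hph c c' g))).
  by exists ph, phi.
have [F2 F2E] : exists F2 : forall c c' (g g' : hm c c') (b : mor g g'), mor (F1 c c' g) (F1 c c' g'),
    forall c c' g g' b, ph c c' g' ∙ (x c' ◂ F2 c c' g g' b) = bm2 Q b (x c) ∙ ph c c' g.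
  have [F2 HF] := dep_choice (fun c => dep_choice (fun c' => dep_choice (fun g : hm c c' => dep_choice (fun g' : hm c c' =>
    dep_choice (fun b : mor g g' => ff_full (xff c') (phi c c' g' ∙ (bm2 Q b (x c) ∙ ph c c' g))))))).
  by exists F2 => c c' g g' b; rewrite HF (cancelK _ (inverse_sym (phP c c' g'))).
(* 2-morphisms into a value of [F] are determined by their action on [x c'] followed by [ph]; all
   laws of [F] are tested in this way. *)
have can c c' (g : hm c c') f (a b : mor f (F1 c c' g)) : ph c c' g ∙ (x c' ◂ a) = ph c c' g ∙ (x c' ◂ b) -> a = b.
  by move=> E; apply: (ff_inj (xff c')); apply: (cancel_l (phP c c' g)) E.
have [Fc FcE] : exists Fc : forall c c' c'' (g' : hm c' c'') (g : hm c c'), mor (F1 c' c'' g' ∘ F1 c c' g) (F1 c c'' (g' ∘ g)),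
    forall c c' c'' g' g, ph c c'' (g' ∘ g) ∙ (x c'' ◂ Fc c c' c'' g' g) ∙ pw (F1 c' c'' g') (F1 c c' g) (x c'')
        = bw Q g' g (x c) ∙ fmor (bm Q g' (F0 c)) (ph c c' g) ∙ bs Q g' (F1 c c' g) (x c') ∙ (ph c' c'' g' • F1 c c' g).
  have [Fc HF] := dep_choice (fun c => dep_choice (fun c' => dep_choice (fun c'' => dep_choice (fun g' : hm c' c'' => dep_choice (fun g : hm c c' =>
    ff_full (xff c'') (phi c c'' (g' ∘ g) ∙ (bw Q g' g (x c) ∙ fmor (bm Q g' (F0 c)) (ph c c' g) ∙ bs Q g' (F1 c c' g) (x c') ∙ (ph c' c'' g' • F1 c c' g))
      ∙ pwi (F1 c' c'' g') (F1 c c' g) (x c''))))))).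
  exists Fc => c c' c'' g' g; rewrite HF -!cmpA (inv12 (pwP _ _ _)) cmpm1.
  by rewrite (cancelK _ (inverse_sym (phP c c'' (g' ∘ g)))).
have [Fu FuE] : exists Fu : forall c, mor (one (F0 c)) (F1 c c (one c)),
    forall c, ph c c (one c) ∙ (x c ◂ Fu c) ∙ pu (x c) = bo Q (x c).
  have [Fu HF] := dep_choice (fun c => ff_full (xff c) (phi c c (one c) ∙ bo Q (x c) ∙ pui (x c))).
  exists Fu => c; rewrite HF -!cmpA (inv12 (puP _)) cmpm1.
  by rewrite (cancelK _ (inverse_sym (phP c c (one c)))).
have FcI c c' c'' (g' : hm c' c'') (g : hm c c') : is_iso (Fc c c' c'' g' g).
  apply: (ff_reflect_iso (xff c'')); have [s sP] := bsI g' (F1 c c' g) (x c'); have [w wP] := bwI g' g (x c).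
  have -> : x c'' ◂ Fc c c' c'' g' g = phi c c'' (g' ∘ g) ∙ (bw Q g' g (x c) ∙ fmor (bm Q g' (F0 c)) (ph c c' g)
      ∙ bs Q g' (F1 c c' g) (x c') ∙ (ph c' c'' g' • F1 c c' g)) ∙ pwi (F1 c' c'' g') (F1 c c' g) (x c'').
    rewrite -FcE -!cmpA (inv21 (pwP _ _ _)) cmpm1.
    by rewrite (cancelK _ (phP c c'' (g' ∘ g))).
  apply: is_iso_cmp; last by exists (pw (F1 c' c'' g') (F1 c c' g) (x c'')); apply/inverse_sym/pwP.
  apply: is_iso_cmp; first by exists (ph c c'' (g' ∘ g)); apply/inverse_sym/phP.
  apply: is_iso_cmp; last by apply: is_iso_fmor; exists (phi c' c'' g'); apply: phP.
  apply: is_iso_cmp; last by exists s.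
  by apply: is_iso_cmp; [exists w | apply: is_iso_fmor; exists (phi c c' g); apply: phP].
have FuI c : is_iso (Fu c).
  apply: (ff_reflect_iso (xff c)); have [w wP] := boI (x c).
  have -> : x c ◂ Fu c = phi c c (one c) ∙ bo Q (x c) ∙ pui (x c).
    rewrite -FuE -!cmpA (inv21 (puP _)) cmpm1.
    by rewrite (cancelK _ (phP c c (one c))).
  apply: is_iso_cmp; last by exists (pu (x c)); apply/inverse_sym/puP.
  by apply: is_iso_cmp; [exists (ph c c (one c)); apply/inverse_sym/phP | exists w].
have FcN c c' c'' (g1 g2 : hm c' c'') (f1 f2 : hm c c') (b : mor g1 g2) (a : mor f1 f2) :
    Fc c c' c'' g2 f2 ∙ (F2 _ _ _ _ b ⋆ F2 _ _ _ _ a) = F2 _ _ _ _ (b ⋆ a) ∙ Fc c c' c'' g1 f1.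
  apply: can; rewrite !pa2_cmp; apply: (cancel_r (pwP (F1 c' c'' g1) (F1 c c' f1) (x c''))).
  rewrite -(hc2_rl (F2 _ _ _ _ b) (F2 _ _ _ _ a)) pa2_cmp -!cmpA; rq (F2E c c'' _ _ (b ⋆ a)); rq (FcE c c' c'' g1 f1).
  rq (esym (pwNl (F2 _ _ _ _ b) (F1 c c' f1) (x c''))); rq (esym (pwNr (F1 c' c'' g2) (F2 _ _ _ _ a) (x c''))).
  rq (FcE c c' c'' g2 f2); rq (esym (pa2N (F2 _ _ _ _ a) (ph c' c'' g2))); rewrite -fmor_cmp F2E fmor_cmp.
  rq (bsNf g2 (F2 _ _ _ _ a) (x c')); rq (whf (bm Q g2 (F0 c)) (F2E c c' _ _ a)); rq (bwNr g2 a (x c)).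
  rq (bsNg b (F1 c c' f1) (x c')); rq (esym (bm2N b (ph c c' f1))); rq (bwNl b f1 (x c)).
  by rewrite cmpA -bm2_cmp hc2_rl.
have Fasc c0 c1 c2 c3 (h : hm c2 c3) (g : hm c1 c2) (f : hm c0 c1) :
    F2 _ _ _ _ (asc h g f) ∙ Fc _ _ _ (h ∘ g) f ∙ (Fc _ _ _ h g ⋆ idm (F1 _ _ f))
    = Fc _ _ _ h (g ∘ f) ∙ (idm (F1 _ _ h) ⋆ Fc _ _ _ g f) ∙ asc (F1 _ _ h) (F1 _ _ g) (F1 _ _ f).
  apply: can; rewrite !pa2_cmp; apply: (cancel_r (pwP (F1 _ _ h ∘ F1 _ _ g) (F1 _ _ f) (x c3))).
  apply: (cancel_r (inverse_fmor (pa (Q c3) (F1 _ _ f)) (pwP (F1 _ _ h) (F1 _ _ g) (x c3)))).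
  have W1 : (ph _ _ (h ∘ g) • F1 _ _ f) ∙ ((x c3 ◂ Fc _ _ _ h g) • F1 _ _ f) ∙ (pw (F1 _ _ h) (F1 _ _ g) (x c3) • F1 _ _ f)
      = (bw Q h g (x c1) • F1 _ _ f) ∙ (fmor (bm Q h _) (ph _ _ g) • F1 _ _ f) ∙ (bs Q h (F1 _ _ g) (x c2) • F1 _ _ f)
        ∙ (ph _ _ h • F1 _ _ g • F1 _ _ f) by rewrite -!fmor_cmp FcE.
  have W2 : fmor (bm Q h _) (ph _ _ (g ∘ f)) ∙ fmor (bm Q h _) (x c2 ◂ Fc _ _ _ g f) ∙ fmor (bm Q h _) (pw (F1 _ _ g) (F1 _ _ f) (x c2))
      = fmor (bm Q h _) (bw Q g f (x c0)) ∙ fmor (bm Q h _) (fmor (bm Q g _) (ph _ _ f)) ∙ fmor (bm Q h _) (bs Q g (F1 _ _ f) (x c1))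
        ∙ fmor (bm Q h _) (ph _ _ g • F1 _ _ f) by rewrite -!fmor_cmp FcE.
  rewrite -!cmpA; rq (F2E _ _ _ _ (asc h g f)); rq (esym (pwNl (Fc _ _ _ h g) (F1 _ _ f) (x c3))).
  rq (FcE _ _ _ (h ∘ g) f); rq W1; rq (bs_bw h g (F1 _ _ f) (x c1)); rq (esym (bwNz h g (ph _ _ f))).
  rq (basc h g f (x c0)).
  rq (pasc (F1 _ _ h) (F1 _ _ g) (F1 _ _ f) (x c3)); rq (esym (pwNr (F1 _ _ h) (Fc _ _ _ g f) (x c3))).
  rq (FcE _ _ _ h (g ∘ f)); rq (esym (pa2N (Fc _ _ _ g f) (ph _ _ h))); rq (esym (pwN (F1 _ _ g) (F1 _ _ f) (ph _ _ h))).
  rq (bsNf h (Fc _ _ _ g f) (x c2)); rq (bs_pw h (F1 _ _ g) (F1 _ _ f) (x c2)); rq W2.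
  by rq (esym (bsN h (F1 _ _ f) (ph _ _ g))).
have Flu c c' (f : hm c c') : F2 _ _ _ _ (lu f) ∙ Fc _ _ _ (one c') f ∙ (Fu c' ⋆ idm (F1 _ _ f)) = lu (F1 _ _ f).
  apply: can; rewrite !pa2_cmp; apply: (cancel_r (pwP (one _) (F1 _ _ f) (x c'))).
  apply: (cancel_r (inverse_fmor (pa (Q c') (F1 _ _ f)) (puP (x c')))).
  have W : (ph _ _ (one c') • F1 _ _ f) ∙ ((x c' ◂ Fu c') • F1 _ _ f) ∙ (pu (x c') • F1 _ _ f) = bo Q (x c') • F1 _ _ f
    by rewrite -!fmor_cmp FuE.
  rewrite -!cmpA; rq (F2E _ _ _ _ (lu f)); rq (esym (pwNl (Fu c') (F1 _ _ f) (x c'))).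
  rq (FcE _ _ _ (one c') f); rq W; rq (bs_bo (F1 _ _ f) (x c')); rq (esym (boN (ph _ _ f))); rq (blu f (x c)).
  by rq (plu (F1 _ _ f) (x c')); rewrite cmpm1 cmp1m.
have Fru c c' (f : hm c c') : F2 _ _ _ _ (ru f) ∙ Fc _ _ _ f (one c) ∙ (idm (F1 _ _ f) ⋆ Fu c) = ru (F1 _ _ f).
  apply: can; rewrite !pa2_cmp; apply: (cancel_r (pwP (F1 _ _ f) (one _) (x c'))).
  apply: (cancel_r (puP (x c' · F1 _ _ f))).
  have W : fmor (bm Q f _) (ph _ _ (one c)) ∙ fmor (bm Q f _) (x c ◂ Fu c) ∙ fmor (bm Q f _) (pu (x c)) = fmor (bm Q f _) (bo Q (x c))
    by rewrite -!fmor_cmp FuE.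
  rewrite -!cmpA; rq (F2E _ _ _ _ (ru f)); rq (esym (pwNr (F1 _ _ f) (Fu c) (x c'))).
  rq (FcE _ _ _ f (one c)); rq (esym (pa2N (Fu c) (ph _ _ f))); rq (esym (puN (ph _ _ f))).
  rq (bsNf f (Fu c) (x c)); rq (bs_pu f (x c)); rq W; rq (bru f (x c)).
  by rq (pru (F1 _ _ f) (x c')); rewrite cmpm1 cmp1m.
have F2id c c' (g : hm c c') : F2 _ _ _ _ (idm g) = idm (F1 _ _ g).
  by apply: can; rewrite F2E bm2_id pa2_id cmp1m cmpm1.
have F2cmp c c' (g1 g2 g3 : hm c c') (b' : mor g2 g3) (b : mor g1 g2) : F2 _ _ _ _ (b' ∙ b) = F2 _ _ _ _ b' ∙ F2 _ _ _ _ b.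
  by apply: can; rewrite pa2_cmp cmpA !F2E bm2_cmp -!cmpA F2E.
pose F : pseudofunctor C D := @Pseudofunctor C D F0 (fun c c' => @Functor _ _ (F1 c c') (F2 c c') (@F2id c c') (@F2cmp c c'))
  Fc Fu FcI FuI FcN Fasc Flu Fru.
by exists F, x, ph; split=> // c c' g; exists (phi c c' g); apply: phP.
Qed.

(** * Comparison with the Hom pseudofunctor *)

Section Comparison.
Variables (k : fieldType) (C D : linbicat k) (A : action k (prod_bicat (op_bicat D) C)) (F : pseudofunctor C D).
Variable x : forall c, A (F c, c).
Variable ph : forall c c' (g : @hm C c c'),
  mor (au A (bu (pf1 F g) (one c')) (x c')) (au A (bu (one (F c)) g) (x c)).
Arguments ph {c c'} g.
Hypothesis phI : forall c c' (g : @hm C c c'), is_iso (ph g).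
Hypothesis phN : forall c c' (g g' : @hm C c c') (b : mor g g'),
  ph g' ∙ a2 (b2 (pf2 F b) (idm (one c'))) (x c') = a2 (b2 (idm (one (F c))) b) (x c) ∙ ph g.

Local Notation pj f g z := (jp (idm (f ∘ g)) (lu (one _)) z).
Local Notation "f ! z" := (fob (lf_fun (au A (bu f (one _)))) z) (at level 35, right associativity).
Local Notation "f !! u" := (fmor (lf_fun (au A (bu f (one _)))) u) (at level 35, right associativity).

Hypothesis phc : forall c c' c'' (g' : @hm C c' c'') (g : @hm C c c'),
  ph (g' ∘ g) ∙ a2 (b2 (pfc F g' g) (idm (one c''))) (x c'') ∙ pj (pf1 F g') (pf1 F g) (x c'')
  = jp (lu (one (F c))) (idm (g' ∘ g)) (x c) ∙ fmor (au A (bu (one (F c)) g')) (ph g)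
    ∙ swp g' (pf1 F g) (x c') ∙ pf1 F g !! ph g'.
Hypothesis phu : forall c, ph (one c) ∙ a2 (b2 (pfu F c) (idm (one c))) (x c) ∙ a1 (x c) = a1 (x c).

Let lu1 (B : bicategory) (c : B) : lu (one c) = ru (one c) := lu_one c.

Lemma pj_iso c X Y Z (f : @hm D Y Z) (g : @hm D X Y) (z : A (Z, c)) : is_iso (pj f g z).
Proof. by apply: jp_iso; [apply: is_iso_id | exists (lui (one c)); apply: luP]. Qed.

Definition pji c X Y Z (f : @hm D Y Z) (g : @hm D X Y) (z : A (Z, c)) := sval (cid (pj_iso f g z)).
Lemma pjP c X Y Z (f : @hm D Y Z) (g : @hm D X Y) (z : A (Z, c)) : inverse (pj f g z) (pji f g z).
Proof. exact: svalP (cid (pj_iso f g z)). Qed.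

Lemma pjNl c X Y Z (f f' : @hm D Y Z) (a : mor f f') (g : @hm D X Y) (z : A (Z, c)) :
  pj f' g z ∙ (g !! a2 (b2 a (idm (one c))) z) = a2 (b2 (a ⋆ idm g) (idm (one c))) z ∙ pj f g z.
Proof. by rewrite jp_inner jp_post hc2_id !cmp1m !cmpm1. Qed.

Lemma pjNr c X Y Z (f : @hm D Y Z) (g g' : @hm D X Y) (a : mor g g') (z : A (Z, c)) :
  pj f g' z ∙ a2 (b2 a (idm (one c))) (f ! z) = a2 (b2 (idm f ⋆ a) (idm (one c))) z ∙ pj f g z.
Proof. by rewrite jp_outer jp_post hc2_id !cmp1m !cmpm1. Qed.

Lemma pj_asc c W X Y Z (h : @hm D Y Z) (g : @hm D X Y) (f : @hm D W X) (z : A (Z, c)) :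
  a2 (b2 (asci h g f) (idm (one c))) z ∙ pj h (g ∘ f) z ∙ pj g f (h ! z) = pj (h ∘ g) f z ∙ (f !! pj h g z).
Proof.
rewrite jp_post cmpm1 cmp1m; apply/esym/jp_assoc; first by rewrite !hc2_id !cmpm1 cmp1m.
by rewrite -[LHS]cmpA triangle lu1.
Qed.

(** The comparison transported along [m]: [ph g] compares [F g] with [g] at the point [x c], and
    [sigma g m] does so at its restriction along [m]. *)
Definition sigma c c' d (g : @hm C c c') (m : @hm D d (F c)) : mor ((pf1 F g ∘ m) ! x c') (au A (bu m g) (x c)) :=
  locked (spr g m (x c) ∙ (m !! ph g) ∙ pji (pf1 F g) m (x c')).

Lemma sigmaE c c' d (g : @hm C c c') (m : @hm D d (F c)) :
  sigma g m ∙ pj (pf1 F g) m (x c') = spr g m (x c) ∙ (m !! ph g).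
Proof. by rewrite /sigma -lock -[LHS]cmpA (inv12 (pjP _ _ _)) cmpm1. Qed.

Lemma sigma_iso c c' d (g : @hm C c c') (m : @hm D d (F c)) : is_iso (sigma g m).
Proof.
rewrite /sigma -lock; apply: is_iso_cmp; last by exists (pj (pf1 F g) m (x c')); apply/inverse_sym/pjP.
by apply: is_iso_cmp; [apply: spr_iso | apply: is_iso_fmor].
Qed.

Definition theta c c' d (g : @hm C c c') (m : @hm D d (F c)) := sval (cid (sigma_iso g m)).
Lemma thetaP c c' d (g : @hm C c c') (m : @hm D d (F c)) : inverse (sigma g m) (theta g m).
Proof. exact: svalP (cid (sigma_iso g m)). Qed.

Lemma sigmaN c c' d (g g' : @hm C c c') (b : mor g g') (m m' : @hm D d (F c)) (a : mor m m') :
  sigma g' m' ∙ a2 (b2 (pf2 F b ⋆ a) (idm (one c'))) (x c') = a2 (b2 a b) (x c) ∙ sigma g m.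
Proof.
apply: (cancel_r (pjP (pf1 F g) m (x c'))); rewrite -[RHS]cmpA sigmaE.
have -> : a2 (b2 (pf2 F b ⋆ a) (idm (one c'))) (x c')
    = a2 (b2 (pf2 F b ⋆ idm m') (idm (one c'))) (x c') ∙ a2 (b2 (idm (pf1 F g) ⋆ a) (idm (one c'))) (x c').
  by rewrite -a2_cmp b2_cmp -hc2_cmp !cmpm1 cmp1m.
rewrite -!cmpA; rq (esym (pjNr (pf1 F g) a (x c'))); rq (esym (pjNl (pf2 F b) m' (x c'))); rq (sigmaE g' m').
have E1 : (m' !! ph g') ∙ (m' !! a2 (b2 (pf2 F b) (idm (one c'))) (x c')) ∙ a2 (b2 a (idm (one c'))) (pf1 F g ! x c')
    = (m' !! a2 (b2 (idm (one (F c))) b) (x c)) ∙ a2 (b2 a (idm (one c'))) (au A (bu (one (F c)) g) (x c)) ∙ (m !! ph g).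
  by rewrite -fmor_cmp phN fmor_cmp -!cmpA a2N.
rq E1; rq (spr_g b m' (x c)); rq (spr_f g a (x c)).
by rewrite cmpA -a2_cmp b2_cmp cmpm1 cmp1m.
Qed.

Lemma thetaN c c' d (g g' : @hm C c c') (b : mor g g') (m m' : @hm D d (F c)) (a : mor m m') :
  a2 (b2 (pf2 F b ⋆ a) (idm (one c'))) (x c') ∙ theta g m = theta g' m' ∙ a2 (b2 a b) (x c).
Proof.
apply: (cancel_l (thetaP g' m')); apply: (cancel_r (thetaP g m)).
by rewrite -!cmpA (inv12 (thetaP g m)) cmpm1 (cmpA (sigma g' m')) (inv21 (thetaP g' m')) cmp1m sigmaN.
Qed.

(** The naturality cell at [(f, g)] of the comparison [h |-> h ! x c]; its target is bracketed as in
    the Hom pseudofunctor. *)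
Definition compar c c' d d' (f : @hm D d' d) (g : @hm C c c') (h : @hm D d (F c)) :
  mor (au A (bu f g) (h ! x c)) ((pf1 F g ∘ (h ∘ f)) ! x c') :=
  theta g (h ∘ f) ∙ jp (f' := f) (idm (h ∘ f)) (ru g) (x c).

Lemma compar_iso c c' d d' (f : @hm D d' d) (g : @hm C c c') (h : @hm D d (F c)) : is_iso (compar f g h).
Proof.
apply: is_iso_cmp; first by exists (sigma g (h ∘ f)); apply/inverse_sym/thetaP.
by apply: jp_iso; [apply: is_iso_id | exists (rui g); apply: ruP].
Qed.

Lemma compar_nat c c' d d' (f : @hm D d' d) (g : @hm C c c') (h h' : @hm D d (F c)) (a : mor h h') :
  compar f g h' ∙ fmor (au A (bu f g)) (a2 (b2 a (idm (one c))) (x c))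
  = a2 (b2 (idm (pf1 F g) ⋆ (a ⋆ idm f)) (idm (one c'))) (x c') ∙ compar f g h.
Proof.
rewrite /compar -[LHS]cmpA jp_inner [RHS]cmpA -(fmor_id (pf1 F)) thetaN -[RHS]cmpA jp_post.
by rewrite hc2_id !cmp1m !cmpm1.
Qed.

Lemma compar_cell c c' d d' (f f' : @hm D d' d) (g g' : @hm C c c') (a : mor f f') (b : mor g g') (h : @hm D d (F c)) :
  a2 (b2 (pf2 F b ⋆ (idm h ⋆ a)) (idm (one c'))) (x c') ∙ compar f g h = compar f' g' h ∙ a2 (b2 a b) (h ! x c).
Proof.
by rewrite /compar -[RHS]cmpA jp_outer [LHS]cmpA thetaN -[LHS]cmpA jp_post !cmpm1 cmp1m ruN.
Qed.

Lemma compar_unit c d (h : @hm D d (F c)) :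
  compar (one d) (one c) h ∙ a1 (h ! x c)
  = a2 (b2 ((pfu F c ⋆ (idm h ⋆ idm (one d))) ∙ (lui (h ∘ one d) ∙ rui h)) (idm (one c))) (x c).
Proof.
have E0 : sigma (one c) h ∙ a2 (b2 ((pfu F c ⋆ idm h) ∙ lui h) (idm (one c))) (x c) = idm (h ! x c).
  have -> : a2 (b2 ((pfu F c ⋆ idm h) ∙ lui h) (idm (one c))) (x c)
      = a2 (b2 (pfu F c ⋆ idm h) (idm (one c))) (x c) ∙ (pj (one (F c)) h (x c) ∙ (h !! a1 (x c))).
    by rewrite jp_unit_r cmp1m lu1 (inv21 (ruP _)) -a2_cmp b2_cmp cmp1m.
  rq (esym (pjNl (pfu F c) h (x c))); rq (sigmaE (one c) h).
  by rewrite -!fmor_cmp cmpA phu jp_unit_r (inv21 (luP h)) lu1 (inv21 (ruP _)) b2_id.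
have -> : (pfu F c ⋆ (idm h ⋆ idm (one d))) ∙ (lui (h ∘ one d) ∙ rui h)
    = (idm (pf1 F (one c)) ⋆ rui h) ∙ ((pfu F c ⋆ idm h) ∙ lui h).
  by rewrite hc2_id -luiN !cmpA -!hc2_cmp !cmp1m !cmpm1.
apply: (cancel_l (thetaP (one c) (h ∘ one d))); rewrite /compar -[X in _ ∙ X = _]cmpA [LHS]cmpA (inv21 (thetaP _ _)) cmp1m.
rewrite jp_unit_l cmp1m -lu1 (inv21 (luP _)).
by rewrite -[idm (one c)]cmp1m -b2_cmp a2_cmp cmpA -(fmor_id (pf1 F)) sigmaN -cmpA E0 !cmpm1.
Qed.

(** Compatibility with composition in [C]: precomposing with invertible cells brings both sides to
    the two sides of [phc], acted on by [m]. Afterwards [theta_join] adds an action of [D], and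
    [compar_comp] the bracketing of the Hom pseudofunctor. *)
Lemma theta_split c c' c'' d (g : @hm C c c') (g' : @hm C c' c'') (m : @hm D d (F c)) :
  theta (g' ∘ g) m ∙ jp (lu m) (idm (g' ∘ g)) (x c) ∙ fmor (au A (bu m g')) (ph g)
  = a2 (b2 ((pfc F g' g ⋆ idm m) ∙ asci (pf1 F g') (pf1 F g) m) (idm (one c''))) (x c'')
    ∙ theta g' (pf1 F g ∘ m) ∙ jp (f := pf1 F g) (idm (pf1 F g ∘ m)) (ru g') (x c').
Proof.
have w2 : spr (g' ∘ g) m (x c) ∙ (m !! jp (lu (one (F c))) (idm (g' ∘ g)) (x c))
   = jp (lu m) (idm (g' ∘ g)) (x c) ∙ spr g' m (au A (bu (one (F c)) g) (x c)).
  apply: jp_assoc; first by rewrite lu1 -cmpA triangle'.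
  by rewrite hc2_id cmpm1 cmp1m lu_hc.
have n1 : jp (idm (pf1 F g ∘ m)) (lu g') (x c') ∙ (m !! spr g' (pf1 F g) (x c'))
    = spr g' (pf1 F g ∘ m) (x c') ∙ pj (pf1 F g) m (au A (bu (one (F c')) g') (x c')).
  apply: jp_assoc; first by rewrite cmp1m lu_hc' hc2_id cmpm1.
  by rewrite -cmpA triangle lu1.
have n2 : jp (idm (pf1 F g ∘ m)) (lu g') (x c') ∙ (m !! spl g' (pf1 F g) (x c'))
    = jp (idm (pf1 F g ∘ m)) (ru g') (x c') ∙ spr g' m (pf1 F g ! x c').
  apply: jp_assoc; first by rewrite !cmp1m triangle'.
  by rewrite -cmpA ru_hc -ruN.
have n3 : jp (idm (pf1 F g ∘ m)) (ru g') (x c') ∙ spr g' m (pf1 F g ! x c') ∙ (m !! swp g' (pf1 F g) (x c'))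
    = spr g' (pf1 F g ∘ m) (x c') ∙ pj (pf1 F g) m (au A (bu (one (F c')) g') (x c')).
  by rewrite -n2 -[LHS]cmpA -fmor_cmp swpE n1.
have E1 : theta g' (pf1 F g ∘ m) ∙ spr g' (pf1 F g ∘ m) (x c') ∙ ((pf1 F g ∘ m) !! ph g') = pj (pf1 F g') (pf1 F g ∘ m) (x c'').
  by rewrite -[LHS]cmpA -sigmaE cmpA (inv12 (thetaP _ _)) cmp1m.
have E1' : theta (g' ∘ g) m ∙ spr (g' ∘ g) m (x c) ∙ (m !! ph (g' ∘ g)) = pj (pf1 F (g' ∘ g)) m (x c'').
  by rewrite -[LHS]cmpA -sigmaE cmpA (inv12 (thetaP _ _)) cmp1m.
have W : (m !! ph (g' ∘ g)) ∙ (m !! a2 (b2 (pfc F g' g) (idm (one c''))) (x c'')) ∙ (m !! pj (pf1 F g') (pf1 F g) (x c''))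
  = (m !! jp (lu (one (F c))) (idm (g' ∘ g)) (x c)) ∙ (m !! fmor (au A (bu (one (F c)) g')) (ph g))
    ∙ (m !! swp g' (pf1 F g) (x c')) ∙ (m !! pf1 F g !! ph g') by rewrite -!fmor_cmp phc.
have [s sP] := spr_iso g' m (pf1 F g ! x c'); have [i iP] := phI g'.
have [w wP] : is_iso (swp g' (pf1 F g) (x c')).
  rewrite /swp -lock; apply: is_iso_cmp; last exact: spr_iso.
  by exists (spl g' (pf1 F g) (x c')); apply/inverse_sym/splP.
apply: (cancel_r sP); apply: (cancel_r (inverse_fmor (au A (bu m (one c''))) wP)).
apply: (cancel_r (inverse_fmor (au A (bu m (one c''))) (inverse_fmor (au A (bu (pf1 F g) (one c''))) iP))).
have -> : a2 (b2 ((pfc F g' g ⋆ idm m) ∙ asci (pf1 F g') (pf1 F g) m) (idm (one c''))) (x c'')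
  = a2 (b2 (pfc F g' g ⋆ idm m) (idm (one c''))) (x c'') ∙ a2 (b2 (asci (pf1 F g') (pf1 F g) m) (idm (one c''))) (x c'').
  by rewrite -a2_cmp b2_cmp cmp1m.
rewrite -!cmpA; rq n3; rq (jpN (idm (pf1 F g ∘ m)) (lu (one c'')) (ph g')); rq E1.
rq (pj_asc (pf1 F g') (pf1 F g) m (x c'')); rq (esym (pjNl (pfc F g' g) m (x c''))); rq (esym E1'); rq W.
by rq w2; rq (esym (jpN (lu m) (lu g') (ph g))).
Qed.

Lemma theta_join c c' c'' d d' (f' : @hm D d' d) (g : @hm C c c') (g' : @hm C c' c'') (m : @hm D d (F c)) :
  theta (g' ∘ g) (m ∘ f') ∙ jp (f := m) (f' := f') (idm (m ∘ f')) (idm (g' ∘ g)) (x c)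
  = a2 (b2 ((pfc F g' g ⋆ idm (m ∘ f')) ∙ asci (pf1 F g') (pf1 F g) (m ∘ f')) (idm (one c''))) (x c'')
    ∙ theta g' (pf1 F g ∘ (m ∘ f')) ∙ jp (f := pf1 F g ∘ m) (f' := f') (asc (pf1 F g) m f') (ru g') (x c')
    ∙ fmor (au A (bu f' g')) (theta g m).
Proof.
have k1 : jp (f := m) (f' := f') (idm (m ∘ f')) (idm (g' ∘ g)) (x c) ∙ fmor (au A (bu f' g')) (spr g m (x c))
    = jp (lu (m ∘ f')) (idm (g' ∘ g)) (x c) ∙ jp (idm (m ∘ f')) (ru g') (au A (bu (one (F c)) g) (x c)).
  apply: jp_assoc; first by rewrite cmp1m hc2_id cmpm1 lu_hc'.
  by rewrite !cmp1m triangle.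
have k3 : jp (f := pf1 F g ∘ m) (asc (pf1 F g) m f') (ru g') (x c') ∙ fmor (au A (bu f' g')) (pj (pf1 F g) m (x c'))
    = jp (f := pf1 F g) (f' := m ∘ f') (idm (pf1 F g ∘ (m ∘ f'))) (ru g') (x c') ∙ jp (f := m) (idm (m ∘ f')) (ru g') (pf1 F g ! x c').
  apply: jp_assoc; first by rewrite !hc2_id !cmpm1 (inv21 (ascP _ _ _)).
  by rewrite -cmpA triangle.
have W : fmor (au A (bu f' g')) (sigma g m) ∙ fmor (au A (bu f' g')) (pj (pf1 F g) m (x c'))
    = fmor (au A (bu f' g')) (spr g m (x c)) ∙ fmor (au A (bu f' g')) (m !! ph g) by rewrite -!fmor_cmp sigmaE.
have E1 : fmor (au A (bu f' g')) (theta g m) ∙ fmor (au A (bu f' g')) (sigma g m) = idm _ := whf1 _ (inv12 (thetaP g m)).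
apply: (cancel_r (inverse_fmor (au A (bu f' g')) (thetaP g m))).
rewrite -[RHS]cmpA E1 cmpm1; apply: (cancel_r (inverse_fmor (au A (bu f' g')) (pjP (pf1 F g) m (x c')))).
rewrite -!cmpA; rq W; rq k1; rq (jpN (f := m) (idm (m ∘ f')) (ru g') (ph g)); rq k3.
by rq (theta_split g g' (m ∘ f')).
Qed.

Lemma compar_comp c c' c'' d d' d'' (f : @hm D d' d) (f' : @hm D d'' d') (g : @hm C c c') (g' : @hm C c' c'') (h : @hm D d (F c)) :
  compar (f ∘ f') (g' ∘ g) h ∙ jp (f := f) (f' := f') (idm (f ∘ f')) (idm (g' ∘ g)) (h ! x c)
  = a2 (b2 ((pfc F g' g ⋆ (idm h ⋆ idm (f ∘ f'))) ∙ (asci (pf1 F g') (pf1 F g) (h ∘ (f ∘ f'))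
      ∙ (idm (pf1 F g') ⋆ ((idm (pf1 F g) ⋆ asc h f f') ∙ asc (pf1 F g) (h ∘ f) f')))) (idm (one c''))) (x c'')
    ∙ compar f' g' (pf1 F g ∘ (h ∘ f)) ∙ fmor (au A (bu f' g')) (compar f g h).
Proof.
have -> : (pfc F g' g ⋆ (idm h ⋆ idm (f ∘ f'))) ∙ (asci (pf1 F g') (pf1 F g) (h ∘ (f ∘ f'))
      ∙ (idm (pf1 F g') ⋆ ((idm (pf1 F g) ⋆ asc h f f') ∙ asc (pf1 F g) (h ∘ f) f')))
    = (idm (pf1 F (g' ∘ g)) ⋆ asc h f f') ∙ ((pfc F g' g ⋆ idm ((h ∘ f) ∘ f')) ∙ asci (pf1 F g') (pf1 F g) ((h ∘ f) ∘ f'))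
      ∙ (idm (pf1 F g') ⋆ asc (pf1 F g) (h ∘ f) f').
  rewrite hc2_id hc2_cmpr -!cmpA [X in _ ∙ X = _]cmpA asciN hc2_id -!cmpA !(cmpA (_ ⋆ _) (_ ⋆ _)) -!hc2_cmp.
  by rewrite !cmp1m !cmpm1.
have k4 : jp (f := h ∘ f) (f' := f') (asc h f f') (idm (g' ∘ g)) (x c) ∙ fmor (au A (bu f' g')) (jp (f' := f) (idm (h ∘ f)) (ru g) (x c))
    = jp (f' := f ∘ f') (idm (h ∘ (f ∘ f'))) (ru (g' ∘ g)) (x c) ∙ jp (f := f) (f' := f') (idm (f ∘ f')) (idm (g' ∘ g)) (h ! x c).
  apply: jp_assoc; first by rewrite !hc2_id !cmpm1 (inv21 (ascP _ _ _)).
  by rewrite cmp1m ru_hc hc2_id cmpm1.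
have k5 : jp (f := h ∘ f) (f' := f') (asc h f f') (idm (g' ∘ g)) (x c)
    = a2 (b2 (asc h f f') (idm (g' ∘ g))) (x c) ∙ jp (f := h ∘ f) (f' := f') (idm ((h ∘ f) ∘ f')) (idm (g' ∘ g)) (x c).
  by rewrite jp_post cmpm1 cmp1m.
have k6 : jp (f := pf1 F g ∘ (h ∘ f)) (f' := f') (asc (pf1 F g) (h ∘ f) f') (ru g') (x c')
    = a2 (b2 (asc (pf1 F g) (h ∘ f) f') (idm g')) (x c') ∙ jp (f := pf1 F g ∘ (h ∘ f)) (f' := f') (idm ((pf1 F g ∘ (h ∘ f)) ∘ f')) (ru g') (x c').
  by rewrite jp_post cmpm1 cmp1m.
have N1 := thetaN (idm (g' ∘ g)) (asc h f f'); rewrite fmor_id in N1.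
have N2 := thetaN (idm g') (asc (pf1 F g) (h ∘ f) f'); rewrite fmor_id in N2.
rewrite /compar -[LHS]cmpA -k4 k5 fmor_cmp.
move: (theta_join f' g g' (h ∘ f)); rewrite k6 => K.
have -> p q r : a2 (b2 (p ∙ q ∙ r) (idm (one c''))) (x c'')
  = a2 (b2 p (idm (one c''))) (x c'') ∙ a2 (b2 q (idm (one c''))) (x c'') ∙ a2 (b2 r (idm (one c''))) (x c'').
  by rewrite -!a2_cmp !b2_cmp !cmp1m.
rewrite -!cmpA in K *; rq N2.
by rq (esym N1); rq K.
Qed.

End Comparison.

Lemma strip_mod (C : category) (x y z w : C) (p : mor y z) (q : mor x y) (r : mor w z) (s : mor x w) (i : mor x x) :
  i = idm x -> p ∙ q = r ∙ s -> idm z ∙ p ∙ q = r ∙ (s ∙ i).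
Proof. by move=> -> E; rewrite cmp1m cmpm1. Qed.

Lemma strip_one (C : category) (x y z : C) (p : mor y z) (q : mor x y) (i : mor x x) (r : mor x z) :
  i = idm x -> p ∙ q = r -> p ∙ (q ∙ i) = idm z ∙ r ∙ idm x ∙ idm x.
Proof. by move=> -> E; rewrite cmp1m !cmpm1. Qed.

Lemma strip_hc (C : category) (x y z w v : C) (p : mor y z) (q : mor x y) (i : mor x x) (r : mor w z) (s : mor v w) (j : mor v v)
  (t : mor x v) :
  i = idm x -> j = idm v -> p ∙ q = r ∙ s ∙ t ->
  p ∙ (q ∙ i) = idm z ∙ r ∙ idm w ∙ (s ∙ j) ∙ idm v ∙ (idm v ∙ t) ∙ idm x.
Proof. by move=> -> -> E; rewrite !cmp1m !cmpm1. Qed.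

Lemma jn_id (k : fieldType) (B : bicategory) (A : action k B) (W X Y : B) (v : hm X Y) (u : hm W X) (z : A W) :
  jn (idm (v ∘ u)) z = aw v u z.
Proof. by rewrite /jn -lock a2_id cmp1m. Qed.

Lemma pstrans_pointwise (k : fieldType) (B : bicategory) (G P : pseudofunctor B (twoVect k)) (t : pstrans_data G P) :
  let T X : linfunctor (G X) (P X) := pt1 t X in
  let Gu X Y (u : hm X Y) : linfunctor (G X) (G Y) := pf1 G u in
  let Pu X Y (u : hm X Y) : linfunctor (P X) (P Y) := pf1 P u in
  let Ga X Y (u v : hm X Y) (a : mor u v) : nattrans (Gu X Y u) (Gu X Y v) := pf2 G a in
  let Pa X Y (u v : hm X Y) (a : mor u v) : nattrans (Pu X Y u) (Pu X Y v) := pf2 P a in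
  let Gc X Y Z (v : hm Y Z) (u : hm X Y) : nattrans (lf_comp (Gu Y Z v) (Gu X Y u)) (Gu X Z (v ∘ u)) := pfc G v u in
  let Pc X Y Z (v : hm Y Z) (u : hm X Y) : nattrans (lf_comp (Pu Y Z v) (Pu X Y u)) (Pu X Z (v ∘ u)) := pfc P v u in
  let G1 X : nattrans (lf_id (G X)) (Gu X X (one X)) := pfu G X in
  let P1 X : nattrans (lf_id (P X)) (Pu X X (one X)) := pfu P X in
  let tu X Y (u : hm X Y) : nattrans (lf_comp (Pu X Y u) (T X)) (lf_comp (T Y) (Gu X Y u)) := pt2 t u in
  (forall X Y (u : hm X Y) y, is_iso (tu X Y u y)) ->
  (forall X Y (u v : hm X Y) (a : mor u v) y, fmor (T Y) (Ga X Y u v a y) ∙ tu X Y u y = tu X Y v y ∙ Pa X Y u v a (T X y)) ->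
  (forall X y, tu X X (one X) y ∙ P1 X (T X y) = fmor (T X) (G1 X y)) ->
  (forall X Y Z (v : hm Y Z) (u : hm X Y) y, tu X Z (v ∘ u) y ∙ Pc X Y Z v u (T X y)
    = fmor (T Z) (Gc X Y Z v u y) ∙ tu Y Z v (Gu X Y u y) ∙ fmor (Pu Y Z v) (tu X Y u y)) ->
  is_pstrans t.
Proof.
move=> T Gu Pu Ga Pa Gc Pc G1 P1 tu I N U K; split.
- by move=> X Y u; apply: nt_is_iso => y; apply: I.
- move=> X Y u v a; apply: nattransP => y; have := N X Y u v a y; rewrite /tu /Ga /Pa /T /Gu /Pu /= => E.
  rewrite /=; apply: strip_mod; first by rewrite /=; exact: fmor_id.
  by rewrite /=; exact: E.
- move=> X; apply: nattransP => y; have := U X y; rewrite /tu /G1 /P1 /T /Gu /Pu /= => E.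
  rewrite /=; apply: strip_one; first by [].
  by rewrite /=; exact: E.
- move=> X Y Z v u; apply: nattransP => y; have := K X Y Z v u y; rewrite /tu /Gc /Pc /T /Gu /Pu /= => E.
  rewrite /=; apply: strip_hc; [rewrite /=; exact: fmor_id2 | rewrite /=; exact: fmor_id2 |].
  by rewrite /=; exact: E.
Qed.

(** * Assembling the equivalence with the Hom pseudofunctor *)

Section AssembledTransformation.
Variables (k : fieldType) (C D : linbicat k) (G P : pseudofunctor (prod_bicat (op_bicat D) C) (twoVect k)).
Local Notation A := (action_of P).
Local Notation GA := (action_of G).
Variable T : forall (d : D) (c : C), linfunctor (GA (d, c)) (A (d, c)).
Variable t2 : forall c c' d d' (f : @hm D d' d) (g : @hm C c c') (y : GA (d, c)),
  mor (au A (bu f g) (T d c y)) (T d' c' (au GA (bu f g) y)).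
Arguments t2 {c c' d d'} f g y.
Hypothesis t2I : forall c c' d d' (f : @hm D d' d) (g : @hm C c c') y, is_iso (t2 f g y).
Hypothesis t2N : forall c c' d d' (f : @hm D d' d) (g : @hm C c c') (y y' : GA (d, c)) (a : mor y y'),
  t2 f g y' ∙ fmor (au A (bu f g)) (fmor (T d c) a) = fmor (T d' c') (fmor (au GA (bu f g)) a) ∙ t2 f g y.
Hypothesis t2_cell : forall c c' d d' (f f' : @hm D d' d) (g g' : @hm C c c') (a : mor f f') (b : mor g g') (y : GA (d, c)),
  fmor (T d' c') (a2 (b2 a b) y) ∙ t2 f g y = t2 f' g' y ∙ a2 (b2 a b) (T d c y).
Hypothesis t2_unit : forall c d (y : GA (d, c)), t2 (one d) (one c) y ∙ a1 (T d c y) = fmor (T d c) (a1 y).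
Hypothesis t2_comp : forall c c' c'' d d' d'' (f : @hm D d' d) (f' : @hm D d'' d') (g : @hm C c c') (g' : @hm C c' c'') (y : GA (d, c)),
  t2 (f ∘ f') (g' ∘ g) y ∙ jp (f := f) (f' := f') (idm (f ∘ f')) (idm (g' ∘ g)) (T d c y)
  = fmor (T d'' c'') (aw (bu f' g') (bu f g) y) ∙ t2 f' g' (au GA (bu f g) y) ∙ fmor (au A (bu f' g')) (t2 f g y).

Definition assembled : pstrans_data G P.
Proof.
refine (@PstransData _ _ G P (fun X => match X return @hm (twoVect k) (G X) (P X) with (d, c) => T d c end) _).
move=> [d c] [d' c'] [f g].
exact (@Nattrans _ _ (lf_comp (pf1 P ((f, g) : @hm (prod_bicat (op_bicat D) C) (d, c) (d', c'))) (T d c))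
  (lf_comp (T d' c') (pf1 G ((f, g) : @hm (prod_bicat (op_bicat D) C) (d, c) (d', c'))))
  (fun y => t2 f g y) (fun y y' a => t2N f g a)).
Defined.

Let jp_id c c' c'' d d' d'' (f : @hm D d' d) (f' : @hm D d'' d') (g : @hm C c c') (g' : @hm C c' c'') (z : A (d, c)) :
  jp (f := f) (f' := f') (idm (f ∘ f')) (idm (g' ∘ g)) z = aw (bu f' g') (bu f g) z.
Proof. exact: jn_id. Qed.

Lemma assembled_pstrans : is_pstrans assembled.
Proof.
apply: pstrans_pointwise.
- by move=> [d c] [d' c'] [f g] y; apply: t2I.
- by move=> [d c] [d' c'] [f g] [f' g'] [a b] y; apply: t2_cell.
- by move=> [d c] y; apply: t2_unit.
- move=> [d c] [d' c'] [d'' c''] [f' g'] [f g] y; have := t2_comp f f' g g' y; rewrite jp_id; exact.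
Qed.

Lemma assembled_equivalence :
  (forall d c (y y' : GA (d, c)) (h : mor (T d c y) (T d c y')), exists! a, fmor (T d c) a = h) ->
  (forall d c (z : A (d, c)), exists y, isomorphic (T d c y) z) -> pf_equivalent P G.
Proof.
move=> Tff Tes; apply: (pf_equivalent_pointwise assembled_pstrans).
- by move=> [d c]; apply: Tff.
- by move=> [d c]; apply: Tes.
Qed.

End AssembledTransformation.

Lemma orbit_ff (k : fieldType) (D : linbicat k) (Q : psh D) (Y : D) (y : Q Y) (X : D) : fully_faithful_at y ->
  forall (f g : lhm X Y) (h : mor (orbit y X f) (orbit y X g)), exists! a, fmor (orbit y X) a = h.
Proof. by move=> yff f g h; exact: (yff X f g h). Qed.

Lemma orbit_hit (k : fieldType) (D : linbicat k) (Q : psh D) (Y : D) (y : Q Y) (X : D) :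
  (forall z : Q X, exists h : hm X Y, isomorphic z (y · h)) ->
  forall z : Q X, exists h, isomorphic (orbit y X h) z.
Proof. by move=> H z; have [h hz] := H z; exists h; apply: isomorphic_sym. Qed.

Section HomComparison.
Variables (k : fieldType) (C D : linbicat k) (DL : locally_finite_semisimple D).
Variables (P : pseudofunctor (prod_bicat (op_bicat D) C) (twoVect k)) (F : pseudofunctor C D).
Local Notation A := (action_of P).
Hypothesis A_lin : forall c (X Y : D) (f g : @hm D X Y) (n : A (Y, c)),
  linear (fun a : @lmor k (lhm X Y) f g => a2 (b2 a (idm (one c))) n : lmor (au A (bu f (one c)) n) (au A (bu g (one c)) n)).
Variable x : forall c, A (F c, c).
Variable ph : forall c c' (g : @hm C c c'),
  mor (au A (bu (pf1 F g) (one c')) (x c')) (au A (bu (one (F c)) g) (x c)).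
Arguments ph {c c'} g.
Hypothesis phI : forall c c' (g : @hm C c c'), is_iso (ph g).
Hypothesis phN : forall c c' (g g' : @hm C c c') (b : mor g g'),
  ph g' ∙ a2 (b2 (pf2 F b) (idm (one c'))) (x c') = a2 (b2 (idm (one (F c))) b) (x c) ∙ ph g.
Hypothesis phc : forall c c' c'' (g' : @hm C c' c'') (g : @hm C c c'),
  ph (g' ∘ g) ∙ a2 (b2 (pfc F g' g) (idm (one c''))) (x c'') ∙ jp (idm (pf1 F g' ∘ pf1 F g)) (lu (one c'')) (x c'')
  = jp (lu (one (F c))) (idm (g' ∘ g)) (x c) ∙ fmor (au A (bu (one (F c)) g')) (ph g)
    ∙ swp g' (pf1 F g) (x c') ∙ fmor (au A (bu (pf1 F g) (one c''))) (ph g').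
Hypothesis phu : forall c, ph (one c) ∙ a2 (b2 (pfu F c) (idm (one c))) (x c) ∙ a1 (x c) = a1 (x c).

Definition orb c d : linfunctor (hom_fs DL d (F c)) (P (d, c)) := orbit (Q := act_psh A_lin c) (x c) d.

Let t2 c c' d d' (f : @hm D d' d) (g : @hm C c c') (y : action_of (hom_along DL F) (d, c)) :
  mor (au A (bu f g) (orb c d y)) (orb c' d' (au (action_of (hom_along DL F)) (bu f g) y)) := compar phI f g y.

Local Notation GA := (action_of (hom_along DL F)).

Let t2_unit c (d : D) (h : hm d (F c)) :
  t2 (one d) (one c) h ∙ @a1 _ _ A (d, c) (orb c d h) = fmor (orb c d) (@a1 _ _ GA (d, c) h).
Proof.
(* [e] is the unit cell of [Hom(-, F -)] at [h]: the unit of [F] after the unitors of [D]. *)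
pose e := (pfu F c ⋆ (idm h ⋆ idm (one d))) ∙ (lui (h ∘ one d) ∙ rui h).
have e1 : t2 (one d) (one c) h ∙ @a1 _ _ A (d, c) (orb c d h)
  = compar phI (one d) (one c) h ∙ a1 (au A (bu h (one c)) (x c)) by [].
have e2 : fmor (orb c d) e = a2 (b2 e (idm (one c))) (x c) by [].
have e3 : fmor (orb c d) (@a1 _ _ GA (d, c) h) = fmor (orb c d) e by [].
exact: etrans e1 (etrans (compar_unit phI phN phu h) (etrans (esym e2) (esym e3))).
Qed.

Let t2_comp c c' c'' (d d' d'' : D) (f : @hm D d' d) (f' : @hm D d'' d') (g : @hm C c c') (g' : @hm C c' c'') (h : hm d (F c)) :
  t2 (f ∘ f') (g' ∘ g) h ∙ jp (A := A) (f := f) (f' := f') (idm (f ∘ f')) (idm (g' ∘ g)) (orb c d h)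
  = fmor (orb c'' d'') (@aw _ _ GA (d, c) (d', c') (d'', c'') (bu f' g') (bu f g) h)
    ∙ t2 f' g' (@au _ _ GA (d, c) (d', c') (bu f g) h) ∙ fmor (au A (bu f' g')) (t2 f g h).
Proof.
(* [e] is the composition cell of [Hom(-, F -)] at [h]: the compositor of [F] after the rebracketing
   in [D]. *)
pose e := (pfc F g' g ⋆ (idm h ⋆ idm (f ∘ f'))) ∙ (asci (pf1 F g') (pf1 F g) (h ∘ (f ∘ f'))
      ∙ (idm (pf1 F g') ⋆ ((idm (pf1 F g) ⋆ asc h f f') ∙ asc (pf1 F g) (h ∘ f) f'))).
have e3 : a2 (b2 e (idm (one c''))) (x c'') = fmor (orb c'' d'') (@aw _ _ GA (d, c) (d', c') (d'', c'') (bu f' g') (bu f g) h) by [].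
exact: etrans (compar_comp phI phN phc f f' g g' h)
  (congr1 (fun w => w ∙ compar phI f' g' (pf1 F g ∘ (h ∘ f)) ∙ fmor (au A (bu f' g')) (compar phI f g h)) e3).
Qed.

Lemma hom_equivalence :
  (forall c, @fully_faithful_at k D (act_psh A_lin c) (F c) (x c)) ->
  (forall c d (z : act_psh A_lin c d), exists h : hm d (F c), isomorphic z ((x c : act_psh A_lin c (F c)) · h)) ->
  pf_equivalent P (hom_along DL F).
Proof.
move=> xff xes.
apply: (@assembled_equivalence k C D (hom_along DL F) P (fun d c => orb c d : linfunctor (GA (d, c)) (A (d, c))) t2).
- by move=> *; apply: compar_iso.
- by move=> c c' d d' f g y y' a; exact: (compar_nat phI phN f g a).
- by move=> c c' d d' f f' g g' a b h; exact: (compar_cell phI phN a b h).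
- exact: t2_unit.
- exact: t2_comp.
- by move=> d c; exact: (orbit_ff (xff c)).
- by move=> d c; exact: (orbit_hit (xes c d)).
Qed.

End HomComparison.

(** [ph] carries the action of [pf2 F b] to that of [b], which is linear in [b], and [y] is a
    faithful point. *)
Lemma represent_linear (k : fieldType) (C D : linbicat k) (Q : bimod C D) (F : pseudofunctor C D) (y : forall c, Q c (F c))
  (ph : forall c c' (g : hm c c'), mor (y c' · pf1 F g) (bm Q g (F c) (y c))) :
  (forall c, fully_faithful_at (y c)) -> (forall c c' (g : hm c c'), is_iso (ph c c' g)) ->
  (forall c c' (g g' : hm c c') (b : mor g g'), ph c c' g' ∙ (y c' ◂ pf2 F b) = bm2 Q b (y c) ∙ ph c c' g) ->
  locally_linear F.
Proof.
move=> yff phI phN c c' g g' a u v; apply: (ff_inj (yff c')).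
have [i iP] := phI _ _ g'; apply: (cancel_l iP); rewrite phN.
rewrite (bm2_lin (y c) a u v) cmpDl cmpZl.
rewrite (pa2_lin (y c') a (pf2 F u) (pf2 F v)) cmpDr cmpZr.
by rewrite -(phN c c' g g' u) -(phN c c' g g' v).
Qed.

Theorem theorem4 (k : closedFieldType) (char0 : [pchar k] =i pred0)
  (C D : linbicat k)
  (hC : finite_semisimple2 C) (hD : finite_semisimple2 D)
  (P : pseudofunctor (prod_bicat (op_bicat D) C) (twoVect k))
  (hP : locally_bilinear P) :
  exists F : pseudofunctor C D,
    locally_linear F /\ pf_equivalent P (hom_along (fss2_local hD) F).
Proof.
pose A := action_of P.
have A_lin c (X Y : D) (f g : @hm D X Y) (n : A (Y, c)) :
    linear (fun a : @lmor k (lhm X Y) f g => a2 (b2 a (idm (one c))) n : lmor (au A (bu f (one c)) n) (au A (bu g (one c)) n)).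
  move=> a u v; have [H _] := hP (Y, c) (X, c) (f, one c) (g, one c).
  exact: (congr1 (fun s : nattrans _ _ => s n) (H (idm (one c)) a u v)).
have A_lin' c c' (d : D) (g g' : @hm C c c') (n : A (d, c)) :
    linear (fun b : @lmor k (lhm c c') g g' => a2 (b2 (idm (one d)) b) n : lmor (au A (bu (one d) g) n) (au A (bu (one d) g') n)).
  move=> a u v; have [_ H] := hP (d, c) (d, c') (one d, g) (one d, g').
  exact: (congr1 (fun s : nattrans _ _ => s n) (H (idm (one d)) a u v)).
pose Q := bimod_of A_lin A_lin'.
have [F0 HF] : exists F0 : C -> D, forall c, exists x : Q c (F0 c), fully_faithful_at x /\
    forall Z (z : Q c Z), exists h : hm Z (F0 c), isomorphic z (x · h).
  exact: (dep_choice (fun c => @psh_representable k char0 D hD (Q c) (fun d => fsP (P (d, c))))).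
have [x xP] := dep_choice HF.
have [F [y [ph [yff yes phI [phN phc phu]]]]] := represent_pf (fun c => proj1 (xP c)) (fun c => proj2 (xP c)).
exists F; split; first exact: (represent_linear yff phI phN).
apply: (@hom_equivalence k C D (fss2_local hD) P F A_lin y ph phI phN phc phu).
- exact: yff.
- exact: yes.
Qed.
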